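(* Let $\mathcal A=(A_g)_{g\in G}$ be a Fell bundle over a discrete group $G$. Assume that $A=A_1$ contains an essential ideal that is separable or of Type I. If $A$ detects ideals in $C^*_{\mathrm r}(H,\mathcal A|_H)$ for any cyclic subgroup $H\subseteq G$, then the dual groupoid of the Fell bundle $\mathcal A$ is topologically free.
   Context: Ideals are closed and two-sided; an ideal is essential if it has non-zero intersection with every non-zero ideal. $A$ detects ideals in a $C^*$-algebra $C\supseteq A$ if $J\cap A=0$ implies $J=0$ for every ideal $J$ of $C$. A Fell bundle over a discrete group $G$ is a family of Banach spaces $(A_g)_{g\in G}$ with bilinear associative multiplications $A_g\times A_h\to A_{gh}$ and conjugate-linear antimultiplicative involutions $A_g\to A_{g^{-1}}$ such that $\|ab\|\le\|a\|\|b\|$, $\|a^*a\|=\|a\|^2$, $A_1$ is a $C^*$-algebra and $a^*a\ge0$ in $A_1$ for all $a\in A_g$; it need not be saturated. Each $A_g$ is a Hilbert $A$-bimodule with $\langle x\mid y\rangle=x^*y$ and $\langle\!\langle x\mid y\rangle\!\rangle=xy^*$. For a subgroup $H$, $C^*_{\mathrm r}(H,\mathcal A|_H)$ is the reduced section $C^*$-algebra: the completion of the $*$-algebra $\bigoplus_{h\in H}A_h$ in its left multiplication representation on the Hilbert $A$-module $\bigoplus_{h\in H}A_h$ with inner product $\langle(x_h)\mid(y_h)\rangle=\sum_h x_h^*y_h$. Let $\widehat A$ be the space of unitary equivalence classes of irreducible representations of $A$, with open subsets $\widehat J=\{[\varrho]:\varrho|_J\ne0\}$ for ideals $J$. Let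 $s(A_g)$ and $r(A_g)$ be the closed ideals of $A$ spanned by $A_g^*A_g$ and $A_gA_g^*$. Then $\widehat{A_g}\colon\widehat{s(A_g)}\to\widehat{r(A_g)}$, $[\varrho]\mapsto[A_g\otimes_\varrho\mathcal H]$, is a homeomorphism. These form a partial action of $G$ on $\widehat A$; the dual groupoid is its transformation groupoid $\{(g,[\varrho])\in G\times\widehat A:[\varrho]\in\widehat{s(A_g)}\}$ with the subspace topology, source $[\varrho]$, range $\widehat{A_g}[\varrho]$ and multiplication induced from $G$. An étale groupoid with unit space $Y$ is topologically free if there is no non-empty open subset of the complement of $Y$ in the arrow space on which the range and source maps coincide. *)

(* Defs.v *)
(* C*-algebras, Fell bundles over discrete groups, their reduced section
   algebras and their dual groupoids, on top of MathComp and
   MathComp-Analysis.  The scalars are R[i] for R : realType. *)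
From HB Require Import structures.
From mathcomp Require Import all_boot all_order all_algebra finmap.
From mathcomp Require Import all_classical all_reals all_analysis complex.

Set Implicit Arguments.
Unset Strict Implicit.
Unset Printing Implicit Defensive.

Import Order.TTheory GRing.Theory Num.Theory.
Import numFieldNormedType.Exports.

Local Open Scope classical_set_scope.
Local Open Scope ring_scope.

(** * Fell bundles *)

(* Since [g * h * k] and [g * (h * k)] are only propositionally equal,
   identities between elements of different fibres are stated in the total
   space {g & A g}.  Positivity of a^* a is expressed as a^* a = b^* b with b in
   the unit fibre.  The unit fibre need not have a unit element. *)
Record fellBundle (R : realType) (G : groupType) := FellBundle {
  fib :> G -> completeNormedModType R[i];
  fmul : forall g h : G, fib g -> fib h -> fib (g * h)%g;
  fstar : forall g : G, fib g -> fib g^-1%g;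
  fmul_linearl : forall (g h : G) (b : fib h),
    linear (fun a : fib g => fmul a b);
  fmul_linearr : forall (g h : G) (a : fib g),
    linear (fun b : fib h => fmul a b);
  fmulA : forall (g h k : G) (a : fib g) (b : fib h) (c : fib k),
    Tagged fib (fmul (fmul a b) c) = Tagged fib (fmul a (fmul b c));
  fstar_conj_linear : forall (g : G) (c : R[i]) (a b : fib g),
    fstar (c *: a + b) = c^* *: fstar a + fstar b;
  fstarM : forall (g h : G) (a : fib g) (b : fib h),
    Tagged fib (fstar (fmul a b)) = Tagged fib (fmul (fstar b) (fstar a));
  fstarK : forall (g : G) (a : fib g),
    Tagged fib (fstar (fstar a)) = Tagged fib a;
  fnormM : forall (g h : G) (a : fib g) (b : fib h),
    `|fmul a b| <= `|a| * `|b|;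
  fnormC : forall (g : G) (a : fib g), `|fmul (fstar a) a| = `|a| ^+ 2;
  fpos : forall (g : G) (a : fib g), exists b : fib 1%g,
    Tagged fib (fmul (fstar a) a) = Tagged fib (fmul (fstar b) b)
}.

Section FellBundle.
Context {R : realType} {G : groupType} (A : fellBundle R G).

Definition fcast (g h : G) (e : g = h) (a : A g) : A h :=
  eq_rect g (fun k => A k : Type) a h e.

Definition mul1 (a b : A 1%g) : A 1%g := fcast (mulg1 1%g) (fmul a b).

Definition star1 (a : A 1%g) : A 1%g := fcast (@invg1 G) (fstar a).

(* left module structure and right inner product of the bimodule A_g *)
Definition lact (g : G) (a : A 1%g) (x : A g) : A g :=
  fcast (mul1g g) (fmul a x).

Definition rip (g : G) (x y : A g) : A 1%g :=
  fcast (mulVg g) (fmul (fstar x) y).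

End FellBundle.

(** * Ideals *)

(* A normed algebra [acar B], presented as a subset of a vector space carrying
   a product; [anorm_le x c] means that the norm of x is at most c.  This covers
   both the unit fibre of a Fell bundle and algebras of operators. *)
Record algebraData (C : numFieldType) := AlgebraData {
  ambient :> lmodType C;
  amul : ambient -> ambient -> ambient;
  anorm_le : ambient -> C -> Prop;
  acar : set ambient
}.
Arguments acar {C} B : rename.

Record ideal (C : numFieldType) (B : algebraData C) (J : set B) : Prop := {
  ideal_sub : J `<=` acar B;
  ideal0 : J 0;
  ideal_lin : forall (c : C) (x y : B), J x -> J y -> J (c *: x + y);
  ideal_mull : forall b x : B, acar B b -> J x -> J (amul b x);
  ideal_mulr : forall b x : B, acar B b -> J x -> J (amul x b);
  ideal_closed : forall x : B, acar B x ->
    (forall e : C, 0 < e -> exists2 y : B, J y & anorm_le (x - y) e) -> J x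
}.

Definition essential_ideal (C : numFieldType) (B : algebraData C)
    (J : set B) : Prop :=
  ideal J /\
  forall K : set B, ideal K -> K <> [set 0] -> J `&` K <> [set 0].

Definition detects_ideals (C : numFieldType) (B : algebraData C)
    (A : set B) : Prop :=
  forall J : set B, ideal J -> J `&` A = [set 0] -> J = [set 0].

Arguments ideal {C} B J.
Arguments essential_ideal {C} B J.
Arguments detects_ideals {C} B A.

Definition unit_algebra (R : realType) (G : groupType) (A : fellBundle R G) :
    algebraData R[i] :=
  {| ambient := A 1%g; amul := @mul1 R G A;
     anorm_le := fun a c => `|a| <= c; acar := setT |}.

Definition separable_set (T : topologicalType) (J : set T) : Prop :=
  exists D : set T, [/\ countable D, D `<=` J & J `<=` closure D].

(** * Reduced section algebras *)

(* not necessarily finitely supported sections of the bundle *)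
Definition section (R : realType) (G : groupType) (A : fellBundle R G) : Type :=
  forall g : G, A g.

Section SectionModule.
Context {R : realType} {G : groupType} (A : fellBundle R G).
Local Notation S := (section A).

HB.instance Definition _ := gen_eqMixin S.
HB.instance Definition _ := gen_choiceMixin S.

Definition section_add (x y : S) : S := fun g => x g + y g.
Definition section_opp (x : S) : S := fun g => - x g.
Definition section_scale (c : R[i]) (x : S) : S := fun g => c *: x g.

Fact section_addA : associative section_add.
Proof.
by move=> x y z; apply: functional_extensionality_dep => g; rewrite /section_add addrA.
Qed.
Fact section_addC : commutative section_add.
Proof.
by move=> x y; apply: functional_extensionality_dep => g; rewrite /section_add addrC.
Qed.
Fact section_add0 : left_id (fun g => 0 : A g) section_add.
Proof.
by move=> x; apply: functional_extensionality_dep => g; rewrite /section_add add0r.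
Qed.
Fact section_addN :
  left_inverse (fun g => 0 : A g) section_opp section_add.
Proof.
by move=> x; apply: functional_extensionality_dep => g;
  rewrite /section_add /section_opp addNr.
Qed.

HB.instance Definition _ := GRing.isZmodule.Build S
  section_addA section_addC section_add0 section_addN.

Fact section_scaleA (a b : R[i]) (x : S) :
  section_scale a (section_scale b x) = section_scale (a * b) x.
Proof.
by apply: functional_extensionality_dep => g; rewrite /section_scale scalerA.
Qed.
Fact section_scale1 : left_id 1 section_scale.
Proof.
by move=> x; apply: functional_extensionality_dep => g; rewrite /section_scale scale1r.
Qed.
Fact section_scaleDr : right_distributive section_scale +%R.
Proof.
by move=> c x y; apply: functional_extensionality_dep => g; exact: scalerDr.
Qed.
Fact section_scaleDl (x : S) :
  {morph section_scale ^~ x : a b / a + b}.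
Proof.
by move=> a b; apply: functional_extensionality_dep => g; exact: scalerDl.
Qed.

HB.instance Definition _ := GRing.Zmodule_isLmodule.Build R[i] S
  section_scaleA section_scale1 section_scaleDr section_scaleDl.

End SectionModule.

Section ReducedAlgebra.
Context {R : realType} {G : groupType} (A : fellBundle R G).
Local Notation S := (section A).

(* [<x | x> = a] in the Hilbert A_1-module direct sum of the A_g: the sum of
   the x_g^* x_g converges unconditionally to a in norm; the norm of x is then
   the square root of that of a *)
Definition l2_sum (x : S) (a : A 1%g) : Prop :=
  forall e : R[i], 0 < e -> exists F0 : {fset G}, forall F : {fset G},
    (F0 `<=` F)%fset -> `|a - \sum_(g <- F) rip (x g) (x g)| < e.

(* The completion of the algebraic direct sum of the A_h, h in H: sections
   supported in H for which the sum of the x_h^* x_h converges. *)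
Definition l2_module (H : {pred G}) : set S :=
  [set x | (forall g, g \notin H -> x g = 0) /\ exists a, l2_sum x a].

(* the algebraic direct sum of the A_h, h in H *)
Definition Cc (H : {pred G}) : set S :=
  [set f | (forall g, g \notin H -> f g = 0) /\
           finite_set [set g | f g <> 0]].

(* (f x)_k = \sum_h f_h x_(h^-1 k), a finite sum for f in Cc H *)
Definition conv (f x : S) : S := fun k =>
  \sum_(h \in [set: G]) fcast (mulVKg h k) (fmul (f h) (x (h^-1 * k)%g)).

(* Operators on [l2_module H] are extended by 0 to all sections, so that each
   of them is represented by exactly one function. *)
Definition left_reg (H : {pred G}) (f : S) : S -> S := fun x =>
  if `[< l2_module H x >] then conv f x else 0.

Definition opnorm_le (H : {pred G}) (T : S -> S) (c : R[i]) : Prop :=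
  0 <= c /\ forall x : S, l2_module H x -> exists a b : A 1%g,
    [/\ l2_sum x a, l2_sum (T x) b & `|b| <= c ^+ 2 * `|a| ].

(* The reduced section algebra of the restriction of A to H: the operator norm
   closure of the image of Cc H under the left regular representation. *)
Definition reduced_algebra (H : {pred G}) : algebraData R[i] :=
  {| ambient := S -> S;
     amul := fun T U => T \o U;
     anorm_le := opnorm_le H;
     acar := [set T : S -> S |
       [/\ forall x, l2_module H x -> l2_module H (T x),
           forall x, ~ l2_module H x -> T x = 0 &
           forall e : R[i], 0 < e ->
             exists2 f : S, Cc H f & opnorm_le H (T - left_reg H f) e]] |}.

Definition unit_coefficients (H : {pred G}) : set (reduced_algebra H) :=
  [set left_reg H f | f in [set f : S | forall g, g != 1%g -> f g = 0]].

End ReducedAlgebra.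
Arguments unit_coefficients {R G} A H.
Arguments reduced_algebra {R G} A H.

Definition cyclic_subgroup (G : groupType) (H : {pred G}) : Prop :=
  group_closed H /\
  exists h : G, forall x : G,
    x \in H <-> exists n : nat, x = (h ^+ n)%g \/ x = (h ^- n)%g.

(** * Representations *)

Record hilbertSpace (R : realType) := HilbertSpace {
  hspace :> completeNormedModType R[i];
  hip : hspace -> hspace -> R[i];
  hip_linear : forall (x : hspace) (c : R[i]) (y z : hspace),
    hip x (c *: y + z) = c * hip x y + hip x z;
  hip_conj : forall x y : hspace, hip y x = (hip x y)^*;
  hip_norm : forall x : hspace, hip x x = `|x| ^+ 2
}.

Definition closed_subspace (C : numFieldType) (V : normedModType C)
    (K : set V) : Prop :=
  [/\ closed K, K 0 &
      forall (c : C) (x y : V), K x -> K y -> K (c *: x + y)].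

Definition compact_operator (R : realType) (H : hilbertSpace R)
    (T : H -> H) : Prop :=
  linear T /\ compact (closure (T @` [set x : H | `|x| <= 1])).

Section Representations.
Context {R : realType} {G : groupType} (A : fellBundle R G).

(* *-representations on H of a closed *-subalgebra D of A_1; the values of pi
   outside D are irrelevant *)
Record representation (D : set (A 1%g)) (H : hilbertSpace R)
    (pi : A 1%g -> H -> H) : Prop := {
  rep_linear : forall a, D a -> linear (pi a);
  rep_bounded : forall a, D a ->
    exists M : R[i], forall x, `|pi a x| <= M * `|x|;
  rep_lin : forall (c : R[i]) a b x, D a -> D b ->
    pi (c *: a + b) x = c *: pi a x + pi b x;
  rep_mul : forall a b x, D a -> D b -> pi (mul1 a b) x = pi a (pi b x);
  rep_star : forall a x y, D a -> hip (pi (star1 a) x) y = hip x (pi a y)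
}.

Definition irreducible (D : set (A 1%g)) (H : hilbertSpace R)
    (pi : A 1%g -> H -> H) : Prop :=
  (exists2 a, D a & exists x, pi a x <> 0) /\
  forall K : set H, closed_subspace K ->
    (forall a x, D a -> K x -> K (pi a x)) -> K = [set 0] \/ K = setT.

(* the ideal J, viewed as a C*-algebra, is of Type I (GCR, postliminal): every
   irreducible representation of J contains the compact operators *)
Definition typeI (J : set (A 1%g)) : Prop :=
  forall (H : hilbertSpace R) (pi : A 1%g -> H -> H),
    representation J pi -> irreducible J pi ->
    forall T : H -> H, compact_operator T -> exists2 a, J a & pi a = T.

Record irrep := Irrep {
  irrep_space : hilbertSpace R;
  irrep_op :> A 1%g -> irrep_space -> irrep_space;
  irrep_rep : representation setT irrep_op;
  irrep_irr : irreducible setT irrep_op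
}.

Definition unitarily_equivalent (p q : irrep) : Prop :=
  exists U : irrep_space p -> irrep_space q,
    [/\ linear U,
        forall x y, hip (U x) (U y) = hip x y,
        forall y, exists x, U x = y &
        forall a x, U (p a x) = q a (U x)].

(* [irrep A] is too large a type for the [set] and [topologicalType] of the
   library, hence plain predicates and [topology] below. *)
Definition unitary_class (p : irrep) : irrep -> Prop :=
  fun q => unitarily_equivalent p q.

(* q is (unitarily equivalent to) the tensor product representation
   A_g (x)_p H_p, with t x v standing for the elementary tensor of x and v: the
   first four conditions say that t induces an isometry from the algebraic
   tensor product with inner product <x (x) v | y (x) w> = <v | p(x^* y) w> that
   intertwines the left actions of A_1, the last one that it has dense range. *)
Definition is_tensor (g : G) (p q : irrep) : Prop :=
  exists t : A g -> irrep_space p -> irrep_space q,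
    [/\ forall v, linear (t ^~ v),
        forall x, linear (t x),
        forall x y v w, hip (t x v) (t y w) = hip v (p (rip x y) w),
        forall a x v, q a (t x v) = t (lact a x) v &
        smallest (@closed_subspace R[i] (irrep_space q))
          [set z | exists x v, z = t x v] = setT].

End Representations.

(** * The dual groupoid *)

Record topology := Topology {
  point :> Type;
  is_open : (point -> Prop) -> Prop
}.

Definition discrete_product (G : Type) (X : topology) : topology :=
  {| point := G * X;
     is_open := fun V => forall g : G, is_open (fun x : X => V (g, x)) |}.

Definition subspace_topology (X : topology) (Y : Type) (i : Y -> X) :
    topology :=
  {| point := Y;
     is_open := fun U => exists2 V : X -> Prop, is_open V &
                  forall y : Y, U y <-> V (i y) |}.

Section Dual.
Context {R : realType} {G : groupType} (A : fellBundle R G).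

Record dual := Dual {
  dual_class :> irrep A -> Prop;
  dualP : exists p : irrep A, dual_class = unitary_class p
}.

Definition dual_hat (J : set (A 1%g)) : dual -> Prop :=
  fun X => exists2 p : irrep A, X p & exists a v, J a /\ p a v <> 0.

Definition dual_topology : topology :=
  {| point := dual;
     is_open := fun V => exists2 J : set (A 1%g),
       ideal (unit_algebra A) J & forall X, V X <-> dual_hat J X |}.

(* s(A_g) *)
Definition source_ideal (g : G) : set (A 1%g) :=
  smallest (@closed_subspace R[i] (A 1%g))
    [set a | exists x y : A g, a = rip x y].

(* the unitary equivalence class of A_g (x)_p H_p for p in the class X *)
Definition dual_map (g : G) (X : irrep A -> Prop) : irrep A -> Prop :=
  fun q => exists2 p : irrep A, X p & is_tensor g p q.

Record dual_arrow := DualArrow {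
  arrow_pair :> G * dual;
  arrow_dom : dual_hat (source_ideal arrow_pair.1) arrow_pair.2
}.

Definition dual_source (c : dual_arrow) : irrep A -> Prop := c.2.

Definition dual_range (c : dual_arrow) : irrep A -> Prop :=
  dual_map c.1 (dual_source c).

End Dual.

(* The structure maps of a topological groupoid; [gunits] is the unit space as a
   subset of the arrows and [gcomp a b c] means that a and b are composable with
   product c. *)
Record groupoidData := GroupoidData {
  garrows : topology;
  gobjects : Type;
  gsource : garrows -> gobjects;
  grange : garrows -> gobjects;
  gunits : garrows -> Prop;
  gcomp : garrows -> garrows -> garrows -> Prop
}.

Definition topologically_free (X : groupoidData) : Prop :=
  ~ exists U : garrows X -> Prop,
      [/\ is_open U, exists c, U c, forall c, U c -> ~ gunits c &
          forall c, U c -> grange c = gsource c].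

(* Objects are represented by the underlying predicates of the elements of
   [dual A]. *)
Definition dual_groupoid (R : realType) (G : groupType) (A : fellBundle R G) :
    groupoidData :=
  {| garrows := subspace_topology
       (X := discrete_product G (dual_topology A)) (@arrow_pair R G A);
     gobjects := irrep A -> Prop;
     gsource := @dual_source R G A;
     grange := @dual_range R G A;
     gunits := fun c => c.1 = 1%g;
     gcomp := fun a b c =>
       [/\ dual_source a = dual_range b, dual_source c = dual_source b &
           c.1 = (a.1 * b.1)%g] |}.

(* Main.v *)
Require Import Defs.
From HB Require Import structures.
From mathcomp Require Import all_boot all_order all_algebra finmap.
From mathcomp Require Import all_classical all_reals all_analysis complex.
From mathcomp Require Import ring lra.

(* Suppose that an open set of arrows off the unit space, with equal range and
   source, contains an arrow over g.  Then there is a non-zero ideal I, inside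
   the given essential ideal, such that every irreducible representation p with
   p(I) <> 0 is equivalent to its image under A_g.  Choosing such an equivalence
   extends p to coherent representations rho of the fibres over the cyclic
   subgroup H = <g>, unique up to a character of H, and these are bounded by
   the reduced norm (amenability of H, by Foelner sets).

   Detection of ideals is used as follows.  If a selfadjoint element of
   C_c(H, A) is positive under one extension rho of every p, then the ideal of
   those elements of C^*_r(H, A) that vanish under the selected extensions
   contains (|m| - m) k for k in I but meets A in 0; hence it is 0 and m is
   positive under all extensions.  Averaging over the characters of H, this
   forces the quadratic form of any x in A_g to be almost 0 at some unit vector
   in the range of any c <> 0 in I, for some p; this provides an element c' in
   cA of norm 1 with c'^* x c' small under all extensions.  Iterating, one gets
   selfadjoint contractions a_n with a_n a_(n+1) = a_(n+1) such that x_n is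
   compressed to almost 0 on the vectors fixed by a_n, and a pure state gives an
   irreducible representation p with a unit vector xi fixed by all a_n.

   In the separable case, the x_n run through d_k y for a dense sequence d_k, so
   that rho(y) xi = 0, which the choice of a_0 excludes.  In the Type I case,
   choosing x_n bounded below on the vectors fixed by a_n makes these spaces
   infinite-dimensional.  So adding an element that p maps to a compact operator
   does not decrease the norm of 1 + sum_n 2^-n a_n; for a maximal ideal with
   this property, killed by p, this contradicts the fact that p maps some
   element to the projection onto xi. *)

(** Cyclic subgroups are enough because an equivalence of [p] with its image under [A_g] is a single
    unitary, whose powers give the operators over all [g^n]. If [g] has finite order [m], the only
    obstruction is a scalar over [g^m = 1], and an [m]-th root removes it. The bundle need not be
    saturated, so products of fibres need not span; operators over a product are therefore defined
    through compositions with adjoints. The modulus [|m|] is the limit of polynomials in [m^2] at a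
    rate that does not depend on the representation, so that it is formed at once in the reduced
    algebra and under every extension. The extensions of the [p] in question see only [I]. An ideal
    defined by them alone would contain the annihilator of [I] in [A], so the ideal used also
    demands that products with this annihilator vanish. The factor [k] in [I] makes [(|m| - m) k]
    meet this demand and stands in for the missing unit. The weights [2^-(n+1)] of the [a_n] sum to
    1 with [a_n] contractive: one maximal value of a state on the sum forces all the equations
    [a_n xi = xi]. *)

Set Implicit Arguments.
Unset Strict Implicit.
Unset Printing Implicit Defensive.

Import Order.TTheory GRing.Theory Num.Theory.
Import numFieldNormedType.Exports.

Local Open Scope classical_set_scope.
Local Open Scope ring_scope.

(** * Deciding linear identities *)

Inductive lexp (K : Type) : Type :=
  | LVar of nat | LZero | LAdd of lexp K & lexp K | LOpp of lexp K
  | LScale of K & lexp K.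
Arguments LVar {K}. Arguments LZero {K}.

Section Lexp.
Context {K : nzRingType} {V : lmodType K}.

Fixpoint leval (env : seq V) (e : lexp K) : V :=
  match e with
  | LVar i => nth 0 env i
  | LZero => 0
  | LAdd a b => leval env a + leval env b
  | LOpp a => - leval env a
  | LScale c a => c *: leval env a
  end.

Fixpoint lcoef (i : nat) (e : lexp K) : K :=
  match e with
  | LVar j => if eqn i j then 1 else 0
  | LZero => 0
  | LAdd a b => lcoef i a + lcoef i b
  | LOpp a => - lcoef i a
  | LScale c a => c * lcoef i a
  end.

Lemma levalE env e :
  leval env e = \sum_(i < size env) lcoef i e *: nth 0 env i.
Proof.
elim: e => /= [j||a -> b ->|a ->|c a ->].
- have [jn|jn] := ltnP j (size env); last first.
    rewrite nth_default// big1// => i _; case: eqnP => [ij|_]; last by rewrite scale0r.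
    by have := ltn_ord i; rewrite ij ltnNge jn.
  rewrite (bigD1 (Ordinal jn))//= big1 => [|i ij].
    by case: eqnP => // _; rewrite scale1r addr0.
  case: eqnP => [e|_]; last by rewrite scale0r.
  by move: ij; rewrite -val_eqE /= e eqxx.
- by rewrite big1// => i _; rewrite scale0r.
- by rewrite -big_split; apply: eq_bigr => i _; rewrite scalerDl.
- by rewrite -sumrN; apply: eq_bigr => i _; rewrite scaleNr.
- by rewrite scaler_sumr; apply: eq_bigr => i _; rewrite scalerA.
Qed.

Fixpoint lcoefs_eq (n : nat) (a b : lexp K) : Prop :=
  if n is m.+1 then lcoef m a = lcoef m b /\ lcoefs_eq m a b else True.

(** By [levalE] both sides are combinations of the atoms in [env], so that finitely many scalar
    identities suffice; these are what [lmod] hands to [ring] and [field]. *)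
Lemma leval_eq env a b :
  lcoefs_eq (size env) a b -> leval env a = leval env b.
Proof.
move=> h; rewrite !levalE; apply: eq_bigr => -[i /=].
elim: (size env) h => // n IHn [hn h]; rewrite ltnS leq_eqVlt.
by case/orP => [/eqP ->|/(IHn h)//]; rewrite hn.
Qed.

End Lexp.

(* The same ring operation may occur with different instance paths, hence this
   comparison instead of a syntactic one. *)
Ltac lmod_same x y :=
  lazymatch constr:((x, y)) with
  | (?a, ?a) => constr:(true)
  | ((?a * ?b)%R, (?c * ?d)%R) =>
    let e := lmod_same a c in
    lazymatch e with true => lmod_same b d | false => constr:(false) end
  | (1%R, 1%R) => constr:(true)
  | _ => constr:(false)
  end.
Ltac lmod_mem x l :=
  lazymatch l with
  | nil => constr:(false)
  | ?y :: ?l' => let e := lmod_same x y in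
    lazymatch e with true => constr:(true) | false => lmod_mem x l' end
  end.
Ltac lmod_index x l :=
  lazymatch l with
  | ?y :: ?l' => let e := lmod_same x y in
    lazymatch e with
    | true => constr:(0%N)
    | false => let n := lmod_index x l' in constr:(S n)
    end
  end.
Ltac lmod_atoms l t :=
  lazymatch t with
  | (?a + ?b)%R => let l1 := lmod_atoms l a in lmod_atoms l1 b
  | (- ?a)%R => lmod_atoms l a
  | (_ *: ?a)%R => lmod_atoms l a
  | 0%R => l
  | _ => let b := lmod_mem t l in
         lazymatch b with true => l | false => constr:(t :: l) end
  end.
Ltac lmod_reify K l t :=
  lazymatch t with
  | (?a + ?b)%R => let a' := lmod_reify K l a in let b' := lmod_reify K l b in
                   constr:(@LAdd K a' b')
  | (- ?a)%R => let a' := lmod_reify K l a in constr:(@LOpp K a')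
  | (?c *: ?a)%R => let a' := lmod_reify K l a in constr:(@LScale K c a')
  | 0%R => constr:(@LZero K)
  | _ => let i := lmod_index t l in constr:(@LVar K i)
  end.
Lemma mulii (R : realType) : ('i : R[i]) * 'i = -1.
Proof. by rewrite -expr2 sqrCi. Qed.

(** The atoms of both sides are collected before either is reified, so that a common term gets one
    index. [mulii] is supplied because ['i * 'i = -1] is not a ring identity. Coefficient goals that
    no solver closes are left to the caller. *)
Ltac lmod :=
  lazymatch goal with
  | R : realType |- @eq ?T ?a ?b =>
    let K := constr:(R[i] : Type) in
    let l0 := constr:(@nil T) in
    let l1 := lmod_atoms l0 a in
    let l := lmod_atoms l1 b in
    let a' := lmod_reify K l a in
    let b' := lmod_reify K l b in
    apply: (@leval_eq (R[i] : nzRingType) _ l a' b');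
    cbn [lcoefs_eq size lcoef eqn]; do ?split; first [ring | ring: (mulii R) | by field | by field: (mulii R) | idtac]
  end.

(** * Real parts and real-valued norms *)

Section Complex.
Context {R : realType}.
Local Notation C := R[i].
Implicit Types (z w : C) (r s : R).

(** Norms take values in [R[i]]. All estimates are carried out with their real counterparts [nm],
    where [lra] and [nra] apply; [normE], [rc_le] and [rc_lt] translate between the two. *)
Definition rc r : C := real_complex R r.
Definition re z : R := complex.Re z.
Definition nm (V : normedZmodType C) (x : V) : R := complex.Re `|x|.

Lemma rc0 : rc 0 = 0. Proof. by []. Qed.
Lemma rc1 : rc 1 = 1. Proof. by []. Qed.
Lemma rcD r s : rc (r + s) = rc r + rc s. Proof. exact: rmorphD. Qed.
Lemma rcN r : rc (- r) = - rc r. Proof. exact: rmorphN. Qed.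
Lemma rcB r s : rc (r - s) = rc r - rc s. Proof. exact: rmorphB. Qed.
Lemma rcM r s : rc (r * s) = rc r * rc s. Proof. exact: rmorphM. Qed.
Lemma rcX r n : rc (r ^+ n) = rc r ^+ n. Proof. exact: rmorphXn. Qed.
Lemma rcV r : rc r^-1 = (rc r)^-1. Proof. exact: fmorphV. Qed.
Lemma rc_nat n : rc n%:R = n%:R. Proof. exact: rmorph_nat. Qed.
Lemma rc_inj r s : rc r = rc s -> r = s. Proof. by case. Qed.
Lemma rc_eq0 r : (rc r == 0) = (r == 0). Proof. exact: fmorph_eq0. Qed.
Lemma rc_le r s : (rc r <= rc s) = (r <= s).
Proof. by rewrite /rc lecR. Qed.
Lemma rc_lt r s : (rc r < rc s) = (r < s).
Proof. by rewrite /rc ltcR. Qed.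
Lemma rc_conj r : (rc r)^* = rc r.
Proof. by rewrite /rc conj_Creal// complex_real. Qed.

Lemma reD z w : re (z + w) = re z + re w. Proof. by case: z w => [a b] []. Qed.
Lemma reN z : re (- z) = - re z. Proof. by case: z. Qed.
Lemma reB z w : re (z - w) = re z - re w. Proof. by rewrite reD reN. Qed.
Lemma re0 : re 0 = 0. Proof. by []. Qed.
Lemma re_rc r : re (rc r) = r. Proof. by []. Qed.
Lemma reZ r z : re (rc r * z) = r * re z.
Proof. by case: z => a b; rewrite /re /rc /=; ring. Qed.
Lemma conjE z : z^* = (z^*)%C.
Proof. by []. Qed.
Lemma re_conj z : re z^* = re z. Proof. by case: z. Qed.
Lemma re_sum I (s : seq I) (P : pred I) (F : I -> C) :
  re (\sum_(i <- s | P i) F i) = \sum_(i <- s | P i) re (F i).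
Proof. exact: (big_morph re reD re0). Qed.
Lemma rc_sum I (s : seq I) (P : pred I) (F : I -> R) :
  rc (\sum_(i <- s | P i) F i) = \sum_(i <- s | P i) rc (F i).
Proof. exact: (big_morph rc rcD rc0). Qed.

Lemma normE (V : normedZmodType C) (x : V) : `|x| = rc (nm x).
Proof.
by rewrite /rc /nm; have := RRe_real (ger0_real (normr_ge0 x)) => ->.
Qed.
Lemma nm_ge0 (V : normedZmodType C) (x : V) : 0 <= nm x.
Proof. by rewrite -rc_le -normE rc0. Qed.
Lemma nmD (V : normedZmodType C) (x y : V) : nm (x + y) <= nm x + nm y.
Proof. by rewrite -rc_le rcD -!normE ler_normD. Qed.
Lemma nmN (V : normedZmodType C) (x : V) : nm (- x) = nm x.
Proof. by rewrite /nm normrN. Qed.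
Lemma nmB (V : normedZmodType C) (x y : V) : nm (x - y) <= nm x + nm y.
Proof. by rewrite -(nmN y) nmD. Qed.
Lemma nmBC (V : normedZmodType C) (x y : V) : nm (x - y) = nm (y - x).
Proof. by rewrite -nmN opprB. Qed.
Lemma nm0 (V : normedZmodType C) : nm (0 : V) = 0.
Proof. by rewrite /nm normr0. Qed.
Lemma nm_eq0 (V : normedZmodType C) (x : V) : nm x = 0 -> x = 0.
Proof. by move=> h; apply/eqP; rewrite -normr_eq0 normE h. Qed.
Lemma nm_gt0 (V : normedZmodType C) (x : V) : x <> 0 -> 0 < nm x.
Proof.
move=> h; rewrite lt_neqAle nm_ge0 andbT eq_sym; apply/eqP => h'.
by apply: h; apply: nm_eq0.
Qed.
Lemma nm_sum (V : normedZmodType C) I (s : seq I) (P : pred I) (F : I -> V) :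
  nm (\sum_(i <- s | P i) F i) <= \sum_(i <- s | P i) nm (F i).
Proof.
rewrite -rc_le -normE (le_trans (ler_norm_sum _ _ _))// rc_sum.
by apply: ler_sum => i _; rewrite normE.
Qed.
Lemma nmZ (V : normedModType C) z (x : V) : nm (z *: x) = nm z * nm x.
Proof. by apply: rc_inj; rewrite rcM -!normE normrZ. Qed.
Lemma nmM z w : nm (z * w) = nm z * nm w.
Proof. by apply: rc_inj; rewrite rcM -!normE normrM. Qed.
Lemma nm1 : nm (1 : C) = 1.
Proof. by apply: rc_inj; rewrite -normE normr1. Qed.
Lemma nm_rc r : nm (rc r) = `|r|.
Proof. by apply: rc_inj; rewrite -normE /rc normc_def /= expr0n addr0 sqrtr_sqr. Qed.
Lemma nm_conj z : nm z^* = nm z.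
Proof. by rewrite /nm norm_conjC. Qed.
Lemma conj_mul z : z^* * z = rc (nm z ^+ 2).
Proof. by rewrite rcX -normE normCK mulrC. Qed.
Lemma mul_conj z : z * z^* = rc (nm z ^+ 2).
Proof. by rewrite rcX -normE normCK. Qed.
Lemma nm_sqr z : nm z ^+ 2 = re z ^+ 2 + re ('i * z) ^+ 2.
Proof.
have : rc (nm z ^+ 2) = z * z^* by rewrite mul_conj.
case: z => a b; move=> h; apply: rc_inj; rewrite h conjE /re /rc /=.
by simpc; congr (_ +i* _)%C; ring.
Qed.
Lemma nm_i : nm ('i : C) = 1.
Proof. by apply: rc_inj; rewrite -normE normCi. Qed.
Lemma re_le_nm z : re z <= nm z.
Proof.
have h := nm_sqr z; have := nm_ge0 z; have := sqr_ge0 (re ('i * z)); nra.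
Qed.
Lemma re_ge_nm z : - nm z <= re z.
Proof. by rewrite lerNl -reN -(nmN z) re_le_nm. Qed.
Lemma re_eq0 z : re z = 0 -> re ('i * z) = 0 -> z = 0.
Proof. by move=> h1 h2; apply: nm_eq0; apply/eqP; rewrite -sqrf_eq0 nm_sqr h1 h2; apply/eqP; ring. Qed.
Lemma conj_rc_re z : z^* = z -> z = rc (re z).
Proof.
case: z => a b; rewrite conjE /= => -[] h; rewrite /rc /re /=; congr (_ +i* _)%C.
by lra.
Qed.
Lemma conjD z w : (z + w)^* = z^* + w^*. Proof. exact: rmorphD. Qed.
Lemma conjN z : (- z)^* = - z^*. Proof. exact: rmorphN. Qed.
Lemma conjB z w : (z - w)^* = z^* - w^*. Proof. exact: rmorphB. Qed.
Lemma conjM z w : (z * w)^* = z^* * w^*. Proof. exact: rmorphM. Qed.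
Lemma conjK z : (z^*)^* = z. Proof. exact: conjCK. Qed.
Lemma conj0 : (0 : C)^* = 0. Proof. exact: rmorph0. Qed.
Lemma conj_i : ('i : C)^* = - 'i. Proof. exact: conjCi. Qed.
Lemma re_i_mul z : z^* = z -> re ('i * z) = 0.
Proof. by move/conj_rc_re ->; rewrite mulrC reZ mulr0. Qed.

Lemma phase z : exists w, [/\ nm w = 1, w * z = rc (nm z) & w^* * w = 1].
Proof.
have [->|/eqP z0] := eqVneq z 0.
  by exists 1; rewrite nm1 nm0 mulr0 conj_mul nm1 expr1n.
have nz : nm z != 0 by apply/eqP => /nm_eq0.
have E : nm (rc (nm z)^-1 * z^*) = 1.
  by rewrite nmM nm_rc nm_conj ger0_norm ?invr_ge0 ?nm_ge0// mulVf.
exists (rc (nm z)^-1 * z^*); split => //.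
  by rewrite -mulrA conj_mul -rcM expr2 mulrA mulVf// mul1r.
by rewrite conj_mul E expr1n.
Qed.

End Complex.

Hint Resolve nm_ge0 : core.

(** The distance is a parameter because limits are taken for norms, for the seminorm of a semi-inner
    product and for the norm of a [cstarAlg]. *)
Definition cvgs {R : realType} {T : Type} (d : T -> T -> R) (u : nat -> T) (l : T) :=
  forall e : R, 0 < e -> exists N, forall n, (N <= n)%N -> d (u n) l <= e.
Definition cauchys {R : realType} {T : Type} (d : T -> T -> R) (u : nat -> T) :=
  forall e : R, 0 < e -> exists N, forall m n, (N <= m)%N -> (N <= n)%N -> d (u m) (u n) <= e.

(** * Completeness, limits and closures by sequences *)

Section Complete.
Context {R : realType}.
Local Notation C := R[i].

Definition dn (V : normedZmodType C) (x y : V) : R := nm (x - y).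

Lemma gt0_rc (e : C) : 0 < e -> exists2 r : R, 0 < r & e = rc r.
Proof.
move=> e0; exists (re e); last by rewrite /rc RRe_real// gtr0_real.
by rewrite -rc_lt rc0 /rc RRe_real// gtr0_real.
Qed.

Lemma cauchys_cvgs (V : completeNormedModType C) (u : nat -> V) :
  cauchys (@dn V) u -> exists l, cvgs (@dn V) u l.
Proof.
move=> cu; have h : cvg (u @ \oo).
  apply/cauchy_cvgP/cauchy_ballP => e e0; near_simpl.
  have [r r0 ->] := gt0_rc e0.
  have r2 : 0 < r / 2 by rewrite divr_gt0.
  have [N HN] := cu _ r2.
  exists (setI [set m | (N <= m)%N] setT, [set m | (N <= m)%N]).
    by split; [apply: filterI; [exists N|exact: filterT]|exists N].
  move=> [m n] /= [[hm _] hn]; rewrite -ball_normE /ball_/=.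
  rewrite normE rc_lt (le_lt_trans (HN _ _ hm hn))//; lra.
exists (lim (u @ \oo)) => e e0.
have e0' : 0 < rc e by rewrite -rc0 rc_lt.
have /cvgrPdist_le /(_ _ e0') [N _ HN] := h.
by exists N => n hn; rewrite /dn nmBC -rc_le -normE; exact: HN.
Unshelve. all: by end_near. Qed.

Lemma cvgs_uniq (V : normedZmodType C) (u : nat -> V) l l' :
  cvgs (@dn V) u l -> cvgs (@dn V) u l' -> l = l'.
Proof.
move=> h h'; apply: subr0_eq; apply/nm_eq0.
apply/eqP; rewrite eq_le nm_ge0 andbT; apply/ler_addgt0Pl => e e0; rewrite addr0.
have e2 : 0 < e / 2 by rewrite divr_gt0.
have [N HN] := h _ e2; have [N' HN'] := h' _ e2.
have := HN _ (leq_maxl N N'); have := HN' _ (leq_maxr N N').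
set x := u _; rewrite /dn => a b.
have -> : l - l' = (x - l') - (x - l) by rewrite opprB [RHS]addrC subrKA.
by have := nmB (x - l') (x - l); lra.
Qed.

Lemma ler_eps (x y : R) : (forall e, 0 < e -> x <= y + e) -> x <= y.
Proof. by move=> h; apply/ler_addgt0Pr => e e0; exact: h. Qed.
Lemma nm_le0 (V : normedZmodType C) (x : V) : nm x <= 0 -> x = 0.
Proof. by move=> h; apply/nm_eq0/le_anti; rewrite h nm_ge0. Qed.
Lemma nm_small (V : normedZmodType C) (x : V) : (forall e, 0 < e -> nm x <= e) -> x = 0.
Proof. by move=> h; apply/nm_le0/ler_eps => e e0; rewrite add0r h. Qed.

Lemma nm_cvgs_le (V : normedZmodType C) (u : nat -> V) l (M : R) :
  cvgs (@dn V) u l -> (forall n, nm (u n) <= M) -> nm l <= M.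
Proof.
move=> h hM; apply: ler_eps => e e0; have [N /(_ N (leqnn _))] := h _ e0.
rewrite /dn => a; have -> : l = u N - (u N - l) by rewrite subKr.
by have := nmB (u N) (u N - l); have := hM N; lra.
Qed.

Lemma cvgsD (V : normedZmodType C) (u v : nat -> V) l k :
  cvgs (@dn V) u l -> cvgs (@dn V) v k -> cvgs (@dn V) (fun n => u n + v n) (l + k).
Proof.
move=> h h' e e0; have e2 : 0 < e / 2 by rewrite divr_gt0.
have [N HN] := h _ e2; have [N' HN'] := h' _ e2.
exists (maxn N N') => n; rewrite geq_max => /andP[/HN a /HN' b].
by rewrite /dn opprD addrACA; have := nmD (u n - l) (v n - k); rewrite /dn in a b; lra.
Qed.

Lemma cvgs_lip (V W : normedZmodType C) (f : V -> W) (K : R) (u : nat -> V) l :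
  (forall x y, nm (f x - f y) <= K * nm (x - y)) ->
  cvgs (@dn V) u l -> cvgs (@dn W) (f \o u) (f l).
Proof.
move=> hf h e e0; have K0 : 0 < `|K| + 1 by rewrite ltr_wpDl.
have e2 : 0 < e / (`|K| + 1) by rewrite divr_gt0.
have [N HN] := h _ e2; exists N => n /HN; rewrite /dn /= => a.
apply: le_trans (hf _ _) _; move: a; rewrite ler_pdivlMr// => a.
by have := ler_norm K; have := nm_ge0 (u n - l); nra.
Qed.

Lemma cvgs_cst (V : normedZmodType C) (l : V) : cvgs (@dn V) (fun=> l) l.
Proof. by move=> e e0; exists 0%N => n _; rewrite /dn subrr nm0 ltW. Qed.

Lemma cvgs_shift (V : normedZmodType C) (u : nat -> V) l :
  cvgs (@dn V) u l -> cvgs (@dn V) (fun n => u n.+1) l.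
Proof. by move=> h e /h [N HN]; exists N => n hn; apply: HN; rewrite leqW. Qed.

Lemma closed_eps (V : normedModType C) (K : set V) : closed K <->
  forall x, (forall e : R, 0 < e -> exists2 y, K y & nm (x - y) <= e) -> K x.
Proof.
split=> [cK x hx|h x].
  apply: cK => B /nbhs_ballP[e /= e0 eB].
  have [r r0 re] := gt0_rc e0.
  have [|y Ky hy] := hx (r / 2); first by rewrite divr_gt0.
  exists y; split => //; apply: eB; rewrite -ball_normE /ball_ /= normE re rc_lt.
  by lra.
move=> hx; apply: h => e e0.
have [|y [Ky]] := hx (ball x (rc e)).
  by apply: nbhsx_ballx; rewrite -rc0 rc_lt.
rewrite -ball_normE /ball_ /= normE rc_lt => hy; exists y => //; lra.
Qed.

Lemma closure_eps (V : normedModType C) (K : set V) x : closure K x <->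
  forall e : R, 0 < e -> exists2 y, K y & nm (x - y) <= e.
Proof.
split=> [hx e e0|h].
  have [|y [Ky]] := hx (ball x (rc e)).
    by apply: nbhsx_ballx; rewrite -rc0 rc_lt.
  rewrite -ball_normE /ball_ /= normE rc_lt => hy; exists y => //; lra.
move=> B /nbhs_ballP[e /= e0 eB].
have [r r0 re] := gt0_rc e0.
have [|y Ky hy] := h (r / 2); first by rewrite divr_gt0.
exists y; split => //; apply: eB; rewrite -ball_normE /ball_ /= normE re rc_lt.
by lra.
Qed.

End Complete.

(** * The square root iteration *)

(* [zeta] majorizes the iteration z |-> (y + z^2) / 2 for 1 - sqrt (1 - y) when
   y has norm at most 1. *)
Fixpoint zeta (R : realType) (n : nat) : R :=
  if n is m.+1 then (1 + zeta R m ^+ 2) / 2 else 0.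

Section Zeta.
Context {R : realType}.

Lemma zeta_bound n : 0 <= zeta R n <= 1.
Proof. by elim: n => [|n /andP[h0 h1]] /=; [lra|apply/andP; split; nra]. Qed.

Lemma zeta_incr n : zeta R n <= zeta R n.+1.
Proof. by have /andP[h0 h1] := zeta_bound n; rewrite /=; nra. Qed.

Lemma zeta_mono m n : (m <= n)%N -> zeta R m <= zeta R n.
Proof.
move=> /subnK <-; elim: (n - m)%N => // k; rewrite addSn => h.
exact: le_trans h (zeta_incr _).
Qed.

Lemma zeta_cauchy (e : R) : 0 < e ->
  exists N, forall m n, (N <= m)%N -> (N <= n)%N -> zeta R n - zeta R m <= e.
Proof.
move=> e0.
have hs : has_sup (range (zeta R)).
  split; first by exists (zeta R 0), 0%N.
  by exists 1 => _ [n _ <-]; have /andP[] := zeta_bound n.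
have [_ [N _ <-] hN] := sup_adherent e0 hs.
exists N => m n hm hn.
have := zeta_mono hm.
have : zeta R n <= sup (range (zeta R)) by apply: ub_le_sup; [case: hs|exists n].
by lra.
Qed.

End Zeta.

Section Iteration.
Context {R : realType} {X : lmodType R[i]}.
Variable nu : X -> R.
Hypothesis nuD : forall x y, nu (x + y) <= nu x + nu y.
Hypothesis nuZ : forall c x, nu (c *: x) = nm c * nu x.

(** The iteration is applied to a vector of a seminormed module, so that one estimate serves left
    multiplication in a C*-algebra, operators on a Hilbert space and operators on a semi-inner
    product space. *)
Fixpoint sqit (Y : X -> X) (n : nat) (x : X) : X :=
  if n is m.+1 then 2^-1 *: (Y x + sqit Y m (sqit Y m x)) else 0.

Lemma sqit_lin Y n : linear Y -> linear (sqit Y n).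
Proof.
move=> lY; elim: n => [|n IHn] c x y /=; first by lmod.
by rewrite lY !IHn; lmod.
Qed.

Lemma sqit_comm Y S n : linear S -> (forall x, S (Y x) = Y (S x)) ->
  forall x, S (sqit Y n x) = sqit Y n (S x).
Proof.
move=> lS h; have S0 : S 0 = 0.
  by have := lS (-1) 0 0; rewrite !scaleN1r !addNr => ->.
have SZ c x : S (c *: x) = c *: S x by have := lS c x 0; rewrite S0 !addr0.
have SD x y : S (x + y) = S x + S y by have := lS 1 x y; rewrite !scale1r.
by elim: n => [|n IHn] x //=; rewrite SZ SD !IHn h.
Qed.

Lemma sqit_sqit Y m n x : linear Y ->
  sqit Y m (sqit Y n x) = sqit Y n (sqit Y m x).
Proof.
move=> lY; apply: sqit_comm; first exact: sqit_lin.
by move=> {}x; apply: esym; apply: sqit_comm.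
Qed.

Hypothesis nu_ge0 : forall x, 0 <= nu x.
Variable Y : X -> X.
Hypothesis linY : linear Y.
Hypothesis nuY : forall x, nu (Y x) <= nu x.

Let nm2 : nm (2^-1 : R[i]) = 2^-1.
Proof. by rewrite -(rc_nat 2) -rcV nm_rc ger0_norm// invr_ge0. Qed.

Lemma sqit_bound n x : nu (sqit Y n x) <= zeta R n * nu x.
Proof.
elim: n x => [|n IHn] x /=.
  by rewrite -(scale0r x) nuZ nm0.
rewrite nuZ nm2.
have /andP[z0 z1] := @zeta_bound R n.
have := nuD (Y x) (sqit Y n (sqit Y n x)); have := nuY x.
have := IHn (sqit Y n x); have := ler_wpM2l z0 (IHn x).
lra.
Qed.

(** The iterates [z_n] commute, hence [z_(n+2) - z_(n+1) = (z_(n+1) - z_n) (z_(n+1) + z_n) / 2]. The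
    same identity holds for [zeta], so that its increments remain majorants by induction. *)
Lemma sqit_step n x :
  nu (sqit Y n.+1 x - sqit Y n x) <= (zeta R n.+1 - zeta R n) * nu x.
Proof.
elim: n x => [|n IHn] x; first by rewrite /= !subr0; exact: (sqit_bound 1).
have D y z : sqit Y n.+1 (y + z) = sqit Y n.+1 y + sqit Y n.+1 z.
  by have := sqit_lin n.+1 linY 1 y z; rewrite !scale1r.
have D' y z : sqit Y n (y + z) = sqit Y n y + sqit Y n z.
  by have := sqit_lin n linY 1 y z; rewrite !scale1r.
have E : sqit Y n.+2 x - sqit Y n.+1 x = 2^-1 *:
   (sqit Y n.+1 (sqit Y n.+1 x + sqit Y n x) - sqit Y n (sqit Y n.+1 x + sqit Y n x)).
  rewrite D D' (sqit_sqit n.+1 n)// [LHS]/=.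
  set a := sqit Y n.+1 (sqit Y n.+1 x).
  change (2^-1 *: (Y x + a) - 2^-1 *: (Y x + sqit Y n (sqit Y n x)) =
    2^-1 *: (a + sqit Y n (sqit Y n.+1 x) - (sqit Y n (sqit Y n.+1 x) + sqit Y n (sqit Y n x)))).
  by lmod.
rewrite E nuZ nm2.
have := IHn (sqit Y n.+1 x + sqit Y n x).
have := nuD (sqit Y n.+1 x) (sqit Y n x).
have := sqit_bound n.+1 x; have := sqit_bound n x.
have := @zeta_incr R n; have := nu_ge0 x.
rewrite [zeta R n.+2]/= -/(zeta R n.+1).
set v := sqit Y n.+1 _ + sqit Y n x; set w := sqit Y n.+1 v - _.
set zn := zeta R n; have -> : zeta R n.+1 = (1 + zn ^+ 2) / 2 by [].
set zn1 := (1 + zn ^+ 2) / 2.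
have e : zn1 = (1 + zn ^+ 2) / 2 by [].
move: zn1 e => zn1 e p1 p2 p3 p4 p5 p6.
have : (zn1 - zn) * nu v <= (zn1 - zn) * ((zn1 + zn) * nu x).
  by rewrite ler_wpM2l ?subr_ge0// (le_trans p5)//; lra.
have -> : (1 + zn1 ^+ 2) / 2 - zn1 = (zn1 ^+ 2 - zn ^+ 2) / 2 by rewrite {2}e; field.
by lra.
Qed.

Lemma sqit_cauchy m n x : (n <= m)%N ->
  nu (sqit Y m x - sqit Y n x) <= (zeta R m - zeta R n) * nu x.
Proof.
move=> /subnK <-; elim: (m - n)%N => [|k IHk].
  by rewrite add0n !subrr -(scale0r x) nuZ nm0.
rewrite addSn; have := sqit_step (k + n) x.
have -> : sqit Y (k + n).+1 x - sqit Y n x =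
  (sqit Y (k + n).+1 x - sqit Y (k + n) x) + (sqit Y (k + n) x - sqit Y n x) by lmod.
by have := nuD (sqit Y (k + n).+1 x - sqit Y (k + n) x) (sqit Y (k + n) x - sqit Y n x); lra.
Qed.

End Iteration.

Lemma nat_gt (R : realType) (x : R) : exists n, x < n%:R.
Proof.
by exists (Num.truncn x).+1; exact: truncnS_gt.
Qed.

Lemma expr_small (R : realType) (q e : R) : 0 <= q -> q < 1 -> 0 < e ->
  exists N, forall n, (N <= n)%N -> q ^+ n <= e.
Proof.
move=> q0 q1 e0; have hq : `|q| < 1 by rewrite ger0_norm.
have /cvgrPdist_le /(_ _ e0) [N _ hN] := cvg_expr hq.
exists N => n hn; have := hN n hn.
by rewrite /= sub0r normrN ger0_norm ?exprn_ge0.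
Qed.

(** * Unital C*-algebras *)

Record cstarAlg (R : realType) := CStarAlg {
  cs_car :> algType R[i];
  star : cs_car -> cs_car;
  nrm : cs_car -> R;
  nrmD : forall x y, nrm (x + y) <= nrm x + nrm y;
  nrmZ : forall c x, nrm (c *: x) = nm c * nrm x;
  nrm_eq0 : forall x, nrm x = 0 -> x = 0;
  nrmM : forall x y, nrm (x * y) <= nrm x * nrm y;
  starL : forall c x y, star (c *: x + y) = c^* *: star x + star y;
  starM : forall x y, star (x * y) = star y * star x;
  starK : forall x, star (star x) = x;
  nrmC : forall x, nrm (star x * x) = nrm x ^+ 2;
  nrm_complete : forall u : nat -> cs_car,
    cauchys (fun x y => nrm (x - y)) u ->
    exists l, cvgs (fun x y => nrm (x - y)) u l
}.

Ltac nce := rewrite ?expr2; repeat (progress rewrite ?mulrDl ?mulrDr ?mulrN ?mulNr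
  ?mul1r ?mulr1 ?mul0r ?mulr0 -?scalerAl -?scalerAr ?mulrA ?scalerA).
Ltac nc := nce; lmod.

Section CStar.
Context {R : realType} {D : cstarAlg R}.
Implicit Types (x y z h : D).
Local Notation dD := (fun x y : D => nrm (x - y)).

Lemma star0 : star (0 : D) = 0.
Proof.
by have := starL (-1) (0 : D) 0; rewrite scaler0 addr0 rmorphN rmorph1 scaleN1r addNr.
Qed.
Lemma starZ c x : star (c *: x) = c^* *: star x.
Proof. by have := starL c x 0; rewrite star0 !addr0. Qed.
Lemma starD x y : star (x + y) = star x + star y.
Proof. by have := starL 1 x y; rewrite rmorph1 !scale1r. Qed.
Lemma starN x : star (- x) = - star x.
Proof. by rewrite -scaleN1r starZ rmorphN rmorph1 scaleN1r. Qed.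
Lemma starB x y : star (x - y) = star x - star y.
Proof. by rewrite starD starN. Qed.
Lemma star_one : star (1 : D) = 1.
Proof. by have := starM (star 1 : D) 1; rewrite mulr1 starK mulr1 => <-. Qed.
Lemma starZr r x : star (rc r *: x) = rc r *: star x.
Proof. by rewrite starZ rc_conj. Qed.

Lemma nrm0 : nrm (0 : D) = 0.
Proof. by rewrite -(scale0r (0 : D)) nrmZ nm0 mul0r. Qed.
Lemma nrmN x : nrm (- x) = nrm x.
Proof. by rewrite -scaleN1r nrmZ nmN nm1 mul1r. Qed.
Lemma nrmBC x y : nrm (x - y) = nrm (y - x).
Proof. by rewrite -nrmN opprB. Qed.
Lemma nrmB x y : nrm (x - y) <= nrm x + nrm y.
Proof. by rewrite -(nrmN y) nrmD. Qed.
Lemma nrm_ge0 x : 0 <= nrm x.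
Proof. by have := nrmB x x; rewrite subrr nrm0; lra. Qed.
Lemma nrm_star x : nrm (star x) = nrm x.
Proof.
have le y : nrm y <= nrm (star y).
  have := nrmC y; have := nrmM (star y) y; have := nrm_ge0 y.
  have := nrm_ge0 (star y); rewrite expr2.
  case: (ltrP 0 (nrm y)) => [h h1 h2 h3 h4|]; last by lra.
  by rewrite -(ler_pM2r h); rewrite -h4.
by apply/eqP; rewrite eq_le le -{2}(starK x) le.
Qed.
Lemma nrmZr r x : 0 <= r -> nrm (rc r *: x) = r * nrm x.
Proof. by move=> r0; rewrite nrmZ nm_rc ger0_norm. Qed.
Lemma nrm1 : nrm (1 : D) = 1.
Proof.
have := nrmC (1 : D); rewrite star_one mul1r => e.
have : nrm (1 : D) != 0.
  by apply/eqP => /nrm_eq0 /eqP; rewrite oner_eq0.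
move=> n0; apply: (mulfI n0); rewrite mulr1 -expr2; exact: esym.
Qed.
Lemma nrm_rc1 r : 0 <= r -> nrm (rc r *: (1 : D)) = r.
Proof. by move=> r0; rewrite nrmZr// nrm1 mulr1. Qed.
Lemma nrm_sa x : star x = x -> nrm (x * x) = nrm x ^+ 2.
Proof. by move=> h; rewrite -{1}h nrmC. Qed.

(** A norm closed subalgebra, with or without unit. Membership of a constructed element in every
    such set containing the data replaces the functional calculus; together with [comm_closed] it
    yields commutation relations. *)
Definition alg_closed (P : set D) : Prop :=
  [/\ forall c x y, P x -> P y -> P (c *: x + y),
      forall x y, P x -> P y -> P (x * y) &
      forall u l, (forall n, P (u n)) -> cvgs dD u l -> P l].

Lemma nrm_small x : (forall e : R, 0 < e -> nrm x <= e) -> x = 0.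
Proof.
move=> h; apply: nrm_eq0; apply/eqP; rewrite eq_le nrm_ge0 andbT.
by apply: ler_eps => e e0; rewrite add0r h.
Qed.

Lemma comm_closed y : alg_closed [set x | x * y = y * x].
Proof.
split=> [c a b /= ha hb|a b /= ha hb|u l hu hl /=].
- by rewrite mulrDl mulrDr -scalerAl -scalerAr ha hb.
- by rewrite -mulrA hb mulrA ha mulrA.
- apply: subr0_eq; apply/nrm_small => e e0.
  have k0 : 0 < 2 * nrm y + 1 by have := nrm_ge0 y; lra.
  have [N /(_ N (leqnn _)) hN] := hl _ (divr_gt0 e0 k0).
  have hu' : u N * y = y * u N := hu N.
  have -> : l * y - y * l = y * (u N - l) - (u N - l) * y.
    by nce; rewrite hu'; lmod.
  have := nrmB (y * (u N - l)) ((u N - l) * y).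
  have := nrmM y (u N - l); have := nrmM (u N - l) y.
  move: hN; rewrite ler_pdivlMr//; have := nrm_ge0 y; have := nrm_ge0 (u N - l); nra.
Qed.

Lemma alg_closed0 P x : alg_closed P -> P x -> P 0.
Proof. by move=> [h _ _] Px; rewrite -(addNr x) -scaleN1r; apply: h. Qed.
Lemma alg_closedZ P c x : alg_closed P -> P x -> P (c *: x).
Proof.
by move=> aP Px; rewrite -(addr0 (c *: x)); case: (aP) => h _ _; apply: h => //; exact: (alg_closed0 aP Px).
Qed.
Lemma alg_closedD P x y : alg_closed P -> P x -> P y -> P (x + y).
Proof. by move=> [h _ _] Px Py; rewrite -(scale1r x); apply: h. Qed.
Lemma alg_closedB P x y : alg_closed P -> P x -> P y -> P (x - y).
Proof. by move=> [h _ _] Px Py; rewrite addrC -scaleN1r; apply: h. Qed.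

(** Here [z = 1 - sqrt (1 - y)]. The iterates are polynomials in [y] without constant term, so [z]
    lies in every closed algebra that contains [y], even without unit. *)
Lemma sqrt_one y : nrm y <= 1 -> exists z,
  [/\ z + z = y + z * z, nrm z <= 1, star y = y -> star z = z &
      forall P, alg_closed P -> P y -> P z].
Proof.
move=> hy; pose Y := fun x : D => y * x.
have lY : linear Y by move=> c a b; rewrite /Y mulrDr -scalerAr.
have nY x : nrm (Y x) <= nrm x.
  by apply: le_trans (nrmM _ _) _; have := nrm_ge0 x; nra.
pose u n := sqit Y n 1.
have uE n x : sqit Y n x = u n * x.
  elim: n x => [|n IHn] x /=; first by rewrite /u /= mul0r.
  by rewrite /u /= -/(u n) !IHn -scalerAl mulrDl /Y mulr1 mulrA.
have u1 n : u n.+1 = 2^-1 *: (y + u n * u n).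
  by rewrite {1}/u /= -/(u n) uE /Y mulr1.
have nu n : nrm (u n) <= 1.
  have := sqit_bound (@nrmD R D) (@nrmZ R D) nY n 1.
  by rewrite nrm1 mulr1 => /le_trans -> //; have /andP[] := @zeta_bound R n.
have cu : cauchys dD u.
  move=> e /zeta_cauchy [N hN]; exists N => m n hm hn.
  wlog mn : m n hm hn / (n <= m)%N.
    by move=> W; case/orP: (leq_total n m) => ?; [|rewrite nrmBC]; exact: W.
  have := sqit_cauchy (@nrmD R D) (@nrmZ R D) nrm_ge0 lY nY 1 mn.
  by rewrite nrm1 mulr1 => /le_trans -> //; exact: hN.
have [z hz] := nrm_complete cu.
exists z; have nz : nrm z <= 1.
  apply: ler_eps => e e0; have [N /(_ N (leqnn _)) hN] := hz _ e0.
  have -> : z = u N - (u N - z) by lmod.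
  by have := nrmB (u N) (u N - z); have := nu N; lra.
split=> //.
- apply: subr0_eq; apply/nrm_small => e e0.
  have e6 : 0 < e / 6 by lra.
  have [N hN] := hz _ e6.
  have a := hN _ (leqnn N); have b := hN N.+1 (leqnSn N).
  have -> : z + z - (y + z * z) = (2 : R[i]) *: (z - u N.+1) + (u N - z) * u N + z * (u N - z).
    rewrite u1 scalerBr scalerA mulfV ?pnatr_eq0// scale1r.
    rewrite (_ : (2:R[i]) *: z = z + z); last by rewrite -[2]/(1 + 1) scalerDl scale1r.
    by nc.
  have := nrmD ((2 : R[i]) *: (z - u N.+1) + (u N - z) * u N) (z * (u N - z)).
  have := nrmD ((2 : R[i]) *: (z - u N.+1)) ((u N - z) * u N).
  have := nrmM (u N - z) (u N); have := nrmM z (u N - z).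
  rewrite nrmZ -[2]rc_nat nm_rc ger0_norm// (nrmBC z).
  by have := nu N; have := nrm_ge0 (u N - z); have := nrm_ge0 (u N); have := nrm_ge0 z; nra.
- move=> sy; have su n : star (u n) = u n.
    elim: n => [|n IHn]; first by rewrite /u /= star0.
    rewrite u1 starZ starD starM IHn sy; congr (_ *: _).
    by rewrite fmorphV rmorph_nat.
  apply: subr0_eq; apply/nrm_small => e e0.
  have e6 : 0 < e / 2 by lra.
  have [N /(_ N (leqnn _)) hN] := hz _ e6.
  have -> : star z - z = (u N - z) - star (u N - z) by rewrite starB su; lmod.
  by have := nrmB (u N - z) (star (u N - z)); rewrite nrm_star; lra.
- move=> P aP Py; case: (aP) => _ PM Plim; apply: Plim hz => n.
  elim: n => [|n IHn]; first exact: (alg_closed0 aP Py).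
  by rewrite u1; apply: alg_closedZ => //; apply: alg_closedD => //; exact: PM.
Qed.

(* [w + i sqrt (1 - w^2)] is unitary *)
Lemma nrm_1Bsq (w : D) : star w = w -> nrm w <= 1 -> nrm (1 - w * w) <= 1.
Proof.
move=> sw nw.
have ny : nrm (w * w) <= 1 by rewrite nrm_sa//; have := nrm_ge0 w; nra.
have [z [hz nz sz Pz]] := sqrt_one ny.
have {}sz : star z = z by apply: sz; rewrite starM sw.
have zw : z * w = w * z by apply: (Pz _ (comm_closed w)); rewrite /= mulrA.
pose u : D := w + 'i *: (1 - z).
have su : star u = w - 'i *: (1 - z).
  by rewrite starD starZ starB star_one sw sz conj_i scaleNr.
have zz : z * z = z + z - w * w by rewrite hz; lmod.
have uu : star u * u = 1.
  by rewrite su /u; nce; rewrite zw zz; lmod.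
have nu : nrm u = 1.
  have := nrmC u; rewrite uu nrm1 => e.
  by have := nrm_ge0 u; nra.
have n1z : nrm (1 - z) <= 1.
  have -> : 1 - z = (- 'i / 2) *: (u - star u).
    by rewrite su /u; lmod.
  rewrite nrmZ nmM nmN nm_i -(rc_nat 2) -rcV nm_rc ger0_norm ?invr_ge0//.
  by have := nrmB u (star u); rewrite nrm_star nu; lra.
have -> : 1 - w * w = (1 - z) * (1 - z).
  by nce; rewrite zz; lmod.
rewrite nrm_sa; last by rewrite starB star_one sz.
by have := nrm_ge0 (1 - z); nra.
Qed.

(** For selfadjoint [h] this says that the spectrum lies in [[0, 2 M]]. In this form sums of
    positive elements are positive by the triangle inequality, and no spectra occur. *)
Definition pos h : Prop := star h = h /\ exists2 M : R, 0 <= M & nrm (rc M *: 1 - h) <= M.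

Lemma pos_sa h : pos h -> star h = h. Proof. by case. Qed.

Lemma pos_ge h : pos h -> exists2 M, 0 < M & forall K, M <= K -> nrm (rc K *: 1 - h) <= K.
Proof.
move=> [_ [M M0 hM]]; exists (M + 1); first by lra.
move=> K hK; have -> : rc K *: 1 - h = rc (K - M) *: 1 + (rc M *: 1 - h).
  by rewrite rcB; lmod.
have K0 : 0 <= K - M by lra.
by have := nrmD (rc (K - M) *: 1) (rc M *: 1 - h); rewrite nrm_rc1//; lra.
Qed.

Lemma posD h k : pos h -> pos k -> pos (h + k).
Proof.
move=> [sh [M M0 hM]] [sk [N N0 hN]]; split; first by rewrite starD sh sk.
exists (M + N); first by lra.
have -> : rc (M + N) *: 1 - (h + k) = (rc M *: 1 - h) + (rc N *: 1 - k) by rewrite rcD; lmod.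
by have := nrmD (rc M *: 1 - h) (rc N *: 1 - k); lra.
Qed.

Lemma posZ r h : 0 <= r -> pos h -> pos (rc r *: h).
Proof.
move=> r0 [sh [M M0 hM]]; split; first by rewrite starZr sh.
exists (r * M); first by rewrite mulr_ge0.
have -> : rc (r * M) *: 1 - rc r *: h = rc r *: (rc M *: 1 - h) by rewrite rcM; lmod.
by rewrite nrmZr// ler_wpM2l.
Qed.

Lemma pos_rc r : 0 <= r -> pos (rc r *: 1).
Proof.
move=> r0; split; first by rewrite starZr star_one.
by exists r => //; rewrite subrr nrm0.
Qed.

Lemma pos0 : pos 0. Proof. by rewrite -(scale0r 1) -rc0; apply: pos_rc. Qed.

Lemma pos_sum I (s : seq I) (F : I -> D) : (forall i, pos (F i)) -> pos (\sum_(i <- s) F i).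
Proof. by move=> h; apply: big_ind => //; [exact: pos0|exact: posD]. Qed.

Lemma pos_sq w : star w = w -> pos (w * w).
Proof.
move=> sw; split; first by rewrite starM sw.
have [w0|w0] := eqVneq (nrm w) 0.
  by rewrite (nrm_eq0 w0) mulr0; have [_] := pos0.
have wp : 0 < nrm w by rewrite lt_neqAle eq_sym w0 nrm_ge0.
exists (nrm w ^+ 2); first exact: sqr_ge0.
pose v := rc (nrm w)^-1 *: w.
have sv : star v = v by rewrite starZr sw.
have wv : w = rc (nrm w) *: v by rewrite /v scalerA -rcM mulfV// scale1r.
have nv : nrm v <= 1 by rewrite nrmZr ?invr_ge0 ?nrm_ge0// mulVf.
have -> : rc (nrm w ^+ 2) *: 1 - w * w = rc (nrm w ^+ 2) *: (1 - v * v).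
  by rewrite [X in _ - X * _]wv [X in _ - _ * X]wv -scalerAl -scalerAr scalerA -rcM -expr2; lmod.
rewrite nrmZr ?sqr_ge0//; have := nrm_1Bsq sv nv; have := sqr_ge0 (nrm w); nra.
Qed.

(** Write [h = M (1 - y)] with [nrm y <= 1]; then [a = sqrt M (1 - z)] for the [z] of [sqrt_one]. *)
Lemma sqrt_pos h : pos h -> exists a,
  [/\ star a = a, a * a = h, pos a &
      forall P, alg_closed P -> P 1 -> P h -> P a].
Proof.
move=> ph; have [M M0 hM] := pos_ge ph; have {}hM := hM _ (lexx M).
have M1 : M != 0 by rewrite gt_eqF.
pose y := 1 - rc M^-1 *: h.
have ny : nrm y <= 1.
  have -> : y = rc M^-1 *: (rc M *: 1 - h).
    by rewrite /y scalerBr scalerA -rcM mulVf// scale1r.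
  rewrite nrmZr; last by rewrite invr_ge0 ltW.
  by rewrite mulrC ler_pdivrMr// mul1r.
have sy : star y = y by rewrite starB star_one starZr (pos_sa ph).
have [z [hz nz sz Pz]] := sqrt_one ny; have {}sz := sz sy.
have s0 := sqrtr_ge0 M; have ss : Num.sqrt M * Num.sqrt M = M.
  by rewrite -expr2 sqr_sqrtr// ltW.
exists (rc (Num.sqrt M) *: (1 - z)); split.
- by rewrite starZr starB star_one sz.
- rewrite -scalerAl -scalerAr scalerA -rcM ss.
  have -> : (1 - z) * (1 - z) = 1 - y.
    have -> : y = z + z - z * z by rewrite hz; lmod.
    by nc.
  by rewrite /y subKr scalerA -rcM mulfV// scale1r.
- split; first by rewrite starZr starB star_one sz.
  exists (Num.sqrt M) => //; have -> : rc (Num.sqrt M) *: 1 - rc (Num.sqrt M) *: (1 - z) = rc (Num.sqrt M) *: z by lmod.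
  by rewrite nrmZr//; nra.
- move=> P aP P1 Ph; apply: alg_closedZ => //; apply: alg_closedB => //.
  by apply: Pz => //; apply: alg_closedB => //; apply: alg_closedZ.
Qed.

(** The square roots [a] of [c - S] and [b] of [c + S] commute, and [u = a + i b] satisfies
    [u^* u = 2 c], while the real part of [u^2] is [a^2 - b^2 = - 2 S]. *)
Lemma interval_pos c S : 0 < c -> pos (rc c *: 1 - S) -> pos (rc c *: 1 + S) -> nrm S <= c.
Proof.
move=> c0 p1 p2.
have [a [sa aa _ Pa]] := sqrt_pos p1; have [b [sb bb _ Pb]] := sqrt_pos p2.
have ab : a * b = b * a.
  apply: (Pa _ (comm_closed b)) => /=; first by rewrite mul1r mulr1.
  rewrite mulrBl mulrBr -scalerAl -scalerAr mul1r mulr1; congr (_ - _).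
  apply: esym; apply: (Pb _ (comm_closed S)) => /=; first by rewrite mul1r mulr1.
  by rewrite mulrDl mulrDr -scalerAl -scalerAr mul1r mulr1.
pose u := a + 'i *: b.
have su : star u = a - 'i *: b by rewrite starD starZ sa sb conj_i scaleNr.
have uu : star u * u = rc (2 * c) *: 1.
  rewrite su /u; nce; rewrite aa bb ab.
  by rewrite rcD; lmod.
have nu : nrm u ^+ 2 = 2 * c by rewrite -nrmC uu nrm_rc1//; lra.
have u2 : u * u = (-2) *: S + (2 * 'i) *: (a * b).
  rewrite /u; nce; rewrite aa bb ab.
  by lmod.
have su2 : star (u * u) = (-2) *: S - (2 * 'i) *: (a * b).
  rewrite starM su; nce; rewrite aa bb ab.
  by lmod.
have -> : S = rc (- 4^-1) *: (u * u + star (u * u)).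
  by rewrite su2 u2 rcN rcV rc_nat; lmod.
rewrite nrmZ nm_rc normrN ger0_norm ?invr_ge0//.
by have := nrmD (u * u) (star (u * u)); rewrite nrm_star; have := nrmM u u; rewrite expr2 in nu; rewrite nu; lra.
Qed.

(** Subtracting the midpoint [(b + e) / 2] reduces this to the symmetric interval of [interval_pos];
    the [e] keeps the radius positive when [b = 0]. *)
Lemma pos_le h b : 0 <= b -> pos h -> pos (rc b *: 1 - h) -> nrm h <= b.
Proof.
move=> b0 ph pb; apply: ler_eps => e e0.
have c0 : 0 < (b + e) / 2 by lra.
have E : rc (b + e) = rc ((b + e) / 2) + rc ((b + e) / 2) by rewrite -rcD; congr rc; lra.
have := @interval_pos _ (h - rc ((b + e) / 2) *: 1) c0.
have -> : rc ((b + e) / 2) *: 1 - (h - rc ((b + e) / 2) *: 1) = (rc b *: 1 - h) + rc e *: 1.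
  have -> : rc ((b + e) / 2) *: 1 - (h - rc ((b + e) / 2) *: 1) = rc (b + e) *: 1 - h.
    by rewrite E; lmod.
  by rewrite rcD; lmod.
have -> : rc ((b + e) / 2) *: 1 + (h - rc ((b + e) / 2) *: 1) = h by lmod.
move=> /(_ (posD pb (pos_rc (ltW e0))) ph) H.
have -> : h = (h - rc ((b + e) / 2) *: 1) + rc ((b + e) / 2) *: 1 by lmod.
by have := nrmD (h - rc ((b + e) / 2) *: 1) (rc ((b + e) / 2) *: 1); rewrite nrm_rc1; lra.
Qed.

Lemma pos_nrm h b : star h = h -> nrm h <= b -> pos (rc b *: 1 - h).
Proof.
move=> sh hb; have b0 := le_trans (nrm_ge0 h) hb.
split; first by rewrite starB starZr star_one sh.
by exists b => //; rewrite subKr.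
Qed.

Lemma pos_mono h k : pos h -> pos (k - h) -> nrm h <= nrm k.
Proof.
move=> ph pk; apply: pos_le => //; first exact: nrm_ge0.
have sk : star k = k by have := posD ph pk; rewrite addrC subrK => /pos_sa.
have -> : rc (nrm k) *: 1 - h = (rc (nrm k) *: 1 - k) + (k - h) by lmod.
by apply: posD => //; exact: pos_nrm.
Qed.

Lemma nrmX_le1 h n : nrm h <= 1 -> nrm (h ^+ n) <= 1.
Proof.
move=> h1; elim: n => [|n IHn]; first by rewrite expr0 nrm1.
rewrite exprS (le_trans (nrmM _ _))//; have := nrm_ge0 h; have := nrm_ge0 (h ^+ n); nra.
Qed.

(* Kelley-Vaught.  If [z^* z = - q^2] with [q] selfadjoint, then [z z^*] is
   positive, so that the powers of [1 - t z z^*] stay bounded; but they contain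
   the powers of [1 + t q^2]. *)
Lemma star_mul_neg_sq (z q : D) : star q = q -> star z * z = - (q * q) -> q * q = 0.
Proof.
move=> sq hz.
pose u := rc 2^-1 *: (z + star z); pose v := (- 'i / 2) *: (z - star z).
have su : star u = u by rewrite starZr starD starK addrC.
have sv : star v = v.
  have e : (- 'i / 2 : R[i])^* = 'i / 2.
    by rewrite rmorphM rmorphN /= conjCi opprK fmorphV rmorph_nat.
  rewrite /v starZ starB starK e; lmod.
have zE : z = u + 'i *: v by rewrite /u /v rcV rc_nat; lmod.
have szE : star z = u - 'i *: v by rewrite [X in star X]zE starD su (starZ 'i v) sv conj_i; lmod.
(* [z z^* + z^* z = 2 (u^2 + v^2)] for the real part [u] and the imaginary part [v], and
   [z^* z = - q^2]. *)
have pz : pos (z * star z).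
  have -> : z * star z = (rc 2 *: (u * u) + rc 2 *: (v * v)) + q * q.
    have -> : q * q = - ((u - 'i *: v) * (u + 'i *: v)) by rewrite -szE -zE hz opprK.
    have -> : z * star z = (u + 'i *: v) * (u - 'i *: v) by rewrite -szE -zE.
    by rewrite rc_nat; clearbody u v; nc.
  by apply: posD; [apply: posD; apply: posZ => //|]; exact: pos_sq.
have [M M0 hM] := pos_ge pz; have {}hM := hM _ (lexx M).
have M1 : M != 0 by rewrite gt_eqF.
pose t := rc M^-1; pose c := 1 - t *: (z * star z).
have nc1 : nrm c <= 1.
  have -> : c = rc M^-1 *: (rc M *: 1 - z * star z).
    by rewrite /c /t scalerBr scalerA -rcM mulVf// scale1r.
  rewrite nrmZr; last by rewrite invr_ge0 ltW.
  by rewrite mulrC ler_pdivrMr// mul1r.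
pose b := 1 + t *: (q * q).
have cz n : c ^+ n * z = z * b ^+ n.
  have c1 : c * z = z * b.
    rewrite /c /b mulrBl mulrDr mul1r mulr1 -scalerAl -scalerAr -mulrA hz.
    by nc.
  elim: n => [|n IHn]; first by rewrite !expr0 mul1r mulr1.
  by rewrite exprSr -mulrA c1 mulrA IHn -mulrA -exprSr.
have bn n : nrm (q * q * b ^+ n) <= nrm z ^+ 2.
  have -> : q * q * b ^+ n = - (star z * (c ^+ n * z)).
    by rewrite cz mulrA hz mulNr opprK.
  rewrite nrmN (le_trans (nrmM _ _))// nrm_star expr2 ler_wpM2l ?nrm_ge0//.
  rewrite (le_trans (nrmM _ _))//; have := nrmX_le1 n nc1; have := nrm_ge0 z; nra.
have t0 : 0 <= M^-1 by rewrite invr_ge0 ltW.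
have pb : pos b.
  apply: posD; first by rewrite -(scale1r 1) -rc1; apply: pos_rc.
  by apply: posZ => //; exact: pos_sq.
have [w [sw ww _ Pw]] := sqrt_pos pb.
have wq : w * q = q * w.
  apply: (Pw _ (comm_closed q)) => /=; first by rewrite mul1r mulr1.
  by rewrite /b; nc.
have wXq n : w ^+ n * q = q * w ^+ n.
  elim: n => [|n IHn]; first by rewrite !expr0 mul1r mulr1.
  by rewrite exprSr -mulrA wq mulrA IHn -mulrA -exprSr.
have swX n : star (w ^+ n) = w ^+ n.
  by elim: n => [|n IHn]; rewrite ?star_one// exprSr starM IHn sw -exprS exprSr.
have bX n : b ^+ n = w ^+ n * w ^+ n by rewrite -exprD addnn -muln2 mulnC exprM expr2 ww.
have pqb n : pos (q * q * b ^+ n).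
  have -> : q * q * b ^+ n = (q * w ^+ n) * (q * w ^+ n).
    by rewrite bX -!mulrA; congr (_ * _); rewrite !mulrA wXq.
  by apply: pos_sq; rewrite starM swX sq wXq.
have pqqb n : pos (q * q * (q * q) * b ^+ n).
  have -> : q * q * (q * q) * b ^+ n = (q * q * w ^+ n) * (q * q * w ^+ n).
    rewrite bX -!mulrA; congr (_ * (_ * _)).
    by rewrite !mulrA wXq -!mulrA; congr (_ * _); rewrite !mulrA wXq.
  apply: pos_sq; rewrite !starM swX sq mulrA wXq -!mulrA; congr (_ * _).
  by rewrite wXq.
(* Bernoulli's inequality for the powers of [b = 1 + q^2 / M], multiplied by [q^2]. With the bound
   [bn], the norm of [n q^4 / M] stays below [nrm z ^+ 2] for all [n]. *)
have grow n : pos (q * q * b ^+ n - rc (n%:R * M^-1) *: (q * q * (q * q))).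
  elim: n => [|n IHn].
    by rewrite mul0r rc0 scale0r subr0; exact: pqb.
  have -> : q * q * b ^+ n.+1 - rc (n.+1%:R * M^-1) *: (q * q * (q * q)) =
    (q * q * b ^+ n - rc (n%:R * M^-1) *: (q * q * (q * q))) +
    t *: (q * q * (q * q) * b ^+ n - q * q * (q * q)).
    have -> : rc (n.+1%:R * M^-1) = rc (n%:R * M^-1) + t.
      by rewrite -[n.+1]addn1 natrD mulrDl mul1r rcD.
    by rewrite exprS {1}/b; nc.
  apply: posD => //; apply: posZ => //.
  elim: {IHn} n => [|n IHn]; first by rewrite expr0 mulr1 subrr; exact: pos0.
  have -> : q * q * (q * q) * b ^+ n.+1 - q * q * (q * q) =
    (q * q * (q * q) * b ^+ n - q * q * (q * q)) + t *: ((q * q) * (q * q * (q * q) * b ^+ n)).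
    by rewrite exprS {1}/b; nc.
  apply: posD => //; apply: posZ => //.
  have -> : q * q * (q * q * (q * q) * b ^+ n) = (q * (q * q * w ^+ n)) * (q * (q * q * w ^+ n)).
    rewrite bX -!mulrA; congr (_ * (_ * (_ * _))).
    by rewrite !mulrA !wXq -!mulrA; congr (_ * _); rewrite !mulrA !wXq -!mulrA; congr (_ * _); rewrite !mulrA wXq.
  apply: pos_sq; rewrite !starM swX sq !mulrA wXq -(mulrA q) wXq mulrA.
  by rewrite -(mulrA (q * q)) wXq !mulrA.
have sqq : star (q * q) = q * q by rewrite starM sq.
have q4 n : nrm (q * q) ^+ 2 * (n%:R * M^-1) <= nrm z ^+ 2.
  apply: le_trans (bn n).
  have nM : 0 <= n%:R * M^-1 by rewrite mulr_ge0.
  rewrite -nrm_sa// mulrC -nrmZr//; apply: pos_mono (grow n).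
  by apply: posZ => //; exact: pos_sq.
apply: nrm_eq0; apply/eqP/negP => /negP nz.
have nq : 0 < nrm (q * q) ^+ 2 by rewrite exprn_gt0// lt_neqAle eq_sym nz nrm_ge0.
have [n hn] := nat_gt (nrm z ^+ 2 * M / nrm (q * q) ^+ 2).
have := q4 n; rewrite mulrA ler_pdivrMr// mulrC -ler_pdivlMr//.
by apply/negP; rewrite -ltNge.
Qed.

(** Let [r] be the modulus of [h = x^* x] and [d = (r - h) / 2] its negative part. Then
    [(x d)^* (x d) = d h d = - r d^2] is minus the square of the selfadjoint element [s d], where
    [s^2 = r]; so it vanishes by [star_mul_neg_sq], which forces [d = 0] and [h = r]. *)
Lemma pos_star_mul x : pos (star x * x).
Proof.
have [h hE] : exists h, h = star x * x by exists (star x * x).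
rewrite -hE; have sh : star h = h by rewrite hE starM starK.
have [r [sr rr pr Pr]] := sqrt_pos (pos_sq sh).
have rh : r * h = h * r.
  by apply: (Pr _ (comm_closed h)) => /=; rewrite ?mul1r ?mulr1// mulrA.
pose d := rc 2^-1 *: (r - h).
have sd : star d = d by rewrite starZr starB sr sh.
have [s [ss sss _ Ps]] := sqrt_pos pr.
have sc y : r * y = y * r -> s * y = y * s.
  by move=> e; apply: (Ps _ (comm_closed y)) => //=; rewrite mul1r mulr1.
have rd : r * d = d * r by rewrite /d; nce; rewrite rh.
have dd : d * d = r * d by rewrite /d rcV rc_nat; nce; rewrite rr rh; lmod.
have dh : d * h = - (r * d) by rewrite /d rcV rc_nat; nce; rewrite rr rh; lmod.
have q2 : (s * d) * (s * d) = 0.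
  apply: (@star_mul_neg_sq (x * d)).
    by rewrite starM ss sd (sc d).
  rewrite starM sd -mulrA (mulrA _ x) -hE mulrA dh mulNr; congr (- _).
  by rewrite -!mulrA (mulrA d s d) -(sc d rd) !mulrA sss.
have d3 : d * d * d = 0.
  rewrite dd; move: q2; rewrite -!mulrA (mulrA d s d) -(sc d rd) !mulrA sss => <-.
  by [].
have dd0 : d * d = 0.
  apply: nrm_eq0; apply/eqP; rewrite -sqrf_eq0 -nrm_sa; last by rewrite starM sd.
  by rewrite mulrA d3 mul0r nrm0.
have d0 : d = 0.
  by apply: nrm_eq0; apply/eqP; rewrite -sqrf_eq0 -nrm_sa// dd0 nrm0.
have -> : h = r.
  apply/eqP; rewrite eq_sym -subr_eq0; apply/eqP.
  have -> : r - h = rc 2 *: d by rewrite /d rcV rc_nat; lmod.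
  by rewrite d0 scaler0.
by [].
Qed.

(** The last clause is the usual bound [1 / (1 - nrm v)] for the norm of the inverse, written
    without a division. *)
Lemma neumann (v : D) : nrm v < 1 -> exists u,
  [/\ u * (1 - v) = 1, (1 - v) * u = 1 & nrm u <= 1 + nrm v * nrm u].
Proof.
move=> v1; pose u n := \sum_(i < n) v ^+ i.
have nX n : nrm (v ^+ n) <= nrm v ^+ n.
  elim: n => [|n IHn]; first by rewrite !expr0 nrm1.
  by rewrite !exprS (le_trans (nrmM _ _))// ler_wpM2l ?nrm_ge0.
have v0 := nrm_ge0 v.
have uS n : u n.+1 = u n + v ^+ n by rewrite /u big_ord_recr.
have tail m n : (n <= m)%N -> nrm (u m - u n) <= nrm v ^+ n / (1 - nrm v).
  move=> /subnK <-; move: (m - n)%N => k; elim: k n => [|k IHk] n.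
    by rewrite add0n subrr nrm0 divr_ge0 ?exprn_ge0// subr_ge0 ltW.
  rewrite addSnnS.
  have -> : u (k + n.+1)%N - u n = (u (k + n.+1)%N - u n.+1) + v ^+ n.
    by rewrite uS; lmod.
  rewrite (le_trans (nrmD _ _))// (le_trans (lerD (IHk _) (nX _)))//.
  rewrite exprS le_eqVlt; apply/orP; left; apply/eqP; field.
  by rewrite subr_eq0 eq_sym lt_eqF.
have cu : cauchys dD u.
  move=> e e0.
  have e1 : 0 < e * (1 - nrm v) by rewrite mulr_gt0// subr_gt0.
  have [N hN] := expr_small v0 v1 e1.
  exists N => m n hm hn; wlog mn : m n hm hn / (n <= m)%N.
    by move=> W; case/orP: (leq_total n m) => ?; [|rewrite nrmBC]; exact: W.
  apply: le_trans (tail _ _ mn) _; rewrite ler_pdivrMr ?subr_gt0//.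
  exact: hN.
have [l hl] := nrm_complete cu.
have E1 n : u n * (1 - v) = 1 - v ^+ n.
  elim: n => [|n IHn]; first by rewrite /u big_ord0 mul0r expr0 subrr.
  by rewrite /u big_ord_recr /= -/(u n) mulrDl IHn exprSr; nc.
have uv n : u n * v = v * u n.
  rewrite /u mulr_suml mulr_sumr; apply: eq_bigr => i _.
  by rewrite -exprSr -exprS.
have lv : l * v = v * l.
  have [_ _ Pl] := comm_closed v; exact: (Pl u l uv hl).
have lE : l * (1 - v) = 1.
  apply: subr0_eq; apply/nrm_small => e e0.
  have e4 : 0 < e / 4 by lra.
  have [N hN] := hl _ e4.
  have [N' hN'] := expr_small v0 v1 e4.
  have a := hN (maxn N N') (leq_maxl _ _); have b := hN' (maxn N N') (leq_maxr _ _).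
  move: a b; set n := maxn N N' => a b.
  have -> : l * (1 - v) - 1 = - (u n - l) * (1 - v) - v ^+ n.
    by rewrite opprB mulrBl E1; lmod.
  have := nrmB (- (u n - l) * (1 - v)) (v ^+ n); have := nX n.
  have := nrmM (- (u n - l)) (1 - v); rewrite nrmN.
  by have := nrmB 1 v; rewrite nrm1; have := nrm_ge0 (u n - l); have := nrm_ge0 (1 - v); nra.
exists l; split => //; first by rewrite mulrBl mul1r -lv -lE mulrBr mulr1.
have lE2 : l = 1 + v * l by rewrite -lv -lE mulrBr mulr1 subrK.
have := nrmD 1 (v * l); rewrite -lE2 nrm1; have := nrmM v l; lra.
Qed.
End CStar.

(** * Extremal linear functionals below a sublinear one *)

Section Extremal.
Context {R : realType} {V : lmodType R[i]}.
Implicit Types (q P : V -> R) (x y b : V).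

Definition rlin (f : V -> R) : Prop :=
  (forall x y, f (x + y) = f x + f y) /\ (forall r x, f (rc r *: x) = r * f x).
Definition sublin q : Prop :=
  (forall x y, q (x + y) <= q x + q y) /\
  (forall r x, 0 <= r -> q (rc r *: x) = r * q x).
(** A sublinear [q] stands for the convex set of real-linear functionals below it, and the last
    clause says that this set is a face of the one of [P]. Extreme points can thus be found without
    a topology on the dual space. *)
Definition face P q : Prop :=
  [/\ sublin q, forall x, q x <= P x &
   forall (f1 f2 : V -> R) t, rlin f1 -> rlin f2 ->
     (forall x, f1 x <= P x) -> (forall x, f2 x <= P x) -> 0 < t < 1 ->
     (forall x, t * f1 x + (1 - t) * f2 x <= q x) ->
     (forall x, f1 x <= q x) /\ (forall x, f2 x <= q x)].

Lemma rlinN f x : rlin f -> f (- x) = - f x.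
Proof. by move=> [_ h]; rewrite -scaleN1r -rc1 -rcN h mulN1r. Qed.
Lemma sublin0 q : sublin q -> q 0 = 0.
Proof. by move=> [_ h]; rewrite -(scale0r (0 : V)) -rc0 h// mul0r. Qed.
Lemma sublin_opp q x : sublin q -> - q (- x) <= q x.
Proof. by move=> hq; have := hq.1 x (- x); rewrite subrr (sublin0 hq); lra. Qed.

(** The real-linear functionals below [cut q b] are those below [q] with the maximal value [q b] at
    [b]: it describes the exposed face in the direction [b]. *)
Definition cut q b x : R := inf [set q (x + rc t *: b) - t * q b | t in [set t | 0 <= t]].

Section Cut.
Variables (q : V -> R) (hq : sublin q) (b : V).

Lemma cut_lb x t : 0 <= t -> - q (- x) <= q (x + rc t *: b) - t * q b.
Proof.
move=> t0; have := hq.1 (x + rc t *: b) (- x).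
by rewrite addrAC subrr add0r hq.2//; lra.
Qed.

Lemma cut_le x t : 0 <= t -> cut q b x <= q (x + rc t *: b) - t * q b.
Proof.
move=> t0; apply: ge_inf; last by exists t.
by exists (- q (- x)) => _ [s s0 <-]; exact: cut_lb.
Qed.

Lemma cut_ge x m : (forall t, 0 <= t -> m <= q (x + rc t *: b) - t * q b) -> m <= cut q b x.
Proof.
move=> h; apply: lb_le_inf; first by exists (q (x + rc 0 *: b) - 0 * q b), 0 => /=.
by move=> _ [t t0 <-]; exact: h.
Qed.

Lemma cut_leq x : cut q b x <= q x.
Proof. by have := @cut_le x 0 (lexx _); rewrite rc0 scale0r addr0 mul0r subr0. Qed.

Lemma cutN : cut q b (- b) <= - q b.
Proof.
have := @cut_le (- b) 1 ler01; rewrite rc1 scale1r addNr (sublin0 hq) mul1r; lra.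
Qed.

Lemma cut_sublin : sublin (cut q b).
Proof.
split=> [x y|r x r0].
  suff : cut q b (x + y) - cut q b y <= cut q b x by lra.
  apply: cut_ge => t t0.
  suff : cut q b (x + y) - (q (x + rc t *: b) - t * q b) <= cut q b y by lra.
  apply: cut_ge => s s0.
  have := @cut_le (x + y) (t + s) (addr_ge0 t0 s0).
  have := hq.1 (x + rc t *: b) (y + rc s *: b).
  have -> : x + rc t *: b + (y + rc s *: b) = x + y + rc (t + s) *: b by rewrite rcD; lmod.
  by rewrite mulrDl; lra.
have [->|rn0] := eqVneq r 0.
  rewrite rc0 scale0r mul0r; apply/eqP; rewrite eq_le; apply/andP; split.
    by have := cut_leq 0; rewrite (sublin0 hq).
  by apply: cut_ge => t t0; rewrite add0r hq.2// subrr.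
have rp : 0 < r by rewrite lt_neqAle eq_sym rn0.
apply/eqP; rewrite eq_le; apply/andP; split.
  rewrite -ler_pdivrMl//; apply: cut_ge => t t0.
  have := @cut_le (rc r *: x) (r * t) (mulr_ge0 r0 t0).
  have -> : rc r *: x + rc (r * t) *: b = rc r *: (x + rc t *: b) by rewrite rcM; lmod.
  rewrite hq.2// ler_pdivrMl//; lra.
apply: cut_ge => t t0.
have := @cut_le x (r^-1 * t) (mulr_ge0 (ltW _) t0); rewrite invr_gt0 => /(_ rp).
rewrite -(ler_pM2l rp) => /le_trans; apply.
have -> : rc r *: x + rc t *: b = rc r *: (x + rc (r^-1 * t) *: b).
  by rewrite scalerDr scalerA -rcM mulrA mulfV// mul1r.
by rewrite hq.2// mulrBr -!mulrA (mulrA r r^-1) mulfV// mul1r.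
Qed.

End Cut.

Lemma cut_face P q b : face P q -> face P (cut q b).
Proof.
move=> [hq qP hf]; split; first exact: cut_sublin.
  by move=> x; apply: le_trans (qP x); exact: cut_leq.
move=> f1 f2 t l1 l2 h1 h2 t01 h.
have [g1 g2] : (forall x, f1 x <= q x) /\ (forall x, f2 x <= q x).
  apply: (hf f1 f2 t) => // x; apply: le_trans (h x) _; exact: cut_leq.
have hb : q b <= t * f1 b + (1 - t) * f2 b.
  by have := h (- b); rewrite (rlinN _ l1) (rlinN _ l2); have := cutN hq b; lra.
have [e1 e2] : f1 b = q b /\ f2 b = q b.
  by have := g1 b; have := g2 b; move/andP: t01 => [? ?]; split; nra.
by split=> x; apply: cut_ge => s s0; [have := g1 (x + rc s *: b)|have := g2 (x + rc s *: b)];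
  rewrite ?l1.1 ?l1.2 ?l2.1 ?l2.2 ?e1 ?e2; lra.
Qed.

Lemma face_refl P : sublin P -> face P P.
Proof. by move=> hP; split. Qed.

(** Zorn's lemma for the reversed pointwise order. A chain has its pointwise infimum as lower bound,
    finite because every member is at least [- P (- x)]. *)
Lemma minimal_face P q0 : face P q0 -> exists q,
  [/\ face P q, forall x, q x <= q0 x &
      forall q', face P q' -> (forall x, q' x <= q x) -> q' = q].
Proof.
move=> hq0; pose T := {q | face P q /\ forall x, q x <= q0 x}.
pose r (a b : T) : bool := `[< forall x, sval b x <= sval a x >].
have [|||A totA|t ht] := @Zorn T r.
- by move=> a; apply/asboolP => x.
- by move=> a b c /asboolP h1 /asboolP h2; apply/asboolP => x; exact: le_trans (h2 x) (h1 x).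
- move=> [a pa] [b pb] /asboolP /= h1 /asboolP /= h2; apply: eq_exist => /=.
  by apply/funext => x; apply/eqP; rewrite eq_le h1 h2.
- have [[a0 Aa0]|An] := pselect (exists a, A a); last first.
    exists (exist _ q0 (conj hq0 (fun x => lexx _))) => s As.
    by exfalso; apply: An; exists s.
  pose m x : R := inf [set sval a x | a in A].
  have lb (a : T) x : - P (- x) <= sval a x.
    case: a => a [[ha aP _] _] /=; have := sublin_opp x ha; have := aP (- x); lra.
  have mle a x : A a -> m x <= sval a x.
    move=> Aa; apply: ge_inf; last by exists a.
    by exists (- P (- x)) => _ [b Ab <-].
  have mge x k : (forall a, A a -> k <= sval a x) -> k <= m x.
    move=> h; apply: lb_le_inf; first by exists (sval a0 x), a0.
    by move=> _ [a Aa <-]; exact: h.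
  have ms : sublin m.
    split=> [x y|k x k0].
      suff : m (x + y) - m y <= m x by lra.
      apply: (mge) => a Aa.
      suff : m (x + y) - sval a x <= m y by lra.
      apply: (mge) => b Ab.
      (* Of two members of the chain the smaller one serves for both arguments, so the infimum
         remains subadditive. *)
      have [/asboolP ab|/asboolP ba] := totA _ _ Aa Ab.
        have [[[hs _] _ _] _] := svalP b; have := hs x y.
        by have := mle b (x + y) Ab; have := ab x; lra.
      have [[[hs _] _ _] _] := svalP a; have := hs x y.
      by have := mle a (x + y) Aa; have := ba y; lra.
    apply/eqP; rewrite eq_le; apply/andP; split.
      have [->|kn] := eqVneq k 0.
        rewrite mul0r rc0 scale0r; have := mle a0 0 Aa0.
        by have [[hs _ _] _] := svalP a0; rewrite (sublin0 hs).
      have kp : 0 < k by rewrite lt_neqAle eq_sym kn.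
      rewrite -ler_pdivrMl//; apply: (mge) => a Aa; rewrite ler_pdivrMl//.
      by have [[[_ <-//] _ _] _] := svalP a; exact: mle.
    apply: (mge) => a Aa; have [[[_ ->//] _ _] _] := svalP a.
    by rewrite ler_wpM2l// mle.
  have mf : face P m.
    split=> // [x|f1 f2 t l1 l2 h1 h2 t01 h].
      by have [[_ aP _] _] := svalP a0; apply: le_trans (aP x); exact: mle.
    by split=> x; apply: (mge) => a Aa; have [[_ _ hf] _] := svalP a;
      have [] := hf f1 f2 t l1 l2 h1 h2 t01 (fun x => le_trans (h x) (mle _ _ Aa)).
  have mq x : m x <= q0 x.
    by have [_ h] := svalP a0; apply: le_trans (h x); exact: mle.
  exists (exist _ m (conj mf mq)) => s As; apply/asboolP => x /=; exact: mle.
case: t ht => q [fq qq0] ht; exists q; split => // q' fq' q'q.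
have q'q0 x : q' x <= q0 x by exact: le_trans (q'q x) (qq0 x).
have := ht (exist _ q' (conj fq' q'q0)).
by move=> /(_ (asboolT q'q)) [].
Qed.

(** Hahn-Banach and Krein-Milman in one. A minimal face [q] below [cut P a] equals all of its own
    cuts, so [q (- b) = - q b] and [q] is linear. A face consisting of one functional is an extreme
    point, and starting from [cut P a] gives it the value [P a] at [a]. *)
Lemma extremal_linear P a : sublin P -> exists f,
  [/\ rlin f, forall x, f x <= P x, f a = P a &
   forall f1 f2 t, rlin f1 -> rlin f2 ->
     (forall x, f1 x <= P x) -> (forall x, f2 x <= P x) -> 0 < t < 1 ->
     (forall x, t * f1 x + (1 - t) * f2 x = f x) -> f1 = f].
Proof.
move=> hP; have [q [fq qq0 qmin]] := minimal_face (cut_face a (face_refl hP)).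
case: (fq) => hq qP hf.
have qN b : q (- b) = - q b.
  have := sublin_opp (- b) hq; rewrite opprK.
  have := qmin _ (cut_face b fq) (cut_leq hq b).
  by have := cutN hq b; move=> h1 h2; rewrite h2 in h1; lra.
have lq : rlin q.
  split=> [x y|r x].
    have := hq.1 x y; have := hq.1 (- x) (- y); rewrite -opprD !qN.
    by move=> ? ?; apply/eqP; rewrite eq_le; apply/andP; split; lra.
  have [r0|r0] := leP 0 r; first exact: hq.2.
  have := hq.2 (- r) (- x); rewrite rcN scaleNr scalerN opprK qN => ->; first by ring.
  by rewrite oppr_ge0 ltW.
exists q; split => //.
  apply/eqP; rewrite eq_le qP /=.
  by have := qq0 (- a); have := cutN hP a; rewrite qN; lra.
move=> f1 f2 t l1 l2 h1 h2 t01 h.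
have hh x : t * f1 x + (1 - t) * f2 x <= q x by rewrite h.
have [g1 _] := hf f1 f2 t l1 l2 h1 h2 t01 hh.
apply/funext => x; apply/eqP; rewrite eq_le g1 /=.
by have := g1 (- x); rewrite (rlinN _ l1) qN; lra.
Qed.

End Extremal.

(** * Hilbert space completions *)

Record semiIP (R : realType) := SemiIP {
  ipV :> lmodType R[i];
  ip : ipV -> ipV -> R[i];
  ipL : forall x c y z, ip x (c *: y + z) = c * ip x y + ip x z;
  ipC : forall x y, ip y x = (ip x y)^*;
  ip_ge0 : forall x, 0 <= re (ip x x)
}.

Section SemiIPTheory.
Context {R : realType} {V : semiIP R}.
Implicit Types (x y z : V) (c : R[i]).

Lemma ipr0 x : ip x 0 = 0.
Proof. by have := ipL x (-1) 0 0; rewrite scaler0 addr0 mulN1r addNr. Qed.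
Lemma iprD x y z : ip x (y + z) = ip x y + ip x z.
Proof. by have := ipL x 1 y z; rewrite scale1r mul1r. Qed.
Lemma iprZ x c y : ip x (c *: y) = c * ip x y.
Proof. by have := ipL x c y 0; rewrite !addr0 ipr0 addr0. Qed.
Lemma iprN x y : ip x (- y) = - ip x y.
Proof. by rewrite -scaleN1r iprZ mulN1r. Qed.
Lemma iprB x y z : ip x (y - z) = ip x y - ip x z.
Proof. by rewrite iprD iprN. Qed.
Lemma ipl0 x : ip 0 x = 0. Proof. by rewrite ipC ipr0 rmorph0. Qed.
Lemma iplD x y z : ip (y + z) x = ip y x + ip z x.
Proof. by rewrite ipC iprD conjD -!ipC. Qed.
Lemma iplZ x c y : ip (c *: y) x = c^* * ip y x.
Proof. by rewrite ipC iprZ conjM -ipC. Qed.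
Lemma iplN x y : ip (- y) x = - ip y x.
Proof. by rewrite ipC iprN conjN -ipC. Qed.
Lemma iplB x y z : ip (y - z) x = ip y x - ip z x.
Proof. by rewrite iplD iplN. Qed.
Lemma ip_real x : ip x x = rc (re (ip x x)).
Proof. by apply: conj_rc_re; rewrite -ipC. Qed.

Definition ipn x : R := Num.sqrt (re (ip x x)).
Lemma ipn_ge0 x : 0 <= ipn x. Proof. exact: sqrtr_ge0. Qed.
Lemma ipn_sqr x : ipn x ^+ 2 = re (ip x x). Proof. by rewrite sqr_sqrtr// ip_ge0. Qed.
Lemma ip_ipn x : ip x x = rc (ipn x ^+ 2). Proof. by rewrite ipn_sqr -ip_real. Qed.

Lemma re_ipD x y : re (ip (x + y) (x + y)) = re (ip x x) + 2 * re (ip x y) + re (ip y y).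
Proof. by rewrite iprD !iplD !reD (ipC x y) re_conj; ring. Qed.

Lemma ip_cs x y : nm (ip x y) <= ipn x * ipn y.
Proof.
have [w [nw wz ww]] := phase (ip x y).
set a := nm (ip x y) in wz *.
have q (t : R) : 0 <= t ^+ 2 * ipn x ^+ 2 + 2 * t * a + ipn y ^+ 2.
  rewrite !ipn_sqr; have := ip_ge0 (rc t *: (w^* *: x) + y).
  rewrite re_ipD !(iplZ, iprZ) rc_conj conjCK !mulrA.
  have -> : rc t * w * ip x y = rc (t * a) by rewrite -mulrA wz rcM.
  have -> : rc t * w * rc t * w^* * ip x x = rc (t ^+ 2) * ip x x.
    by rewrite -(mulrA _ (rc t)) (mulrC (rc t) w^*) mulrA -(mulrA _ w) (mulrC w) ww mulr1 expr2 rcM.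
  by rewrite reZ re_rc; lra.
have a0 : 0 <= a by exact: nm_ge0.
have x0 := ipn_ge0 x; have y0 := ipn_ge0 y.
have [xz|xn] := eqVneq (ipn x) 0.
  (* The polynomial is affine in [t] when [ipn x = 0]; this [t] gives it the value -1 if [a] is not
     0. *)
  rewrite xz mul0r; have := q (- (ipn y ^+ 2 + 1) / 2 / a); rewrite xz.
  have [->|an] := eqVneq a 0; first by [].
  have -> : (- (ipn y ^+ 2 + 1) / 2 / a) ^+ 2 * 0 ^+ 2 + 2 * (- (ipn y ^+ 2 + 1) / 2 / a) * a + ipn y ^+ 2 = -1 by field.
  by rewrite ler0N1.
have xp : 0 < ipn x by rewrite lt_neqAle eq_sym xn.
have := q (- a / ipn x ^+ 2).
have -> : (- a / ipn x ^+ 2) ^+ 2 * ipn x ^+ 2 + 2 * (- a / ipn x ^+ 2) * a + ipn y ^+ 2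
  = ((ipn x * ipn y) ^+ 2 - a ^+ 2) / ipn x ^+ 2 by field.
rewrite pmulr_lge0 ?invr_gt0 ?exprn_gt0// subr_ge0.
by rewrite ler_pXn2r// ?nnegrE// mulr_ge0.
Qed.

Lemma ipnD x y : ipn (x + y) <= ipn x + ipn y.
Proof.
have x0 := ipn_ge0 x; have y0 := ipn_ge0 y.
rewrite -(@ler_pXn2r _ 2)// ?nnegrE ?ipn_ge0 ?addr_ge0//.
rewrite ipn_sqr re_ipD -!ipn_sqr sqrrD.
by have := ip_cs x y; have := re_le_nm (ip x y); lra.
Qed.
Lemma ipnZ c x : ipn (c *: x) = nm c * ipn x.
Proof.
rewrite /ipn iplZ iprZ mulrA conj_mul reZ sqrtrM ?sqr_ge0// sqrtr_sqr.
by rewrite (ger0_norm (nm_ge0 c)).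
Qed.
Lemma ipn0 : ipn 0 = 0. Proof. by rewrite /ipn ipr0 re0 sqrtr0. Qed.
Lemma ipnN x : ipn (- x) = ipn x.
Proof. by rewrite -scaleN1r ipnZ nmN nm1 mul1r. Qed.
Lemma ipnB x y : ipn (x - y) <= ipn x + ipn y.
Proof. by rewrite -(ipnN y) ipnD. Qed.
Lemma ipnBC x y : ipn (x - y) = ipn (y - x).
Proof. by rewrite -ipnN opprB. Qed.

Lemma parallelogram x y : ipn (x + y) ^+ 2 + ipn (x - y) ^+ 2 = 2 * ipn x ^+ 2 + 2 * ipn y ^+ 2.
Proof. by rewrite !ipn_sqr !re_ipD !(iprN, iplN) opprK reN; lra. Qed.

End SemiIPTheory.

Lemma re_i (R : realType) : re ('i : R[i]) = 0.
Proof. by []. Qed.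

Definition einv (R : realType) (n : nat) : R := n.+1%:R^-1.
Lemma einv_gt0 (R : realType) n : 0 < einv R n.
Proof. by rewrite /einv invr_gt0. Qed.
Lemma einv_le1 (R : realType) n : einv R n <= 1.
Proof. by rewrite /einv invf_le1 ?ltr0n// ler1n. Qed.
Lemma near_inv (R : realType) (e : R) : 0 < e ->
  exists N, forall n, (N <= n)%N -> einv R n <= e.
Proof.
move=> e0; have [N hN] := nat_gt e^-1; exists N => n hn.
rewrite /einv -[leRHS]invrK lef_pV2 ?posrE ?invr_gt0//.
by rewrite (le_trans (ltW hN))// ler_nat leqW.
Qed.

Section Completion.
Context {R : realType} (V : semiIP R).
Implicit Types (x y z : V).

(* The completion consists of the conjugate-linear functionals on [V] that are
   limits of the functionals [ip _ x]. *)
Definition hnear u x (e : R) : Prop := forall y, nm (u y - ip y x) <= e * ipn y.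
Definition hpred : {pred V -> R[i]} :=
  fun u => `[< forall e : R, 0 < e -> exists x, hnear u x e >].

Lemma hnearD u w x y c (e f : R) : hnear u x e -> hnear w y f ->
  hnear (c *: u + w) (c *: x + y) (nm c * e + f).
Proof.
move=> h k z; rewrite ipL.
have -> : (c *: u + w) z - (c * ip z x + ip z y) = c * (u z - ip z x) + (w z - ip z y).
  have -> : (c *: u + w) z = c * u z + w z by [].
  by ring.
rewrite (le_trans (nmD _ _))// nmM mulrDl -mulrA lerD//.
by apply: ler_wpM2l; [exact: nm_ge0|exact: h].
Qed.

Lemma hpred_submod : submod_closed hpred.
Proof.
split.
  apply/asboolP => e e0; exists 0 => y.
  by rewrite ipr0 subrr nm0 mulr_ge0 ?ipn_ge0// ltW.
move=> c u w /asboolP hu /asboolP hw; apply/asboolP => e e0.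
have k0 : 0 < nm c + 1 by have := nm_ge0 c; lra.
have e1 : 0 < e / 2 / (nm c + 1) by rewrite !divr_gt0.
have e2 : 0 < e / 2 by rewrite divr_gt0.
have [x hx] := hu _ e1; have [y hy] := hw _ e2.
exists (c *: x + y) => z; apply: le_trans (hnearD c hx hy z) _.
rewrite ler_wpM2r ?ipn_ge0//.
have : nm c * (e / 2 / (nm c + 1)) <= e / 2.
  rewrite mulrA ler_pdivrMr//; have := nm_ge0 c; nra.
by lra.
Qed.
HB.instance Definition _ := GRing.isSubmodClosed.Build _ _ hpred hpred_submod.

Record hcomp := HComp { hfun :> V -> R[i]; hfunP : hfun \in hpred }.
HB.instance Definition _ := [isSub for hfun].
HB.instance Definition _ := [Choice of hcomp by <:].
HB.instance Definition _ := [SubChoice_isSubLmodule of hcomp by <:].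

Lemma hcompP (u : hcomp) (e : R) : 0 < e -> exists x, hnear u x e.
Proof. by move=> e0; have /asboolP := hfunP u; exact. Qed.

Lemma hcomp_eq (u w : hcomp) : (forall y, u y = w y) -> u = w.
Proof. by move=> h; apply/val_inj/funext. Qed.

Definition hseq (u : hcomp) : nat -> V :=
  fun n => xget 0 [set x | hnear u x (einv R n)].
Lemma hseqP (u : hcomp) n : hnear u (hseq u n) (einv R n).
Proof.
have n0 := einv_gt0 R n.
by have [x hx] := hcompP u n0; rewrite /hseq; case: xgetP => // /(_ x).
Qed.

Lemma hcomp_bound (u : hcomp) : exists2 M : R, 0 <= M & forall y, nm (u y) <= M * ipn y.
Proof.
have [x hx] := hcompP u ltr01; exists (ipn x + 1); first by have := ipn_ge0 x; lra.
move=> y; have -> : u y = (u y - ip y x) + ip y x by rewrite subrK.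
by have := nmD (u y - ip y x) (ip y x); have := hx y; have := ip_cs y x; lra.
Qed.

Lemma hcompB (u : hcomp) x y : u (x - y) = u x - u y.
Proof.
apply: subr0_eq; apply: nm_small => e e0.
have k0 : 0 < ipn (x - y) + ipn x + ipn y + 1.
  by have := ipn_ge0 (x - y); have := ipn_ge0 x; have := ipn_ge0 y; lra.
have [z hz] := hcompP u (divr_gt0 e0 k0).
have -> : u (x - y) - (u x - u y) =
  (u (x - y) - ip (x - y) z) - ((u x - ip x z) - (u y - ip y z)) by rewrite iplB; ring.
set d := e / _ in hz.
have := nmB (u (x - y) - ip (x - y) z) ((u x - ip x z) - (u y - ip y z)).
have := nmB (u x - ip x z) (u y - ip y z).
have := hz (x - y); have := hz x; have := hz y.
have : d * (ipn (x - y) + ipn x + ipn y + 1) = e by rewrite /d divfK// gt_eqF.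
have : 0 < d by rewrite divr_gt0.
by lra.
Qed.

Lemma hseq_ipn (u : hcomp) m n : ipn (hseq u m - hseq u n) <= (einv R m) + (einv R n).
Proof.
set y := _ - _; have y0 := ipn_ge0 y.
have : ipn y ^+ 2 <= ((einv R m) + (einv R n)) * ipn y.
  have -> : ipn y ^+ 2 = nm (ip y y) by rewrite ip_ipn nm_rc ger0_norm// sqr_ge0.
  have -> : ip y y = (u y - ip y (hseq u n)) - (u y - ip y (hseq u m)).
    by rewrite {2}/y iprB; ring.
  by have := nmB (u y - ip y (hseq u n)) (u y - ip y (hseq u m)); have := hseqP u n y; have := hseqP u m y; lra.
have [->|yn] := eqVneq (ipn y) 0; first by move=> _; have := einv_gt0 R n; try have := einv_gt0 R m; lra.
by rewrite expr2 ler_pM2r// lt_neqAle eq_sym yn.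
Qed.

Lemma complex_cauchy (z : nat -> R[i]) :
  cauchys (@dn R _) z -> exists l, cvgs (@dn R _) z l.
Proof.
move=> cz.
have rcv (f : R[i] -> R) : (forall a b, f (a - b) = f a - f b) -> (forall a, `|f a| <= nm a) ->
    exists l : R, forall e, 0 < e -> exists N, forall n, (N <= n)%N -> `|f (z n) - l| <= e.
  move=> fB fn; have h : cvg (f \o z @ \oo).
    apply/cauchy_cvgP/cauchy_ballP => e e0; near_simpl.
    have e2 : 0 < e / 2 by rewrite divr_gt0.
    have [N HN] := cz _ e2.
    exists ([set m | (N <= m)%N], [set m | (N <= m)%N]); first by split; exists N.
    move=> [m n] /= [hm hn]; rewrite /ball /= /ball_/= -fB.
    by have := HN _ _ hm hn; have := fn (z m - z n); rewrite /dn; lra.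
  exists (lim (f \o z @ \oo)) => e e0.
  have /cvgrPdist_le /(_ _ e0) [N _ HN] := h.
  by exists N => n hn; rewrite distrC; exact: HN.
have nre (x : R[i]) : `|re x| <= nm x by rewrite ler_norml re_le_nm re_ge_nm.
have [a ha] := rcv re (@reB R) nre.
have imB (x y : R[i]) : re ('i * (x - y)) = re ('i * x) - re ('i * y).
  by rewrite mulrBr reB.
have nim (x : R[i]) : `|re ('i * x)| <= nm x.
  by rewrite -[nm x]mul1r -(nm_i (R := R)) -nmM ler_norml re_le_nm re_ge_nm.
have [b hb] := rcv (fun t : R[i] => re ('i * t)) imB nim.
exists (rc a - 'i * rc b) => e e0.
have e2 : 0 < e / 2 by rewrite divr_gt0.
have [N hN] := ha _ e2; have [N' hN'] := hb _ e2.
exists (maxn N N') => n; rewrite geq_max => /andP[/hN h1 /hN' h2].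
rewrite /dn; set d := z n - _.
have r1 : re d = re (z n) - a.
  by rewrite /d reB reB re_rc mulrC reZ re_i; ring.
have r2 : re ('i * d) = re ('i * z n) - b.
  rewrite /d !mulrBr reB reB mulrA mulii mulN1r reN re_rc opprK (mulrC 'i (rc a)) reZ.
  by rewrite re_i; ring.
have := nm_sqr d; rewrite r1 r2; move: h1 h2.
rewrite !ler_norml => /andP[? ?] /andP[? ?] e'.
have := nm_ge0 d; nra.
Unshelve. all: by end_near. Qed.

Definition hdot (u w : hcomp) : R[i] :=
  xget 0 [set l | cvgs (@dn R _) (fun n => w (hseq u n)) l].

Lemma hdotP (u w : hcomp) : cvgs (@dn R _) (fun n => w (hseq u n)) (hdot u w).
Proof.
rewrite /hdot; case: xgetP => // /(_ _) nx.
have [|l hl] := @complex_cauchy (fun n => w (hseq u n)); last by case: (nx l).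
move=> e e0; have [M M0 hM] := hcomp_bound w.
have k0 : 0 < 2 * (M + 1) by lra.
have [N hN] := near_inv (divr_gt0 e0 k0).
exists N => m n /hN hm /hN hn; rewrite /dn -hcompB.
have := hM (hseq u m - hseq u n); have := hseq_ipn u m n.
have := ipn_ge0 (hseq u m - hseq u n).
set d := e / _ in hm hn; have de : d * (2 * (M + 1)) = e by rewrite /d divfK// gt_eqF.
have d0 : 0 < d by rewrite divr_gt0.
by nra.
Qed.

(** An explicit error for any approximating vectors. Symmetry, positivity and the values on vectors
    of [V] follow by letting [e] and [f] tend to 0. *)
Lemma hdot_approx (u w : hcomp) x z (e f : R) : 0 <= e -> 0 <= f -> hnear u x e -> hnear w z f ->
  nm (hdot u w - ip x z) <= e * ipn z + f * (ipn x + e).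
Proof.
move=> e0 f0 hu hw; apply: ler_eps => r r0.
have k0 : 0 < ipn z + f + 1 by have := ipn_ge0 z; lra.
have [N hN] := near_inv (divr_gt0 (divr_gt0 r0 (ltr0n _ 2)) k0).
have r2 : 0 < r / 2 by lra.
have [N' hN'] := hdotP u w r2.
have := hN' (maxn N N') (leq_maxr _ _); have := hN (maxn N N') (leq_maxl _ _).
set n := maxn N N'; set y := hseq u n; rewrite /dn => h1 h2.
have hy := hseqP u n; rewrite -/y in hy.
have ny : ipn (x - y) <= e + (einv R n).
  set a := x - y; have a0 := ipn_ge0 a.
  have : ipn a ^+ 2 <= (e + (einv R n)) * ipn a.
    have -> : ipn a ^+ 2 = nm (ip a a) by rewrite ip_ipn nm_rc ger0_norm// sqr_ge0.
    have -> : ip a a = (u a - ip a y) - (u a - ip a x) by rewrite {2}/a iprB; ring.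
    by have := nmB (u a - ip a y) (u a - ip a x); have := hy a; have := hu a; lra.
  have [->|an] := eqVneq (ipn a) 0; first by move=> _; have := einv_gt0 R n; try have := einv_gt0 R m; lra.
  by rewrite expr2 ler_pM2r// lt_neqAle eq_sym an.
have -> : hdot u w - ip x z = (w y - ip y z) - (w y - hdot u w) - ip (x - y) z.
  by rewrite iplB; ring.
have := nmB ((w y - ip y z) - (w y - hdot u w)) (ip (x - y) z).
have := nmB (w y - ip y z) (w y - hdot u w).
have := hw y; have := ip_cs (x - y) z.
have : ipn y <= ipn x + ipn (x - y) by rewrite -{1}(subKr x y) ipnB.
set d := (einv R n) in h1 ny; have d0 : 0 <= d := ltW (einv_gt0 R n).
set k := r / 2 / _ in h1; have kk : k * (ipn z + f + 1) = r / 2 by rewrite /k divfK// gt_eqF.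
have := ipn_ge0 z; have := ipn_ge0 x; have := ipn_ge0 y; have := ipn_ge0 (x - y).
move=> q1 q2 q3 q4 p1 p2 p3 p4 p5.
have p6 : ipn (x - y) * ipn z <= (e + d) * ipn z by rewrite ler_wpM2r.
have p7 : f * ipn y <= f * (ipn x + (e + d)) by rewrite ler_wpM2l//; lra.
have p8 : d * (ipn z + f) <= k * (ipn z + f) by rewrite ler_wpM2r// addr_ge0.
have : k * (ipn z + f) <= r / 2 by rewrite -kk; have k1 := le_trans d0 h1; nra.
by lra.
Qed.

Fact hdotL (u : hcomp) c (v w : hcomp) : hdot u (c *: v + w) = c * hdot u v + hdot u w.
Proof.
apply: cvgs_uniq (hdotP u _) _.
have h1 := @cvgs_lip R _ _ (fun t : R[i] => c * t) (nm c) _ _ _ (hdotP u v).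
apply: (cvgsD _ (hdotP u w)) => //; apply: h1 => a b.
by rewrite -mulrBr nmM.
Qed.

Fact hdotC (u w : hcomp) : hdot w u = (hdot u w)^*.
Proof.
apply: subr0_eq; apply/nm_eq0/eqP; rewrite eq_le nm_ge0 andbT.
have [M M0 hM] : exists2 M, 1 <= M & forall n, ipn (hseq u n) <= M /\ ipn (hseq w n) <= M.
  exists (ipn (hseq u 0) + ipn (hseq w 0) + 2).
    by have := ipn_ge0 (hseq u 0); have := ipn_ge0 (hseq w 0); lra.
  have i1 := @einv_le1 R.
  have b v n : ipn (hseq v n) <= ipn (hseq v 0) + 2.
    have := ipnB (hseq v 0) (hseq v 0 - hseq v n); rewrite subKr.
    by have := hseq_ipn v 0 n; have := i1 n; have := i1 0%N; lra.
  move=> n; have := b u n; have := b w n.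
  by have := ipn_ge0 (hseq u 0); have := ipn_ge0 (hseq w 0); split; lra.
apply: ler_eps => e e0; rewrite add0r.
have k0 : 0 < 6 * M by lra.
have [N hN] := near_inv (divr_gt0 e0 k0).
set d := e / _ in hN; have dM : d * (6 * M) = e by rewrite /d divfK// gt_eqF.
have d0 : 0 < d by rewrite divr_gt0.
have := hN N (leqnn _); have i1 := einv_le1 R N.
have i0 : 0 <= (einv R N) := ltW (einv_gt0 R N).
move: i1 i0; set i := (einv R N) => i1 i0 id.
have h1 := hdot_approx i0 i0 (hseqP u N) (hseqP w N).
have h2 := hdot_approx i0 i0 (hseqP w N) (hseqP u N).
have -> : hdot w u - (hdot u w)^* = (hdot w u - ip (hseq w N) (hseq u N))
   - (hdot u w - ip (hseq u N) (hseq w N))^*.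
  by rewrite conjB -ipC; ring.
have := nmB (hdot w u - ip (hseq w N) (hseq u N)) (hdot u w - ip (hseq u N) (hseq w N))^*.
rewrite nm_conj; have [] := hM N; move: h1 h2; rewrite -/i.
set a := ipn _; set b := ipn _ => h1 h2 aM bM hh.
have : i * a <= d * M by rewrite ler_pM// ipn_ge0.
have : i * b <= d * M by rewrite ler_pM// ipn_ge0.
have : i * i <= d * M by rewrite ler_pM//; lra.
by lra.
Qed.

Fact hdot_ge0 (u : hcomp) : 0 <= re (hdot u u).
Proof.
apply: ler_eps => e e0; have k0 : 0 < 2 * (ipn (hseq u 0) + 2) + 1 by have := ipn_ge0 (hseq u 0); lra.
have [N /(_ N (leqnn _)) hN] := near_inv (divr_gt0 e0 k0).
set d := e / _ in hN; have dM : d * (2 * (ipn (hseq u 0) + 2) + 1) = e by rewrite /d divfK// gt_eqF.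
have d0 : 0 < d by rewrite divr_gt0.
have i1 := @einv_le1 R.
have i0 : 0 <= (einv R N) := ltW (einv_gt0 R N).
have := hdot_approx i0 i0 (hseqP u N) (hseqP u N).
have b : ipn (hseq u N) <= ipn (hseq u 0) + 2.
  have := ipnB (hseq u 0) (hseq u 0 - hseq u N); rewrite subKr.
  by have := hseq_ipn u 0 N; have := i1 N; have := i1 0%N; lra.
have := i1 N; move: hN i0; set i := (einv R N) => hN i0 h1 h2.
have := re_ge_nm (hdot u u - ip (hseq u N) (hseq u N)); rewrite reB.
have := ip_ge0 (hseq u N); have := ipn_ge0 (hseq u N).
move: dM h2 b; set a := ipn (hseq u N); set b := ipn _; set c := nm _ => dM h2 ab a0 p0 p1.
have : i * a <= d * (b + 2) by rewrite ler_pM.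
have : i * i <= d * 1 by rewrite ler_pM.
by lra.
Qed.

Definition hcompIP : semiIP R := SemiIP hdotL hdotC hdot_ge0.

Lemma hj_in x : (fun y => ip y x) \in hpred.
Proof.
by apply/asboolP => e e0; exists x => y; rewrite subrr nm0 mulr_ge0 ?ipn_ge0// ltW.
Qed.
Definition hj x : hcomp := HComp (hj_in x).

Lemma hj_lin : linear hj.
Proof. by move=> c x y; apply: hcomp_eq => z; rewrite /= ipL. Qed.

Lemma hnear_hj x : hnear (hj x) x 0.
Proof. by move=> y; rewrite /= subrr nm0 mul0r. Qed.

Lemma hdot_hj x (u : hcomp) : hdot (hj x) u = u x.
Proof.
apply: subr0_eq; apply: nm_small => e e0.
have k0 : 0 < 2 * (ipn x + 1) by have := ipn_ge0 x; lra.
have [z hz] := hcompP u (divr_gt0 e0 k0); set d := e / _ in hz.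
have dM : d * (2 * (ipn x + 1)) = e by rewrite /d divfK// gt_eqF.
have d0 : 0 < d by rewrite divr_gt0.
have := hdot_approx (lexx 0) (ltW d0) (hnear_hj x) hz.
have := hz x; have -> : hdot (hj x) u - u x = (hdot (hj x) u - ip x z) - (u x - ip x z) by ring.
by have := nmB (hdot (hj x) u - ip x z) (u x - ip x z); lra.
Qed.

Lemma hdot_hjj x y : hdot (hj x) (hj y) = ip x y.
Proof. by rewrite hdot_hj. Qed.

Local Notation hn := (@ipn R hcompIP).

Lemma hn_bound (u : hcomp) y : nm (u y) <= hn u * ipn y.
Proof.
have := @ip_cs R hcompIP (hj y) u; rewrite /= hdot_hj mulrC; congr (_ <= _ * _).
by rewrite /ipn /= hdot_hjj.
Qed.

Lemma hn_le (u : hcomp) (e : R) : 0 <= e -> (forall y, nm (u y) <= e * ipn y) -> hn u <= e.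
Proof.
move=> e0 h; have u0 := @ipn_ge0 R hcompIP u.
have hh : hnear u 0 e by move=> y; rewrite ipr0 subr0.
have := hdot_approx e0 e0 hh hh; rewrite ipr0 subr0 ipn0 mulr0 !add0r.
have -> : nm (hdot u u) = hn u ^+ 2.
  by rewrite -[hdot u u]/(@ip R hcompIP u u) ip_ipn nm_rc ger0_norm// sqr_ge0.
by rewrite -expr2 ler_pXn2r// nnegrE.
Qed.

Lemma hn_near (u : hcomp) x (e : R) : 0 <= e -> hnear u x e -> hn (u - hj x) <= e.
Proof. by move=> e0 h; apply: hn_le => // y; exact: h. Qed.

Lemma hn_eq0 (u : hcomp) : hn u = 0 -> u = 0.
Proof.
move=> h; apply: hcomp_eq => y; apply: nm_le0.
by have := hn_bound u y; rewrite h mul0r.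
Qed.

Definition hnorm (u : hcomp) : R[i] := rc (hn u).
Fact hnormD u w : hnorm (u + w) <= hnorm u + hnorm w.
Proof. by rewrite /hnorm -rcD rc_le; exact: (@ipnD R hcompIP). Qed.
Fact hnormZ (c : R[i]) u : hnorm (c *: u) = `|c| * hnorm u.
Proof. by rewrite /hnorm normE -rcM; congr rc; exact: (@ipnZ R hcompIP). Qed.
Fact hnorm_eq0 u : hnorm u = 0 -> u = 0.
Proof. by rewrite -rc0 => /rc_inj; exact: hn_eq0. Qed.
HB.instance Definition _ := @Lmodule_isNormed.Build R[i] hcomp hnorm hnormD hnormZ hnorm_eq0.

Lemma nm_hcomp (u : hcomp) : nm u = hn u.
Proof. by apply: rc_inj; rewrite -normE. Qed.

Lemma hcomp_seq_complete (u : nat -> hcomp) :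
  cauchys (@dn R _) u -> exists l : hcomp, cvgs (@dn R _) u l.
Proof.
move=> cu; have hb m n y : nm (u m y - u n y) <= dn (u m) (u n) * ipn y.
  by rewrite /dn nm_hcomp; exact: (hn_bound (u m - u n) y).
have pc y : exists l, cvgs (@dn R _) (fun n => u n y) l.
  apply: complex_cauchy => e e0.
  have k0 : 0 < ipn y + 1 by have := ipn_ge0 y; lra.
  have [N hN] := cu _ (divr_gt0 e0 k0); exists N => m n hm hn.
  apply: le_trans (hb m n y) _; have := hN m n hm hn.
  set d := e / _; have dM : d * (ipn y + 1) = e by rewrite /d divfK// gt_eqF.
  have d0 : 0 < d by rewrite divr_gt0.
  by have := ipn_ge0 y; nra.
pose l y := xget 0 [set l | cvgs (@dn R _) (fun n => u n y) l].
have hl y : cvgs (@dn R _) (fun n => u n y) (l y).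
  by rewrite /l; case: xgetP => // nx; have [k hk] := pc y; case: (nx k).
have ul (e : R) : 0 < e -> exists N, forall n, (N <= n)%N -> forall y, nm (l y - u n y) <= e * ipn y.
  move=> e0; have [N hN] := cu _ e0; exists N => n hn y.
  apply: ler_eps => r r0; have [N' hN'] := hl y _ r0.
  have := hN' _ (leq_maxr N N'); have := hN _ n (leq_maxl N N') hn.
  have := hb (maxn N N') n y; set m := maxn N N'; rewrite /dn (nmBC _ (l y)).
  have -> : l y - u n y = (l y - u m y) + (u m y - u n y) by ring.
  have := nmD (l y - u m y) (u m y - u n y); have := ipn_ge0 y; nra.
have lin : l \in hpred.
  apply/asboolP => e e0; have e2 : 0 < e / 2 by lra.
  have [N /(_ N (leqnn _)) hN] := ul _ e2; have [x hx] := hcompP (u N) e2.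
  exists x => y; have -> : l y - ip y x = (l y - u N y) + (u N y - ip y x) by ring.
  by have := nmD (l y - u N y) (u N y - ip y x); have := hN y; have := hx y; lra.
exists (HComp lin) => e e0; have [N hN] := ul _ e0; exists N => n hn.
rewrite /dn nm_hcomp; apply: hn_le; first exact: ltW.
by move=> y; have := hN n hn y; rewrite nmBC.
Qed.

End Completion.

(** A Cauchy filter contains balls of every radius [einv R n]; their centres form a Cauchy sequence,
    whose limit is the limit of the filter. *)
Lemma seq_complete (R : realType) (V : normedModType R[i]) :
  (forall u : nat -> V, cauchys (@dn R _) u -> exists l, cvgs (@dn R _) u l) ->
  forall F : set_system V, ProperFilter F -> cauchy F -> cvg F.
Proof.
move=> h F FF cF; have cF' : cauchy_ex F by apply/cauchyP.
have inv0 n : 0 < rc (einv R n) by rewrite -rc0 rc_lt einv_gt0.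
have /choice [x hx] n : exists x, F (ball x (rc (einv R n))) by exact: cF'.
have [|l hl] := h x.
  move=> e e0; have e2 : 0 < e / 2 by lra.
  have [N hN] := near_inv e2; exists N => m n /hN hm /hN hn.
  have [y [ym yn]] := filter_ex (filterI (hx m) (hx n)).
  move: ym yn; rewrite -!ball_normE /ball_ /= !normE !rc_lt /dn => ym yn.
  have -> : x m - x n = (x m - y) - (x n - y) by lmod.
  by have := nmB (x m - y) (x n - y); lra.
apply/cvg_ex; exists l; apply/cvg_ballP => e e0.
have [r r0 re] := gt0_rc e0; have r2 : 0 < r / 2 by lra.
have [N hN] := near_inv r2; have [N' hN'] := hl _ r2.
apply: filterS (hx (maxn N N')) => y; rewrite -!ball_normE /ball_ /= !normE re !rc_lt.
have := hN _ (leq_maxl N N'); have := hN' _ (leq_maxr N N').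
rewrite /dn nmBC; set m := maxn N N' => h1 h2 h3.
have -> : l - y = (l - x m) + (x m - y) by lmod.
by have := nmD (l - x m) (x m - y); lra.
Qed.

Section CompletionHilbert.
Context {R : realType} (V : semiIP R).

HB.instance Definition _ :=
  Uniform_isComplete.Build (hcomp V) (@seq_complete R (hcomp V) (@hcomp_seq_complete R V)).

Fact hcomp_norm (u : hcomp V) : hdot u u = `|u| ^+ 2.
Proof. by rewrite normE -rcX nm_hcomp -ip_ipn. Qed.

Definition completion : hilbertSpace R :=
  @HilbertSpace R (hcomp V) (@hdot R V) (fun x c y z => hdotL x c y z)
    (fun x y => hdotC x y) hcomp_norm.

End CompletionHilbert.

(** * Hilbert spaces *)

Definition hsIP (R : realType) (H : hilbertSpace R) : semiIP R.
Proof.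
refine (@SemiIP R H (@hip R H) (fun x c y z => hip_linear x c y z) (@hip_conj R H) _).
by move=> x; rewrite hip_norm normE -rcX re_rc sqr_ge0.
Defined.

Section HilbertBasics.
Context {R : realType} {H : hilbertSpace R}.
Implicit Types (x y z : H) (c : R[i]).
Local Notation V := (hsIP H).

Lemma hipr0 x : hip x 0 = 0. Proof. exact: (@ipr0 R V). Qed.
Lemma hiprD x y z : hip x (y + z) = hip x y + hip x z. Proof. exact: (@iprD R V). Qed.
Lemma hiprZ x c y : hip x (c *: y) = c * hip x y. Proof. exact: (@iprZ R V). Qed.
Lemma hiprN x y : hip x (- y) = - hip x y. Proof. exact: (@iprN R V). Qed.
Lemma hiprB x y z : hip x (y - z) = hip x y - hip x z. Proof. exact: (@iprB R V). Qed.
Lemma hipl0 x : hip 0 x = 0. Proof. exact: (@ipl0 R V). Qed.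
Lemma hiplD x y z : hip (y + z) x = hip y x + hip z x. Proof. exact: (@iplD R V). Qed.
Lemma hiplZ x c y : hip (c *: y) x = c^* * hip y x. Proof. exact: (@iplZ R V). Qed.
Lemma hiplB x y z : hip (y - z) x = hip y x - hip z x. Proof. exact: (@iplB R V). Qed.
Lemma hipxx x : hip x x = rc (nm x ^+ 2).
Proof. by rewrite hip_norm normE rcX. Qed.
Lemma ipn_nm x : @ipn R V x = nm x.
Proof. by rewrite /ipn /= hipxx re_rc sqrtr_sqr ger0_norm// nm_ge0. Qed.
Lemma hip_cs x y : nm (hip x y) <= nm x * nm y.
Proof. by have := @ip_cs R V x y; rewrite !ipn_nm. Qed.
Lemma hip_sumr I (s : seq I) (F : I -> H) x : hip x (\sum_(i <- s) F i) = \sum_(i <- s) hip x (F i).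
Proof. exact: (big_morph _ (hiprD x) (hipr0 x)). Qed.
Lemma hip_suml I (s : seq I) (F : I -> H) x : hip (\sum_(i <- s) F i) x = \sum_(i <- s) hip (F i) x.
Proof. exact: (big_morph (fun y => hip y x) (hiplD x) (hipl0 x)). Qed.
Lemma nm_sqr_hip x : nm x ^+ 2 = re (hip x x).
Proof. by rewrite hipxx. Qed.
Lemma nm_sqrD x y : nm (x + y) ^+ 2 = nm x ^+ 2 + 2 * re (hip x y) + nm y ^+ 2.
Proof. by rewrite !nm_sqr_hip; exact: (@re_ipD R V). Qed.
Lemma nm_sqrB x y : nm (x - y) ^+ 2 = nm x ^+ 2 - 2 * re (hip x y) + nm y ^+ 2.
Proof. by rewrite nm_sqrD hiprN reN nmN mulrN. Qed.
Lemma hip_eq0 x : hip x x = 0 -> x = 0.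
Proof.
by rewrite hipxx -rc0 => /rc_inj/eqP; rewrite sqrf_eq0 => /eqP/nm_eq0.
Qed.
Lemma hip_ext x y : (forall z, hip z x = hip z y) -> x = y.
Proof.
move=> h; apply: subr0_eq; apply/hip_eq0.
by rewrite hiprB h subrr.
Qed.
Lemma nm_le_hip x (M : R) : 0 <= M -> (forall z, nm (hip z x) <= M * nm z) -> nm x <= M.
Proof.
move=> M0 /(_ x); rewrite hipxx nm_rc ger0_norm ?sqr_ge0// => h.
have := nm_ge0 x; case: (ltrP 0 (nm x)) => [x0 _|]; last by lra.
by move: h; rewrite expr2 ler_pM2r.
Qed.

End HilbertBasics.

Section LinearMaps.
Context {R : realType} {U V : lmodType R[i]} (T : U -> V) (lT : linear T).
Lemma lin0 : T 0 = 0.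
Proof. by have := lT (-1) 0 0; rewrite scaler0 addr0 scaleN1r addNr. Qed.
Lemma linD x y : T (x + y) = T x + T y.
Proof. by have := lT 1 x y; rewrite !scale1r. Qed.
Lemma linZ c x : T (c *: x) = c *: T x.
Proof. by have := lT c x 0; rewrite lin0 !addr0. Qed.
Lemma linN x : T (- x) = - T x.
Proof. by rewrite -scaleN1r linZ scaleN1r. Qed.
Lemma linB x y : T (x - y) = T x - T y.
Proof. by rewrite linD linN. Qed.
Lemma lin_sum I (s : seq I) (F : I -> U) : T (\sum_(i <- s) F i) = \sum_(i <- s) T (F i).
Proof. exact: (big_morph T linD lin0). Qed.
End LinearMaps.

Section Projection.
Context {R : realType} (V : semiIP R).

(** A minimizing sequence for the distance from [x] to [K]. It is stated for real-linear [K] and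
    without a limit because [rep_density] applies it to a set that is only real-linear and not
    closed. *)
Lemma min_seq (K : set V) (x : V) : K 0 ->
  (forall r y z, K y -> K z -> K (rc r *: y + z)) ->
  exists y : nat -> V, [/\ forall n, K (y n), cauchys (fun a b => ipn (a - b)) y &
    forall z, K z -> forall e, 0 < e -> exists N, forall n, (N <= n)%N ->
      `|re (ip z (x - y n))| <= e].
Proof.
move=> K0 KL; pose d := inf [set ipn (x - y) ^+ 2 | y in K].
have dle y : K y -> d <= ipn (x - y) ^+ 2.
  move=> Ky; apply: ge_inf; last by exists y.
  by exists 0 => _ [z _ <-]; exact: sqr_ge0.
have /choice [y hy] n : exists y, K y /\ ipn (x - y) ^+ 2 <= d + einv R n.
  have hi : has_inf [set ipn (x - y) ^+ 2 | y in K].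
    by split; [exists (ipn (x - 0) ^+ 2), 0|exists 0 => _ [z _ <-]; exact: sqr_ge0].
  have [_ [z Kz <-] hz] := inf_adherent (einv_gt0 R n) hi.
  by exists z; split => //; exact: ltW.
exists y; split; first by move=> n; have [] := hy n.
  move=> e e0; have [|N hN] := @near_inv R (e ^+ 2 / 4); first by rewrite divr_gt0// exprn_gt0.
  exists N => m n /hN hm /hN hn; have [Km ym] := hy m; have [Kn yn] := hy n.
  have := parallelogram (x - y m) (x - y n).
  have -> : x - y m - (x - y n) = - (y m - y n) by lmod.
  have -> : x - y m + (x - y n) = rc 2 *: (x - (rc 2^-1 *: y m + rc 2^-1 *: y n)).
    by rewrite rcV rc_nat; lmod.
  rewrite ipnN ipnZ nm_rc ger0_norm// exprMn => par.
  have Kmn : K (rc 2^-1 *: y m + rc 2^-1 *: y n).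
    by apply: (KL) => //; rewrite -(addr0 (_ *: y n)); exact: KL.
  have := dle _ Kmn => dm.
  rewrite -(@ler_pXn2r _ 2)// ?nnegrE ?ipn_ge0 ?(ltW e0)//.
  by move: par dm; set a := ipn _ ^+ 2; lra.
move=> z Kz e e0.
have z0 : 0 <= ipn z ^+ 2 := sqr_ge0 _.
(* The variation [key] at [r = s] and at [r = - s] bounds [2 s |re (ip z (x - y n))|] by
   [einv R n + s^2 ipn z ^+ 2]. Both terms are at most [e s] once [einv R n <= e s]. *)
pose s := e / (ipn z ^+ 2 + 1).
have s0 : 0 < s by rewrite divr_gt0//; lra.
have sE : s * (ipn z ^+ 2 + 1) = e by rewrite /s divfK// gt_eqF//; lra.
have [|N hN] := @near_inv R (e * s); first by rewrite mulr_gt0.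
exists N => n /hN hn; have [Kn yn] := hy n.
have key r : - (einv R n) <= - (2 * r * re (ip z (x - y n))) + r ^+ 2 * ipn z ^+ 2.
  have Kr : K (y n + rc r *: z) by rewrite addrC; exact: KL.
  have := dle _ Kr.
  have -> : x - (y n + rc r *: z) = (- rc r) *: z + (x - y n) by lmod.
  rewrite ipn_sqr re_ipD !iplZ iprZ -!rcN rc_conj mulrA -rcM !reZ -!ipn_sqr; nra.
have k1 := key s; have k2 := key (- s).
rewrite ler_norml; apply/andP; split; rewrite -(ler_pM2l s0); nra.
Qed.

Lemma projection (K : set V) :
  (forall u, cauchys (fun a b : V => ipn (a - b)) u -> exists l, cvgs (fun a b => ipn (a - b)) u l) ->
  K 0 -> (forall c y z, K y -> K z -> K (c *: y + z)) ->
  (forall y, (forall e, 0 < e -> exists2 z, K z & ipn (y - z) <= e) -> K y) ->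
  forall x, exists2 y, K y & forall z, K z -> ip z (x - y) = 0.
Proof.
move=> cV K0 KL Kc x.
have [y [Ky cy oy]] := min_seq x K0 (fun r => KL (rc r)).
have [l hl] := cV _ cy; exists l.
  by apply: Kc => e e0; have [N /(_ N (leqnn _)) hN] := hl _ e0; exists (y N); rewrite // ipnBC.
have rz z : K z -> re (ip z (x - l)) = 0.
  move=> Kz; apply/eqP; rewrite -normr_le0; apply: ler_eps => e e0; rewrite add0r.
  have k0 : 0 < ipn z + 1 by have := ipn_ge0 z; lra.
  have e2 : 0 < e / 2 by lra.
  have [N hN] := oy z Kz _ e2; have [N' hN'] := hl _ (divr_gt0 e2 k0).
  have := hN _ (leq_maxl N N'); have := hN' _ (leq_maxr N N'); set n := maxn _ _.
  have -> : x - l = (x - y n) + (y n - l) by lmod.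
  rewrite (iprD z (x - y n)) reD => h1 h2; apply: le_trans (ler_normD _ _) _.
  have h3 : `|re (ip z (y n - l))| <= ipn z * ipn (y n - l).
    apply: le_trans (ip_cs _ _); by rewrite ler_norml re_le_nm re_ge_nm.
  have h4 : ipn z * ipn (y n - l) <= ipn z * (e / 2 / (ipn z + 1)) by rewrite ler_wpM2l// ipn_ge0.
  have h5 : ipn z * (e / 2 / (ipn z + 1)) <= e / 2.
    by rewrite mulrA ler_pdivrMr//; have := ipn_ge0 z; nra.
  by lra.
move=> z Kz; apply: re_eq0; first exact: rz.
have := rz ((- 'i) *: z); rewrite iplZ conjN conj_i opprK; apply.
by rewrite -(addr0 (_ *: z)); exact: KL.
Qed.

End Projection.

(** * Adjoints, extensions and moduli of bounded operators *)

Section Operators.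
Context {R : realType} {H : hilbertSpace R}.
Implicit Types (x y z : H).

Definition bdd (T : H -> H) : Prop := exists M : R, forall x, nm (T x) <= M * nm x.

Lemma bddP T : bdd T -> exists2 M : R, 0 < M & forall x, nm (T x) <= M * nm x.
Proof.
move=> [M hM]; exists (`|M| + 1); first by rewrite ltr_wpDl.
by move=> x; apply: le_trans (hM x) _; rewrite ler_wpM2r ?nm_ge0//; have := ler_norm M; lra.
Qed.

Lemma cauchys_hs (u : nat -> H) : cauchys (fun a b : hsIP H => ipn (a - b)) u ->
  exists l : hsIP H, cvgs (fun a b : hsIP H => ipn (a - b)) u l.
Proof.
move=> cu; have [|l hl] := @cauchys_cvgs R H u.
  by move=> e /cu [N hN]; exists N => m n hm hn; rewrite /dn -ipn_nm; exact: hN.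
by exists l => e /hl [N hN]; exists N => n /hN; rewrite /dn -ipn_nm.
Qed.

Lemma hproj (K : set H) : closed_subspace K ->
  forall x, exists2 y, K y & forall z, K z -> hip z (x - y) = 0.
Proof.
move=> [/closed_eps cK K0 KL]; apply: (@projection R (hsIP H)) => //.
  exact: cauchys_hs.
by move=> y h; apply: cK => e /h [z Kz]; rewrite ipn_nm; exists z.
Qed.

Lemma riesz (f : H -> R[i]) (M : R) : (forall c x y, f (c *: x + y) = c * f x + f y) ->
  (forall x, nm (f x) <= M * nm x) -> exists w, forall x, f x = hip w x.
Proof.
move=> fL fM.
have f0 : f 0 = 0 by have := fL (-1) 0 0; rewrite scaler0 addr0 mulN1r addNr.
have fD x y : f (x + y) = f x + f y by have := fL 1 x y; rewrite scale1r mul1r.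
have fZ c x : f (c *: x) = c * f x by have := fL c x 0; rewrite f0 !addr0.
have fB x y : f (x - y) = f x - f y by rewrite fD -scaleN1r fZ mulN1r.
have [|/existsNP [x0 /eqP n0]] := pselect (forall x, f x = 0).
  by move=> h; exists 0 => x; rewrite h hipl0.
have ck : closed_subspace [set x | f x = 0].
  split=> //; last by move=> c x y /= hx hy; rewrite fL hx hy mulr0 addr0.
  apply/closed_eps => x h /=; apply: nm_small => e e0.
  have k0 : 0 < `|M| + 1 by rewrite ltr_wpDl.
  have [y /= fy hy] := h _ (divr_gt0 e0 k0).
  have -> : f x = f (x - y) by rewrite fB fy subr0.
  apply: le_trans (fM _) _; move: hy; rewrite ler_pdivlMr//.
  by have := ler_norm M; have := nm_ge0 (x - y); nra.
have [y /= fy oy] := hproj ck x0; pose u := x0 - y.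
have fu : f u != 0 by rewrite /u fB fy subr0.
have un : hip u u != 0.
  by apply/eqP => /hip_eq0 u0; move: fu; rewrite u0 f0 eqxx.
exists ((f u / hip u u)^* *: u) => x.
have := oy (x - (f x / f u) *: u); rewrite fB fZ divfK// subrr => /(_ erefl).
rewrite -/u hiplB hiplZ => /eqP; rewrite subr_eq0 => /eqP e.
have -> : hip ((f u / hip u u)^* *: u) x = f u / hip u u * hip u x by rewrite hiplZ conjK.
rewrite (hip_conj x u) e (conjM (f x / f u)^*) conjK -(hip_conj u u).
by field; rewrite fu un.
Qed.

Lemma adjoint (T : H -> H) : linear T -> bdd T ->
  exists T', [/\ linear T', bdd T' & forall x y, hip (T' x) y = hip x (T y)].
Proof.
move=> lT /bddP [M M0 hM].
have /choice [T' hT'] x : exists w, forall y, hip x (T y) = hip w y.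
  apply: (@riesz _ (nm x * M)).
    by move=> c y z; rewrite lT hiprD hiprZ.
  move=> y; apply: le_trans (hip_cs _ _) _.
  by rewrite -mulrA ler_wpM2l ?nm_ge0.
have adj x y : hip y (T' x) = hip (T y) x.
  by rewrite hip_conj -hT' -hip_conj.
exists T'; split => //.
  by move=> c x y; apply: hip_ext => z; rewrite adj !hiprD !hiprZ !adj.
exists M => x; apply: nm_le_hip; first by rewrite mulr_ge0 ?nm_ge0 ?(ltW M0).
move=> z; rewrite adj; apply: le_trans (hip_cs _ _) _.
by have := hM z; have := nm_ge0 x; nra.
Qed.

(** The operator is given by a graph with dense domain. That the graph is single-valued need not be
    checked beforehand: it follows from linearity and the bound. *)
Lemma extension (G : set (H * H)) (C : R) : 0 <= C ->
  (forall c p q, G p -> G q -> G (c *: p.1 + q.1, c *: p.2 + q.2)) ->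
  (forall p, G p -> nm p.2 <= C * nm p.1) ->
  (forall x e, 0 < e -> exists2 p, G p & nm (x - p.1) <= e) ->
  exists T, [/\ linear T, forall x, nm (T x) <= C * nm x & forall p, G p -> T p.1 = p.2].
Proof.
move=> C0 GL GC Gd.
have GB p q : G p -> G q -> nm (p.2 - q.2) <= C * nm (p.1 - q.1).
  move=> Gp Gq; have := GC _ (GL (-1) q p Gq Gp); rewrite /= !scaleN1r.
  by rewrite addrC (addrC _ p.1).
pose rel x u := forall e, 0 < e -> exists2 p, G p & nm (x - p.1) <= e /\ nm (u - p.2) <= e.
have ex x : exists u, rel x u.
  have /choice [p hp] n : exists p, G p /\ nm (x - p.1) <= einv R n.
    by have [p ? ?] := Gd x _ (einv_gt0 R n); exists p.
  have [|l hl] := @cauchys_cvgs R H (fun n => (p n).2).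
    move=> e e0; have k0 : 0 < 2 * (C + 1) by lra.
    have [N hN] := near_inv (divr_gt0 e0 k0).
    exists N => m n /hN hm /hN hn; have [Gm pm] := hp m; have [Gn pn] := hp n.
    rewrite /dn; apply: le_trans (GB _ _ Gm Gn) _.
    have -> : (p m).1 - (p n).1 = (x - (p n).1) - (x - (p m).1) by lmod.
    have := nmB (x - (p n).1) (x - (p m).1).
    set d := e / _ in hm hn; have dE : d * (2 * (C + 1)) = e by rewrite /d divfK// gt_eqF.
    have d0 : 0 < d by rewrite divr_gt0.
    move=> h; have : C * nm (x - (p n).1 - (x - (p m).1)) <= C * (d + d).
      by rewrite ler_wpM2l//; lra.
    by nra.
  exists l => e e0; have [N hN] := hl _ e0; have [N' hN'] := near_inv e0.
  have := hN _ (leq_maxl N N'); have := hN' _ (leq_maxr N N'); set n := maxn _ _ => h1 h2.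
  have [Gn pn] := hp n; exists (p n) => //; split; first exact: le_trans pn h1.
  by rewrite nmBC.
have relC x u p : rel x u -> G p -> nm (u - p.2) <= C * nm (x - p.1).
  move=> hr Gp; apply: ler_eps => e e0.
  have k0 : 0 < C + 2 by lra.
  have [q Gq [q1 q2]] := hr _ (divr_gt0 e0 k0).
  set d := e / _ in q1 q2; have dE : d * (C + 2) = e by rewrite /d divfK// gt_eqF.
  have d0 : 0 < d by rewrite divr_gt0.
  have -> : u - p.2 = (u - q.2) + (q.2 - p.2) by lmod.
  have := nmD (u - q.2) (q.2 - p.2); have := GB _ _ Gq Gp.
  have -> : q.1 - p.1 = (x - p.1) - (x - q.1) by lmod.
  have := nmB (x - p.1) (x - q.1) => h1 h2 h3.
  have : C * nm (x - p.1 - (x - q.1)) <= C * (nm (x - p.1) + d) by rewrite ler_wpM2l//; lra.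
  by nra.
have un x u u' : rel x u -> rel x u' -> u = u'.
  move=> h h'; apply: subr0_eq; apply/nm_small => e e0.
  have k0 : 0 < C + 2 by lra.
  have [q Gq [q1 q2]] := h' _ (divr_gt0 e0 k0).
  set d := e / _ in q1 q2; have dE : d * (C + 2) = e by rewrite /d divfK// gt_eqF.
  have d0 : 0 < d by rewrite divr_gt0.
  have := relC _ _ _ h Gq; have -> : u - u' = (u - q.2) - (u' - q.2) by lmod.
  have := nmB (u - q.2) (u' - q.2) => h1 h2.
  have : C * nm (x - q.1) <= C * d by rewrite ler_wpM2l.
  by nra.
have /choice [T hT] := ex.
have TG p : G p -> T p.1 = p.2.
  by move=> Gp; apply: un (hT _) _ => e e0; exists p; rewrite // !subrr !nm0 ltW.
exists T; split => //.
  move=> c x y; apply: un (hT _) _ => e e0.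
  have k0 : 0 < nm c + 1 by have := nm_ge0 c; lra.
  have [p Gp [p1 p2]] := hT x _ (divr_gt0 e0 (mulr_gt0 (ltr0n _ 2) k0)).
  have e2 : 0 < e / 2 by lra.
  have [q Gq [q1 q2]] := hT y _ e2.
  set d := e / _ in p1 p2; have dE : d * (2 * (nm c + 1)) = e by rewrite /d divfK// gt_eqF// mulr_gt0.
  exists (c *: p.1 + q.1, c *: p.2 + q.2); first exact: GL.
  have cc a b : nm (a - b) <= d -> nm (c *: (a - b)) <= e / 2.
    by move=> h; rewrite nmZ; have := nm_ge0 c; have := nm_ge0 (a - b); nra.
  split=> /=.
    have -> : c *: x + y - (c *: p.1 + q.1) = c *: (x - p.1) + (y - q.1) by lmod.
    by have := nmD (c *: (x - p.1)) (y - q.1); have := cc _ _ _ p1; lra.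
  have -> : c *: T x + T y - (c *: p.2 + q.2) = c *: (T x - p.2) + (T y - q.2) by lmod.
  by have := nmD (c *: (T x - p.2)) (T y - q.2); have := cc _ _ _ p2; lra.
move=> x; have -> : nm (T x) = nm (T x - (0 : H)) by rewrite subr0.
have [p Gp _] := Gd x 1 ltr01.
have G0 : G (0, 0).
  by have := GL (-1) p p Gp Gp; rewrite !scaleN1r !addNr.
by have := relC x (T x) _ (hT x) G0; rewrite /= !subr0.
Qed.

(* The modulus of a selfadjoint contraction; [sqit] is the iteration that
   computes it. *)
Lemma op_abs (T : H -> H) : linear T -> (forall x, nm (T x) <= nm x) ->
  (forall x y, hip (T x) y = hip x (T y)) ->
  exists r, [/\ linear r, forall x, nm (r x) <= 2 * nm x, forall x y, hip (r x) y = hip x (r y) &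
    [/\ forall x, r (r x) = T (T x), forall x, 0 <= re (hip x (r x)),
     forall S, linear S -> bdd S -> (forall x, S (T x) = T (S x)) -> forall x, S (r x) = r (S x) &
     forall x, cvgs (@dn R _) (fun n => x - sqit (fun y => y - T (T y)) n x) (r x)]].
Proof.
move=> lT cT sT; pose Y x := x - T (T x).
have lY : linear Y by move=> c x y; rewrite /Y lT lT; lmod.
have nY x : nm (Y x) <= nm x.
  rewrite -(@ler_pXn2r _ 2)// ?nnegrE ?nm_ge0// nm_sqrB -sT hipxx re_rc.
  have := cT (T x); have := nm_ge0 (T x); have := nm_ge0 (T (T x)); nra.
have nD (x y : H) : nm (x + y) <= nm x + nm y := nmD x y.
have nZ (c : R[i]) (x : H) : nm (c *: x) = nm c * nm x := nmZ c x.
have n0 (x : H) : 0 <= nm x := nm_ge0 x.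
have cz x : cauchys (@dn R _) (fun n => sqit Y n x).
  move=> e e0; have k0 : 0 < nm x + 1 by have := nm_ge0 x; lra.
  have [N hN] := zeta_cauchy (divr_gt0 e0 k0); exists N => m n hm hn.
  wlog mn : m n hm hn / (n <= m)%N.
    by move=> W; case/orP: (leq_total n m) => ?; [|rewrite /dn nmBC]; exact: W.
  apply: le_trans (sqit_cauchy nD nZ n0 lY nY x mn) _.
  have := hN n m hn hm; set d := e / _ => hd.
  have dE : d * (nm x + 1) = e by rewrite /d divfK// gt_eqF.
  have d0 : 0 < d by rewrite divr_gt0.
  by have := nm_ge0 x; nra.
have /choice [z hz] x : exists l, cvgs (@dn R _) (fun n => sqit Y n x) l.
  exact: cauchys_cvgs (cz x).
have lz : linear z.
  move=> c x y; apply: cvgs_uniq (hz _) _.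
  have h1 := @cvgs_lip R H H (fun t => c *: t) (nm c) _ _ _ (hz x).
  have h : cvgs (@dn R _) (fun n => c *: sqit Y n x + sqit Y n y) (c *: z x + z y).
    by apply: cvgsD (hz y); apply: h1 => a b; rewrite -scalerBr nmZ.
  by move=> e /h [N hN]; exists N => n /hN; rewrite (sqit_lin n lY).
have nz x : nm (z x) <= nm x.
  apply: nm_cvgs_le (hz x) _ => n; apply: le_trans (sqit_bound nD nZ nY n x) _.
  by have /andP[? ?] := @zeta_bound R n; have := nm_ge0 x; nra.
have sY x y : hip (Y x) y = hip x (Y y) by rewrite /Y hiplB hiprB !sT.
have sS n x y : hip (sqit Y n x) y = hip x (sqit Y n y).
  elim: n x y => [|n IHn] x y /=; first by rewrite hipl0 hipr0.
  rewrite hiplZ hiprZ hiplD hiprD sY !IHn fmorphV rmorph_nat; congr (_ * (_ + _)).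
have limip x y u l : cvgs (@dn R H) u l -> (forall n, hip (u n) y = hip x (sqit Y n y)) -> hip l y = hip x (z y).
  move=> hu hE; apply: subr0_eq; apply: nm_small => e e0.
  have k0 : 0 < nm x + nm y + 1 by have := nm_ge0 x; have := nm_ge0 y; lra.
  have [N hN] := hu _ (divr_gt0 e0 k0); have [N' hN'] := hz y _ (divr_gt0 e0 k0).
  have := hN _ (leq_maxl N N'); have := hN' _ (leq_maxr N N'); set n := maxn _ _.
  set d := e / _; have dE : d * (nm x + nm y + 1) = e by rewrite /d divfK// gt_eqF.
  have d0 : 0 < d by rewrite divr_gt0.
  rewrite /dn => h1 h2.
  have -> : hip l y - hip x (z y) = hip x (sqit Y n y - z y) - hip (u n - l) y.
    by rewrite hiplB hiprB hE; ring.
  have := nmB (hip x (sqit Y n y - z y)) (hip (u n - l) y).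
  have := hip_cs x (sqit Y n y - z y); have := hip_cs (u n - l) y.
  by have := nm_ge0 x; have := nm_ge0 y; nra.
have sz x y : hip (z x) y = hip x (z y) by apply: limip (hz x) _ => n; exact: sS.
have zz x : z x + z x = Y x + z (z x).
  have h1 : cvgs (@dn R _) (fun n => sqit Y n (sqit Y n x)) (z (z x)).
    move=> e e0; have e2 : 0 < e / 2 by lra.
    have [N hN] := hz x _ e2; have [N' hN'] := hz (z x) _ e2.
    exists (maxn N N') => n; rewrite geq_max => /andP[/hN a /hN' b].
    rewrite /dn in a b *.
    have -> : sqit Y n (sqit Y n x) - z (z x) = sqit Y n (sqit Y n x - z x) + (sqit Y n (z x) - z (z x)).
      by rewrite (linB (sqit_lin n lY)); lmod.
    have := nmD (sqit Y n (sqit Y n x - z x)) (sqit Y n (z x) - z (z x)).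
    have := sqit_bound nD nZ nY n (sqit Y n x - z x).
    have /andP[? ?] := @zeta_bound R n; have := nm_ge0 (sqit Y n x - z x); nra.
  have h2 := cvgs_shift (hz x).
  have h3 := cvgsD (cvgs_cst (Y x)) h1.
  have h4 := cvgsD h2 h2.
  apply: cvgs_uniq h4 _ => e /h3 [N hN]; exists N => n /hN /=.
  set a := sqit Y n (sqit Y n x); have -> : 2^-1 *: (Y x + a) + 2^-1 *: (Y x + a) = Y x + a by lmod.
  by [].
have comm S : linear S -> bdd S -> (forall x, S (T x) = T (S x)) -> forall x, S (z x) = z (S x).
  move=> lS bS hS x; have [M M0 hM] := bddP bS.
  have h1 := @cvgs_lip R H H S M _ _ _ (hz x).
  apply: cvgs_uniq (hz (S x)).
  have h : cvgs (@dn R _) (S \o (fun n => sqit Y n x)) (S (z x)).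
    by apply: h1 => a b; rewrite -(linB lS).
  move=> e /h [N hN]; exists N => n /hN /=; rewrite (sqit_comm n lS)//.
  by move=> y; rewrite /Y (linB lS) !hS.
(* The relation [2 z = Y + z^2] says [(1 - z)^2 = 1 - Y = T^2]. *)
exists (fun x => x - z x); split.
- by move=> c x y; rewrite lz; lmod.
- by move=> x; have := nmB x (z x); have := nz x; lra.
- by move=> x y; rewrite hiplB hiprB sz.
split.
- move=> x; rewrite (linB lz).
  have -> : z (z x) = z x + z x - (x - T (T x)) by rewrite zz /Y; lmod.
  by lmod.
- move=> x; rewrite hiprB reB -nm_sqr_hip.
  have := re_le_nm (hip x (z x)); have := hip_cs x (z x); have := nz x.
  by have := nm_ge0 x; nra.
- by move=> S lS bS hS x; rewrite (linB lS) comm.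
- move=> x e /(hz x) [N hN]; exists N => n /hN; rewrite /dn -/Y.
  have -> : x - sqit Y n x - (x - z x) = - (sqit Y n x - z x) by lmod.
  by rewrite nmN.
Qed.

Lemma nonneg_sa_eq0 (S : H -> H) : linear S -> (forall x y, hip (S x) y = hip x (S y)) ->
  (forall x, re (hip x (S x)) = 0) -> forall x, S x = 0.
Proof.
move=> lS sS h x; apply: hip_eq0.
have e : re (hip (x + S x) (S (x + S x))) = 0 by exact: h.
move: e; rewrite (linD lS) hiplD !hiprD !reD h h -(sS x) !hipxx !re_rc add0r addr0.
move=> e; suff -> : nm (S x) ^+ 2 = 0 by rewrite rc0.
by have := sqr_ge0 (nm (S x)); lra.
Qed.

(** * Schur's lemma for irreducible sets of operators *)

Section Schur.
Variable A : set (H -> H).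
Hypothesis lA : forall a, A a -> linear a.
Hypothesis bA : forall a, A a -> bdd a.
Hypothesis irrA : forall K : set H, closed_subspace K ->
  (forall a x, A a -> K x -> K (a x)) -> K = [set 0] \/ K = setT.

Lemma ker_closed (S : H -> H) : linear S -> bdd S -> closed_subspace [set x | S x = 0].
Proof.
move=> lS bS; have [M M0 hM] := bddP bS; split.
- apply/closed_eps => x h /=; apply: nm_small => e e0.
  have [y /= Sy hy] := h _ (divr_gt0 e0 M0).
  have -> : S x = S (x - y) by rewrite (linB lS) Sy subr0.
  by apply: le_trans (hM _) _; move: hy; rewrite ler_pdivlMr// mulrC.
- exact: (lin0 lS).
- by move=> c x y /= hx hy; rewrite lS hx hy scaler0 addr0.
Qed.

Lemma comm_ker (S : H -> H) : linear S -> bdd S ->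
  (forall a, A a -> forall x, S (a x) = a (S x)) ->
  (forall x, S x = 0) \/ (forall x, S x = 0 -> x = 0).
Proof.
move=> lS bS cS; have [|k|k] := irrA (ker_closed lS bS).
- by move=> a x Aa /= Sx; rewrite cS// Sx (lin0 (lA Aa)).
- by right=> x Sx; have : [set x | S x = 0] x by []; rewrite k.
- by left=> x; have : [set x | S x = 0] x by rewrite k.
Qed.

(** With [r] the modulus of [T], the kernel of [r - T] is invariant. If it is everything, [T = r] is
    positive; if it is 0, then [(r - T) (r + T) = 0] gives [T = - r]. *)
Lemma schur_sign (T : H -> H) : linear T -> (forall x, nm (T x) <= nm x) ->
  (forall x y, hip (T x) y = hip x (T y)) ->
  (forall a, A a -> forall x, T (a x) = a (T x)) ->
  (forall x, 0 <= re (hip x (T x))) \/ (forall x, re (hip x (T x)) <= 0).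
Proof.
move=> lT cT sT comT; have [r [lr br sr [rr r0 rc' _]]] := op_abs lT cT sT.
have cr a : A a -> forall x, r (a x) = a (r x).
  move=> Aa x; apply: esym; apply: rc' => //; [exact: lA|exact: bA|].
  by move=> y; rewrite comT.
have bT : bdd T by exists 1 => x; rewrite mul1r.
have rT x : T (r x) = r (T x) by apply: rc'.
have lB : linear (fun x => r x - T x) by move=> c x y; rewrite lT lr; lmod.
have bB : bdd (fun x => r x - T x).
  by exists 3 => x; have := nmB (r x) (T x); have := br x; have := cT x; lra.
have [a Aa x|h|h] := comm_ker lB bB.
- by rewrite (linB (lA Aa)) cr// comT.
- by left=> x; have /eqP := h x; rewrite subr_eq0 => /eqP <-.
right=> x; have -> : T x = - r x.
  apply/eqP; rewrite -addr_eq0; apply/eqP/h.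
  by rewrite (linD lr) (linD lT) rr rT; lmod.
by rewrite hiprN reN oppr_le0.
Qed.

(** By [schur_sign], applied to rescaled translates, every [T - l] is positive or negative. At the
    supremum [l0] of the lower bounds of [T] it is both, hence 0. *)
Lemma schur_sa (T : H -> H) : linear T -> bdd T ->
  (forall x y, hip (T x) y = hip x (T y)) ->
  (forall a, A a -> forall x, T (a x) = a (T x)) ->
  exists r : R, forall x, T x = rc r *: x.
Proof.
move=> lT bT sT comT; have [M M0 hM] := bddP bT.
have sgn l : (forall x, l * nm x ^+ 2 <= re (hip x (T x))) \/ (forall x, re (hip x (T x)) <= l * nm x ^+ 2).
  pose k := (M + `|l| + 1)^-1.
  have k0 : 0 < k by rewrite invr_gt0; have := normr_ge0 l; lra.
  pose S x := rc k *: (T x - rc l *: x).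
  have E x : re (hip x (S x)) = k * (re (hip x (T x)) - l * nm x ^+ 2).
    by rewrite /S hiprZ reZ hiprB hiprZ reB reZ -nm_sqr_hip.
  have [||||h|h] := @schur_sign S.
  - by move=> c x y; rewrite /S lT; lmod.
  - move=> x; rewrite /S nmZ nm_rc ger0_norm ?(ltW k0)//.
    have h : nm (T x - rc l *: x) <= (M + `|l| + 1) * nm x.
      have := nmB (T x) (rc l *: x); rewrite nmZ nm_rc.
      by have := hM x; have := nm_ge0 x; lra.
    rewrite -[leRHS](@mulKf _ (M + `|l| + 1)); last by have := normr_ge0 l; lra.
    by rewrite ler_wpM2l// ltW.
  - by move=> x y; rewrite /S hiplZ hiprZ hiplB hiprB hiplZ hiprZ !rc_conj sT.
  - by move=> a Aa x; rewrite /S comT// !(linZ (lA Aa), linB (lA Aa)).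
  - by left=> x; have := h x; rewrite E pmulr_rge0// subr_ge0.
  - by right=> x; have := h x; rewrite E pmulr_rle0// subr_le0.
pose P l := forall x, l * nm x ^+ 2 <= re (hip x (T x)).
have PM : P (- M).
  move=> x; have := re_ge_nm (hip x (T x)); have := hip_cs x (T x); have := hM x.
  by have := nm_ge0 x; nra.
have [[x0 x0n]|/forallNP x0] := pselect (exists x : H, x <> 0); last first.
  by exists 0 => x; have /contrapT -> := x0 x; rewrite scaler0 (lin0 lT).
have nx0 : 0 < nm x0 ^+ 2 by rewrite exprn_gt0// nm_gt0.
have ub l : P l -> l <= M.
  move=> /(_ x0); have := re_le_nm (hip x0 (T x0)); have := hip_cs x0 (T x0); have := hM x0.
  have := nm_gt0 x0n => p q s t u.
  have : l * nm x0 ^+ 2 <= M * nm x0 ^+ 2 by nra.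
  by rewrite ler_pM2r.
have hs : has_sup [set l | P l] by split; [exists (- M)|exists M].
pose l0 := sup [set l | P l].
have Pl0 : P l0.
  move=> x; apply: ler_eps => e e0.
  have k0 : 0 < nm x ^+ 2 + 1 by have := sqr_ge0 (nm x); lra.
  have [l Pl hl] := sup_adherent (divr_gt0 e0 k0) hs.
  have := Pl x; set d := e / _ in hl.
  have dE : d * (nm x ^+ 2 + 1) = e by rewrite /d divfK// gt_eqF.
  have d0 : 0 < d by rewrite divr_gt0.
  by move: hl; rewrite -/l0; have := sqr_ge0 (nm x); nra.
have Ql0 x : re (hip x (T x)) <= l0 * nm x ^+ 2.
  apply: ler_eps => e e0.
  have k0 : 0 < nm x ^+ 2 + 1 by have := sqr_ge0 (nm x); lra.
  set d := e / (nm x ^+ 2 + 1).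
  have dE : d * (nm x ^+ 2 + 1) = e by rewrite /d divfK// gt_eqF.
  have d0 : 0 < d by rewrite divr_gt0.
  have [h|h] := sgn (l0 + d); last by have := h x; have := sqr_ge0 (nm x); nra.
  have : l0 + d <= l0 by apply: sup_upper_bound.
  by lra.
exists l0 => x; apply: subr0_eq.
apply: (@nonneg_sa_eq0 (fun x => T x - rc l0 *: x)).
- by move=> c y z; rewrite lT; lmod.
- by move=> y z; rewrite hiplB hiprB hiplZ hiprZ rc_conj sT.
- move=> y; rewrite hiprB hiprZ reB reZ -nm_sqr_hip.
  by have := Pl0 y; have := Ql0 y; rewrite /P; lra.
Qed.

Lemma schur (T T' : H -> H) : linear T -> bdd T -> linear T' -> bdd T' ->
  (forall x y, hip (T' x) y = hip x (T y)) ->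
  (forall a, A a -> forall x, T (a x) = a (T x)) ->
  (forall a, A a -> forall x, T' (a x) = a (T' x)) ->
  exists c : R[i], forall x, T x = c *: x.
Proof.
move=> lT bT lT' bT' adj cT cT'.
have adj' x y : hip (T x) y = hip x (T' y) by rewrite hip_conj -adj -hip_conj.
have [M M0 hM] := bddP bT; have [M' M'0 hM'] := bddP bT'.
have [||||r hr] := @schur_sa (fun x => T x + T' x).
- by move=> c x y; rewrite lT lT'; lmod.
- by exists (M + M') => x; have := nmD (T x) (T' x); have := hM x; have := hM' x; lra.
- by move=> x y; rewrite hiplD hiprD adj adj' addrC.
- by move=> a Aa x; rewrite (linD (lA Aa)) cT// cT'.
have [||||s hs] := @schur_sa (fun x => 'i *: (T x - T' x)).
- by move=> c x y; rewrite lT lT'; lmod.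
- exists (M + M') => x; rewrite nmZ nm_i mul1r.
  by have := nmB (T x) (T' x); have := hM x; have := hM' x; lra.
- move=> x y; rewrite hiplZ hiprZ hiplB hiprB adj adj' conj_i; ring.
- by move=> a Aa x; rewrite (linZ (lA Aa)) (linB (lA Aa)) cT// cT'.
exists (2^-1 * (rc r - 'i * rc s)) => x.
have -> : T x = 2^-1 *: ((T x + T' x) - 'i *: ('i *: (T x - T' x))) by lmod.
by rewrite hs hr; lmod.
Qed.

End Schur.
End Operators.

Section Projector.
Context {R : realType} (V : semiIP R).

Lemma projector (K : set V) :
  (forall x : V, ip x x = 0 -> x = 0) ->
  (forall u, cauchys (fun a b : V => ipn (a - b)) u -> exists l, cvgs (fun a b => ipn (a - b)) u l) ->
  K 0 -> (forall c y z, K y -> K z -> K (c *: y + z)) ->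
  (forall y, (forall e, 0 < e -> exists2 z, K z & ipn (y - z) <= e) -> K y) ->
  exists P : V -> V, [/\ linear P, forall x, K (P x), forall x, K x -> P x = x,
    forall x y, ip (P x) y = ip x (P y) &
    [/\ forall x, ipn (P x) <= ipn x, forall x z, K z -> ip z (x - P x) = 0 &
    forall x y, K y -> (forall z, K z -> ip z (x - y) = 0) -> P x = y]].
Proof.
move=> def cV K0 KL Kc.
have /choice [P hP] x : exists y, K y /\ forall z, K z -> ip z (x - y) = 0.
  by have [y Ky hy] := projection cV K0 KL Kc x; exists y.
have un x y : K y -> (forall z, K z -> ip z (x - y) = 0) -> P x = y.
  move=> Ky hy; have [KP oP] := hP x.
  have KB : K (P x - y) by rewrite addrC -scaleN1r; exact: KL.
  apply: subr0_eq; apply/def.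
  have -> : ip (P x - y) (P x - y) = ip (P x - y) (x - y) - ip (P x - y) (x - P x).
    by rewrite -iprB; congr ip; lmod.
  by rewrite hy// oP// subr0.
have sa x y : ip (P x) y = ip (P x) (P y).
  have [KP _] := hP x; have [_ oP] := hP y.
  by apply/eqP; rewrite -subr_eq0 -iprB oP.
have sa' x y : ip x (P y) = ip (P x) (P y) by rewrite ipC sa -ipC.
exists P; split => //.
- move=> c x y; apply: un; first by apply: KL; [case: (hP x)|case: (hP y)].
  move=> z Kz; have [_ ox] := hP x; have [_ oy] := hP y.
  have -> : c *: x + y - (c *: P x + P y) = c *: (x - P x) + (y - P y) by lmod.
  by rewrite ipL ox// oy// mulr0 addr0.
- by move=> x; case: (hP x).
- by move=> x Kx; apply: un => // z _; rewrite subrr ipr0.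
- by move=> x y; rewrite (sa x y) (sa' x y).
split => //; last by move=> x z Kz; have [_ o] := hP x; exact: o.
- move=> x; have : ipn (P x) ^+ 2 <= ipn (P x) * ipn x.
    rewrite ipn_sqr -sa; apply: le_trans (ip_cs _ _); exact: re_le_nm.
  have := ipn_ge0 x; have := ipn_ge0 (P x).
  have [->//|n0] := eqVneq (ipn (P x)) 0.
  by move=> p q; rewrite expr2 ler_pM2l// lt_neqAle eq_sym n0.
Qed.

End Projector.

(** The direct sum of two copies of [H], as a [semiIP] because this is what [projector] and
    [min_seq] take. *)
Definition prodIP (R : realType) (H : hilbertSpace R) : semiIP R.
Proof.
refine (@SemiIP R (H * H)%type (fun p q => hip p.1 q.1 + hip p.2 q.2) _ _ _).
- by move=> p c q r /=; rewrite !hiprD !hiprZ; ring.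
- by move=> p q; rewrite conjD -!hip_conj.
- by move=> p; rewrite reD !hipxx !re_rc addr_ge0// sqr_ge0.
Defined.

Section ProdIP.
Context {R : realType} {H : hilbertSpace R}.

Lemma prodIP_sqr (p : prodIP H) : ipn p ^+ 2 = nm p.1 ^+ 2 + nm p.2 ^+ 2.
Proof. by rewrite ipn_sqr /= !hipxx. Qed.
Lemma prodIP_fst (p : prodIP H) : nm p.1 <= ipn p.
Proof.
rewrite -(@ler_pXn2r _ 2)// ?nnegrE ?nm_ge0 ?ipn_ge0// prodIP_sqr.
by have := sqr_ge0 (nm p.2); lra.
Qed.
Lemma prodIP_snd (p : prodIP H) : nm p.2 <= ipn p.
Proof.
rewrite -(@ler_pXn2r _ 2)// ?nnegrE ?nm_ge0 ?ipn_ge0// prodIP_sqr.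
by have := sqr_ge0 (nm p.1); lra.
Qed.
Lemma prodIP_le (p : prodIP H) : ipn p <= nm p.1 + nm p.2.
Proof.
have a := nm_ge0 p.1; have b := nm_ge0 p.2.
rewrite -(@ler_pXn2r _ 2)// ?nnegrE ?ipn_ge0 ?addr_ge0// prodIP_sqr; nra.
Qed.
Lemma prodIP_complete (u : nat -> prodIP H) : cauchys (fun a b : prodIP H => ipn (a - b)) u ->
  exists l, cvgs (fun a b : prodIP H => ipn (a - b)) u l.
Proof.
move=> cu.
have [|l hl] := @cauchys_cvgs R H (fun n => (u n).1).
  by move=> e /cu [N hN]; exists N => m n hm hn; apply: le_trans (hN m n hm hn); exact: (prodIP_fst (u m - u n)).
have [|k hk] := @cauchys_cvgs R H (fun n => (u n).2).
  by move=> e /cu [N hN]; exists N => m n hm hn; apply: le_trans (hN m n hm hn); exact: (prodIP_snd (u m - u n)).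
exists ((l, k) : prodIP H) => e e0; have e2 : 0 < e / 2 by lra.
have [N hN] := hl _ e2; have [N' hN'] := hk _ e2.
exists (maxn N N') => n; rewrite geq_max => /andP[/hN a /hN' b].
apply: le_trans (prodIP_le _) _; rewrite /dn in a b; rewrite /=; lra.
Qed.
Lemma prodIP_def (p : prodIP H) : ip p p = 0 -> p = 0.
Proof.
rewrite ip_ipn -rc0 => /rc_inj; rewrite prodIP_sqr => h.
have := sqr_ge0 (nm p.1); have := sqr_ge0 (nm p.2) => a b.
have h1 : nm p.1 ^+ 2 = 0 by lra.
have h2 : nm p.2 ^+ 2 = 0 by lra.
move/eqP: h1; move/eqP: h2; rewrite !sqrf_eq0 => /eqP/nm_eq0 h2 /eqP/nm_eq0 h1.
by apply/pair_eqP/andP; split; apply/eqP.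
Qed.
End ProdIP.

(** * Irreducible representations *)

Section Irreducible.
Context {R : realType} {H : hilbertSpace R} {B : lmodType R[i]}.
Variables (pi : B -> H -> H) (st : B -> B) (ml : B -> B -> B).
Hypothesis pl : forall b, linear (pi b).
Hypothesis pb : forall b, bdd (pi b).
Hypothesis pL : forall c a b x, pi (c *: a + b) x = c *: pi a x + pi b x.
Hypothesis pM : forall a b x, pi (ml a b) x = pi a (pi b x).
Hypothesis pS : forall a x y, hip (pi (st a) x) y = hip x (pi a y).
Hypothesis pn : exists a x, pi a x <> 0.
Hypothesis irr : forall K : set H, closed_subspace K ->
  (forall a x, K x -> K (pi a x)) -> K = [set 0] \/ K = setT.

Lemma rep0 x : pi 0 x = 0.
Proof. by have := pL (-1) 0 0 x; rewrite scaler0 addr0 scaleN1r addNr. Qed.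
Lemma repZ c a x : pi (c *: a) x = c *: pi a x.
Proof. by have := pL c a 0 x; rewrite rep0 !addr0. Qed.
Lemma repS' a x y : hip x (pi (st a) y) = hip (pi a x) y.
Proof. by rewrite hip_conj pS -hip_conj. Qed.

Lemma rep_nondeg x : (forall b, pi b x = 0) -> x = 0.
Proof.
move=> h; pose K : set H := [set y | forall b, pi b y = 0].
have cK : closed_subspace K.
  split.
  - apply/closed_eps => y hy b; apply: nm_small => e e0.
    have [M M0 hM] := bddP (pb b).
    have [z Kz hz] := hy _ (divr_gt0 e0 M0).
    have -> : pi b y = pi b (y - z) by rewrite (linB (pl b)) Kz subr0.
    by apply: le_trans (hM _) _; move: hz; rewrite ler_pdivlMr// mulrC.
  - by move=> b; rewrite (lin0 (pl b)).
  - by move=> c y z Ky Kz b; rewrite pl Ky Kz scaler0 addr0.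
have [|e|e] := irr cK.
- by move=> a y Ky b; rewrite Ky (lin0 (pl _)).
- by have : K x by []; rewrite e.
- have [a [y []]] := pn; have : K y by rewrite e.
  by move=> ->.
Qed.

Definition cl (K : set H) : set H := [set y | forall e : R, 0 < e -> exists2 z, K z & nm (y - z) <= e].

Lemma cl_closed (K : set H) : K 0 -> (forall c y z, K y -> K z -> K (c *: y + z)) ->
  closed_subspace (cl K).
Proof.
move=> K0 KL; split.
- apply/closed_eps => x h e e0; have e2 : 0 < e / 2 by lra.
  have [y hy xy] := h _ e2; have [z Kz yz] := hy _ e2.
  exists z => //; have -> : x - z = (x - y) + (y - z) by lmod.
  by have := nmD (x - y) (y - z); lra.
- by move=> e e0; exists 0; rewrite // subrr nm0 ltW.
- move=> c x y hx hy e e0; have k0 : 0 < nm c + 1 by have := nm_ge0 c; lra.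
  have e2 : 0 < e / 2 by lra.
  have [x' Kx' xx] := hx _ (divr_gt0 e2 k0); have [y' Ky' yy] := hy _ e2.
  exists (c *: x' + y'); first exact: KL.
  have -> : c *: x + y - (c *: x' + y') = c *: (x - x') + (y - y') by lmod.
  have := nmD (c *: (x - x')) (y - y'); rewrite nmZ.
  have : nm c * nm (x - x') <= e / 2.
    move: xx; set d := e / 2 / _ => xx; have dE : d * (nm c + 1) = e / 2 by rewrite /d divfK// gt_eqF.
    have d0 : 0 < d by rewrite divr_gt0.
    by have := nm_ge0 c; have := nm_ge0 (x - x'); nra.
  by lra.
Qed.

Lemma cl_invariant (K : set H) (S : H -> H) : linear S -> bdd S ->
  (forall x, K x -> K (S x)) -> forall x, cl K x -> cl K (S x).
Proof.
move=> lS bS h x hx e e0; have [M M0 hM] := bddP bS.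
have [y Ky xy] := hx _ (divr_gt0 e0 M0); exists (S y); first exact: h.
rewrite -(linB lS); apply: le_trans (hM _) _.
by move: xy; rewrite ler_pdivlMr// mulrC.
Qed.

Lemma rep_dense_sub (K : set H) : K 0 -> (forall c y z, K y -> K z -> K (c *: y + z)) ->
  (forall a x, K x -> K (pi a x)) -> (exists2 x, K x & x <> 0) ->
  forall y (e : R), 0 < e -> exists2 z, K z & nm (y - z) <= e.
Proof.
move=> K0 KL Ki [x Kx x0] y; have [| |h] := irr (cl_closed K0 KL).
- by move=> a z; apply: cl_invariant => //; exact: Ki.
- move=> h; have : cl K x by move=> e e0; exists x; rewrite // subrr nm0 ltW.
  by rewrite h => /x0.
- by have : cl K y by rewrite h.
Qed.

Lemma rep_dense x y (e : R) : x <> 0 -> 0 < e -> exists b, nm (y - pi b x) <= e.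
Proof.
move=> x0 e0; pose K : set H := range (fun b => pi b x).
have K0 : K 0 by exists 0; rewrite // rep0.
have KL c y1 z : K y1 -> K z -> K (c *: y1 + z).
  by move=> [a _ <-] [b _ <-]; exists (c *: a + b); rewrite // pL.
have Ki a y1 : K y1 -> K (pi a y1) by move=> [b _ <-]; exists (ml a b); rewrite // pM.
have Kn : exists2 y1, K y1 & y1 <> 0.
  have [b hb] : exists b, pi b x <> 0.
    by apply: contrapT => /forallNP h; apply: x0; apply: rep_nondeg => b; by apply: contrapT => hb; exact: (h b).
  by exists (pi b x) => //; exists b.
by have [z [b _ <-] hz] := rep_dense_sub K0 KL Ki Kn y e0; exists b.
Qed.

Lemma rep_schur (T T' : H -> H) : linear T -> bdd T -> linear T' -> bdd T' ->
  (forall x y, hip (T' x) y = hip x (T y)) ->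
  (forall a x, T (pi a x) = pi a (T x)) -> exists c : R[i], forall x, T x = c *: x.
Proof.
move=> lT bT lT' bT' adj cT.
have adj' := adj; apply: (@schur R H (range pi)) lT bT lT' bT' (adj) _ _.
- by move=> _ [a _ <-].
- by move=> _ [a _ <-].
- by move=> K cK h; apply: irr => // a x; apply: h; exists a.
- by move=> _ [a _ <-] x.
- move=> _ [a _ <-] x; apply: hip_ext => y.
  have key u w : hip w (T' u) = hip (T w) u by rewrite hip_conj adj' -hip_conj.
  by rewrite key -pS -cT -key pS.
Qed.

(** By the double commutant theorem the functional in the hypothesis vanishes on all bounded
    operators, in particular on the projection onto [et], where the second term drops out since [v]
    and [et] are orthogonal. The proof is direct: the projection onto the closure of the vectors
    [(pi b v, pi b al)] commutes with the action on two copies of [H], so that its matrix entries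
    are scalars by Schur's lemma. *)
Lemma rep_rank_one (al v et be : H) :
  (forall b, hip (pi b et) al + hip (pi b be) v = 0) -> hip v et = 0 -> hip et al = 0.
Proof.
move=> h vet.
have [v0|v0] := pselect (v = 0).
  have [->|et0] := pselect (et = 0); first by rewrite hipl0.
  suff -> : al = 0 by rewrite hipr0.
  apply: hip_eq0; apply: nm_small => e e0.
  have k0 : 0 < nm al + 1 by have := nm_ge0 al; lra.
  have [b hb] := rep_dense al et0 (divr_gt0 e0 k0).
  have -> : hip al al = hip (al - pi b et) al.
    by have := h b; rewrite hiplB v0 hipr0 addr0 => ->; rewrite subr0.
  apply: le_trans (hip_cs _ _) _; move: hb; set d := e / _ => hb.
  have dE : d * (nm al + 1) = e by rewrite /d divfK// gt_eqF.
  by have := nm_ge0 al; have := nm_ge0 (al - pi b et); nra.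
pose W := prodIP H.
pose K0 : set W := [set q | exists b, q = (pi b v, pi b al)].
pose K : set W := [set q | forall e : R, 0 < e -> exists2 z, K0 z & ipn (q - z) <= e].
have K0K q : K0 q -> K q by move=> Kq e e0; exists q; rewrite // subrr ipn0 ltW.
have K00 : K0 0 by exists 0; rewrite !rep0.
have K0L c y z : K0 y -> K0 z -> K0 (c *: y + z).
  by move=> [a ->] [b ->]; exists (c *: a + b); rewrite !pL.
have KL c y z : K y -> K z -> K (c *: y + z).
  move=> hx hy e e0; have k0 : 0 < nm c + 1 by have := nm_ge0 c; lra.
  have e2 : 0 < e / 2 by lra.
  have [x' Kx' xx] := hx _ (divr_gt0 e2 k0); have [y' Ky' yy] := hy _ e2.
  exists (c *: x' + y'); first exact: K0L.
  have -> : c *: y + z - (c *: x' + y') = c *: (y - x') + (z - y') by lmod.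
  have := ipnD (c *: (y - x')) (z - y'); rewrite ipnZ.
  have : nm c * ipn (y - x') <= e / 2.
    move: xx; set d := e / 2 / _ => xx; have dE : d * (nm c + 1) = e / 2 by rewrite /d divfK// gt_eqF.
    have d0 : 0 < d by rewrite divr_gt0.
    by have := nm_ge0 c; have := ipn_ge0 (y - x'); nra.
  by lra.
have Kc y : (forall e, 0 < e -> exists2 z, K z & ipn (y - z) <= e) -> K y.
  move=> hy e e0; have e2 : 0 < e / 2 by lra.
  have [z Kz yz] := hy _ e2; have [w Kw zw] := Kz _ e2; exists w => //.
  have -> : y - w = (y - z) + (z - w) by lmod.
  by have := ipnD (y - z) (z - w); lra.
have [P [lP KP PK sP [cP oP uP]]] := projector (@prodIP_def R H) (@prodIP_complete R H) (K0K _ K00) KL Kc.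
have piK a q : K q -> K (pi a q.1, pi a q.2).
  move=> Kq e e0; have [M M0 hM] := bddP (pb a).
  have [z [b zE] hz] := Kq _ (divr_gt0 e0 M0).
  exists (pi (ml a b) v, pi (ml a b) al); first by exists (ml a b).
  rewrite !pM; have := prodIP_sqr (q - z); have := ipn_ge0 (q - z).
  set r := (_ - _ : W); have := prodIP_sqr r.
  have -> : r = (pi a (q - z).1, pi a (q - z).2) by rewrite /r zE /= !(linB (pl a)).
  move=> rE p0 pE; suff : ipn ((pi a (q - z).1, pi a (q - z).2) : W) ^+ 2 <= e ^+ 2.
    by rewrite ler_pXn2r// ?nnegrE ?ipn_ge0 ?(ltW e0).
  rewrite rE.
  rewrite /=; move: hz; rewrite ler_pdivlMr// => hz.
  have h1 := hM (q - z).1; have h2 := hM (q - z).2.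
  have h3 : nm (pi a (q - z).1) ^+ 2 <= (M * nm (q - z).1) ^+ 2.
    by rewrite ler_pXn2r// ?nnegrE ?nm_ge0// mulr_ge0 ?nm_ge0// ltW.
  have h4 : nm (pi a (q - z).2) ^+ 2 <= (M * nm (q - z).2) ^+ 2.
    by rewrite ler_pXn2r// ?nnegrE ?nm_ge0// mulr_ge0 ?nm_ge0// ltW.
  apply: le_trans (lerD h3 h4) _; rewrite !exprMn -mulrDr -pE -exprMn.
  by rewrite ler_pXn2r// ?nnegrE ?(ltW e0) ?mulr_ge0 ?ipn_ge0 ?(ltW M0)// mulrC.
have Ppi a q : P (pi a q.1, pi a q.2) = (pi a (P q).1, pi a (P q).2).
  apply: uP; first exact: piK.
  move=> z Kz; have := oP q _ (piK (st a) z Kz).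
  by rewrite /= -!(linB (pl a)) !pS.
have nP1 q : nm (P q).1 <= nm q.1 + nm q.2.
  by apply: le_trans (prodIP_fst _) _; apply: le_trans (cP _) (prodIP_le _).
have nP2 q : nm (P q).2 <= nm q.1 + nm q.2.
  by apply: le_trans (prodIP_snd _) _; apply: le_trans (cP _) (prodIP_le _).
pose T11 x := (P (x, 0)).1; pose T12 x := (P (0, x)).1.
pose T21 x := (P (x, 0)).2; pose T22 x := (P (0, x)).2.
have pr1 c x y : ((c *: x + y, 0) : W) = c *: ((x, 0) : W) + (y, 0).
  by congr (_, _); rewrite /= scaler0 addr0.
have pr2 c x y : ((0, c *: x + y) : W) = c *: ((0, x) : W) + (0, y).
  by congr (_, _); rewrite /= scaler0 addr0.
have l11 : linear T11 by move=> c x y; rewrite /T11 pr1 lP.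
have l12 : linear T12 by move=> c x y; rewrite /T12 pr2 lP.
have l21 : linear T21 by move=> c x y; rewrite /T21 pr1 lP.
have l22 : linear T22 by move=> c x y; rewrite /T22 pr2 lP.
have b11 : bdd T11 by exists 1 => x; apply: le_trans (nP1 _) _; rewrite nm0 addr0 mul1r.
have b12 : bdd T12 by exists 1 => x; apply: le_trans (nP1 _) _; rewrite nm0 add0r mul1r.
have b21 : bdd T21 by exists 1 => x; apply: le_trans (nP2 _) _; rewrite nm0 addr0 mul1r.
have b22 : bdd T22 by exists 1 => x; apply: le_trans (nP2 _) _; rewrite nm0 add0r mul1r.
have a11 x y : hip (T11 x) y = hip x (T11 y).
  by have := sP (x, 0) (y, 0); rewrite /= hipr0 hipl0 !addr0.
have a22 x y : hip (T22 x) y = hip x (T22 y).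
  by have := sP (0, x) (0, y); rewrite /= hipr0 hipl0 !add0r.
have a21 x y : hip (T21 x) y = hip x (T12 y).
  by have := sP (x, 0) (0, y); rewrite /= hipr0 hipl0 addr0 add0r.
have c1 a x : ((pi a x, 0) : W) = (pi a (x, (0 : H)).1, pi a (x, (0 : H)).2) by rewrite /= (lin0 (pl a)).
have c2 a x : ((0, pi a x) : W) = (pi a ((0 : H), x).1, pi a ((0 : H), x).2) by rewrite /= (lin0 (pl a)).
have [r11 e11] := rep_schur l11 b11 l11 b11 a11 (fun a x => congr1 fst (etrans (congr1 P (c1 a x)) (Ppi a (x, 0)))).
have [r12 e12] := rep_schur l12 b12 l21 b21 a21 (fun a x => congr1 fst (etrans (congr1 P (c2 a x)) (Ppi a (0, x)))).
have [r22 e22] := rep_schur l22 b22 l22 b22 a22 (fun a x => congr1 snd (etrans (congr1 P (c2 a x)) (Ppi a (0, x)))).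
have Kva : K (v, al).
  suff -> : ((v, al) : W) = P (v, al) by exact: KP.
  have d0 a : (pi a ((v, al) - P (v, al)).1, pi a ((v, al) - P (v, al)).2) = (0, 0) :> H * H.
    rewrite /= !(linB (pl a)).
    have e := Ppi a (v, al); have kk : K (pi a v, pi a al) by apply: K0K; exists a.
    rewrite (PK _ kk) in e; case: e => /= <- <-.
    by rewrite !subrr.
  apply: subr0_eq; apply/pair_eqP/andP; split; apply/eqP.
    by apply: rep_nondeg => a; case: (d0 a).
  by apply: rep_nondeg => a; case: (d0 a).
have dec : ((v, al) : W) = 1 *: ((v, 0) : W) + (0, al).
  by rewrite scale1r; congr (_, _); rewrite /= ?addr0 ?add0r.
have vE : r11 *: v + r12 *: al = v.
  by rewrite -e11 -e12; have := congr1 fst (PK _ Kva); rewrite {1}dec lP scale1r.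
(* If [r12 <> 0], then [al] is a multiple of [v], which is orthogonal to [et]. Otherwise the
   projection is diagonal; unless [al = 0], both entries are 1 and [K] is everything. *)
have [r0|rn] := eqVneq r12 0; last first.
  have alE : al = (r12^-1 * (1 - r11)) *: v.
    have -> : al = r12^-1 *: (r12 *: al) by rewrite scalerA mulVf// scale1r.
    have -> : r12 *: al = v - r11 *: v by rewrite -{1}vE; lmod.
    by lmod.
  by rewrite alE hiprZ (hip_conj v) vet conj0 mulr0.
have r11E : r11 = 1.
  have : (r11 - 1) *: v = 0 by rewrite scalerBl scale1r -{2}vE r0; lmod.
  by move/eqP; rewrite scaler_eq0 => /orP[/eqP/eqP|/eqP//]; rewrite subr_eq0 => /eqP.
have t21 x : T21 x = 0.
  apply: hip_eq0; rewrite a21 e12 r0 scale0r; exact: hipr0.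
have alE : r22 *: al = al.
  by rewrite -e22; have := congr1 snd (PK _ Kva); rewrite {1}dec lP scale1r /= -/(T21 v) t21 add0r.
have [->|al0] := pselect (al = 0); first by rewrite hipr0.
have r22E : r22 = 1.
  have : (r22 - 1) *: al = 0 by rewrite scalerBl scale1r alE subrr.
  by move/eqP; rewrite scaler_eq0 => /orP[|/eqP//]; rewrite subr_eq0 => /eqP.
have Kall x y : K (x, y).
  have e : ((x, y) : W) = 1 *: ((x, 0) : W) + (0, y).
    by rewrite scale1r; congr (_, _); rewrite /= ?addr0 ?add0r.
  suff -> : ((x, y) : W) = P (x, y) by exact: KP.
  rewrite [in RHS]e lP scale1r; apply/pair_eqP/andP; split; apply/eqP.
    by rewrite /= -/(T11 x) -/(T12 y) e11 e12 r0 r11E scale1r scale0r addr0.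
  by rewrite /= -/(T21 x) -/(T22 y) t21 e22 r22E scale1r add0r.
(* This is the hypothesis at the products of [st c] and [b]. When [K] is everything it gives
   [pi b et = 0] for all [b], hence [et = 0]. *)
have orth b q : K q -> ip ((pi b be, pi b et) : W) q = 0.
  move=> Kq; apply: nm_small => e e0.
  set w := ((pi b be, pi b et) : W).
  have k0 : 0 < ipn w + 1 by have := ipn_ge0 w; lra.
  have [z [c zE] hz] := Kq _ (divr_gt0 e0 k0).
  have -> : ip w q = ip w (q - z).
    rewrite iprB zE /w /= -!(pS c) -!pM.
    have := h (ml (st c) b); rewrite addrC => ->; by rewrite subr0.
  apply: le_trans (ip_cs _ _) _; move: hz; set d := e / _ => hz.
  have dE : d * (ipn w + 1) = e by rewrite /d divfK// gt_eqF.
  have d0 : 0 < d by rewrite divr_gt0.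
  by have := ipn_ge0 w; have := ipn_ge0 (q - z); nra.
have et0 b : pi b et = 0.
  by apply: hip_eq0; have := orth b _ (Kall 0 (pi b et)); rewrite /= hipr0 add0r.
by rewrite (rep_nondeg et0) hipl0.
Qed.

Lemma stZ_rep c b x y : hip (pi (st (c *: b)) x) y = hip (pi (st b) x) (c *: y).
Proof. by rewrite !pS repZ (linZ (pl b)). Qed.

(** A two-vector case of Kadison's transitivity theorem, up to [e]: [(et, 0)] is to lie in the
    closure of the real-linear set of the pairs [(pi b et, pi (st b) v)]. The difference [(al, be)]
    from the nearest point [l] of the closure is orthogonal to the set and to [l]; [rep_rank_one]
    shows that it is also orthogonal to [(et, 0)], so it is 0. *)
Lemma rep_density (v et : H) (e : R) : hip v et = 0 -> 0 < e ->
  exists b, nm (pi b et - et) <= e /\ nm (pi (st b) v) <= e.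
Proof.
move=> vet e0.
pose W := prodIP H.
pose K : set W := [set q | exists b, q = (pi b et, pi (st b) v)].
have st0 x : pi (st 0) x = 0 by apply: hip_ext => y; rewrite repS' rep0 hipl0 hipr0.
have stL (r : R) a b x : pi (st (rc r *: a + b)) x = rc r *: pi (st a) x + pi (st b) x.
  apply: hip_ext => y; rewrite repS' pL hiplD hiplZ hiprD hiprZ !repS' rc_conj.
  by [].
have K0 : K 0 by exists 0; rewrite rep0 st0.
have KL (r : R) y z : K y -> K z -> K (rc r *: y + z).
  by move=> [a ->] [b ->]; exists (rc r *: a + b); rewrite pL stL.
have [y [Ky cy oy]] := min_seq ((et, 0) : W) K0 KL.
have [l hl] := prodIP_complete cy.
have lim0 (f : W) : (forall e, 0 < e -> exists N, forall n, (N <= n)%N -> `|re (ip f ((et, 0) - y n))| <= e) ->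
    re (ip f ((et, 0) - l)) = 0.
  move=> hf; apply/eqP; rewrite -normr_le0; apply: ler_eps => r r0; rewrite add0r.
  have k0 : 0 < ipn f + 1 by have := ipn_ge0 f; lra.
  have r2 : 0 < r / 2 by lra.
  have [N hN] := hf _ r2; have [N' hN'] := hl _ (divr_gt0 r2 k0).
  have := hN _ (leq_maxl N N'); have := hN' _ (leq_maxr N N'); set n := maxn _ _ => h1 h2.
  have -> : ((et, 0) : W) - l = (((et, 0) : W) - y n) + (y n - l) by lmod.
  rewrite (iprD f (_ - y n)) reD; apply: le_trans (ler_normD _ _) _.
  have h3 : `|re (ip f (y n - l))| <= ipn f * ipn (y n - l).
    by apply: le_trans (ip_cs _ _); rewrite ler_norml re_le_nm re_ge_nm.
  have h4 : ipn f * ipn (y n - l) <= r / 2.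
    move: h1; set d := r / 2 / _ => h1; have dE : d * (ipn f + 1) = r / 2 by rewrite /d divfK// gt_eqF.
    have d0 : 0 < d by rewrite divr_gt0.
    by have := ipn_ge0 f; have := ipn_ge0 (y n - l); nra.
  by lra.
pose al := et - l.1; pose be := - l.2.
have xl : ((et, 0) : W) - l = (al, be) by congr (_, _); rewrite /= sub0r.
(* The orthogonality concerns real parts only. Replacing [b] by ['i *: b] supplies the imaginary
   part, after conjugating the term in which [b] occurs through its adjoint. *)
have ob b : hip (pi b et) al + hip (pi b be) v = 0.
  have r1 c : re (hip (pi c et) al + hip (pi (st c) v) be) = 0.
    have kc : K (pi c et, pi (st c) v) by exists c.
    by have := lim0 _ (oy _ kc); rewrite xl.
  have e2 : hip (pi b be) v = (hip (pi (st b) v) be)^* by rewrite pS -hip_conj.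
  rewrite e2; apply: re_eq0; first by have := r1 b; rewrite !reD re_conj.
  have := r1 ('i *: b); rewrite repZ stZ_rep hiplZ hiprZ conj_i !reD.
  rewrite mulrDr reD -[re ('i * (hip _ be)^*)]re_conj conjM conjK conj_i.
  by rewrite !mulNr !reN; lra.
have eta0 := rep_rank_one ob vet.
have ll : re (ip (l : W) ((et, 0) - l)) = 0.
  apply/eqP; rewrite -normr_le0; apply: ler_eps => r r0; rewrite add0r.
  set f := ((et, 0) : W) - l.
  have k0 : 0 < ipn f + 1 by have := ipn_ge0 f; lra.
  have [N /(_ N (leqnn _)) hN] := hl _ (divr_gt0 r0 k0).
  have -> : ip l f = ip (y N) f - ip (y N - l) f by rewrite iplB; ring.
  rewrite reB lim0; last exact: oy.
  rewrite sub0r normrN.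
  have h3 : `|re (ip (y N - l) f)| <= ipn (y N - l) * ipn f.
    by apply: le_trans (ip_cs _ _); rewrite ler_norml re_le_nm re_ge_nm.
  move: hN; set d := r / _ => h1; have dE : d * (ipn f + 1) = r by rewrite /d divfK// gt_eqF.
  have d0 : 0 < d by rewrite divr_gt0.
  by have := ipn_ge0 f; have := ipn_ge0 (y N - l); nra.
have z0 : nm al ^+ 2 + nm be ^+ 2 = 0.
  have : re (ip (((et, 0) : W) - l) (((et, 0) : W) - l)) = 0.
    rewrite iplB reB ll xl /= hipl0 addr0 eta0 re0; lra.
  by rewrite xl /= reD !hipxx.
have al0 : al = 0.
  by apply: nm_eq0; apply/eqP; rewrite -sqrf_eq0; apply/eqP; have := sqr_ge0 (nm al); have := sqr_ge0 (nm be); lra.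
have be0 : be = 0.
  by apply: nm_eq0; apply/eqP; rewrite -sqrf_eq0; apply/eqP; have := sqr_ge0 (nm al); have := sqr_ge0 (nm be); lra.
have [N /(_ N (leqnn _)) hN] := hl _ e0.
have [b yb] := Ky N; exists b.
have e1 : l.1 = et by apply/eqP; rewrite eq_sym -subr_eq0 -/al al0.
have e2 : l.2 = 0 by apply/eqP; rewrite -oppr_eq0 -/be be0.
have := prodIP_fst (y N - l); have := prodIP_snd (y N - l).
move: hN; rewrite /dn; set q := y N - l.
have -> : q.1 = pi b et - et by rewrite /q yb /= e1.
have -> : q.2 = pi (st b) v by rewrite /q yb /= e2 subr0.
by move=> ? ? ?; split; lra.
Qed.

End Irreducible.

(** * Convexity of the numerical range *)

Section NumericalRange.
Context {R : realType} {H : hilbertSpace R}.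
Variables (T : H -> H) (M : set H).
Hypothesis lT : linear T.
Hypothesis ML : forall c x y, M x -> M y -> M (c *: x + y).

(** An affine change of [T] to [S] moves the two values to 1 and 0, and [z = r u y + x] is sought
    with [<z | S z> = t <z | z>]. The phase [u] makes the left side real, and [r] then solves a
    quadratic equation. *)
Lemma toeplitz_hausdorff x y (t : R) : M x -> M y -> nm x = 1 -> nm y = 1 -> 0 <= t <= 1 ->
  exists z, [/\ M z, nm z = 1 & hip z (T z) = rc t * hip x (T x) + rc (1 - t) * hip y (T y)].
Proof.
move=> Mx My nx ny /andP[t0 t1].
have [e|ne] := eqVneq (hip x (T x)) (hip y (T y)).
  by exists x; split => //; rewrite -e -mulrDl -rcD addrC subrK mul1r.
have [->|tn0] := eqVneq t 0; first by exists y; split => //; rewrite rc0 mul0r subr0 mul1r add0r.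
have [->|tn1] := eqVneq t 1; first by exists x; split => //; rewrite subrr mul1r rc0 mul0r addr0.
have tp : 0 < t by rewrite lt_neqAle eq_sym tn0.
have tl : t < 1 by rewrite lt_neqAle tn1.
set w1 := hip x (T x) in ne *; set w2 := hip y (T y) in ne *.
have dn0 : w1 - w2 != 0 by rewrite subr_eq0.
pose S z := (w1 - w2)^-1 *: (T z - w2 *: z).
have lS : linear S by move=> c a b; rewrite /S lT; lmod.
have Tz z : T z = (w1 - w2) *: S z + w2 *: z by rewrite /S scalerA divff// scale1r subrK.
have xx : hip x x = 1 by rewrite hipxx nx expr1n.
have yy : hip y y = 1 by rewrite hipxx ny expr1n.
have Sx : hip x (S x) = 1 by rewrite /S hiprZ hiprB hiprZ xx mulr1 mulVf.
have Sy : hip y (S y) = 0 by rewrite /S hiprZ hiprB hiprZ yy mulr1 subrr mulr0.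
clearbody S.
pose a := hip x (S y); pose b := hip y (S x).
have [u [nu ua uu]] := phase (a - b^*).
have uu' : u * u^* = 1 by rewrite mulrC.
have cr : u * a + u^* * b = rc (re (u * a + u^* * b)).
  apply: conj_rc_re; rewrite conjD !conjM conjK.
  have : (u * (a - b^*))^* = u * (a - b^*) by rewrite ua rc_conj.
  rewrite conjM conjB conjK => e.
  apply: subr0_eq.
  have -> : u^* * a^* + u * b^* - (u * a + u^* * b) = (u^* * (a^* - b)) - (u * (a - b^*)) by ring.
  by rewrite e subrr.
set k := re _ in cr.
pose kn := re (u * hip x y).
(* Comparing [1 + r k] with [t (1 + 2 r kn + r^2)] gives [t r^2 + B r - (1 - t) = 0], which has the
   positive root [r] because [0 < t < 1]. *)
pose B := 2 * t * kn - k; pose disc := B ^+ 2 + 4 * t * (1 - t).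
have dpos : B ^+ 2 < disc by rewrite /disc ltrDl; nra.
pose s := Num.sqrt disc.
have ss : s ^+ 2 = disc by rewrite sqr_sqrtr//; have := sqr_ge0 B; lra.
have s0 : 0 <= s by exact: sqrtr_ge0.
have Bs : B < s by have := sqr_ge0 B; nra.
pose r := (s - B) / (2 * t).
have r0 : 0 < r by rewrite divr_gt0 ?subr_gt0// mulr_gt0.
have rE : t * r ^+ 2 + B * r - (1 - t) = 0.
  have -> : t * r ^+ 2 + B * r - (1 - t) = (s ^+ 2 - disc) / (4 * t).
    by rewrite /r /disc; field.
  by rewrite ss subrr mul0r.
pose z := (rc r * u) *: y + x.
have Mz : M z by exact: ML.
have ruc : (rc r * u)^* = rc r * u^* by rewrite conjM rc_conj.
have Sz : hip z (S z) = rc (1 + r * k).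
  have -> : rc (1 + r * k) = 1 + rc r * (u * a + u^* * b) by rewrite cr rcD rcM rc1.
  rewrite /z (lS (rc r * u) y x) hiplD hiplZ !hiprD !hiprZ Sx Sy -/a -/b ruc; ring.
have zz : hip z z = rc (1 + 2 * r * kn + r ^+ 2).
  rewrite hipxx /z nm_sqrD nx nmZ nmM nm_rc nu ny hiplZ ruc (hip_conj x y).
  have -> : re (rc r * u^* * (hip x y)^*) = r * kn.
    by rewrite -mulrA reZ -conjM re_conj.
  by congr rc; rewrite (ger0_norm (ltW r0)); ring.
have zn : 0 < nm z.
  apply: nm_gt0 => z0.
  have xE : x = - (rc r * u) *: y.
    by apply/eqP; rewrite scaleNr -addr_eq0 addrC; apply/eqP.
  have r1 : r = 1.
    by have := nx; rewrite xE nmZ nmN nmM nm_rc nu ny !mulr1 ger0_norm// ltW.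
  move: Sx; rewrite xE (linZ lS) hiplZ hiprZ Sy !mulr0 => /eqP.
  by rewrite eq_sym oner_eq0.
have zz' : nm z ^+ 2 = 1 + 2 * r * kn + r ^+ 2 by have := zz; rewrite hipxx => /rc_inj.
exists (rc (nm z)^-1 *: z); split.
- by rewrite -(addr0 (_ *: z)); apply: ML => //; rewrite -(addNr z) -scaleN1r; exact: ML.
- by rewrite nmZ nm_rc ger0_norm ?invr_ge0 ?(ltW zn)// mulVf// gt_eqF.
rewrite (linZ lT) hiplZ hiprZ rc_conj.
rewrite Tz hiprD !hiprZ Sz hipxx.
have -> : 1 + r * k = t * nm z ^+ 2 by rewrite zz'; move: rE; rewrite /B; lra.
rewrite mulrDr mulrDr.
have nn : nm z != 0 by rewrite gt_eqF.
have -> : rc (nm z)^-1 * (rc (nm z)^-1 * (w2 * rc (nm z ^+ 2))) = w2.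
  by rewrite rcX rcV; field; rewrite rc_eq0.
have -> : rc (nm z)^-1 * (rc (nm z)^-1 * ((w1 - w2) * rc (t * nm z ^+ 2))) = rc t * (w1 - w2).
  have -> : rc (t * nm z ^+ 2) = rc t * rc (nm z) ^+ 2 by rewrite rcM rcX.
  by rewrite rcV; field; rewrite rc_eq0.
by rewrite rcB rc1; ring.
Qed.

Lemma numerical_range_avg n (z : nat -> H) : (forall i, M (z i)) -> (forall i, nm (z i) = 1) ->
  exists w, [/\ M w, nm w = 1 &
    hip w (T w) = rc n.+1%:R^-1 * \sum_(i < n.+1) hip (z i) (T (z i))].
Proof.
move=> Mz nz; elim: n => [|n [w [Mw nw hw]]].
  by exists (z 0%N); rewrite big_ord1 invr1 mul1r.
have n1 : (n.+1%:R : R) != 0 by rewrite pnatr_eq0.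
have n2 : (n.+2%:R : R) != 0 by rewrite pnatr_eq0.
have [|u [Mu nu hu]] := @toeplitz_hausdorff (z n.+1) w (n.+2%:R^-1) (Mz _) Mw (nz _) nw.
  by rewrite invr_ge0 ler0n invf_le1 ?ltr0n// ler1n.
exists u; split => //; rewrite hu hw [in RHS]big_ord_recr /= mulrDr addrC; congr (_ + _).
rewrite mulrA -rcM; congr (rc _ * _).
have -> : (n.+2%:R : R) = n.+1%:R + 1 by rewrite natr1.
have m0 : 0 <= n.+1%:R :> R by rewrite ler0n.
by move: n1 m0; set m : R := _%:R => n1 m0; field; rewrite ?n1 ?andbT ?gt_eqF//; lra.
Qed.

End NumericalRange.

Lemma sqr_le (R : realDomainType) (x y : R) : 0 <= y -> x ^+ 2 <= y ^+ 2 -> x <= y.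
Proof. by move=> y0 h; rewrite leNgt; apply/negP => yx; nra. Qed.

Lemma max_sqr (R : realDomainType) (x y : R) : 0 <= x -> 0 <= y ->
  Num.max (x ^+ 2) (y ^+ 2) = Num.max x y ^+ 2.
Proof.
move=> x0 y0; have [xy|yx] := leP x y.
  by apply/max_idPr; rewrite ler_pXn2r// nnegrE.
by apply/max_idPl; rewrite ler_pXn2r// ?nnegrE// ltW.
Qed.

(** * Unitization *)

Record nucstar (R : realType) := NuCStar {
  ncar :> completeNormedModType R[i];
  bm : ncar -> ncar -> ncar;
  bs : ncar -> ncar;
  bmLl : forall c a a' b, bm (c *: a + a') b = c *: bm a b + bm a' b;
  bmLr : forall c a b b', bm a (c *: b + b') = c *: bm a b + bm a b';
  bmA : forall a b c, bm (bm a b) c = bm a (bm b c);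
  bsL : forall c a b, bs (c *: a + b) = c^* *: bs a + bs b;
  bsM : forall a b, bs (bm a b) = bm (bs b) (bs a);
  bsK : forall a, bs (bs a) = a;
  bnM : forall a b, nm (bm a b) <= nm a * nm b;
  bnC : forall a, nm (bm (bs a) a) = nm a ^+ 2
}.

Section NuTheory.
Context {R : realType} {B : nucstar R}.
Implicit Types (a b : B).

Lemma bm0l b : bm 0 b = 0.
Proof. by have := bmLl (-1) (0 : B) 0 b; rewrite scaler0 addr0 scaleN1r addNr. Qed.
Lemma bm0r a : bm a 0 = 0.
Proof. by have := bmLr (-1) a (0 : B) 0; rewrite scaler0 addr0 scaleN1r addNr. Qed.
Lemma bmDl a a' b : bm (a + a') b = bm a b + bm a' b.
Proof. by have := bmLl 1 a a' b; rewrite !scale1r. Qed.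
Lemma bmDr a b b' : bm a (b + b') = bm a b + bm a b'.
Proof. by have := bmLr 1 a b b'; rewrite !scale1r. Qed.
Lemma bmZl c a b : bm (c *: a) b = c *: bm a b.
Proof. by have := bmLl c a 0 b; rewrite bm0l !addr0. Qed.
Lemma bmZr c a b : bm a (c *: b) = c *: bm a b.
Proof. by have := bmLr c a b 0; rewrite bm0r !addr0. Qed.
Lemma bs0 : bs (0 : B) = 0.
Proof.
by have := bsL (-1) (0 : B) 0; rewrite scaler0 addr0 rmorphN rmorph1 scaleN1r addNr.
Qed.
Lemma bsD a b : bs (a + b) = bs a + bs b.
Proof. by have := bsL 1 a b; rewrite rmorph1 !scale1r. Qed.
Lemma bsZ c a : bs (c *: a) = c^* *: bs a.
Proof. by have := bsL c a 0; rewrite bs0 !addr0. Qed.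
Lemma nm_bs a : nm (bs a) = nm a.
Proof.
have le y : nm y <= nm (bs y).
  have := bnC y; have := bnM (bs y) y; have := nm_ge0 y.
  have := nm_ge0 (bs y); rewrite expr2.
  case: (ltrP 0 (nm y)) => [h h1 h2 h3 h4|]; last by lra.
  by rewrite -(ler_pM2r h); rewrite -h4.
by apply/eqP; rewrite eq_le le -{2}(bsK a) le.
Qed.
End NuTheory.

Definition unz (R : realType) (B : nucstar R) : Type := (R[i]^o * B)%type.

Section Unitization.
Context {R : realType} (B : nucstar R).
Local Notation D := (unz B).
HB.instance Definition _ := GRing.Lmodule.copy D (R[i]^o * B)%type.

Definition uone : D := (1, 0).
Definition umul (d e : D) : D := (d.1 * e.1, d.1 *: e.2 + e.1 *: d.2 + bm d.2 e.2).
Definition ustar (d : D) : D := (d.1^*, bs d.2).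

Lemma unz_eq (d e : D) : d.1 = e.1 -> d.2 = e.2 -> d = e.
Proof. by case: d e => [a b] [c d] /= -> ->. Qed.
Lemma unzZ c (d : D) : c *: d = (c * d.1, c *: d.2). Proof. by []. Qed.

Fact umulA : associative umul.
Proof.
move=> d e f; apply: unz_eq => /=; first by rewrite mulrA.
rewrite !bmDl !bmDr !bmZl !bmZr bmA.
set x := bm d.2 e.2; set y := bm d.2 f.2; set z := bm e.2 f.2; set w := bm d.2 (bm _ _).
by clearbody x y z w; lmod.
Qed.
Fact umul1l : left_id uone umul.
Proof. by move=> d; apply: unz_eq => /=; rewrite ?mul1r// bm0l scaler0 !addr0 scale1r. Qed.
Fact umul1r : right_id uone umul.
Proof. by move=> d; apply: unz_eq => /=; rewrite ?mulr1// bm0r scaler0 !addr0 add0r scale1r. Qed.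
Fact umulDl_aux (a b c : R[i]) (x y z u v : B) :
  (a + b) *: z + c *: (x + y) + (u + v) = a *: z + c *: x + u + (b *: z + c *: y + v).
Proof. by lmod. Qed.
Fact umulDr_aux (a b c : R[i]) (x y z u v : B) :
  a *: (y + z) + (b + c) *: x + (u + v) = a *: y + b *: x + u + (a *: z + c *: x + v).
Proof. by lmod. Qed.
Fact uscaleAl_aux (c a b : R[i]) (x y u : B) :
  c *: (a *: y + b *: x + u) = (c * a) *: y + b *: (c *: x) + c *: u.
Proof. by lmod. Qed.
Fact uscaleAr_aux (c a b : R[i]) (x y u : B) :
  c *: (a *: y + b *: x + u) = a *: (c *: y) + (c * b) *: x + c *: u.
Proof. by lmod. Qed.
Fact uactZ_aux (c a : R[i]) (x y : B) : (c * a) *: x + c *: y = c *: (a *: x + y).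
Proof. by lmod. Qed.
Fact umulDl : left_distributive umul +%R.
Proof.
move=> d e f; apply: unz_eq => /=; first by rewrite mulrDl.
rewrite bmDl; exact: umulDl_aux.
Qed.
Fact umulDr : right_distributive umul +%R.
Proof.
move=> d e f; apply: unz_eq => /=; first by rewrite mulrDr.
rewrite bmDr; exact: umulDr_aux.
Qed.
Fact uone_neq0 : uone != 0.
Proof. by apply/eqP => /(congr1 fst) /eqP; rewrite /= oner_eq0. Qed.
HB.instance Definition _ := GRing.Zmodule_isNzRing.Build D umulA umul1l umul1r umulDl umulDr uone_neq0.
Fact uscaleAl (c : R[i]) (d e : D) : c *: (d * e) = (c *: d) * e.
Proof.
apply: unz_eq => /=; first by rewrite [LHS]mulrA.
rewrite bmZl; exact: uscaleAl_aux.
Qed.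
HB.instance Definition _ := GRing.Lmodule_isLalgebra.Build R[i] D uscaleAl.
Fact uscaleAr (c : R[i]) (d e : D) : c *: (d * e) = d * (c *: e).
Proof.
apply: unz_eq => /=; first by rewrite [LHS]mulrCA.
rewrite bmZr; exact: uscaleAr_aux.
Qed.
HB.instance Definition _ := GRing.Lalgebra_isAlgebra.Build R[i] D uscaleAr.

Definition uact (d : D) (b : B) : B := d.1 *: b + bm d.2 b.
Definition unorm (d : D) : R := sup [set nm (uact d b) | b in [set b : B | nm b <= 1]].
(** [unorm] is the norm of left multiplication on [B], which is degenerate if [B] already has a
    unit. The maximum with the norm of the quotient by [B] is a C*-norm in all cases, and [unrm_fst]
    keeps scalars at a distance from [B]. *)
Definition unrm (d : D) : R := Num.max (nm (d.1 : R[i])) (unorm d).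

Lemma uactM d e b : uact (d * e) b = uact d (uact e b).
Proof.
rewrite /uact /= !bmDl !bmDr !bmZl !bmZr bmA.
set x := bm d.2 b; set y := bm e.2 b; set w := bm d.2 (bm _ _).
by clearbody x y w; lmod.
Qed.
Lemma uactD d e b : uact (d + e) b = uact d b + uact e b.
Proof. by rewrite /uact /= bmDl; set x := bm _ _; set y := bm _ _; lmod. Qed.
Lemma uactZ (c : R[i]) (d : D) b : uact (c *: d) b = c *: uact d b.
Proof. rewrite /uact /= bmZl; exact: uactZ_aux. Qed.
Lemma uactZr c d b : uact d (c *: b) = c *: uact d b.
Proof. by rewrite /uact /= bmZr; set x := bm _ _; lmod. Qed.

Lemma unorm_has d : has_sup [set nm (uact d b) | b in [set b : B | nm b <= 1]].
Proof.
split; first by exists (nm (uact d 0)); exists 0 => //=; rewrite nm0.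
exists (nm (d.1 : R[i]) + nm d.2) => _ [b /= b1 <-].
apply: le_trans (nmD _ _) _; rewrite nmZ.
have := bnM d.2 b; have := nm_ge0 (d.1 : R[i]); have := nm_ge0 d.2; have := nm_ge0 b; nra.
Qed.
Lemma unorm_ub d b : nm (uact d b) <= unorm d * nm b.
Proof.
have [->|b0] := pselect (b = 0); first by rewrite /uact scaler0 bm0r addr0 nm0 mulr0.
have bp := nm_gt0 b0.
have := @sup_ubound _ _ (unorm_has d).2 (nm (uact d (rc (nm b)^-1 *: b))).
rewrite uactZr nmZ nm_rc ger0_norm ?invr_ge0 ?nm_ge0// => h.
rewrite -ler_pdivrMr// mulrC; apply: h; exists (rc (nm b)^-1 *: b).
  by rewrite /= nmZ nm_rc ger0_norm ?invr_ge0 ?nm_ge0// mulVf// gt_eqF.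
by rewrite uactZr nmZ nm_rc ger0_norm ?invr_ge0 ?nm_ge0.
Qed.
Lemma unorm_le d M : 0 <= M -> (forall b, nm (uact d b) <= M * nm b) -> unorm d <= M.
Proof.
move=> M0 h; apply: ge_sup; first exact: (unorm_has d).1.
by move=> _ [b /= b1 <-]; apply: le_trans (h b) _; have := nm_ge0 b; nra.
Qed.
Lemma unorm_ge0 d : 0 <= unorm d.
Proof.
have := @sup_ubound _ _ (unorm_has d).2 (nm (uact d 0)).
by move=> h; apply: le_trans (h _) => //; [exact: nm_ge0|exists 0 => //=; rewrite nm0].
Qed.
Lemma unrm_le d M : nm (d.1 : R[i]) <= M -> unorm d <= M -> unrm d <= M.
Proof. by move=> a b; rewrite /unrm ge_max a b. Qed.
Lemma unrm_fst d : nm (d.1 : R[i]) <= unrm d. Proof. by rewrite /unrm le_max lexx. Qed.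
Lemma unrm_snd d : unorm d <= unrm d. Proof. by rewrite /unrm le_max lexx orbT. Qed.
Lemma unrm_ge0' d : 0 <= unrm d. Proof. exact: le_trans (unorm_ge0 d) (unrm_snd d). Qed.

Fact unrmD d e : unrm (d + e) <= unrm d + unrm e.
Proof.
apply: unrm_le; first by apply: le_trans (nmD _ _) _; rewrite lerD ?unrm_fst.
apply: unorm_le => [|b]; first by rewrite addr_ge0 ?unrm_ge0'.
rewrite uactD mulrDl; apply: le_trans (nmD _ _) _.
by apply: lerD; apply: le_trans (unorm_ub _ _) _; rewrite ler_wpM2r ?nm_ge0 ?unrm_snd.
Qed.
Fact unrmZ_le c d : unrm (c *: d) <= nm c * unrm d.
Proof.
have c0 := nm_ge0 c; apply: unrm_le.
  by rewrite unzZ /= nmM ler_wpM2l// unrm_fst.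
apply: unorm_le => [|b]; first by rewrite mulr_ge0 ?unrm_ge0'.
rewrite uactZ nmZ -mulrA ler_wpM2l//; apply: le_trans (unorm_ub _ _) _.
by rewrite ler_wpM2r ?nm_ge0 ?unrm_snd.
Qed.
Fact unrmZ c d : unrm (c *: d) = nm c * unrm d.
Proof.
apply/eqP; rewrite eq_le unrmZ_le /=.
have [->|c0] := eqVneq c 0; first by rewrite nm0 mul0r unrm_ge0'.
have cp : 0 < nm c by apply: nm_gt0; apply/eqP.
have := unrmZ_le c^-1 (c *: d); rewrite scalerA mulVf// scale1r.
have : nm (c^-1) * nm c = 1 by rewrite -nmM mulVf// nm1.
have := unrm_ge0' (c *: d); have := unrm_ge0' d; set p := unrm d; set q := unrm (c *: d).
by have := nm_ge0 c^-1; nra.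
Qed.
Fact unrmM d e : unrm (d * e) <= unrm d * unrm e.
Proof.
apply: unrm_le.
  by rewrite /= nmM ler_pM ?nm_ge0 ?unrm_fst.
apply: unorm_le => [|b]; first by rewrite mulr_ge0 ?unrm_ge0'.
rewrite uactM; apply: le_trans (unorm_ub _ _) _; rewrite -mulrA ler_pM ?unorm_ge0 ?nm_ge0 ?unrm_snd//.
by apply: le_trans (unorm_ub _ _) _; rewrite ler_wpM2r ?nm_ge0 ?unrm_snd.
Qed.
Fact unorm_snd a : unorm (0, a) = nm a.
Proof.
apply/eqP; rewrite eq_le; apply/andP; split.
  apply: unorm_le => [|b]; first exact: nm_ge0.
  by rewrite /uact /= scale0r add0r bnM.
have [->|a0] := pselect (a = 0); first by rewrite nm0 unorm_ge0.
have := unorm_ub (0, a) (bs a); rewrite /uact /= scale0r add0r.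
have := bnC (bs a); rewrite bsK nm_bs => ->.
by rewrite expr2 ler_pM2r// nm_gt0.
Qed.
Fact unrm_in a : unrm (0, a) = nm a.
Proof. by rewrite /unrm unorm_snd /= nm0; apply/max_idPr; exact: nm_ge0. Qed.
Fact unorm1 c : unrm (c, 0) <= nm c.
Proof.
apply: unrm_le => //; apply: unorm_le => [|b]; first exact: nm_ge0.
by rewrite /uact /= bm0l addr0 nmZ.
Qed.
Fact unrm_split d : nm d.2 <= 2 * unrm d.
Proof.
rewrite -unrm_in; have -> : ((0, d.2) : D) = d + (- d.1, 0).
  by apply: unz_eq; rewrite /= ?subrr ?addr0.
have := unrmD d (- d.1, 0); have := unorm1 (- d.1); have := unrm_fst d; rewrite nmN; lra.
Qed.
Fact unrm_eq0 d : unrm d = 0 -> d = 0.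
Proof.
move=> h; have := unrm_fst d; have := unrm_split d; rewrite h mulr0 => h1 h2.
by apply: unz_eq; apply: nm_le0.
Qed.
Fact ustarL c d e : ustar (c *: d + e) = c^* *: ustar d + ustar e.
Proof. by apply: unz_eq; rewrite /= ?bsL// conjD [_ *: _]/(_ * _) conjM. Qed.
Fact ustarM d e : ustar (d * e) = ustar e * ustar d.
Proof.
apply: unz_eq; rewrite /= ?conjM 1?mulrC// !bsD !bsZ bsM; congr (_ + _); exact: addrC.
Qed.
Fact ustarK d : ustar (ustar d) = d.
Proof. by apply: unz_eq; rewrite /= ?conjK ?bsK. Qed.
Fact uact_star d b c : bm (bs (uact d b)) c = bm (bs b) (uact (ustar d) c).
Proof. by rewrite /uact /= bsD bsZ bsM bmDl bmZl bmDr bmZr bmA. Qed.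
Fact unorm_sqr d : unorm d ^+ 2 <= unorm (ustar d * d).
Proof.
have n0 := unorm_ge0 (ustar d * d).
suff : unorm d <= Num.sqrt (unorm (ustar d * d)).
  by move=> h; rewrite -[leRHS]sqr_sqrtr// ler_pXn2r// nnegrE ?sqrtr_ge0 ?unorm_ge0.
apply: unorm_le => [|b]; first exact: sqrtr_ge0.
apply: sqr_le; first by rewrite mulr_ge0 ?nm_ge0 ?sqrtr_ge0.
rewrite exprMn sqr_sqrtr//.
rewrite -bnC uact_star -uactM; apply: le_trans (bnM _ _) _; rewrite nm_bs expr2.
have := unorm_ub (ustar d * d) b; have := nm_ge0 b; nra.
Qed.
Fact unormM d e : unorm (d * e) <= unorm d * unorm e.
Proof.
apply: unorm_le => [|b]; first by rewrite mulr_ge0 ?unorm_ge0.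
rewrite uactM; apply: le_trans (unorm_ub _ _) _; rewrite -mulrA ler_wpM2l ?unorm_ge0//.
exact: unorm_ub.
Qed.
Fact unorm_ustar d : unorm (ustar d) = unorm d.
Proof.
have le e : unorm e <= unorm (ustar e).
  have := unorm_sqr e; have := unormM (ustar e) e; have := unorm_ge0 e; have := unorm_ge0 (ustar e).
  set x := unorm e; set y := unorm (ustar e) => y0 x0 h1 h2; rewrite leNgt; apply/negP => yx; nra.
by apply/eqP; rewrite eq_le le -{2}(ustarK d) le.
Qed.
Fact unrmC d : unrm (ustar d * d) = unrm d ^+ 2.
Proof.
have n2 : unorm (ustar d * d) = unorm d ^+ 2.
  have := unormM (ustar d) d; rewrite unorm_ustar -expr2 => h.
  by apply/eqP; rewrite eq_le h unorm_sqr.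
have n1 : nm (d.1^* * d.1 : R[i]) = nm (d.1 : R[i]) ^+ 2 by rewrite nmM nm_conj expr2.
by rewrite {1}/unrm n2 [nm _]n1 max_sqr ?nm_ge0 ?unorm_ge0.
Qed.
Fact unrm_complete (u : nat -> D) : cauchys (fun x y => unrm (x - y)) u ->
  exists l, cvgs (fun x y => unrm (x - y)) u l.
Proof.
move=> cu.
have [|l hl] := @cauchys_cvgs R B (fun n => (u n).2).
  move=> e e0; have e2 : 0 < e / 2 by lra.
  have [N hN] := cu _ e2; exists N => m n hm hn.
  have := hN m n hm hn; have := unrm_split (u m - u n); rewrite /dn /=; lra.
have [k hk] := complex_cauchy (z := fun n => (u n).1 : R[i]) (fun e e0 => match cu e e0 with ex_intro N hN => ex_intro _ N (fun m n hm hn => le_trans (unrm_fst (u m - u n)) (hN m n hm hn)) end).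
exists ((k, l) : D) => e e0; have e2 : 0 < e / 2 by lra.
have [N hN] := hl _ e2; have [N' hN'] := hk _ e2.
exists (maxn N N') => n; rewrite geq_max => /andP[/hN a /hN' b].
have -> : u n - (k, l) = ((u n).1 - k, 0) + (0, (u n).2 - l).
  by apply: unz_eq; rewrite /= ?addr0 ?add0r.
apply: le_trans (unrmD _ _) _; rewrite unrm_in; have := unorm1 ((u n).1 - k).
by rewrite /dn in a b; lra.
Qed.

Definition unitization : cstarAlg R :=
  @CStarAlg R D ustar unrm unrmD unrmZ unrm_eq0 unrmM ustarL ustarM ustarK unrmC unrm_complete.

End Unitization.

(** * States *)

Record starRep (R : realType) (D : cstarAlg R) (H : hilbertSpace R) (pi : D -> H -> H) : Prop := StarRep {
  sr_lin : forall a, linear (pi a);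
  sr_nm : forall a x, nm (pi a x) <= nrm a * nm x;
  sr_L : forall c a b x, pi (c *: a + b) x = c *: pi a x + pi b x;
  sr_M : forall a b x, pi (a * b) x = pi a (pi b x);
  sr_S : forall a x y, hip (pi (star a) x) y = hip x (pi a y);
  sr_1 : forall x, pi 1 x = x
}.

Lemma c_decomp (R : realType) (c : R[i]) : c = rc (re c) - 'i * rc (re ('i * c)).
Proof.
have ri (r : R) : re ('i * rc r) = 0 by rewrite mulrC reZ re_i mulr0.
apply: subr0_eq; set a := re c; set b := re _.
apply: re_eq0; first by rewrite !reB ri re_rc subr0 subrr.
have -> : 'i * (c - (rc a - 'i * rc b)) = 'i * c - 'i * rc a + ('i * 'i) * rc b by ring.
by rewrite mulii mulN1r reB reB ri re_rc subr0 subrr.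
Qed.

Section Functional.
Context {R : realType} {D : cstarAlg R}.
Variable f : D -> R.
Hypothesis lf : rlin f.
Hypothesis nf : forall x, f x <= nrm x.
Hypothesis f1 : f 1 = 1.

Lemma fn_D x y : f (x + y) = f x + f y. Proof. exact: lf.1. Qed.
Lemma fn_Z r x : f (rc r *: x) = r * f x. Proof. exact: lf.2. Qed.
Lemma fn_N x : f (- x) = - f x. Proof. exact: rlinN. Qed.
Lemma fn_B x y : f (x - y) = f x - f y. Proof. by rewrite fn_D fn_N. Qed.

(** For selfadjoint [t], the norm of [K + i t] is at most [sqrt (K^2 + nrm t ^+ 2)], while [f] has
    the value [K + f ('i *: t)] there. Large [K] excludes a positive [f ('i *: t)]. *)
Lemma fn_im s : star s = s -> f ('i *: s) = 0.
Proof.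
have le t : star t = t -> f ('i *: t) <= 0.
  move=> st; set y := f _; rewrite leNgt; apply/negP => y0.
  have h K : 0 <= K -> 2 * K * y <= nrm t ^+ 2.
    move=> K0; pose x : D := rc K *: 1 + 'i *: t.
    have fx : f x = K + y by rewrite fn_D fn_Z f1 mulr1.
    have := nf x; rewrite fx => h1.
    have h2 : nrm x ^+ 2 <= K ^+ 2 + nrm t ^+ 2.
      rewrite -nrmC.
      have -> : star x * x = rc (K ^+ 2) *: 1 + t * t.
        by rewrite /x starD !starZ star_one st rc_conj conj_i rcX; nc.
      apply: le_trans (nrmD _ _) _; rewrite nrm_rc1 ?sqr_ge0// lerD2l expr2; exact: nrmM.
    have : (K + y) ^+ 2 <= nrm x ^+ 2 by rewrite ler_pXn2r// nnegrE ?nrm_ge0//; lra.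
    by move=> h3; have := sqr_ge0 y; nra.
  (* At this [K] the left side [2 K y] is [nrm t ^+ 2 + 1]. *)
  have := h ((nrm t ^+ 2 + 1) / (2 * y)); have := sqr_ge0 (nrm t) => n0.
  have K0 : 0 <= (nrm t ^+ 2 + 1) / (2 * y) by rewrite divr_ge0//; lra.
  move=> /(_ K0); set K := _ / _ in K0 *.
  have -> : 2 * K * y = nrm t ^+ 2 + 1 by rewrite /K; field; rewrite gt_eqF.
  by lra.
move=> ss; apply/eqP; rewrite eq_le le//=.
have := le (- s); rewrite starN ss scalerN fn_N => /(_ erefl); lra.
Qed.

Lemma fn_star d : f (star d) = f d.
Proof.
have := @fn_im (- 'i *: (d - star d)).
rewrite starZ conjN conj_i opprK starB starK scalerA mulrN mulii opprK scale1r fn_B.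
have -> : 'i *: (star d - d) = - 'i *: (d - star d) by lmod.
by move=> /(_ erefl); lra.
Qed.

Lemma fn_pos h : pos h -> 0 <= f h.
Proof. by move=> [_ [M M0 hM]]; have := nf (rc M *: 1 - h); rewrite fn_B fn_Z f1; lra. Qed.

(** The complex-linear functional with real part [f]; it is a state. *)
Definition cfn d : R[i] := rc (f d) - 'i * rc (f ('i *: d)).

Lemma re_cfn d : re (cfn d) = f d.
Proof.
by rewrite /cfn reB re_rc mulrC reZ re_i mulr0 subr0.
Qed.
Lemma cfnD x y : cfn (x + y) = cfn x + cfn y.
Proof. by rewrite /cfn scalerDr !fn_D !rcD; ring. Qed.
Lemma cfnZ c x : cfn (c *: x) = c * cfn x.
Proof.
rewrite {1 2}(c_decomp c); set a := re c; set b := re _.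
have -> : (rc a - 'i * rc b) *: x = rc a *: x - rc b *: ('i *: x) by lmod.
rewrite /cfn; have -> : 'i *: (rc a *: x - rc b *: ('i *: x)) = rc a *: ('i *: x) + rc b *: x by lmod.
rewrite !fn_D !fn_N !fn_Z !rcD !rcN !rcM; have := mulii R; set i := 'i => ii.
set u := rc (f x); set v := rc (f _); set a' := rc a; set b' := rc b.
have -> : (a' - i * b') * (u - i * v) = a' * u - i * b' * u - i * a' * v + (i * i) * b' * v by ring.
by rewrite ii; ring.
Qed.
Lemma cfn_star d : cfn (star d) = (cfn d)^*.
Proof.
have -> : (cfn d)^* = rc (f d) + 'i * rc (f ('i *: d)).
  by rewrite /cfn conjB conjM !rc_conj conj_i; ring.
rewrite /cfn fn_star; have -> : 'i *: star d = star (- 'i *: d) by rewrite starZ conjN conj_i opprK.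
by rewrite fn_star scaleNr fn_N rcN; ring.
Qed.

Definition gnsIP : semiIP R.
Proof.
refine (@SemiIP R D (fun x y => cfn (star x * y)) _ _ _).
- by move=> x c y z; rewrite mulrDr -scalerAr cfnD cfnZ.
- by move=> x y; rewrite -cfn_star starM starK.
- by move=> x; rewrite re_cfn; apply/fn_pos/pos_star_mul.
Defined.

(** With [s^2 = nrm a ^+ 2 - a^* a], the functional is non-negative on [(s x)^* (s x)], the
    difference of the two squared sides. *)
Lemma gns_ipnM a (x : gnsIP) : ipn (a * x : gnsIP) <= nrm a * ipn x.
Proof.
apply: sqr_le; first by rewrite mulr_ge0 ?nrm_ge0 ?ipn_ge0.
have E (y : gnsIP) : ipn y ^+ 2 = f (star y * y) by rewrite ipn_sqr re_cfn.
rewrite exprMn !E.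
have sa : star (star a * a) = star a * a by rewrite starM starK.
have := @pos_nrm _ D (star a * a) (nrm a ^+ 2) sa; rewrite nrmC => /(_ (lexx _)) /sqrt_pos [s [ss sE _ _]].
have := fn_pos (pos_star_mul (s * x)).
have -> : star (s * x) * (s * x) = rc (nrm a ^+ 2) *: (star x * x) - star (a * x) * (a * x).
  rewrite !starM ss -mulrA (mulrA s) sE mulrBl -scalerAl mul1r mulrBr -scalerAr.
  by rewrite -!mulrA.
by rewrite fn_B fn_Z subr_ge0.
Qed.

Lemma gns_dense (u : completion gnsIP) (e : R) : 0 < e -> exists x : gnsIP, nm (u - (hj x : completion gnsIP)) <= e.
Proof.
move=> e0; have [x hx] := hcompP u e0; exists x; rewrite nm_hcomp.
by apply: hn_near hx; exact: ltW.
Qed.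

Lemma gns_hip (x y : gnsIP) : hip (hj x : completion gnsIP) (hj y) = cfn (star x * y).
Proof. exact: hdot_hjj. Qed.

Lemma gns_nm (x : gnsIP) : nm (hj x : completion gnsIP) = ipn x.
Proof.
have := @hipxx R (completion gnsIP) (hj x); rewrite gns_hip -[cfn _]/(ip x x) ip_ipn => /rc_inj.
by move=> h; apply/eqP; rewrite eq_le; apply/andP; split; apply: sqr_le; rewrite ?ipn_ge0 ?nm_ge0// h.
Qed.

Lemma dense_eq (T S : completion gnsIP -> completion gnsIP) : linear T -> bdd T -> linear S -> bdd S ->
  (forall x, T (hj x) = S (hj x)) -> forall u, T u = S u.
Proof.
move=> lT bT lS bS h u; have [M M0 hM] := bddP bT; have [N N0 hN] := bddP bS.
apply: subr0_eq; apply/nm_small => e e0.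
have MN : 0 < M + N by rewrite addr_gt0.
have [x hx] := gns_dense u (divr_gt0 e0 MN).
have -> : T u - S u = T (u - hj x) - S (u - hj x).
  by rewrite (linB lT) (linB lS) h; lmod.
apply: le_trans (nmB _ _) _; have := hM (u - hj x); have := hN (u - hj x).
move: hx; rewrite ler_pdivlMr//; lra.
Qed.

Lemma gns : exists (H : hilbertSpace R) (pi : D -> H -> H) (xi : H),
  [/\ starRep pi, forall d, hip xi (pi d xi) = cfn d &
      forall u (e : R), 0 < e -> exists d, nm (u - pi d xi) <= e].
Proof.
pose H := completion gnsIP.
have /choice [pi hpi] a : exists T : H -> H, [/\ linear T, forall x, nm (T x) <= nrm a * nm x &
    forall x : gnsIP, T (hj x) = hj (a * x : gnsIP)].
  pose G : set (H * H) := [set p | exists x : gnsIP, p = (hj x, hj (a * x : gnsIP))].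
  have G1 c p q : G p -> G q -> G (c *: p.1 + q.1, c *: p.2 + q.2).
    move=> [x ->] [y ->]; exists (c *: x + y); congr (_, _); rewrite /=.
      by rewrite (@hj_lin R gnsIP).
    by rewrite -(@hj_lin R gnsIP) mulrDr -scalerAr.
  have G2 p : G p -> nm p.2 <= nrm a * nm p.1.
    by move=> [x ->] /=; rewrite !gns_nm gns_ipnM.
  have G3 (x : H) e : 0 < e -> exists2 p, G p & nm (x - p.1) <= e.
    by move=> /(gns_dense x) [y hy]; exists (hj y : H, hj (a * y : gnsIP) : H) => //; exists y.
  have [T [lT nT hT]] := extension (nrm_ge0 a) G1 G2 G3.
  by exists T; split => // x; apply: (hT (hj x : H, hj (a * x : gnsIP) : H)); exists x.
have bpi a : bdd (pi a) by exists (nrm a); case: (hpi a).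
have lpi a : linear (pi a) by case: (hpi a).
have pj a (x : gnsIP) : pi a (hj x) = hj (a * x : gnsIP) by case: (hpi a).
have bC (T S : H -> H) : bdd T -> bdd S -> bdd (fun x => T (S x)).
  move=> /bddP[M M0 hM] /bddP[N N0 hN]; exists (M * N) => x.
  by apply: le_trans (hM _) _; rewrite -mulrA ler_pM2l.
have bLin c (T S : H -> H) : bdd T -> bdd S -> bdd (fun x => c *: T x + S x).
  move=> /bddP[M M0 hM] /bddP[N N0 hN]; exists (nm c * M + N) => x.
  apply: le_trans (nmD _ _) _; by rewrite nmZ mulrDl lerD// -mulrA ler_wpM2l ?nm_ge0.
have hjL (c : R[i]) (x y : gnsIP) : (hj (c *: x + y) : H) = c *: (hj x : H) + hj y := @hj_lin R gnsIP c x y.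
pose one : gnsIP := (1 : D).
exists H, pi, (hj one : H); split.
- split => //.
  + by move=> a; case: (hpi a).
  + move=> c a b x; apply: (@dense_eq (pi (c *: a + b)) (fun x => c *: pi a x + pi b x)) => //.
    * by move=> d y z; rewrite !lpi; lmod.
    * exact: bLin.
    * by move=> y; rewrite !pj -hjL mulrDl -scalerAl.
  + move=> a b x; apply: (@dense_eq (pi (a * b)) (fun x => pi a (pi b x))) => //.
    * by move=> d y z; rewrite !lpi.
    * exact: bC.
    * by move=> y; rewrite !pj mulrA.
  + move=> a x y.
    have [T [lT [M hM] hT]] := adjoint (lpi a) (bpi a).
    suff e u : pi (star a) u = T u by rewrite e hT.
    apply: dense_eq => //; first by exists M.
    move=> z; apply: hip_ext => v.
    apply: subr0_eq; apply/nm_eq0/eqP; rewrite eq_le nm_ge0 andbT.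
    set w := pi (star a) (hj z) - T (hj z).
    rewrite -hiprB -/w; apply: ler_eps => e e0; rewrite add0r.
    have k0 : 0 < nm w + 1 by have := nm_ge0 w; lra.
    have [t ht] := gns_dense v (divr_gt0 e0 k0).
    have -> : hip v w = hip (v - hj t) w.
      rewrite hiplB; suff -> : hip (hj t : H) w = 0 by rewrite subr0.
      rewrite /w hiprB (hip_conj (T _)) hT -hip_conj !pj !gns_hip starM mulrA subrr //.
    apply: le_trans (hip_cs _ _) _; move: ht; set d := e / _ => ht.
    have dE : d * (nm w + 1) = e by rewrite /d divfK// gt_eqF.
    by have := nm_ge0 w; have := nm_ge0 (v - (hj t : H)); nra.
  + move=> x; apply: (@dense_eq (pi 1) id) => //; first by exists 1 => y; rewrite mul1r.
    by move=> y; rewrite pj mul1r.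
- by move=> d; rewrite pj gns_hip star_one mul1r mulr1.
- by move=> u e e0; have [d hd] := gns_dense u e0; exists d; rewrite pj mulr1.
Qed.

End Functional.

(** * Pure states that vanish on an ideal, and their irreducible representations *)

Section Pure.
Context {R : realType} {D : cstarAlg R}.
Variable J : set D.
Hypothesis J0 : J 0.
Hypothesis JL : forall c x y, J x -> J y -> J (c *: x + y).
Hypothesis JM : forall x j y, J j -> J (x * j * y).
Hypothesis J1 : forall K j, 0 <= K -> J j -> K <= nrm (rc K *: 1 + j).

(** The infimum [Ps] is arranged so that a real-linear functional below it is the real part of a
    state vanishing on [J]: it is below [nrm], the element [K = 1] at [d = -1] forces the value 1 at
    1, and adding elements of [J] forces the value 0 on [J]. *)
Let vals d := [set nrm (rc p.1 *: 1 + d + p.2) - p.1 | p in [set p : R * D | 0 <= p.1 /\ J p.2]].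
Let Ps d : R := inf (vals d).

Let vals_lb d K j : 0 <= K -> J j -> - nrm d <= nrm (rc K *: 1 + d + j) - K.
Proof.
move=> K0 Jj; have := J1 K0 Jj.
have -> : rc K *: 1 + j = (rc K *: 1 + d + j) - d by lmod.
by have := nrmB (rc K *: 1 + d + j) d; lra.
Qed.
Let Ps_le d K j : 0 <= K -> J j -> Ps d <= nrm (rc K *: 1 + d + j) - K.
Proof.
move=> K0 Jj; apply: ge_inf; last by exists (K, j).
by exists (- nrm d) => _ [[K' j'] [/= ? ?] <-]; exact: vals_lb.
Qed.
Let Ps_ge d m : (forall K j, 0 <= K -> J j -> m <= nrm (rc K *: 1 + d + j) - K) -> m <= Ps d.
Proof.
move=> h; apply: lb_le_inf; first by exists (nrm (rc 0 *: 1 + d + 0) - 0); exists (0, 0).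
by move=> _ [[K' j'] [/= ? ?] <-]; exact: h.
Qed.
Let JD x y : J x -> J y -> J (x + y). Proof. by move=> a b; rewrite -(scale1r x); exact: JL. Qed.
Let JZ c x : J x -> J (c *: x). Proof. by move=> a; rewrite -(addr0 (c *: x)); exact: JL. Qed.

Let PsZ_le r x : 0 < r -> Ps (rc r *: x) <= r * Ps x.
Proof.
move=> r0; rewrite -ler_pdivrMl//; apply: Ps_ge => K j K0 Jj; rewrite ler_pdivrMl//.
apply: le_trans (Ps_le (rc r *: x) (mulr_ge0 (ltW r0) K0) (JZ (rc r) Jj)) _.
have -> : rc (r * K) *: 1 + rc r *: x + rc r *: j = rc r *: (rc K *: 1 + x + j).
  by rewrite rcM; lmod.
by rewrite nrmZr ?(ltW r0)// mulrBr.
Qed.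

Let Ps0 : Ps 0 = 0.
Proof.
apply/eqP; rewrite eq_le; apply/andP; split.
  by have := Ps_le 0 (lexx 0) J0; rewrite scale0r !addr0 nrm0 subr0.
by apply: Ps_ge => K j K0 Jj; rewrite addr0 subr_ge0 J1.
Qed.

Let Ps_sublin : sublin Ps.
Proof.
split=> [x y|r x].
  rewrite -lerBlDr; apply: Ps_ge => K j K0 Jj; rewrite lerBlDl -lerBlDr.
  apply: Ps_ge => K' j' K0' Jj'; rewrite lerBlDr.
  apply: le_trans (Ps_le (x + y) (addr_ge0 K0 K0') (JD Jj Jj')) _.
  have -> : rc (K + K') *: 1 + (x + y) + (j + j') = (rc K *: 1 + x + j) + (rc K' *: 1 + y + j').
    by rewrite rcD; lmod.
  by have := nrmD (rc K *: 1 + x + j) (rc K' *: 1 + y + j'); lra.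
rewrite le_eqVlt => /predU1P[<-|r0]; first by rewrite rc0 scale0r mul0r Ps0.
apply/eqP; rewrite eq_le PsZ_le//=.
have r1 : 0 < r^-1 by rewrite invr_gt0.
have := PsZ_le (rc r *: x) r1; rewrite scalerA -rcM mulVf ?gt_eqF// rc1 scale1r => h.
by rewrite -ler_pdivlMl.
Qed.

(** The state is an extremal functional below [Ps] with the maximal value at [a]. If [P] projects
    onto an invariant subspace and [t = nm (P xi) ^+ 2] lies strictly between 0 and 1, the state is
    a convex combination of the vector states of [P xi] and [xi - P xi]. Extremality makes the first
    of them equal to it, so [P xi = t xi] because [xi] is cyclic, and then [t = t^2]. *)
Lemma pure_rep (a : D) (r : R) :
  (forall K j, 0 <= K -> J j -> K + r <= nrm (rc K *: 1 + a + j)) ->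
  exists (H : hilbertSpace R) (pi : D -> H -> H) (xi : H),
  [/\ starRep pi, nm xi = 1, r <= re (hip xi (pi a xi)), forall j x, J j -> pi j x = 0 &
      forall K : set H, closed_subspace K -> (forall d x, K x -> K (pi d x)) -> K = [set 0] \/ K = setT].
Proof.
move=> har.
have [f [lf fP fa fext]] := extremal_linear a Ps_sublin.
have fnr x : f x <= nrm x.
  by apply: le_trans (fP x) _; have := Ps_le x (lexx 0) J0; rewrite scale0r add0r addr0 subr0.
have f1 : f 1 = 1.
  apply/eqP; rewrite eq_le; apply/andP; split; first by rewrite -[leRHS](@nrm1 R D).
  have := fP (- 1); have := Ps_le (- 1) ler01 J0.
  rewrite rc1 scale1r subrr addr0 nrm0 (rlinN _ lf); lra.
have fJ j : J j -> f j = 0.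
  have h x : J x -> f x <= 0.
    move=> Jx; apply: le_trans (fP x) _; have := Ps_le x (lexx 0) (JZ (-1) Jx).
    by rewrite scaleN1r scale0r add0r subrr nrm0 subr0.
  move=> Jj; apply/eqP; rewrite eq_le h//=.
  by have := h _ (JZ (-1) Jj); rewrite scaleN1r (rlinN _ lf); lra.
have [H [pi [xi [sr hxi dxi]]]] := gns lf fnr f1.
case: (sr) => pl pn pL pM pS p1.
have cJ j : J j -> cfn f j = 0.
  by move=> Jj; rewrite /cfn !fJ ?rc0 ?mulr0 ?subrr//; exact: JZ.
have xn : nm xi = 1.
  have := hxi 1; rewrite p1 hipxx => h.
  have : nm xi ^+ 2 = 1 by rewrite -[LHS]re_rc h re_cfn.
  by move=> h2; have := nm_ge0 xi; nra.
have pS' b x y : hip x (pi (star b) y) = hip (pi b x) y by rewrite hip_conj pS -hip_conj.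
have piJ j x : J j -> pi j x = 0.
  move=> Jj; apply: nm_small => e e0.
  have k0 : 0 < nrm j + 1 by have := nrm_ge0 j; lra.
  have [d hd] := dxi x _ (divr_gt0 e0 k0).
  have -> : pi j x = pi j (x - pi d xi) + pi j (pi d xi) by rewrite (linB (pl j)) subrK.
  have -> : pi j (pi d xi) = 0.
    apply: hip_eq0; rewrite -pS' -pS' -!pM hxi; apply: cJ; exact: JM.
  rewrite addr0; apply: le_trans (pn _ _) _; move: hd; set t := e / _ => hd.
  have dE : t * (nrm j + 1) = e by rewrite /t divfK// gt_eqF.
  by have := nrm_ge0 j; have := nm_ge0 (x - pi d xi); nra.
have pZ c x v : pi (c *: x) v = c *: pi x v.
  by have := pL c x 0 v; rewrite (piJ 0 v J0) !addr0.
exists H, pi, xi; split => //.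
  by rewrite hxi re_cfn fa; apply: Ps_ge => K j K0 Jj; have := har K j K0 Jj; lra.
move=> K cK Kpi; case: (cK) => /closed_eps Kc K0 KL.
have Vdef (x : hsIP H) : ip x x = 0 -> x = 0 by exact: hip_eq0.
have Vc (u : nat -> hsIP H) : cauchys (fun a b : hsIP H => ipn (a - b)) u ->
    exists l, cvgs (fun a b : hsIP H => ipn (a - b)) u l by exact: cauchys_hs.
have Kc' (y : hsIP H) : (forall e, 0 < e -> exists2 z, K z & ipn (y - z) <= e) -> K y.
  by move=> h; apply: Kc => e /h [z Kz hz]; exists z => //; rewrite -ipn_nm.
have [P [lP KP PK sP [cP oP uP]]] := @projector R (hsIP H) K Vdef Vc K0 KL Kc'.
have Ppi d x : P (pi d x) = pi d (P x).
  apply: uP; first exact/Kpi/KP.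
  by move=> z Kz; rewrite -(linB (pl d)) -[ip _ _]/(hip _ _) -pS; apply: oP; exact: Kpi.
have bP : bdd P by exists 1 => x; rewrite mul1r -!ipn_nm.
have ext (T : H -> H) : linear T -> bdd T -> (forall d x, T (pi d x) = pi d (T x)) -> T xi = 0 -> forall x, T x = 0.
  move=> lT /bddP[M M0 hM] cT Tx x; apply: nm_small => e e0.
  have [d hd] := dxi x _ (divr_gt0 e0 M0).
  have -> : T x = T (x - pi d xi) by rewrite (linB lT) cT Tx (lin0 (pl d)) subr0.
  by apply: le_trans (hM _) _; move: hd; rewrite ler_pdivlMr// mulrC.
pose t := nm (P xi) ^+ 2.
have PP x : P (P x) = P x by apply: PK.
have sP' x y : hip (P x) y = hip x (P y) := sP x y.
have t01 : nm (xi - P xi) ^+ 2 = 1 - t.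
  have := nm_sqrB xi (P xi); rewrite xn -/t => ->.
  by rewrite -{1}PP -sP' hipxx re_rc -/t; lra.
have [t0|t0] := eqVneq t 0.
  left; apply/seteqP; split => x /=; last by move=> ->.
  move=> Kx; rewrite -(PK _ Kx); apply: ext => //.
  by apply: nm_eq0; apply/eqP; rewrite -sqrf_eq0; apply/eqP.
have [t1|t1] := eqVneq t 1.
  right; apply/seteqP; split => x //= _.
  have : x - P x = 0.
    apply: (ext (fun x => x - P x)).
    - by move=> c y z; rewrite lP; lmod.
    - by exists 2 => y; have := nmB y (P y); have := cP y; rewrite !ipn_nm; lra.
    - by move=> d y; rewrite Ppi (linB (pl d)).
    - by apply: nm_eq0; apply/eqP; rewrite -sqrf_eq0 t01 t1 subrr.
  by move/eqP; rewrite subr_eq0 => /eqP ->.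
have tp : 0 < t by rewrite lt_neqAle eq_sym t0 sqr_ge0.
have tl : t < 1 by rewrite lt_neqAle t1 -subr_ge0 -t01 sqr_ge0.
pose g v d := (nm v ^+ 2)^-1 * re (hip v (pi d v)).
have gl v : rlin (g v).
  split=> [x y|c x]; rewrite /g.
    by rewrite -[x]scale1r pL hiprD hiprZ mul1r scale1r reD mulrDr.
  by rewrite pZ hiprZ reZ mulrCA.
have gP v : v <> 0 -> forall x, g v x <= Ps x.
  move=> v0 x; apply: Ps_ge => K' j K0' Jj.
  have vp : 0 < nm v ^+ 2 by rewrite exprn_gt0// nm_gt0.
  have := pn (rc K' *: 1 + x + j) v.
  have -> : pi (rc K' *: 1 + x + j) v = rc K' *: v + pi x v.
    rewrite -addrA pL p1; congr (_ + _); by rewrite -{1}[x]scale1r pL (piJ j)// addr0 scale1r.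
  move=> h; rewrite lerBrDl /g mulrC -lerBrDl ler_pdivrMr// .
  have := hip_cs v (rc K' *: v + pi x v); have := re_le_nm (hip v (rc K' *: v + pi x v)).
  rewrite hiprD hiprZ reD reZ hipxx re_rc; have := nm_ge0 v; nra.
have Pxi0 : P xi <> 0.
  by move=> h; move: t0; rewrite /t h nm0 expr0n eqxx.
have Qxi0 : xi - P xi <> 0.
  by move=> h; move: t01; rewrite h nm0 expr0n /=; move/eqP: t1 => t1 h1; apply: t1; lra.
have oo d : hip (P xi) (pi d (xi - P xi)) = 0 by rewrite sP' (linB (pl d)) (linB lP) !Ppi PP subrr hipr0.
have oo' d : hip (xi - P xi) (pi d (P xi)) = 0.
  by rewrite -Ppi -sP' (linB lP) PP subrr hipl0.
have dec d : hip xi (pi d xi) = hip (P xi) (pi d (P xi)) + hip (xi - P xi) (pi d (xi - P xi)).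
  have -> : hip xi (pi d xi) = hip (P xi + (xi - P xi)) (pi d (P xi + (xi - P xi))) by rewrite addrC subrK.
  rewrite (linD (pl d)) (hiplD (pi d (P xi) + pi d (xi - P xi)) (P xi)).
  by rewrite (hiprD (P xi)) (hiprD (xi - P xi)) oo oo' addr0 add0r.
have gf : g (P xi) = f.
  apply: (fext _ (g (xi - P xi)) t (gl _) (gl _) (gP _ Pxi0) (gP _ Qxi0)); first by rewrite tp tl.
  move=> x; rewrite /g t01 -/t !mulrA !divff ?mul1r; [|by rewrite subr_eq0 eq_sym|by []].
  by rewrite -reD -dec hxi re_cfn.
have gc d : hip (P xi) (pi d (P xi)) = rc t * cfn f d.
  have e x : re (hip (P xi) (pi x (P xi))) = t * f x.
    by rewrite -gf /g mulrA -/t divff// mul1r.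
  rewrite [LHS]c_decomp e; have := e ('i *: d).
  by rewrite pZ hiprZ => ->; rewrite /cfn !rcM; ring.
have o1 d : hip (pi d xi) (P xi - rc t *: xi) = 0.
  have e : hip (pi d xi) (P xi) = hip (P xi) (pi (star d) (P xi)).
    by rewrite pS' -Ppi sP' PP.
  by rewrite hiprB hiprZ e gc -pS' hxi subrr.
have Pt : P xi = rc t *: xi.
  apply: subr0_eq; apply/hip_eq0.
  set w := P xi - _ in o1 *.
  apply: nm_small => e e0.
  have k0 : 0 < nm w + 1 by have := nm_ge0 w; lra.
  have [d hd] := dxi w _ (divr_gt0 e0 k0).
  have -> : hip w w = hip (w - pi d xi) w by rewrite (hiplB w w (pi d xi)) o1 subr0.
  apply: le_trans (hip_cs _ _) _; move: hd; set q := e / _ => hd.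
  have dE : q * (nm w + 1) = e by rewrite /q divfK// gt_eqF.
  by have := nm_ge0 w; have := nm_ge0 (w - pi d xi); nra.
have : t = t ^+ 2.
  by rewrite {1}/t Pt nmZ xn mulr1 nm_rc ger0_norm// ltW.
move=> tt; exfalso; have : 0 < t * (1 - t) by rewrite mulr_gt0// subr_gt0.
by rewrite mulrBr mulr1 -expr2 -tt subrr ltxx.
Qed.

End Pure.

(** * The total space of a Fell bundle *)

Section Total.
Context {R : realType} {G : groupType} (A : fellBundle R G).
Implicit Types (g h k : G).
(** In the total space products of several fibres are associative on the nose, without casts along
    equations in [G]. [tagI] and [fibre] lead back to a single fibre. *)
Definition tot := {g : G & A g : Type}.
Implicit Types (u v w : tot).
Definition tg g (a : A g) : tot := Tagged (fib A) a.

Lemma tagI g (a b : A g) : tg a = tg b -> a = b.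
Proof. exact: (Eqdep_dec.inj_pair2_eq_dec G (fun x y => decP (x =P y)) (fun k => A k : Type)). Qed.
Lemma tag_fcast g h (e : g = h) (a : A g) : tg (fcast e a) = tg a.
Proof. by case: h / e. Qed.
Lemma fcastL g h (e : g = h) c (a b : A g) : fcast e (c *: a + b) = c *: fcast e a + fcast e b.
Proof. by case: h / e. Qed.
Lemma nm_fcast g h (e : g = h) (a : A g) : nm (fcast e a) = nm a.
Proof. by case: h / e. Qed.

Definition tmul u v : tot := tg (fmul (tagged u) (tagged v)).
Definition tstar u : tot := tg (fstar (tagged u)).
Definition nmt u : R := nm (tagged u).
Lemma tmulA u v w : tmul (tmul u v) w = tmul u (tmul v w). Proof. exact: fmulA. Qed.
Lemma tstarM u v : tstar (tmul u v) = tmul (tstar v) (tstar u). Proof. exact: fstarM. Qed.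
Lemma tstarK u : tstar (tstar u) = u.
Proof. by case: u => g a; exact: fstarK. Qed.
Lemma tag_tmul u v : tag (tmul u v) = (tag u * tag v)%g. Proof. by []. Qed.
Lemma tag_tstar u : tag (tstar u) = (tag u)^-1%g. Proof. by []. Qed.
Lemma nmt_mul u v : nmt (tmul u v) <= nmt u * nmt v.
Proof. by rewrite /nmt -rc_le rcM -!normE; exact: fnormM. Qed.
Lemma nmt_starmul u : nmt (tmul (tstar u) u) = nmt u ^+ 2.
Proof. by apply: rc_inj; rewrite rcX /nmt -!normE; exact: fnormC. Qed.
Lemma nmt_ge0 u : 0 <= nmt u. Proof. exact: nm_ge0. Qed.
Lemma nmt_star u : nmt (tstar u) = nmt u.
Proof.
have le y : nmt y <= nmt (tstar y).
  have := nmt_starmul y; have := nmt_mul (tstar y) y; have := nmt_ge0 y.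
  have := nmt_ge0 (tstar y); rewrite expr2.
  case: (ltrP 0 (nmt y)) => [h h1 h2 h3 h4|]; last by lra.
  by rewrite -(ler_pM2r h); rewrite -h4.
by apply/eqP; rewrite eq_le le -{2}(tstarK u) le.
Qed.

Lemma tag_eta u g : tag u = g -> exists a : A g, u = tg a.
Proof. by case: u => h a /= <-; exists a. Qed.

Definition fibre k u : A k :=
  if tag u =P k is ReflectT e then fcast e (tagged u) else 0.
Lemma fibreT k (a : A k) : fibre k (tg a) = a.
Proof.
rewrite /fibre; case: eqP => // e; apply: tagI; exact: tag_fcast.
Qed.
Lemma fibreK k u : tag u = k -> tg (fibre k u) = u.
Proof. by move=> /tag_eta [a ->]; rewrite fibreT. Qed.
Lemma fibre0 k u : tag u <> k -> fibre k u = 0.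
Proof. by rewrite /fibre; case: eqP. Qed.
Lemma nm_fibre k u : nm (fibre k u) <= nmt u.
Proof.
have [e|ne] := pselect (tag u = k); first by case: (tag_eta e) => a ->; rewrite fibreT.
by rewrite fibre0// nm0 nmt_ge0.
Qed.

Local Notation T := tg.

Lemma T_mul1 (a b : A 1%g) : T (mul1 a b) = tmul (T a) (T b). Proof. exact: tag_fcast. Qed.
Lemma T_star1 (a : A 1%g) : T (star1 a) = tstar (T a). Proof. exact: tag_fcast. Qed.
Lemma T_lact g (a : A 1%g) (x : A g) : T (lact a x) = tmul (T a) (T x). Proof. exact: tag_fcast. Qed.
Lemma T_rip g (x y : A g) : T (rip x y) = tmul (tstar (T x)) (T y). Proof. exact: tag_fcast. Qed.

Lemma fmulLl g h (c : R[i]) (a b : A g) (x : A h) : fmul (c *: a + b) x = c *: fmul a x + fmul b x.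
Proof. exact: fmul_linearl. Qed.
Lemma fmulLr g h (c : R[i]) (a b : A g) (x : A h) : fmul x (c *: a + b) = c *: fmul x a + fmul x b.
Proof. exact: fmul_linearr. Qed.
Lemma fmul0l g h (x : A h) : fmul (0 : A g) x = 0.
Proof. by have := fmulLl (-1) (0 : A g) 0 x; rewrite scaler0 addr0 scaleN1r addNr. Qed.
Lemma fmul0r g h (x : A h) : fmul x (0 : A g) = 0.
Proof. by have := fmulLr (-1) (0 : A g) 0 x; rewrite scaler0 addr0 scaleN1r addNr. Qed.
Lemma fcast0 g h (e : g = h) : fcast e (0 : A g) = 0.
Proof. by case: h / e. Qed.

Definition fib1 : nucstar R.
Proof.
refine (@NuCStar R (A 1%g) (@mul1 R G A) (@star1 R G A) _ _ _ _ _ _ _ _).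
- by move=> c a a' b; rewrite /mul1 fmulLl fcastL.
- by move=> c a b b'; rewrite /mul1 fmulLr fcastL.
- by move=> a b c; apply: tagI; rewrite !T_mul1 tmulA.
- by move=> c a b; rewrite /star1 fstar_conj_linear fcastL.
- by move=> a b; apply: tagI; rewrite !T_mul1 !T_star1 T_mul1 tstarM.
- by move=> a; apply: tagI; rewrite !T_star1 tstarK.
- by move=> a b; rewrite /mul1 nm_fcast; exact: (nmt_mul (T a) (T b)).
- move=> a; rewrite -[nm (mul1 _ _)]/(nmt (T (mul1 _ _))) T_mul1 T_star1; exact: nmt_starmul.
Defined.

Lemma ripL g c (x y z : A g) : rip x (c *: y + z) = c *: rip x y + rip x z.
Proof. by rewrite /rip fmulLr fcastL. Qed.
Lemma rip_star g (x y : A g) : star1 (rip x y) = rip y x.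
Proof. by apply: tagI; rewrite T_star1 !T_rip tstarM tstarK. Qed.
Lemma rip_lact g a (x y : A g) : rip (lact a x) y = rip x (lact (star1 a) y).
Proof. by apply: tagI; rewrite !T_rip !T_lact T_star1 tstarM tmulA. Qed.
Lemma nm_rip g (x : A g) : nm (rip x x) = nm x ^+ 2.
Proof. by rewrite -[nm _]/(nmt (T _)) T_rip nmt_starmul. Qed.
Lemma lactL g (a : A 1%g) c (x y : A g) : lact a (c *: x + y) = c *: lact a x + lact a y.
Proof. by rewrite /lact fmulLr fcastL. Qed.

(** * The unitization of the unit fibre *)

Definition uni : cstarAlg R := unitization fib1.
Definition uin (a : A 1%g) : uni := (0, a).
Definition posA (a : A 1%g) : Prop := pos (uin a).

Lemma injL c a b : uin (c *: a + b) = c *: uin a + uin b.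
Proof. by apply: unz_eq; rewrite //= [_ *: _]mulr0 addr0. Qed.
Lemma injM (a b : A 1%g) : uin (mul1 a b) = uin a * uin b.
Proof. by apply: unz_eq; rewrite /= ?mulr0// !scale0r !add0r. Qed.
Lemma inj_star (a : A 1%g) : uin (star1 a) = star (uin a).
Proof. by apply: unz_eq; rewrite //= conj0. Qed.
Lemma nrm_inj a : nrm (uin a) = nm a. Proof. exact: unrm_in. Qed.
Lemma inj_closed : alg_closed (range uin).
Proof.
split.
- by move=> c _ _ [a _ <-] [b _ <-]; exists (c *: a + b) => //; rewrite injL.
- by move=> _ _ [a _ <-] [b _ <-]; exists (mul1 a b) => //; rewrite injM.
- move=> u l hu hl; exists l.2 => //; apply: unz_eq => //=.
  apply/esym/nm_eq0/eqP; rewrite eq_le nm_ge0 andbT; apply: ler_eps => e e0; rewrite add0r.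
  have [N /(_ N (leqnn _)) hN] := hl e e0; have [a _ ua] := hu N.
  apply: le_trans hN; have := unrm_fst (u N - l); rewrite -ua /= sub0r nmN; exact.
Qed.
Lemma inj_mul (d : uni) a : exists b, uin a * d = uin b.
Proof. by exists (uin a * d).2; apply: unz_eq; rewrite //= mul0r. Qed.
Lemma uniE (d : uni) : d = d.1 *: 1 + uin d.2.
Proof. by apply: unz_eq; rewrite /= ?addr0 ?scaler0 ?add0r// [_ *: _]mulr1. Qed.

Lemma posA_rip g (x : A g) : posA (rip x x).
Proof.
have [b hb] := fpos x; rewrite /posA.
have -> : rip x x = mul1 (star1 b) b by apply: tagI; rewrite T_rip T_mul1 T_star1; exact: hb.
by rewrite injM inj_star; exact: pos_star_mul.
Qed.

End Total.

(** * Irreducible representations of the unit fibre *)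

Section Irreps.
Context {R : realType} {G : groupType} (A : fellBundle R G).
Implicit Types (p : irrep A) (a b : A 1%g).

(** The bound of a representation is a complex number. The order of [R[i]] makes it real and
    non-negative as soon as [y] is nonzero. *)
Lemma nm_le_norm (V W : normedZmodType R[i]) (x : V) (y : W) (M : R[i]) : `|x| <= M * `|y| -> nm x <= nm M * nm y.
Proof.
move=> h; rewrite -rc_le rcM -!normE (le_trans h)//.
have [->|y0] := pselect (y = 0); first by rewrite normr0 !mulr0.
have yp : 0 < `|y| by rewrite normr_gt0; apply/eqP.
rewrite ler_pM2r//; apply: real_ler_norm.
have M0 : 0 <= M by rewrite -(pmulr_lge0 _ yp) (le_trans _ h).
exact: ger0_real.
Qed.

Lemma irr_lin p a : linear (p a). Proof. exact: (rep_linear (irrep_rep p)). Qed.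
Lemma irr_bdd p a : bdd (p a).
Proof.
have [M hM] := rep_bounded (irrep_rep p) (a := a) Logic.I.
by exists (nm M) => x; apply: nm_le_norm.
Qed.
Lemma irr_L p c a b x : p (c *: a + b) x = c *: p a x + p b x.
Proof. exact: (rep_lin (irrep_rep p)). Qed.
Lemma irr_M p a b x : p (mul1 a b) x = p a (p b x).
Proof. exact: (rep_mul (irrep_rep p)). Qed.
Lemma irr_S p a x y : hip (p (star1 a) x) y = hip x (p a y).
Proof. exact: (rep_star (irrep_rep p)). Qed.
Lemma irr_S' p a x y : hip x (p (star1 a) y) = hip (p a x) y.
Proof. by rewrite hip_conj irr_S -hip_conj. Qed.
Lemma irr_n p : exists a x, p a x <> 0.
Proof. by have [[a _ [x hx]] _] := irrep_irr p; exists a, x. Qed.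
Lemma irr_i p (K : set (irrep_space p)) : closed_subspace K ->
  (forall a x, K x -> K (p a x)) -> K = [set 0] \/ K = setT.
Proof. by move=> cK h; apply: (irrep_irr p).2 => // a x _; exact: h. Qed.
Lemma irr_0 p x : p 0 x = 0.
Proof. by have := @irr_L p (-1) 0 0 x; rewrite scaler0 addr0 scaleN1r addNr. Qed.
Lemma irr_Z p c a x : p (c *: a) x = c *: p a x.
Proof. by have := @irr_L p c a 0 x; rewrite irr_0 !addr0. Qed.
Lemma irr_D p a b x : p (a + b) x = p a x + p b x.
Proof. by have := @irr_L p 1 a b x; rewrite !scale1r. Qed.
Lemma irr_B p a b x : p (a - b) x = p a x - p b x.
Proof. by rewrite irr_D -scaleN1r irr_Z scaleN1r. Qed.
Lemma irr_sum p I (s : seq I) (F : I -> A 1%g) x : p (\sum_(i <- s) F i) x = \sum_(i <- s) p (F i) x.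
Proof. by elim: s => [|i s IHs]; rewrite ?big_nil ?irr_0// !big_cons irr_D IHs. Qed.
Lemma irr_nondeg p x : (forall a, p a x = 0) -> x = 0.
Proof. apply: (@rep_nondeg R (irrep_space p) (A 1%g) p); [exact: irr_lin|exact: irr_bdd|exact: irr_n|exact: irr_i]. Qed.
Lemma irr_density p (v et : irrep_space p) (e : R) : hip v et = 0 -> 0 < e ->
  exists b, nm (p b et - et) <= e /\ nm (p (star1 b) v) <= e.
Proof.
apply: (@rep_density R (irrep_space p) (A 1%g) p (@star1 R G A) (@mul1 R G A));
  [exact: irr_lin|exact: irr_bdd|exact: irr_L|exact: irr_M|exact: irr_S|exact: irr_n|exact: irr_i].
Qed.
Lemma irr_dense p (x y : irrep_space p) (e : R) : y <> 0 -> 0 < e -> exists b, nm (x - p b y) <= e.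
Proof.
apply: (@rep_dense R (irrep_space p) (A 1%g) p (@mul1 R G A));
  [exact: irr_lin|exact: irr_bdd|exact: irr_L|exact: irr_M|exact: irr_n|exact: irr_i].
Qed.
Lemma irr_schur p (T T' : irrep_space p -> irrep_space p) : linear T -> bdd T -> linear T' -> bdd T' ->
  (forall x y, hip (T' x) y = hip x (T y)) ->
  (forall a x, T (p a x) = p a (T x)) -> exists c : R[i], forall x, T x = c *: x.
Proof. apply: (@rep_schur R (irrep_space p) (A 1%g) p (@star1 R G A));
  [exact: irr_lin|exact: irr_bdd|exact: irr_S|exact: irr_i]. Qed.

Definition pu p (d : uni A) (x : irrep_space p) : irrep_space p := d.1 *: x + p d.2 x.
Lemma pu_inj p a x : pu (uin a) x = p a x.
Proof. by rewrite /pu scale0r add0r. Qed.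
Lemma pu_1 p (x : irrep_space p) : pu 1 x = x.
Proof. by rewrite /pu scale1r irr_0 addr0. Qed.
Lemma pu_lin p d : linear (@pu p d).
Proof. by move=> c x y; rewrite /pu irr_lin; lmod. Qed.
Lemma pu_L_aux (V : lmodType R[i]) (c a b : R[i]) (x y z : V) :
  (c * a + b) *: x + (c *: y + z) = c *: (a *: x + y) + (b *: x + z).
Proof. by lmod. Qed.
Lemma pu_L p c (d e : uni A) (x : irrep_space p) : pu (c *: d + e) x = c *: pu d x + pu e x.
Proof. by rewrite /pu irr_L; exact: pu_L_aux. Qed.
Lemma pu_M_aux (V : lmodType R[i]) (a b : R[i]) (x y z w : V) :
  (a * b) *: x + (a *: y + (b *: z + w)) = a *: (b *: x + y) + (b *: z + w).
Proof. by lmod. Qed.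
Lemma pu_M p (d e : uni A) (x : irrep_space p) : pu (d * e) x = pu d (pu e x).
Proof.
rewrite /pu (linD (irr_lin _)) (linZ (irr_lin _)) -irr_M /= -addrA irr_D irr_Z irr_D irr_Z; exact: pu_M_aux.
Qed.
Lemma pu_S p (d : uni A) (x y : irrep_space p) : hip (pu (star d) x) y = hip x (pu d y).
Proof. by rewrite /pu /= hiplD hiprD hiplZ hiprZ conjK irr_S. Qed.
Lemma pu_S' p (d : uni A) (x y : irrep_space p) : hip x (pu (star d) y) = hip (pu d x) y.
Proof. by rewrite hip_conj pu_S -hip_conj. Qed.
Lemma pu_B p (d e : uni A) (x : irrep_space p) : pu (d - e) x = pu d x - pu e x.
Proof. by have := pu_L (-1) e d x; rewrite !scaleN1r addrC => ->; rewrite addrC. Qed.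
Lemma pu_D p (d e : uni A) (x : irrep_space p) : pu (d + e) x = pu d x + pu e x.
Proof. by have := pu_L 1 d e x; rewrite !scale1r. Qed.
Lemma pu_Z p c (d : uni A) (x : irrep_space p) : pu (c *: d) x = c *: pu d x.
Proof. by have := pu_L c d 0 x; rewrite /(pu 0) irr_0 scale0r !addr0. Qed.

(** For [nrm b <= 1] let [z = 1 - sqrt (1 - b^* b)]. Then [|b x|^2 = |x|^2 - |x - z x|^2]. *)
Lemma pu_contr p (d : uni A) (x : irrep_space p) : nm (pu d x) <= nrm d * nm x.
Proof.
have [d0|d0] := eqVneq (nrm d) 0.
  by rewrite (nrm_eq0 d0) /pu irr_0 scale0r addr0 !nm0 nrm0 mul0r.
have dp : 0 < nrm d by rewrite lt_neqAle eq_sym d0 nrm_ge0.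
pose b := rc (nrm d)^-1 *: d.
suff h : nm (pu b x) <= nm x.
  move: h; rewrite /b pu_Z nmZ nm_rc ger0_norm ?invr_ge0 ?nrm_ge0//.
  by rewrite mulrC ler_pdivrMr// mulrC.
have nb : nrm b <= 1 by rewrite nrmZr ?invr_ge0 ?nrm_ge0// mulVf.
have ny : nrm (star b * b) <= 1.
  rewrite nrmC; have := nrm_ge0 b; nra.
have [z [zE _ sz _]] := sqrt_one ny.
have {}sz : star z = z by apply: sz; rewrite starM starK.
have e2 : nm (pu b x) ^+ 2 = nm x ^+ 2 - nm (x - pu z x) ^+ 2.
  rewrite nm_sqrB !nm_sqr_hip -!pu_S' -!pu_M sz.
  have -> : star b * b = z + z - z * z by rewrite zE addrK.
  by rewrite pu_B pu_D hiprB hiprD reB reD; lra.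
by apply: sqr_le; [exact: nm_ge0|rewrite e2; have := sqr_ge0 (nm (x - pu z x)); lra].
Qed.
Lemma irr_contr p a x : nm (p a x) <= nm a * nm x.
Proof. by rewrite -pu_inj -nrm_inj pu_contr. Qed.
Lemma pu_pos p (d : uni A) (x : irrep_space p) : pos d -> 0 <= re (hip x (pu d x)).
Proof.
move=> /sqrt_pos [s [ss <- _ _]].
by rewrite pu_M -{1}ss pu_S' hipxx re_rc sqr_ge0.
Qed.

(** [J] is only an algebraic ideal: what keeps states that vanish on [J] from being trivial is the
    norm hypothesis, and the scalar part of the norm of the unitization gives the lower bound
    [K]. *)
Lemma exists_irrep (J : set (A 1%g)) a (r : R) : J 0 ->
  (forall c x y, J x -> J y -> J (c *: x + y)) ->
  (forall b x, J x -> J (mul1 b x)) -> (forall b x, J x -> J (mul1 x b)) -> 0 < r ->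
  (forall K j, 0 <= K -> J j -> K + r <= nrm (rc K *: 1 + uin a + uin j)) ->
  exists p (xi : irrep_space p), [/\ nm xi = 1, r <= re (hip xi (p a xi)) & forall j x, J j -> p j x = 0].
Proof.
move=> J0 JL Jl Jr r0 hr.
pose J' : set (uni A) := [set d | exists2 j, J j & d = uin j].
have J'0 : J' 0 by exists 0.
have J'L c x y : J' x -> J' y -> J' (c *: x + y).
  by move=> [i Ji ->] [j Jj ->]; exists (c *: i + j); [exact: JL|rewrite injL].
have J'M x j y : J' j -> J' (x * j * y).
  move=> [i Ji ->].
  have [k Jk ->] : exists2 k, J k & x * uin i = uin k.
    exists (x.1 *: i + mul1 x.2 i); first by apply: JL => //; exact: Jl.
    by rewrite {1}(uniE x) mulrDl -injM injL -scalerAl mul1r.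
  exists (y.1 *: k + mul1 k y.2); first by apply: JL => //; exact: Jr.
  by rewrite {1}(uniE y) mulrDr -injM injL -scalerAr mulr1.
have J'1 K j : 0 <= K -> J' j -> K <= nrm (rc K *: 1 + j).
  move=> K0 [i Ji ->]; have := unrm_fst (rc K *: 1 + uin i); apply: le_trans.
  rewrite /= addr0 [_ *: _]mulr1 nm_rc; exact: ler_norm.
have har K j : 0 <= K -> J' j -> K + r <= nrm (rc K *: 1 + uin a + j) by move=> K0 [i Ji ->]; exact: hr.
have [H [pi [xi [sr xn hxi piJ irr]]]] := pure_rep J'0 J'L J'M J'1 har.
case: (sr) => pl pn pL pM pS p1.
have rp : @representation R G A setT H (fun b => pi (uin b)).
  split.
  - by move=> b _; exact: pl.
  - move=> b _; exists (rc (nm b)) => x; rewrite !normE -rcM rc_le -nrm_inj; exact: pn.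
  - by move=> c b b' x _ _; rewrite injL pL.
  - by move=> b b' x _ _; rewrite injM pM.
  - by move=> b x y _; rewrite inj_star pS.
have ir : @irreducible R G A setT H (fun b => pi (uin b)).
  split.
    exists a => //; exists xi => h; move: hxi; rewrite h hipr0 re0; lra.
  move=> K cK hK; apply: irr => // d x Kx; rewrite (uniE d) pL p1.
  by case: cK => _ _; apply => //; exact: hK.
exists (Irrep rp ir), xi; split => //= j x Jj; apply: piJ; by exists j.
Qed.

Lemma norm_attained (a : A 1%g) : posA a -> 0 < nm a ->
  exists p (xi : irrep_space p), nm xi = 1 /\ nm a <= re (hip xi (p a xi)).
Proof.
move=> pa a0.
have [||||||p [xi [xn h _]]] := @exists_irrep [set 0] a (nm a).
- by [].
- by move=> c x y /= -> ->; rewrite scaler0 addr0.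
- by move=> b x /= ->; exact: (@bm0r R (fib1 A)).
- by move=> b x /= ->; exact: (@bm0l R (fib1 A)).
- by [].
- move=> K j K0 jE; rewrite jE -[uin 0]/(0 : uni A) addr0.
  set n := nrm _.
  have sK : star (rc K *: 1 + uin a) = rc K *: 1 + uin a.
    by rewrite starD starZr star_one (pos_sa pa).
  have h1 : pos (rc n *: 1 - (rc K *: 1 + uin a)) by apply: pos_nrm.
  have nK : K <= n.
    by rewrite -[leLHS](@nrm_rc1 R (uni A) K)//; apply: pos_mono; [exact: pos_rc|rewrite addrC addKr].
  have h2 : pos (rc (n - K) *: 1 - uin a).
    by have -> : rc (n - K) *: 1 - uin a = rc n *: 1 - (rc K *: 1 + uin a) by rewrite rcB; lmod.
  by have := pos_le (_ : 0 <= n - K) pa h2; rewrite nrm_inj subr_ge0 => /(_ nK); lra.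
by exists p, xi.
Qed.

End Irreps.

(** * Representations of the fibres over a cyclic group *)

Section Total.
Context {R : realType} {H : hilbertSpace R}.

Lemma total_all (K : set H) : closed_subspace K ->
  (forall y, (forall v, K v -> hip v y = 0) -> y = 0) -> forall x, K x.
Proof.
move=> cK h x; have [y Ky hy] := hproj cK x.
by have := h (x - y) hy; move/eqP; rewrite subr_eq0 => /eqP ->.
Qed.

Lemma total_eq (S : set H) (T T' : H -> H) : linear T -> bdd T -> linear T' -> bdd T' ->
  (forall y, (forall v, S v -> hip v y = 0) -> y = 0) -> (forall v, S v -> T v = T' v) ->
  forall x, T x = T' x.
Proof.
move=> lT bT lT' bT' hS h x.
have lD : linear (fun x => T x - T' x) by move=> c y z; rewrite lT lT'; lmod.
have bD : bdd (fun x => T x - T' x).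
  have [M _ hM] := bddP bT; have [N _ hN] := bddP bT'; exists (M + N) => y.
  by have := nmB (T y) (T' y); have := hM y; have := hN y; lra.
apply: subr0_eq.
apply: (total_all (ker_closed lD bD)) => y hy; apply: hS => v Sv; apply: hy.
by rewrite /= h// subrr.
Qed.

Lemma total_dense (K : set H) : K 0 -> (forall c y z, K y -> K z -> K (c *: y + z)) ->
  (forall y, (forall v, K v -> hip v y = 0) -> y = 0) ->
  forall x e, 0 < e -> exists2 z, K z & nm (x - z) <= e.
Proof.
move=> K0 KL h x; have := @total_all (cl K) (cl_closed K0 KL) _ x; apply.
move=> y hy; apply: h => v Kv; apply: hy => e e0; exists v => //.
by rewrite subrr nm0 ltW.
Qed.

End Total.

Lemma big_eq_In (V : nmodType) (I : Type) (s : seq I) (F F' : I -> V) :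
  (forall i, List.In i s -> F i = F' i) -> \sum_(i <- s) F i = \sum_(i <- s) F' i.
Proof.
elim: s => [|i s IHs] h; first by rewrite !big_nil.
by rewrite !big_cons h ?IHs//; [move=> j hj; apply: h; right|left].
Qed.

(** * Unitaries from [A_k (x) H] to [H] and their products *)

Section Cocycle.
Context {R : realType} {G : groupType} {A : fellBundle R G} (p : irrep A).
Local Notation H := (irrep_space p).
Implicit Types (u v w z : tot A) (x y : H).

Definition pE w : H -> H := p (fibre 1%g w).

Lemma pE_lin w : linear (pE w). Proof. exact: irr_lin. Qed.
Lemma pE_le w x : nm (pE w x) <= nmt w * nm x.
Proof. by apply: le_trans (irr_contr _ _) _; rewrite ler_wpM2r ?nm_ge0 ?nm_fibre. Qed.
Lemma pE_bdd w : bdd (pE w). Proof. by exists (nmt w); exact: pE_le. Qed.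
Lemma pE_mul u v x : tag u = 1%g -> tag v = 1%g -> pE (tmul u v) x = pE u (pE v x).
Proof.
move=> /tag_eta [a ->] /tag_eta [b ->].
by rewrite /pE -T_mul1 !fibreT irr_M.
Qed.
Lemma pE_star u x y : tag u = 1%g -> hip (pE (tstar u) x) y = hip x (pE u y).
Proof. by move=> /tag_eta [a ->]; rewrite /pE -T_star1 !fibreT irr_S. Qed.
Lemma pE_T (a : A 1%g) x : pE (tg a) x = p a x. Proof. by rewrite /pE fibreT. Qed.

(** A unitary from the tensor product of [A_k] and [H] over [p] onto [H], sending [u (x) x] to
    [T u x], with [T' u] the adjoint of [T u]. Values outside the fibre over [k] are arbitrary. The
    clauses are symmetric in [T] and [T'], so that the inverse over [k^-1] is of the same kind. *)
Record coc (k : G) (T T' : tot A -> H -> H) : Prop := Coc {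
  coc_lin : forall u, tag u = k -> linear (T u);
  coc_add : forall c (a b : A k) x, T (tg (c *: a + b)) x = c *: T (tg a) x + T (tg b) x;
  coc_adj : forall u x y, tag u = k -> hip (T u x) y = hip x (T' u y);
  coc_s : forall u v x y, tag u = k -> tag v = k ->
    hip (T u x) (T v y) = hip x (pE (tmul (tstar u) v) y);
  coc_r : forall u v x, tag u = k -> tag v = k -> T u (T' v x) = pE (tmul u (tstar v)) x;
  coc_n : forall x, (forall u, tag u = k -> T u x = 0) -> x = 0;
  coc_n' : forall x, (forall u, tag u = k -> T' u x = 0) -> x = 0
}.

Section CocTheory.
Variables (k : G) (T T' : tot A -> H -> H).
Hypothesis cT : coc k T T'.

Lemma coc_adj' u x y : tag u = k -> hip (T' u x) y = hip x (T u y).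
Proof. by move=> e; rewrite hip_conj -(coc_adj cT)// -hip_conj. Qed.
Lemma coc_lin' u : tag u = k -> linear (T' u).
Proof.
move=> e c x y; apply: hip_ext => z; rewrite hiprD hiprZ -!(coc_adj cT)//.
by rewrite hiprD hiprZ.
Qed.
Lemma coc_le u x : tag u = k -> nm (T u x) <= nmt u * nm x.
Proof.
move=> e; apply: sqr_le; first by rewrite mulr_ge0 ?nm_ge0.
rewrite nm_sqr_hip (coc_s cT)//; apply: le_trans (re_le_nm _) _; apply: le_trans (hip_cs _ _) _.
have := pE_le (tmul (tstar u) u) x; rewrite nmt_starmul; have := nm_ge0 x; nra.
Qed.
Lemma coc_le' u x : tag u = k -> nm (T' u x) <= nmt u * nm x.
Proof.
move=> e; apply: nm_le_hip => [|z]; first by rewrite mulr_ge0 ?nm_ge0.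
rewrite -(coc_adj cT)//; apply: le_trans (hip_cs _ _) _.
have := coc_le z e; have := nm_ge0 x; have := nm_ge0 z; nra.
Qed.
Lemma coc_bdd u : tag u = k -> bdd (T u).
Proof. by move=> e; exists (nmt u) => x; exact: coc_le. Qed.
Lemma coc_bdd' u : tag u = k -> bdd (T' u).
Proof. by move=> e; exists (nmt u) => x; exact: coc_le'. Qed.

(** Both sides have the same inner products with all vectors [T v y], and these are total by
    [coc_n']. *)
Lemma coc_a u a x : tag u = k -> tag a = 1%g -> T (tmul u a) x = T u (pE a x).
Proof.
move=> e ea; have eu : tag (tmul u a) = k by rewrite tag_tmul e ea mulg1.
apply: subr0_eq; apply/(coc_n' cT) => v ev; apply: hip_ext => y.
rewrite -(coc_adj cT)// hipr0 hiprB !(coc_s cT)// -pE_mul ?tag_tmul ?tag_tstar ?e ?ev ?mulVg//.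
by rewrite tmulA subrr.
Qed.
Lemma coc_total' (U V : H -> H) : linear U -> bdd U -> linear V -> bdd V ->
  (forall u x, tag u = k -> U (T' u x) = V (T' u x)) -> forall x, U x = V x.
Proof.
move=> lU bU lV bV h; apply: (@total_eq R H [set v | exists2 u, tag u = k & exists x, v = T' u x]) => //.
  move=> y hy; apply: (coc_n cT) => u e; apply: hip_ext => x; rewrite hipr0 -coc_adj'//.
  by apply: hy; exists u => //; exists x.
by move=> _ [u e [x ->]]; exact: h.
Qed.
Lemma coc_total (U V : H -> H) : linear U -> bdd U -> linear V -> bdd V ->
  (forall u x, tag u = k -> U (T u x) = V (T u x)) -> forall x, U x = V x.
Proof.
move=> lU bU lV bV h; apply: (@total_eq R H [set v | exists2 u, tag u = k & exists x, v = T u x]) => //.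
  move=> y hy; apply: (coc_n' cT) => u e; apply: hip_ext => x; rewrite hipr0 -(coc_adj cT)//.
  by apply: hy; exists u => //; exists x.
by move=> _ [u e [x ->]]; exact: h.
Qed.
Lemma coc_b u a x : tag u = k -> tag a = 1%g -> pE a (T u x) = T (tmul a u) x.
Proof.
move=> e ea; have eu : tag (tmul a u) = k by rewrite tag_tmul e ea mul1g.
apply: (coc_total' (U := fun x => pE a (T u x))).
- by move=> c y z; rewrite (coc_lin cT e) pE_lin.
- by exists (nmt a * nmt u) => y; apply: le_trans (pE_le _ _) _; rewrite -mulrA ler_wpM2l ?nmt_ge0 ?coc_le.
- exact: (coc_lin cT).
- exact: coc_bdd.
- move=> v y ev; rewrite !(coc_r cT)// -pE_mul ?tmulA// tag_tmul tag_tstar e ev mulgV //.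
Qed.
Lemma coc_inv : coc k^-1%g (fun u => T' (tstar u)) (fun u => T (tstar u)).
Proof.
have tk u : tag u = k^-1%g -> tag (tstar u) = k by rewrite tag_tstar => ->; rewrite invgK.
have tk' u : tag u = k -> tag (tstar u) = k^-1%g by rewrite tag_tstar => ->.
split.
- by move=> u /tk e; exact: coc_lin'.
- move=> c a b x; apply: hip_ext => y; rewrite hiprD hiprZ.
  have e (b' : A k^-1%g) : tag (tstar (tg b')) = k by rewrite tag_tstar /= invgK.
  rewrite -!(coc_adj cT)//.
  have st (b' : A k^-1%g) : tstar (tg b') = tg (fcast (invgK k) (fstar b')) by rewrite tag_fcast.
  rewrite !st; set F := fcast _.
  have -> : F (fstar (c *: a + b)) = c^* *: F (fstar a) + F (fstar b).
    by rewrite fstar_conj_linear /F fcastL.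
  by rewrite (coc_add cT) hiplD hiplZ conjK.
- by move=> u x y /tk e; rewrite coc_adj'.
- by move=> u v x y /tk e /tk f; rewrite coc_adj'// (coc_r cT)// tstarK.
- move=> u v x /tk e /tk f; apply: hip_ext => y; rewrite -(coc_adj cT)// (coc_s cT)// tstarK//.
- by move=> x h; apply: (coc_n' cT) => u /tk' e; rewrite -[u]tstarK; exact: h.
- by move=> x h; apply: (coc_n cT) => u /tk' e; rewrite -[u]tstarK; exact: h.
Qed.

End CocTheory.

Lemma coc_1 : coc 1%g pE (fun u => pE (tstar u)).
Proof.
have nd x : (forall u, tag u = 1%g -> pE u x = 0) -> x = 0.
  by move=> h; apply: irr_nondeg => a; rewrite -pE_T; exact: h.
have ts u : tag u = 1%g -> tag (tstar u) = 1%g by rewrite tag_tstar => ->; rewrite invg1.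
split => //.
- by move=> u _; exact: pE_lin.
- by move=> c a b x; rewrite !pE_T irr_L.
- by move=> u x y e; rewrite -{1}[u]tstarK pE_star//; exact: ts.
- by move=> u v x y e f; rewrite pE_mul ?ts// -[in RHS]pE_star ?ts// tstarK.
- by move=> u v x e f; rewrite pE_mul ?ts.
- by move=> x h; apply: nd => u e; rewrite -[u]tstarK; apply: h; exact: ts.
Qed.

(** The formula [U (u v) = T u (S v)] does not determine [U], since products need not span the fibre
    over [k l]. But [z y^*] lies over [k] when [z] lies over [k l] and [y] over [l], so [U z] can be
    prescribed on the vectors [S' y x], which are total. *)
Lemma coc_mul k l T T' S S' : coc k T T' -> coc l S S' -> exists U U',
  [/\ coc (k * l)%g U U',
      forall z (y : tot A) (x : H), tag z = (k * l)%g -> tag y = l -> U z (S' y x) = T (tmul z (tstar y)) x &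
      forall u v x, tag u = k -> tag v = l -> U (tmul u v) x = T u (S v x)].
Proof.
move=> cT cS.
have tz z (y : tot A) : tag z = (k * l)%g -> tag y = l -> tag (tmul z (tstar y)) = k.
  by move=> e f; rewrite tag_tmul tag_tstar e f mulgK.
have t1 u v j : tag u = j -> tag v = j -> tag (tmul (tstar u) v) = 1%g.
  by move=> e f; rewrite tag_tmul tag_tstar e f mulVg.
have /choice [U hU] z : exists V : H -> H, tag z = (k * l)%g -> [/\ linear V, bdd V &
    forall (y : tot A) (x : H), tag y = l -> V (S' y x) = T (tmul z (tstar y)) x].
  have [e|ne] := pselect (tag z = (k * l)%g); last by exists id.
  pose Q : set (H * H) := [set q | exists s : seq (tot A * H), [/\ forall i, List.In i s -> tag i.1 = l,
     q.1 = \sum_(i <- s) S' i.1 i.2 & q.2 = \sum_(i <- s) T (tmul z (tstar i.1)) i.2]].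
  have Q1 c q r : Q q -> Q r -> Q (c *: q.1 + r.1, c *: q.2 + r.2).
    move=> [s [ts q1 q2]] [t [tt r1 r2]].
    exists ([seq (i.1, c *: i.2) | i <- s] ++ t); split => /=.
    + move=> i /(@List.in_app_or _ _ _ _) [|]; last exact: tt.
      by move=> /(@List.in_map_iff _ _ _ _ _)[j [<- /ts]].
    + rewrite big_cat big_map q1 r1 scaler_sumr; congr (_ + _).
      by apply: big_eq_In => i /ts ti; rewrite /= (linZ (coc_lin' cS ti)).
    + rewrite big_cat big_map q2 r2 scaler_sumr; congr (_ + _).
      by apply: big_eq_In => i /ts ti; rewrite /= (linZ (coc_lin cT (tz _ _ e ti))).
  (* The prescribed values satisfy [|q.2|^2 = <q.1 | p(z^* z) q.1>]. This bound also makes the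
     prescription well defined. *)
  have Q2 q : Q q -> nm q.2 <= nmt z * nm q.1.
    move=> [s [ts q1 q2]].
    have eq : hip q.2 q.2 = hip q.1 (pE (tmul (tstar z) z) q.1).
      rewrite q1 q2 (lin_sum (pE_lin _)) !hip_suml; apply: big_eq_In => i /ts ti.
      rewrite !hip_sumr; apply: big_eq_In => j /ts tj.
      rewrite (coc_s cT) ?tz// (coc_adj' cS)// -(coc_a cS)// ?(t1 _ _ _ e e)//.
      rewrite (coc_r cS)// ?tag_tmul ?(t1 _ _ _ e e)//; last first.
        by rewrite ti tag_tstar e mulVg mulg1.
      by rewrite tstarM tstarK !tmulA.
    apply: sqr_le; first by rewrite mulr_ge0 ?nm_ge0.
    rewrite nm_sqr_hip eq; apply: le_trans (re_le_nm _) _; apply: le_trans (hip_cs _ _) _.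
    have := pE_le (tmul (tstar z) z) q.1; rewrite nmt_starmul; have := nm_ge0 q.1; nra.
  have Q0 : Q (0, 0) by exists [::]; split => //=; rewrite big_nil.
  pose K : set H := [set x | exists y, Q (x, y)].
  have K0 : K 0 by exists 0.
  have KL c x y : K x -> K y -> K (c *: x + y).
    by move=> [x' hx] [y' hy]; exists (c *: x' + y'); exact: (Q1 c _ _ hx hy).
  have Q3 x d : 0 < d -> exists2 q, Q q & nm (x - q.1) <= d.
    move=> d0; have [|w [w' hw] xw] := @total_dense R H K K0 KL _ x d d0; last by exists (w, w').
    move=> y hy; apply: (coc_n cS) => u tu; apply: hip_ext => v; rewrite hipr0 -(coc_adj' cS)//.
    apply: hy; exists (T (tmul z (tstar u)) v), [:: (u, v)]; split => /=; rewrite ?big_seq1//.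
    by move=> i [<-|[]].
  have [V [lV bV hV]] := extension (nmt_ge0 z) Q1 Q2 Q3.
  exists V => _; split => //; first by exists (nmt z).
  move=> y x ty; apply: (hV (S' y x, T (tmul z (tstar y)) x)).
  by exists [:: (y, x)]; split => /=; rewrite ?big_seq1//; move=> i [<-|[]].
have lU z : tag z = (k * l)%g -> linear (U z) by move=> /hU[].
have bU z : tag z = (k * l)%g -> bdd (U z) by move=> /hU[].
have US z (y : tot A) (x : H) : tag z = (k * l)%g -> tag y = l -> U z (S' y x) = T (tmul z (tstar y)) x.
  by move=> /hU[_ _ h] /h.
have /choice [U' hU'] z : exists V : H -> H, tag z = (k * l)%g -> [/\ linear V, bdd V &
    forall x y, hip (U z x) y = hip x (V y)].
  have [e|ne] := pselect (tag z = (k * l)%g); last by exists id.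
  have [V [lV bV hV]] := adjoint (lU _ e) (bU _ e).
  by exists V => _; split => // x y; rewrite hip_conj -hV -hip_conj.
have adj z x y : tag z = (k * l)%g -> hip (U z x) y = hip x (U' z y) by move=> /hU'[].
have lU' z : tag z = (k * l)%g -> linear (U' z) by move=> /hU'[].
have bU' z : tag z = (k * l)%g -> bdd (U' z) by move=> /hU'[].
have adj' z x y : tag z = (k * l)%g -> hip (U' z x) y = hip x (U z y).
  by move=> e; rewrite hip_conj -adj// -hip_conj.
have prod u v x : tag u = k -> tag v = l -> U (tmul u v) x = T u (S v x).
  move=> tu tv; have tuv : tag (tmul u v) = (k * l)%g by rewrite tag_tmul tu tv.
  apply: (coc_total' cS (U := U (tmul u v)) (V := fun x => T u (S v x))); [exact: lU|exact: bU| | |].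
  - by move=> c y z; rewrite (coc_lin cS tv) (coc_lin cT tu).
  - exists (nmt u * nmt v) => y; apply: le_trans (coc_le cT _ tu) _.
    by rewrite -mulrA ler_wpM2l ?nmt_ge0 ?(coc_le cS).
  - move=> w y tw; rewrite US// (coc_r cS)// -(coc_a cT)// ?tmulA//.
    by rewrite tag_tmul tag_tstar tv tw mulgV.
have SU' (y : tot A) w (x : H) : tag y = l -> tag w = (k * l)%g -> S y (U' w x) = T' (tmul w (tstar y)) x.
  move=> ty tw; apply: hip_ext => v; rewrite -(coc_adj' cS)// -adj// US//.
  by rewrite (coc_adj cT)// tz.
exists U, U'; split => //; split => //.
- move=> c a b x; apply: (coc_total' cS (U := U (tg (c *: a + b))) (V := fun x => c *: U (tg a) x + U (tg b) x)).
  + exact: lU.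
  + exact: bU.
  + by move=> d y z; rewrite !lU//; lmod.
  + have [M _ hM] := bddP (bU (tg a) erefl); have [N _ hN] := bddP (bU (tg b) erefl).
    exists (nm c * M + N) => y; apply: le_trans (nmD _ _) _.
    by rewrite nmZ mulrDl lerD// -mulrA ler_wpM2l ?nm_ge0.
  + move=> y w ty; rewrite !US//.
    case: (tag_eta ty) => d ->.
    have st (b' : A (k * l)%g) : tmul (tg b') (tstar (tg d)) = tg (fcast (mulgK l k) (fmul b' (fstar d))).
      by rewrite tag_fcast.
    by rewrite !st fmulLl fcastL (coc_add cT).
- move=> u v x y tu tv; rewrite adj//.
  have e (w : H) : U' u (U v w) = pE (tmul (tstar u) v) w.
    apply: (coc_total' cS (U := fun x => U' u (U v x)) (V := pE (tmul (tstar u) v))).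
    + by move=> c a b; rewrite lU// lU'.
    + have [M M0 hM] := bddP (bU v tv); have [N N0 hN] := bddP (bU' u tu).
      exists (N * M) => a; apply: le_trans (hN _) _; rewrite -mulrA ler_pM2l//.
    + exact: pE_lin.
    + exact: pE_bdd.
    + move=> a b ta; rewrite US//; apply: subr0_eq; apply/(coc_n cS) => d td.
      rewrite (linB (coc_lin cS td)) SU'// -(coc_a cS)// ?(t1 _ _ _ tu tv)//.
      rewrite (coc_r cS)//; last by rewrite tag_tmul (t1 _ _ _ tu tv) mulg1.
      apply/eqP; rewrite subr_eq0; apply/eqP; apply: hip_ext => f.
      by rewrite -(coc_adj cT) ?tz// (coc_s cT) ?tz// tstarM tstarK !tmulA.
  by rewrite e.
- move=> z w x tz' tw.
  have UT a b : tag a = k -> U' w (T a b) = S' (tmul (tstar a) w) b.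
    move=> ta; have taw : tag (tmul (tstar a) w) = l by rewrite tag_tmul tag_tstar ta tw mulKg.
    apply: subr0_eq; apply/(coc_n cS) => d td.
    rewrite (linB (coc_lin cS td)) SU'// (coc_r cS)//.
    apply/eqP; rewrite subr_eq0; apply/eqP; apply: hip_ext => f.
    by rewrite -(coc_adj cT) ?tz// (coc_s cT) ?tz// !tstarM !tstarK !tmulA.
  apply: (coc_total cT (U := fun x => U z (U' w x)) (V := pE (tmul z (tstar w)))).
  + by move=> c a b; rewrite lU'// lU.
  + have [M M0 hM] := bddP (bU z tz'); have [N N0 hN] := bddP (bU' w tw).
    exists (M * N) => a; apply: le_trans (hM _) _; rewrite -mulrA ler_pM2l//.
  + exact: pE_lin.
  + exact: pE_bdd.
  + move=> a b ta; have taw : tag (tmul (tstar a) w) = l by rewrite tag_tmul tag_tstar ta tw mulKg.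
    rewrite UT// US// (coc_b cT)// ?tstarM ?tstarK ?tmulA//.
    by rewrite tag_tmul tag_tstar tz' tw mulgV.
- move=> x h; apply: (coc_n cS) => v tv; apply: (coc_n cT) => u tu.
  by rewrite -prod//; apply: h; rewrite tag_tmul tu tv.
- move=> x h; apply: (coc_n' cT) => u tu; apply: (coc_n' cS) => v tv; apply: hip_ext => y.
  rewrite -(coc_adj cS)// -(coc_adj cT)// -prod// adj ?tag_tmul ?tu ?tv// h ?hipr0//.
  by rewrite tag_tmul tu tv.
Qed.
End Cocycle.

(** * Extensions of an irreducible representation over a cyclic subgroup *)

Section Coherent.
Context {R : realType} {G : groupType} {A : fellBundle R G} (p : irrep A).
Local Notation H := (irrep_space p).
Local Notation ops := (tot A -> H -> H).
Local Notation pE := (@pE R G A p).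
Local Notation coc := (@coc R G A p).
Implicit Types (u v w : tot A) (x y z : H) (T S : ops).

Lemma coc_scale k T T' (c : R[i]) : nm c = 1 -> coc k T T' ->
  coc k (fun u x => c *: T u x) (fun u x => c^* *: T' u x).
Proof.
move=> c1 cT; have cc : c * c^* = 1 by rewrite mul_conj c1 expr1n.
have c0 : c != 0 by apply/eqP => h; move: c1; rewrite h nm0 => /eqP; rewrite eq_sym oner_eq0.
have cc0 : c^* != 0 by apply/eqP => h; move: cc; rewrite h mulr0 => /eqP; rewrite eq_sym oner_eq0.
split.
- by move=> u e d x y; rewrite (coc_lin cT e); lmod.
- by move=> d a b x; rewrite (coc_add cT); lmod.
- by move=> u x y e; rewrite hiplZ hiprZ (coc_adj cT).
- by move=> u v x y e f; rewrite hiplZ hiprZ mulrA [c^* * c]mulrC cc mul1r (coc_s cT).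
- by move=> u v x e f; rewrite (linZ (coc_lin cT e)) scalerA cc scale1r (coc_r cT).
- move=> x h; apply: (coc_n cT) => u e; have /eqP := h u e.
  by rewrite scaler_eq0 (negPf c0) => /eqP.
- move=> x h; apply: (coc_n' cT) => u e; have /eqP := h u e.
  by rewrite scaler_eq0 (negPf cc0) => /eqP.
Qed.

Lemma irr_total z (T S : H -> H) : z <> 0 -> linear T -> bdd T -> linear S -> bdd S ->
  (forall b, T (p b z) = S (p b z)) -> forall x, T x = S x.
Proof.
move=> z0 lT bT lS bS h; apply: (@total_eq R H (range (fun b => p b z))) => //; last by move=> _ [b _ <-].
move=> y hy; apply: hip_eq0; apply: nm_small => e e0.
have k0 : 0 < nm y + 1 by have := nm_ge0 y; lra.
have [b hb] := irr_dense y z0 (divr_gt0 e0 k0).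
have bz : hip (p b z) y = 0 by apply: hy; exists b.
have -> : hip y y = hip (y - p b z) y by rewrite hiplB bz subr0.
apply: le_trans (hip_cs _ _) _; move: hb; set d := e / _ => hb.
have dE : d * (nm y + 1) = e by rewrite /d divfK// gt_eqF.
by have := nm_ge0 y; have := nm_ge0 (y - p b z); nra.
Qed.

(** The map [p b z |-> S b z] is well defined and isometric, because [S] and [p] have the same inner
    products, and it commutes with [p]; so Schur's lemma applies. *)
Lemma coc_1_scalar S S' : coc 1%g S S' -> exists2 c : R[i], nm c = 1 &
  forall u x, tag u = 1%g -> S u x = c *: pE u x.
Proof.
move=> cS; have [a [z az]] := irr_n p.
have z0 : z <> 0 by move=> h; apply: az; rewrite h (lin0 (@irr_lin _ _ _ p a)).
have nS u x : tag u = 1%g -> nm (S u x) = nm (pE u x).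
  move=> e; have h : nm (S u x) ^+ 2 = nm (pE u x) ^+ 2.
    by rewrite !nm_sqr_hip (coc_s cS)// (coc_s (coc_1 p)).
  by apply/eqP; rewrite eq_le; apply/andP; split; apply: sqr_le; rewrite ?nm_ge0// h.
pose Q : set (H * H) := [set q | exists b, q = (p b z, S (tg b) z)].
have Q1 c q r : Q q -> Q r -> Q (c *: q.1 + r.1, c *: q.2 + r.2).
  by move=> [b ->] [d ->]; exists (c *: b + d); rewrite irr_L (coc_add cS).
have Q2 q : Q q -> nm q.2 <= 1 * nm q.1.
  by move=> [b ->] /=; rewrite nS// pE_T mul1r.
have Q3 x e : 0 < e -> exists2 q, Q q & nm (x - q.1) <= e.
  by move=> /(irr_dense x z0)[b hb]; exists (p b z, S (tg b) z) => //; exists b.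
have [V [lV nV hV]] := extension ler01 Q1 Q2 Q3.
have VE b : V (p b z) = S (tg b) z by apply: (hV (p b z, S (tg b) z)); exists b.
have bV : bdd V by exists 1.
have bC (T1 T2 : H -> H) : bdd T1 -> bdd T2 -> bdd (fun x => T1 (T2 x)).
  move=> /bddP[M M0 hM] /bddP[N N0 hN]; exists (M * N) => x.
  by apply: le_trans (hM _) _; rewrite -mulrA ler_pM2l.
have cV b x : V (p b x) = p b (V x).
  apply: (irr_total z0 (T := fun x => V (p b x)) (S := fun x => p b (V x))).
  - by move=> c y w; rewrite irr_lin lV.
  - by apply: bC => //; exact: irr_bdd.
  - by move=> c y w; rewrite lV irr_lin.
  - by apply: bC => //; exact: irr_bdd.
  - move=> d; rewrite -irr_M !VE -[p b _]pE_T (coc_b cS)//.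
    by rewrite -T_mul1.
have [V' [lV' bV' aV]] := adjoint lV bV.
have [c hc] := irr_schur lV bV lV' bV' aV cV.
have SE u x : tag u = 1%g -> S u x = c *: pE u x.
  move=> e; apply: (irr_total z0 (S := fun x => c *: pE u x)).
  - exact: (coc_lin cS).
  - exact: (coc_bdd cS).
  - by move=> d y w; rewrite pE_lin; lmod.
  - have [M _ hM] := bddP (pE_bdd p u); exists (nm c * M) => y.
    by rewrite nmZ -mulrA ler_wpM2l ?nm_ge0.
  - move=> b; rewrite -[p b z]pE_T -(coc_a cS)//; case: (tag_eta e) => d ->.
    by rewrite -T_mul1 -VE hc -pE_mul// -T_mul1 pE_T.
exists c => //; have := nS (tg a) z erefl; rewrite SE// nmZ pE_T => h.
have n0 : nm (p a z) != 0 by rewrite gt_eqF// nm_gt0.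
by apply: (mulIf n0); rewrite mul1r.
Qed.

(** Density of the range of [t] gives injectivity of the adjoints and then [coc_r]. The common
    kernel of the [T u] is invariant under [p] and is not everything, so it is 0 by
    irreducibility. *)
Lemma tensor_coc g : is_tensor g p p -> exists T T', coc g T T'.
Proof.
move=> [t [t1 t2 t3 t4 t5]]; pose T u := t (fibre g u).
have ts u v : tag u = g -> tag v = g -> tag (tmul (tstar u) v) = 1%g.
  by move=> e f; rewrite tag_tmul tag_tstar e f mulVg.
have tr u v : tag u = g -> tag v = g -> tag (tmul u (tstar v)) = 1%g.
  by move=> e f; rewrite tag_tmul tag_tstar e f mulgV.
have Ts u v x y : tag u = g -> tag v = g -> hip (T u x) (T v y) = hip x (pE (tmul (tstar u) v) y).
  by move=> /tag_eta[a ->] /tag_eta[b ->]; rewrite /T !fibreT t3 -T_rip pE_T.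
have bT u : tag u = g -> bdd (T u).
  move=> e; exists (nmt u) => x; apply: sqr_le; first by rewrite mulr_ge0 ?nm_ge0.
  rewrite nm_sqr_hip Ts//; apply: le_trans (re_le_nm _) _; apply: le_trans (hip_cs _ _) _.
  have := pE_le (tmul (tstar u) u) x; rewrite nmt_starmul; have := nm_ge0 x; nra.
have lT u : linear (T u) by exact: t2.
have /choice [T' hT'] u : exists V : H -> H, tag u = g -> [/\ linear V, bdd V &
    forall x y, hip (T u x) y = hip x (V y)].
  have [e|ne] := pselect (tag u = g); last by exists id.
  have [V [lV bV hV]] := adjoint (lT u) (bT _ e).
  by exists V => _; split => // x y; rewrite hip_conj -hV -hip_conj.
have adj u x y : tag u = g -> hip (T u x) y = hip x (T' u y) by move=> /hT'[].
have n' x : (forall u, tag u = g -> T' u x = 0) -> x = 0.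
  move=> h; apply: hip_eq0.
  have : [set: H] x by []; rewrite -t5 => /(_ [set w | hip x w = 0]); apply; split.
    split.
    - apply/closed_eps => y hy; apply: nm_small => e e0.
      have k0 : 0 < nm x + 1 by have := nm_ge0 x; lra.
      have [w xw hw] := hy _ (divr_gt0 e0 k0).
      have -> : hip x y = hip x (y - w) by rewrite hiprB xw subr0.
      apply: le_trans (hip_cs _ _) _; move: hw; set d := e / _ => hw.
      have dE : d * (nm x + 1) = e by rewrite /d divfK// gt_eqF.
      by have := nm_ge0 x; have := nm_ge0 (y - w); nra.
    - exact: hipr0.
    - by move=> c y w /= hy hw; rewrite hiprD hiprZ hy hw mulr0 addr0.
  move=> _ [a [v ->]] /=; rewrite -[t a v]/(t a v) hip_conj.
  have -> : t a v = T (tg a) v by rewrite /T fibreT.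
  by rewrite adj// h// hipr0 conj0.
have Ta u a x : tag u = g -> tag a = 1%g -> T (tmul u a) x = T u (pE a x).
  move=> e ea; have eu : tag (tmul u a) = g by rewrite tag_tmul e ea mulg1.
  apply: subr0_eq; apply/n' => v ev; apply: hip_ext => y.
  rewrite -adj// hipr0 hiprB !Ts// -pE_mul ?ts// tmulA subrr //.
have Tb u a x : tag u = g -> tag a = 1%g -> pE a (T u x) = T (tmul a u) x.
  by move=> /tag_eta[b ->] /tag_eta[c ->]; rewrite /T fibreT pE_T t4 -T_lact fibreT.
exists T, T'; split => //.
- by move=> c a b x; rewrite /T !fibreT t1.
- move=> u v x e f; apply: (@total_eq R H [set y | exists2 w, tag w = g & exists y', y = T w y'] (fun x => T u (T' v x))).
  + by move=> c y y'; have [l _ _] := hT' v f; rewrite l lT.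
  + have [M M0 hM] := bddP (bT u e); have [_ /bddP[N N0 hN] _] := hT' v f.
    by exists (M * N) => y; apply: le_trans (hM _) _; rewrite -mulrA ler_pM2l.
  + exact: pE_lin.
  + exact: pE_bdd.
  + move=> y hy; apply: n' => w ew; apply: hip_ext => y'; rewrite hipr0 -adj//.
    by apply: hy; exists w => //; exists y'.
  + move=> _ [w ew [y ->]].
    have -> : T' v (T w y) = pE (tmul (tstar v) w) y.
      by apply: hip_ext => y'; rewrite -adj// Ts.
    by rewrite -Ta ?ts// Tb ?tr// tmulA.
- move=> x h; pose K : set H := [set x | forall u, tag u = g -> T u x = 0].
  have cK : closed_subspace K.
    split.
    - apply/closed_eps => y hy u e; apply: nm_small => d d0.
      have [M M0 hM] := bddP (bT u e).
      have [w Kw hw] := hy _ (divr_gt0 d0 M0).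
      have -> : T u y = T u (y - w) by rewrite (linB (lT u)) Kw// subr0.
      by apply: le_trans (hM _) _; move: hw; rewrite ler_pdivlMr// mulrC.
    - by move=> u e; rewrite (lin0 (lT u)).
    - by move=> c y w Ky Kw u e; rewrite lT Ky// Kw// scaler0 addr0.
  have iK a y : K y -> K (p a y).
    move=> Ky u e; rewrite -pE_T -Ta//; apply: Ky; by rewrite tag_tmul e mulg1.
  have Kx : K x by [].
  have [e|e] := irr_i cK iK; first by move: Kx; rewrite e.
  have [a [y []]] := irr_n p; apply: n' => u eu; apply: hip_ext => w; rewrite -adj// hipr0.
  have Kw : K w by rewrite e.
  by rewrite (Kw u eu) hipl0.
Qed.

(** The index is an exponent and not an element of [G]: if [g] has finite order, the operators
    obtained for two exponents of the same element may differ by a scalar. [consistent] excludes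
    this. *)
Definition powfam (g : G) (P P' : nat -> ops) : Prop :=
  [/\ forall n, coc (g ^+ n)%g (P n) (P' n), forall u x, P 0%N u x = pE u x &
   forall m n u v x, tag u = (g ^+ m)%g -> tag v = (g ^+ n)%g -> P (m + n)%N (tmul u v) x = P m u (P n v x)].

Lemma powfam_scale g P P' (c : R[i]) : nm c = 1 -> powfam g P P' ->
  powfam g (fun n u x => c ^+ n *: P n u x) (fun n u x => (c ^+ n)^* *: P' n u x).
Proof.
move=> c1 [h1 h2 h3]; split.
- move=> n; apply: coc_scale => //.
  by elim: n => [|n IHn]; rewrite ?expr0 ?nm1// exprS nmM c1 IHn mulr1.
- by move=> u x; rewrite expr0 scale1r.
- by move=> m n u v x e f; rewrite h3// (linZ (coc_lin (h1 m) e)) scalerA exprD.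
Qed.

Lemma powfam_exists g T T' : coc g T T' -> exists P P', powfam g P P' /\
  forall u x, tag u = g -> P 1%N u x = T u x.
Proof.
move=> cT.
have /choice [F hF] (q : nat * (ops * ops)) : exists r : ops * ops,
    coc (g ^+ q.1)%g q.2.1 q.2.2 -> [/\ coc (g ^+ q.1.+1)%g r.1 r.2 &
      forall w v x, tag w = (g ^+ q.1.+1)%g -> tag v = g -> r.1 w (T' v x) = q.2.1 (tmul w (tstar v)) x].
  have [h|h] := pselect (coc (g ^+ q.1)%g q.2.1 q.2.2); last by exists (q.2).
  have [U [U' [cU hU _]]] := coc_mul h cT.
  by exists (U, U') => _; rewrite expgSr.
pose PP := fix PP n : ops * ops := if n is m.+1 then F (m, PP m) else (pE, fun u => pE (tstar u)).
have cP n : coc (g ^+ n)%g (PP n).1 (PP n).2.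
  elim: n => [|n IHn]; first by rewrite expg0; exact: coc_1.
  by have [] := hF (n, PP n) IHn.
have PS n w v x : tag w = (g ^+ n.+1)%g -> tag v = g -> (PP n.+1).1 w (T' v x) = (PP n).1 (tmul w (tstar v)) x.
  by have [_] := hF (n, PP n) (cP n); exact.
exists (fun n => (PP n).1), (fun n => (PP n).2); split; last first.
  move=> u x e; apply: (coc_total' cT) => //.
  - by apply: (coc_lin (cP 1%N)); rewrite expg1.
  - by apply: (coc_bdd (cP 1%N)); rewrite expg1.
  - exact: (coc_lin cT).
  - exact: (coc_bdd cT).
  - by move=> v y f; rewrite PS// ?expg1// (coc_r cT).
split => //.
move=> m n; elim: n m => [|n IHn] m u v x e f.
  rewrite addn0; rewrite expg0 in f; exact: (coc_a (cP m)).
have ef : tag (tmul u v) = (g ^+ (m + n.+1))%g by rewrite tag_tmul e f expgnDr.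
apply: (coc_total' cT (U := (PP (m + n.+1)%N).1 (tmul u v)) (V := fun x => (PP m).1 u ((PP n.+1).1 v x))).
- exact: (coc_lin (cP _)).
- exact: (coc_bdd (cP _)).
- by move=> c y w; rewrite (coc_lin (cP n.+1) f) (coc_lin (cP m) e).
- exists (nmt u * nmt v) => y; apply: le_trans (coc_le (cP m) _ e) _.
  by rewrite -mulrA ler_wpM2l ?nmt_ge0 ?(coc_le (cP n.+1)).
- move=> w y tw; rewrite (PS n)// addnS PS -?addnS// tmulA IHn//.
  by rewrite tag_tmul tag_tstar f tw expgSr mulgK.
Qed.

Definition consistent (g : G) (P : nat -> ops) : Prop :=
  forall i j u x, tag u = (g ^+ i)%g -> (g ^+ i = g ^+ j)%g -> P i u x = P j u x.

(** With [a] in the unit fibre, [a u] can be read as a product over [g^m] and [g^j]. So [P (j + m)]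
    and [P j] agree after multiplication by [p a], and nondegeneracy removes [a]. *)
Lemma consistent_torsion g m P P' : (0 < m)%N -> (g ^+ m = 1)%g ->
  (forall n, (0 < n)%N -> (g ^+ n = 1)%g -> (m <= n)%N) ->
  powfam g P P' -> (forall u x, tag u = 1%g -> P m u x = pE u x) -> consistent g P.
Proof.
move=> m0 gm mmin [cP P0 PM] hm.
have per j u x : tag u = (g ^+ j)%g -> P (j + m)%N u x = P j u x.
  move=> e; apply: subr0_eq; apply/irr_nondeg => a.
  have e' : tag u = (g ^+ (j + m))%g by rewrite expgnDr gm mulg1.
  rewrite (linB (@irr_lin _ _ _ p a)) -!pE_T (coc_b (cP _))// (coc_b (cP _))//.
  rewrite addnC PM ?gm// hm// (coc_b (cP _))// subrr//.
have perq j q u x : tag u = (g ^+ j)%g -> P (j + q * m)%N u x = P j u x.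
  elim: q => [|q IHq] e; first by rewrite mul0n addn0.
  by rewrite mulSnr addnA per ?IHq// expgnDr mulnC expgnA gm expg1n mulg1.
have le i j u x : (i <= j)%N -> tag u = (g ^+ i)%g -> (g ^+ i = g ^+ j)%g -> P i u x = P j u x.
  move=> ij e gij; have gd : (g ^+ (j - i) = 1)%g.
    by apply: (mulgI (g ^+ i)%g); rewrite -expgnDr subnKC// mulg1.
  have : ((j - i) %% m = 0)%N.
    apply/eqP; rewrite -leqn0 leqNgt; apply/negP => r0.
    have : (g ^+ ((j - i) %% m) = 1)%g.
      by move: gd; rewrite {1}(divn_eq (j - i) m) expgnDr mulnC expgnA gm expg1n mul1g.
    by move/(mmin _ r0); rewrite leqNgt ltn_mod m0.
  move=> r0; have : (j = i + (j - i) %/ m * m)%N.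
    by rewrite -{1}(subnKC ij) {1}(divn_eq (j - i) m) r0 addn0.
  by move=> ->; rewrite perq.
move=> i j u x e gij; have [ij|/ltnW ji] := leqP i j; first exact: le.
by rewrite [RHS](le j i)// -?gij.
Qed.

Definition cyc (g h : G) : Prop := exists n : nat, h = (g ^+ n)%g \/ h = (g ^- n)%g.

(** A representation of the bundle over the cyclic subgroup of [g] that extends [p] and in which
    each fibre acts as a unitary [coc]. *)
Record cohrep (g : G) (rho : ops) : Prop := CohRep {
  cr_coc : forall h, cyc g h -> exists rho', coc h rho rho';
  cr_1 : forall u x, tag u = 1%g -> rho u x = pE u x;
  cr_mul : forall u v x, cyc g (tag u) -> cyc g (tag v) -> rho (tmul u v) x = rho u (rho v x);
  cr_star : forall u x y, cyc g (tag u) -> hip (rho (tstar u) x) y = hip x (rho u y)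
}.

Lemma cyc_V g h : cyc g h -> cyc g h^-1%g.
Proof. by move=> [n [->|->]]; exists n; [right|left; rewrite invgK]. Qed.

(** Multiplication by a large positive power moves any elements of the subgroup to positive powers,
    so that inverses can be avoided in comparisons. The lower bound on [j] lets two shifts be
    composed. *)
Lemma cyc_shift g h : cyc g h -> exists N, forall M, (N <= M)%N -> exists j, (h * g ^+ M = g ^+ j)%g /\ (M - N <= j)%N.
Proof.
move=> [n [->|->]].
  by exists 0%N => M _; exists (n + M)%N; rewrite expgnDr subn0 leq_addl.
exists n => M nM; exists (M - n)%N; split => //.
by rewrite -{1}(subnKC nM) expgnDr mulgA mulVg mul1g.
Qed.
Lemma cyc_shift2 g h k : cyc g h -> cyc g k -> exists N j l, (k * g ^+ N = g ^+ j)%g /\ (h * g ^+ j = g ^+ l)%g.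
Proof.
move=> /cyc_shift[N hN] /cyc_shift[M hM].
have [j [hj jj]] := hM (M + N)%N (leq_addr _ _).
have [|l [hl _]] := hN j; first by apply: leq_trans jj; rewrite addKn.
by exists (M + N)%N, j, l.
Qed.
Lemma cyc_M g h k : cyc g h -> cyc g k -> cyc g (h * k)%g.
Proof.
move=> ch ck; have [N [j [l [e1 e2]]]] := cyc_shift2 ch ck.
have e : (h * k = g ^+ l * g ^- N)%g by rewrite -e2 -e1 mulgA mulgK.
have [Nl|/ltnW lN] := leqP N l.
  by exists (l - N)%N; left; rewrite e -{1}(subnK Nl) expgnDr mulgK.
by exists (N - l)%N; right; rewrite e -{1}(subnK lN) expgnDr invgM mulgA mulgV mul1g.
Qed.

(** Over [g^-n] the adjoints [P' n] are used. Multiplicativity is checked on the total vectors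
    [P N v x] for large [N], where only products over non-negative powers remain. *)
Lemma coherent g P P' : powfam g P P' -> consistent g P ->
  exists2 rho, cohrep g rho & forall u x, tag u = g -> rho u x = P 1%N u x.
Proof.
move=> [cP P0 PM] con.
(* This determines [S] and does not refer to the way in which [h] is written as a power of [g]. *)
pose compat h (S : ops) := forall N j u v x, (h * g ^+ N = g ^+ j)%g -> tag u = h -> tag v = (g ^+ N)%g ->
  S u (P N v x) = P j (tmul u v) x.
have cpos n : compat (g ^+ n)%g (P n).
  move=> N j u v x e eu ev; rewrite -PM//; apply: con; last by rewrite expgnDr.
  by rewrite tag_tmul eu ev expgnDr.
have cneg n : compat (g ^- n)%g (fun u => P' n (tstar u)).
  move=> N j u v x e eu ev.
  have tu : tag (tstar u) = (g ^+ n)%g by rewrite tag_tstar eu invgK.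
  have gN : (g ^+ N = g ^+ (n + j))%g by rewrite expgnDr -e mulgA mulgV mul1g.
  have tuv : tag (tmul u v) = (g ^+ j)%g by rewrite tag_tmul eu ev.
  apply: subr0_eq; apply/(coc_n (cP n)) => w ew.
  rewrite (linB (coc_lin (cP n) ew)) (coc_r (cP n))// tstarK -PM//.
  have t1 : tag (tmul w u) = 1%g by rewrite tag_tmul ew eu mulgV.
  rewrite (coc_b (cP N))// -tmulA (con N (n + j)%N) ?subrr// .
  by rewrite tag_tmul t1 ev mul1g.
have /choice [S hS] h : exists S : ops, cyc g h -> compat h S /\ exists S', coc h S S'.
  have [[n [e|e]]|nc] := pselect (cyc g h); last by exists pE.
    by exists (P n) => _; rewrite e; split => //; exists (P' n).
  exists (fun u => P' n (tstar u)) => _; rewrite e; split => //.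
  by exists (fun u => P n (tstar u)); exact: (coc_inv (cP n)).
pose rho u := S (tag u) u.
have cr h : cyc g h -> exists rho', coc h rho rho'.
  move=> ch; have [_ [S' c]] := hS h ch; exists S'; split.
  - by move=> u e; rewrite /rho e; exact: (coc_lin c).
  - by move=> d a b x; rewrite /rho /= (coc_add c).
  - by move=> u x y e; rewrite /rho e (coc_adj c).
  - by move=> u v x y e f; rewrite /rho e f (coc_s c).
  - by move=> u v x e f; rewrite /rho e (coc_r c).
  - by move=> x hx; apply: (coc_n c) => u e; have := hx u e; rewrite /rho e.
  - exact: (coc_n' c).
have rc' u N j v x : cyc g (tag u) -> (tag u * g ^+ N = g ^+ j)%g -> tag v = (g ^+ N)%g ->
    rho u (P N v x) = P j (tmul u v) x.
  by move=> cu e ev; have [c _] := hS _ cu; exact: c.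
have cyc1 : cyc g 1%g by exists 0%N; left; rewrite expg0.
have r1 u x : tag u = 1%g -> rho u x = pE u x.
  move=> e; have [r' cr'] := cr _ cyc1.
  apply: (coc_total (coc_1 p) (U := rho u)); [exact: (coc_lin cr')|exact: (coc_bdd cr')|exact: pE_lin|exact: pE_bdd|].
  by move=> v y ev; rewrite -P0 (rc' u 0%N 0%N) ?expg0 ?e ?mulg1// P0 pE_mul// P0.
have bC (T1 T2 : H -> H) : bdd T1 -> bdd T2 -> bdd (fun x => T1 (T2 x)).
  move=> /bddP[M M0 hM] /bddP[N N0 hN]; exists (M * N) => x.
  by apply: le_trans (hM _) _; rewrite -mulrA ler_pM2l.
have rmul u v x : cyc g (tag u) -> cyc g (tag v) -> rho (tmul u v) x = rho u (rho v x).
  move=> cu cv; have [N [j [l [e1 e2]]]] := cyc_shift2 cu cv.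
  have [ru cru] := cr _ cu; have [rv crv] := cr _ cv.
  have [ruv cruv] := cr _ (cyc_M cu cv).
  apply: (coc_total (cP N) (U := rho (tmul u v)) (V := fun x => rho u (rho v x))).
  - exact: (coc_lin cruv).
  - exact: (coc_bdd cruv).
  - by move=> c y z; rewrite (coc_lin crv)// (coc_lin cru).
  - by apply: bC; [exact: (coc_bdd cru)|exact: (coc_bdd crv)].
  - move=> w y ew; have e3 : tag (tmul v w) = (g ^+ j)%g by rewrite tag_tmul ew.
    rewrite (rc' v N j)// (rc' u j l)// (rc' (tmul u v) N l) ?tmulA//; first exact: cyc_M.
    by rewrite tag_tmul -mulgA e1.
exists rho; last first.
  have cg : cyc g g by exists 1%N; left; rewrite expg1.
  move=> u x e; have [r' cr'] := cr _ cg.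
  apply: (coc_total (coc_1 p) (U := rho u) (V := P 1%N u)).
  - exact: (coc_lin cr').
  - exact: (coc_bdd cr').
  - by apply: (coc_lin (cP 1%N)); rewrite expg1.
  - by apply: (coc_bdd (cP 1%N)); rewrite expg1.
  - move=> v y ev; rewrite -P0 (rc' u 0%N 1%N) ?expg0 ?e ?mulg1 ?expg1// P0.
    by rewrite (coc_a (cP 1%N)) ?expg1.
split => //.
move=> u x y cu; have [r' cr'] := cr _ cu; rewrite -(coc_adj' cr')//; congr hip.
have [rs crs] := cr _ (cyc_V cu).
apply: (coc_total cr' (U := rho (tstar u)) (V := r' u)).
- exact: (coc_lin crs).
- exact: (coc_bdd crs).
- exact: (coc_lin' cr').
- exact: (coc_bdd' cr').
- move=> v z ev; rewrite -rmul ?ev//; last exact: cyc_V.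
  rewrite r1; last by rewrite tag_tmul tag_tstar ev mulVg.
  by apply: hip_ext => w; rewrite -(coc_adj cr')// (coc_s cr').
Qed.

(* Twisting [t] by the powers of a root of unity, or of [-1] if [g] has infinite
   order. *)
Lemma coherent_family g : is_tensor g p p -> g <> 1%g ->
  exists (N : nat) (c : nat -> R[i]) (rho : nat -> ops),
  [/\ forall j, cohrep g (rho j), forall j, nm (c j) = 1,
      forall j u x, tag u = g -> rho j u x = c j *: rho 0%N u x &
      \sum_(j < N.+1) c j = 0].
Proof.
move=> /tensor_coc[T [T' cT]] g1.
have [P [P' [pP P1]]] := powfam_exists cT.
suff [Q [N [c [pQ con cn cs]]]] : exists (Q : nat -> ops) (N : nat) (c : R[i]),
    [/\ exists Q', powfam g Q Q', forall j, exists Q', powfam g (fun n u x => (c ^+ j) ^+ n *: Q n u x) Q' /\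
          consistent g (fun n u x => (c ^+ j) ^+ n *: Q n u x), nm c = 1 & \sum_(j < N.+1) c ^+ j = 0].
  have nj j : nm (c ^+ j) = 1 by elim: j => [|j IHj]; rewrite ?expr0 ?nm1// exprS nmM cn IHj mulr1.
  have /choice [rho hrho] j : exists rho, cohrep g rho /\ forall u x, tag u = g -> rho u x = c ^+ j *: Q 1%N u x.
    have [Q' [pQ' cQ]] := con j; have [rho cr hr] := coherent pQ' cQ.
    by exists rho; split => // u x e; rewrite hr// expr1.
  exists N, (fun j => c ^+ j), rho; split => //.
  - by move=> j; case: (hrho j).
  - by move=> j u x e; rewrite (hrho j).2// (hrho 0%N).2// expr0 scale1r.
have [[m m0 gm]|inf] := pselect (exists2 m, (0 < m)%N & (g ^+ m = 1)%g); last first.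
  have con Q : consistent g Q.
    have le i j : (i <= j)%N -> (g ^+ i = g ^+ j)%g -> i = j.
      move=> ij e; apply/eqP; rewrite eqn_leq ij leqNgt; apply/negP => ji; apply: inf.
      exists (j - i)%N; first by rewrite subn_gt0.
      by apply: (mulgI (g ^+ i)%g); rewrite -expgnDr subnKC// mulg1.
    move=> i j u x _ e; have [ij|/ltnW ji] := leqP i j; first by rewrite (le i j).
    by rewrite (le j i).
  exists P, 1%N, (-1); split; [by exists P'| |by rewrite nmN nm1|].
    move=> j; have n1 : nm ((-1 : R[i]) ^+ j) = 1.
      by elim: j => [|j IHj]; rewrite ?expr0 ?nm1// exprS nmM IHj nmN nm1 mulr1.
    by exists (fun n u x => (((-1) ^+ j) ^+ n)^* *: P' n u x); split; [exact: powfam_scale|].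
  by rewrite !big_ord_recl big_ord0 /= expr0 expr1 addr0 subrr.
have ex : exists m, (0 < m)%N && (g ^+ m == 1)%g by exists m; rewrite m0 gm eqxx.
case: (ex_minnP ex) => {m0 gm}m /andP[m0 /eqP gm] mmin.
have {}mmin n : (0 < n)%N -> (g ^+ n = 1)%g -> (m <= n)%N.
  by move=> n0 gn; apply: mmin; rewrite n0 gn eqxx.
have [cP P0 PM] := pP.
have c1 : coc 1%g (P m) (P' m) by rewrite -gm; exact: cP.
have [d d1 hd] := coc_1_scalar c1.
(* Multiplying [P n] by [mu^n] cancels the scalar [d] by which [P m] differs from [p] on the unit
   fibre. *)
pose mu : R[i] := m.-root d^-1.
have mum : mu ^+ m = d^-1 by rewrite /mu rootCK.
have nX (z : R[i]) n : nm (z ^+ n) = nm z ^+ n.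
  by elim: n => [|n IHn]; rewrite ?expr0 ?nm1// !exprS nmM IHn.
have d0 : d != 0 by apply/eqP => h; move: d1; rewrite h nm0 => /eqP; rewrite eq_sym oner_eq0.
have nmu : nm mu = 1.
  have h : nm mu ^+ m = 1.
    rewrite -nX mum; have : nm d^-1 * nm d = 1 by rewrite -nmM mulVf// nm1.
    by rewrite d1 mulr1.
  by apply/eqP; rewrite -(@pexpr_eq1 _ _ m) ?nm_ge0 ?h.
pose Q n u x := mu ^+ n *: P n u x.
have pQ := powfam_scale nmu pP.
have Qm u x : tag u = 1%g -> Q m u x = pE u x.
  by move=> e; rewrite /Q hd// scalerA mum mulVf// scale1r.
have m1 : (1 < m)%N.
  rewrite ltn_neqAle m0 andbT; apply/eqP => h; apply: g1; by rewrite -gm -h expg1.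
(* A root of [1 + X + ... + X^(m-1)], which is not constant since [g <> 1] gives [m > 1]. Such a [c]
   satisfies [c^m = 1], so the twists remain consistent, and their sum is 0; it need not be
   primitive. *)
have [c rc] : exists c : R[i], \sum_(j < m) c ^+ j = 0.
  have sz : size (\poly_(j < m) (1 : R[i])) = m by rewrite size_poly_eq ?oner_eq0.
  have /closed_rootP [c /rootP hc] : size (\poly_(j < m) (1 : R[i])) != 1%N by rewrite sz gtn_eqF.
  exists c; move: hc; rewrite horner_poly => hc; rewrite -[RHS]hc.
  by apply: eq_bigr => j _; rewrite mul1r.
have cm : c ^+ m = 1.
  by apply/eqP; rewrite -subr_eq0 subrX1 rc mulr0.
have nc : nm c = 1 by apply/eqP; rewrite -(@pexpr_eq1 _ _ m) ?nm_ge0// -nX cm nm1.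
exists Q, m.-1, c; split => //; [by exists (fun n u x => (mu ^+ n)^* *: P' n u x)| |by rewrite prednK].
move=> j; have n1 : nm (c ^+ j) = 1 by rewrite nX nc expr1n.
have pp := powfam_scale n1 pQ; eexists; split; first exact: pp.
apply: (consistent_torsion m0 gm mmin pp) => u x e.
by rewrite exprAC cm expr1n scale1r; exact: Qm.
Qed.

End Coherent.

(** * Norms of sections *)

Section Norms.
Context {R : realType} {G : groupType} {A : fellBundle R G}.
Local Notation S := (section A).
Implicit Types (x y : S) (s t : seq G) (g : G).

Definition rsum s x : A 1%g := \sum_(g <- s) rip (x g) (x g).
Definition nF s x : R := Num.sqrt (nm (rsum s x)).
Lemma nF_ge0 s x : 0 <= nF s x. Proof. exact: sqrtr_ge0. Qed.
Lemma nF_sqr s x : nF s x ^+ 2 = nm (rsum s x). Proof. by rewrite sqr_sqrtr ?nm_ge0. Qed.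

(** Norms in the Hilbert module are suprema of these scalar seminorms over irreducible
    representations and unit vectors, since the norm of a positive element is attained. The triangle
    inequality thus comes from the scalar Cauchy-Schwarz inequality. *)
Definition secIP (p : irrep A) (xi : irrep_space p) s : semiIP R.
Proof.
refine (@SemiIP R S (fun x y => \sum_(g <- s) hip xi (p (rip (x g) (y g)) xi)) _ _ _).
- move=> x c y z; rewrite mulr_sumr -big_split; apply: eq_bigr => g _ /=.
  by rewrite ripL irr_L hiprD hiprZ.
- move=> x y; rewrite rmorph_sum; apply: eq_bigr => g _ /=.
  by rewrite -hip_conj -irr_S rip_star.
- move=> x; rewrite re_sum; apply: sumr_ge0 => g _.
  by rewrite -pu_inj; apply: pu_pos; exact: posA_rip.
Defined.

Lemma secIP_sqr (p : irrep A) (xi : irrep_space p) s x :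
  @ipn R (secIP xi s) x ^+ 2 = re (hip xi (p (rsum s x) xi)).
Proof. by rewrite ipn_sqr /= /rsum irr_sum hip_sumr. Qed.

Lemma inj_sum I (r : seq I) (F : I -> A 1%g) : uin (\sum_(i <- r) F i) = \sum_(i <- r) uin (F i).
Proof.
elim: r => [|i r IHr]; rewrite ?big_nil// !big_cons -IHr.
by have := injL 1 (F i) (\sum_(j <- r) F j); rewrite !scale1r.
Qed.
Lemma posA_rsum s x : posA (rsum s x).
Proof. by rewrite /posA inj_sum; apply: pos_sum => g; exact: posA_rip. Qed.

Lemma nF_le s x (M : R) : 0 <= M ->
  (forall (p : irrep A) (xi : irrep_space p), nm xi = 1 -> @ipn R (secIP xi s) x <= M) -> nF s x <= M.
Proof.
move=> M0 h; apply: sqr_le => //; rewrite nF_sqr.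
have [->|/nm_gt0 n0] := pselect (rsum s x = 0); first by rewrite nm0 sqr_ge0.
have [p [xi [xn hx]]] := norm_attained (posA_rsum s x) n0.
apply: le_trans hx _; rewrite -secIP_sqr.
by rewrite ler_pXn2r ?nnegrE ?ipn_ge0// h.
Qed.
Lemma nF_ge s x (p : irrep A) (xi : irrep_space p) : nm xi = 1 -> @ipn R (secIP xi s) x <= nF s x.
Proof.
move=> xn; apply: sqr_le; rewrite ?nF_ge0// nF_sqr secIP_sqr.
apply: le_trans (re_le_nm _) _; apply: le_trans (hip_cs _ _) _; rewrite xn mul1r.
by have := irr_contr (rsum s x) xi; rewrite xn mulr1.
Qed.
Lemma nFD s x y : nF s (x + y) <= nF s x + nF s y.
Proof.
apply: nF_le => [|p xi xn]; first by rewrite addr_ge0 ?nF_ge0.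
by apply: le_trans (@ipnD R (secIP xi s) x y) _; rewrite lerD ?nF_ge.
Qed.
Lemma nFZ s (c : R[i]) x : nF s (c *: x) <= nm c * nF s x.
Proof.
apply: nF_le => [|p xi xn]; first by rewrite mulr_ge0 ?nF_ge0 ?nm_ge0.
by rewrite (@ipnZ R (secIP xi s) c x) ler_wpM2l ?nm_ge0 ?nF_ge.
Qed.
Lemma rsum_perm s t x : perm_eq s t -> rsum s x = rsum t x.
Proof. exact: perm_big. Qed.
Lemma nF_eq s x y : (forall g, g \in s -> x g = y g) -> nF s x = nF s y.
Proof.
by move=> h; rewrite /nF /rsum (eq_big_seq (fun g => rip (y g) (y g)))// => g gs; rewrite h.
Qed.
Lemma rsum_split s t x : uniq s -> uniq t -> {subset s <= t} ->
  rsum t x = rsum s x + rsum [seq g <- t | g \notin s] x.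
Proof.
move=> us ut st.
have -> : rsum t x = rsum [seq g <- t | g \in s] x + rsum [seq g <- t | g \notin s] x.
  by rewrite /rsum !big_filter [LHS](bigID (mem s)).
congr (_ + _); apply: perm_big; apply: uniq_perm; rewrite ?filter_uniq// => g.
by rewrite mem_filter; case: (boolP (g \in s)) => // /st ->.
Qed.
Lemma nF_mono s t x : uniq s -> uniq t -> {subset s <= t} -> nF s x <= nF t x.
Proof.
move=> us ut st; rewrite /nF ler_psqrt ?nnegrE ?nm_ge0// -!nrm_inj.
apply: pos_mono; first exact: posA_rsum.
rewrite (rsum_split x us ut st).
have -> : uin (rsum s x + rsum [seq g <- t | g \notin s] x) = uin (rsum s x) + uin (rsum [seq g <- t | g \notin s] x).
  by have := injL 1 (rsum s x) (rsum [seq g <- t | g \notin s] x); rewrite !scale1r.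
by rewrite addrC addKr; exact: posA_rsum.
Qed.
Lemma nF1 g x : nF [:: g] x = nm (x g).
Proof. by rewrite /nF /rsum big_seq1 nm_rip sqrtr_sqr ger0_norm ?nm_ge0. Qed.
Lemma nF_nil x : nF [::] x = 0.
Proof. by rewrite /nF /rsum big_nil nm0 sqrtr0. Qed.

(** ** Square summable sections *)

(** [ub] bounds the norm in the Hilbert module by partial sums, without naming the sum, and [tails]
    is the Cauchy criterion for unconditional convergence of the sum. *)
Definition ub x (M : R) : Prop := forall s, uniq s -> nF s x <= M.
Definition tails x : Prop := forall e : R, 0 < e -> exists s0, uniq s0 /\
  forall s, uniq s -> (forall g, g \in s -> g \notin s0) -> nF s x <= e.

Lemma ub_ge0 x M : ub x M -> 0 <= M.
Proof. by move=> /(_ [::] erefl); rewrite nF_nil. Qed.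
Lemma ubD x y M N : ub x M -> ub y N -> ub (x + y) (M + N).
Proof. by move=> h k s us; apply: le_trans (nFD _ _ _) _; rewrite lerD ?h ?k. Qed.
Lemma ubZ c x M : ub x M -> ub (c *: x) (nm c * M).
Proof. by move=> h s us; apply: le_trans (nFZ _ _ _) _; rewrite ler_wpM2l ?nm_ge0 ?h. Qed.
Lemma ub_le x M N : M <= N -> ub x M -> ub x N.
Proof. by move=> MN h s us; apply: le_trans (h s us) MN. Qed.
Lemma ub0 : ub 0 0.
Proof.
move=> s us; have := nFZ s 0 0; rewrite scale0r nm0 mul0r; exact.
Qed.

Let Fs (F : {fset G}) : uniq F. Proof. exact: fset_uniq. Qed.

Lemma l2_sum_near x a (e : R) : l2_sum x a -> 0 < e -> exists s0, uniq s0 /\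
  forall s, uniq s -> {subset s0 <= s} -> nm (a - rsum s x) <= e.
Proof.
move=> ha e0; have e1 : 0 < rc e by rewrite -rc0 rc_lt.
have [F0 hF] := ha _ e1; exists (F0 : seq G); split; first exact: Fs.
move=> s us F0s; pose F : {fset G} := [fset g in s]%fset.
have sub : (F0 `<=` F)%fset by apply/fsubsetP => g gF; rewrite in_fset F0s.
have := hF F sub; rewrite normE rc_lt => /ltW.
suff -> : \sum_(g <- F) rip (x g) (x g) = rsum s x by [].
by apply: rsum_perm; apply: uniq_perm => // g; rewrite in_fset.
Qed.
Lemma l2_sum_ub x a : l2_sum x a -> ub x (Num.sqrt (nm a)).
Proof.
move=> ha s us; rewrite /nF ler_psqrt ?nnegrE ?nm_ge0//; apply: ler_eps => e e0.
have [s0 [us0 h0]] := l2_sum_near ha e0.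
have := h0 (undup (s0 ++ s)) (undup_uniq _) _.
have h1 : {subset s <= undup (s0 ++ s)} by move=> g gs; rewrite mem_undup mem_cat gs orbT.
have h2 : {subset s0 <= undup (s0 ++ s)} by move=> g gs; rewrite mem_undup mem_cat gs.
move=> /(_ h2); have := nF_mono x us (undup_uniq _) h1; set u := undup _.
rewrite /nF ler_psqrt ?nnegrE ?nm_ge0// => h3 h4.
have := nmB a (a - rsum u x); have -> : a - (a - rsum u x) = rsum u x by lmod.
by lra.
Qed.
Lemma l2_sum_le x a M : l2_sum x a -> ub x M -> nm a <= M ^+ 2.
Proof.
move=> ha hM; apply: ler_eps => e e0; have [s0 [us0 h0]] := l2_sum_near ha e0.
have := h0 s0 us0 (fun g gs => gs); have := hM s0 us0.
have M0 := ub_ge0 hM => h.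
have : nF s0 x ^+ 2 <= M ^+ 2 by rewrite ler_pXn2r// nnegrE ?nF_ge0.
rewrite nF_sqr; have := nmD (rsum s0 x) (a - rsum s0 x).
by rewrite addrC subrK; lra.
Qed.
Lemma l2_sum_tails x a : l2_sum x a -> tails x.
Proof.
move=> ha e e0; have e2 : 0 < e ^+ 2 / 2 by rewrite divr_gt0// exprn_gt0.
have [s0 [us0 h0]] := l2_sum_near ha e2; exists s0; split => // s us ds.
have ut : uniq (s0 ++ s).
  by rewrite cat_uniq us0 us andbT /=; apply/hasPn => g /ds.
have st : {subset s0 <= s0 ++ s} by move=> g gs; rewrite mem_cat gs.
have := h0 _ ut st; have := h0 _ us0 (fun g gs => gs).
have -> : rsum (s0 ++ s) x = rsum s0 x + rsum s x by rewrite /rsum big_cat.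
move=> h1 h2; apply: sqr_le; first exact: ltW.
rewrite nF_sqr; have := nmB (a - rsum s0 x) (a - (rsum s0 x + rsum s x)).
have -> : a - rsum s0 x - (a - (rsum s0 x + rsum s x)) = rsum s x by lmod.
by lra.
Qed.
Lemma tails_l2_sum x : tails x -> exists a, l2_sum x a.
Proof.
move=> tx; have tn n : exists s0, uniq s0 /\
    forall s, uniq s -> (forall g, g \in s -> g \notin s0) -> nF s x <= einv R n.
  by apply: tx; exact: einv_gt0.
have /choice [t ht] := tn.
have ut n : uniq (t n) by case: (ht n).
have near n s : uniq s -> {subset t n <= s} -> nm (rsum s x - rsum (t n) x) <= einv R n.
  move=> us sub; rewrite (rsum_split x (ut n) us sub) addrC addKr -nF_sqr.
  have [_ /(_ [seq g <- s | g \notin t n]) h] := ht n.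
  have := h (filter_uniq _ us) _; have := nF_ge0 [seq g <- s | g \notin t n] x.
  have := @einv_le1 R n; have := @einv_gt0 R n => e1 e2 e3 e4.
  have : nF [seq g <- s | g \notin t n] x <= einv R n.
    by apply: e4 => g; rewrite mem_filter => /andP[].
  by set v := nF _ _ in e3 *; set w := einv R n in e1 e2 *; nra.
have [|a ha] := @cauchys_cvgs R (A 1%g) (fun n => rsum (t n) x).
  move=> e e0; have e2 : 0 < e / 2 by lra.
  have [N hN] := near_inv e2; exists N => m n hm hn.
  pose u := undup (t m ++ t n).
  have h1 : {subset t m <= u} by move=> g gs; rewrite mem_undup mem_cat gs.
  have h2 : {subset t n <= u} by move=> g gs; rewrite mem_undup mem_cat gs orbT.
  have := near m u (undup_uniq _) h1; have := near n u (undup_uniq _) h2.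
  have := hN m hm; have := hN n hn.
  have := nmB (rsum u x - rsum (t n) x) (rsum u x - rsum (t m) x); rewrite /dn.
  have -> : rsum u x - rsum (t n) x - (rsum u x - rsum (t m) x) = rsum (t m) x - rsum (t n) x by lmod.
  by lra.
exists a => e /gt0_rc [r r0 ->]; have r2 : 0 < r / 3 by lra.
have [N hN] := near_inv r2; have [N' hN'] := ha _ r2.
pose n := maxn N N'; exists [fset g in t n]%fset => F /fsubsetP sub.
have sub' : {subset t n <= F} by move=> g gt; apply: sub; rewrite in_fset.
rewrite normE rc_lt -[\sum_(g <- F) _]/(rsum F x).
have := near n F (Fs F) sub'; have := hN n (leq_maxl _ _); have := hN' n (leq_maxr _ _); rewrite /dn.
have := nmB (rsum (t n) x - rsum F x) (rsum (t n) x - a).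
have -> : rsum (t n) x - rsum F x - (rsum (t n) x - a) = a - rsum F x by lmod.
by rewrite (nmBC (rsum (t n) x)); lra.
Qed.
Lemma tails_ub x : tails x -> exists M, ub x M.
Proof. by move=> /tails_l2_sum [a /l2_sum_ub h]; eexists; exact: h. Qed.
Lemma tails_lin c x y : tails x -> tails y -> tails (c *: x + y).
Proof.
move=> hx hy e e0; have k0 : 0 < nm c + 1 by have := nm_ge0 c; lra.
have e2 : 0 < e / 2 by lra.
have [s [us h]] := hx _ (divr_gt0 e2 k0); have [t [ut k]] := hy _ e2.
exists (undup (s ++ t)); split; first exact: undup_uniq.
move=> r ur dr; apply: le_trans (nFD _ _ _) _.
have d1 g : g \in r -> g \notin s by move=> /dr; rewrite mem_undup mem_cat negb_or => /andP[].
have d2 g : g \in r -> g \notin t by move=> /dr; rewrite mem_undup mem_cat negb_or => /andP[].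
have := h r ur d1; have := k r ur d2; have := nFZ r c x.
set d := e / 2 / _; have dE : d * (nm c + 1) = e / 2 by rewrite /d divfK// gt_eqF.
have d0 : 0 < d by rewrite !divr_gt0.
by have := nF_ge0 r x; have := nm_ge0 c; nra.
Qed.
Lemma tails_lim x : (forall e : R, 0 < e -> exists y, tails y /\ ub (x - y) e) -> tails x.
Proof.
move=> h e e0; have e2 : 0 < e / 2 by lra.
have [y [ty hy]] := h _ e2; have [s [us hs]] := ty _ e2; exists s; split => // t ut dt.
have -> : x = (x - y) + y by rewrite subrK.
by apply: le_trans (nFD _ _ _) _; have := hy t ut; have := hs t ut dt; lra.
Qed.

Section H.
Variable H : {pred G}.
Definition l2m x : Prop := (forall g, g \notin H -> x g = 0) /\ tails x.
Lemma l2mP x : l2_module H x <-> l2m x.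
Proof.
split=> [[h [a ha]]|[h tx]]; split => //; first exact: l2_sum_tails ha.
exact: tails_l2_sum.
Qed.
Lemma l2m_lin c x y : l2m x -> l2m y -> l2m (c *: x + y).
Proof.
move=> [h tx] [k ty]; split; last exact: tails_lin.
by move=> g gH; rewrite -[LHS]/(c *: x g + y g) h// k// scaler0 addr0.
Qed.
Lemma tails_0 : tails 0.
Proof. by move=> e e0; exists [::]; split => // s us _; apply: le_trans (ub0 us) (ltW e0). Qed.
Lemma l2m_0 : l2m 0.
Proof. by split => //; exact: tails_0. Qed.
Lemma l2m_B x y : l2m x -> l2m y -> l2m (x - y).
Proof. by move=> hx hy; rewrite addrC -scaleN1r; exact: l2m_lin. Qed.

(** [opnorm_le] with real constants and bounds of vectors in place of sums; it also contains the
    invariance of the module, so that such operators can be composed. *)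
Definition opb (T : S -> S) (c : R) : Prop :=
  0 <= c /\ forall x, l2m x -> l2m (T x) /\ forall M, ub x M -> ub (T x) (c * M).

Lemma opnorm_opb (T : S -> S) c : (forall x, l2m x -> l2m (T x)) -> opnorm_le H T (rc c) -> opb T c.
Proof.
move=> hT [c0 h]; have {}c0 : 0 <= c by rewrite -rc_le rc0.
split => // x lx; split => [|M hM]; first exact: hT.
have [a [b [ha hb]]] := h x (iffRL (l2mP x) lx).
rewrite !normE -rcX -rcM rc_le => hab s us.
apply: sqr_le; first by rewrite mulr_ge0// (ub_ge0 hM).
have := l2_sum_ub hb us; have := l2_sum_le ha hM; rewrite exprMn => h1 h2.
have : nF s (T x) ^+ 2 <= nm b.
  by rewrite -[leRHS]sqr_sqrtr ?nm_ge0// ler_pXn2r ?nnegrE ?nF_ge0 ?sqrtr_ge0.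
move=> h3; apply: le_trans h3 _; apply: le_trans hab _; rewrite ler_wpM2l ?sqr_ge0//.
Qed.
Lemma opb_opnorm (T : S -> S) c : opb T c -> opnorm_le H T (rc c).
Proof.
move=> [c0 h]; split; first by rewrite -rc0 rc_le.
move=> x /l2mP lx; have [lT hT] := h x lx.
have [_ [a ha]] := iffRL (l2mP x) lx; have [_ [b hb]] := iffRL (l2mP _) lT.
exists a, b; split => //; rewrite !normE -rcX -rcM rc_le.
have := l2_sum_le hb (hT _ (l2_sum_ub ha)).
by rewrite exprMn sqr_sqrtr ?nm_ge0.
Qed.
Lemma opb_le T c d : c <= d -> opb T c -> opb T d.
Proof.
move=> cd [c0 h]; split; first exact: le_trans cd.
move=> x lx; have [l k] := h x lx; split => // M hM; apply: ub_le (k M hM).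
by rewrite ler_wpM2r// (ub_ge0 hM).
Qed.
Lemma opb_comp T U c d : opb T c -> opb U d -> opb (T \o U) (c * d).
Proof.
move=> [c0 h] [d0 k]; split; first exact: mulr_ge0.
move=> x /k [lU hU]; have [lT hT] := h _ lU; split => // M hM.
by rewrite -mulrA; apply: hT; exact: hU.
Qed.
Lemma opb_lin a T U c d : opb T c -> opb U d -> opb (a *: T + U) (nm a * c + d).
Proof.
move=> [c0 h] [d0 k]; split; first by rewrite addr_ge0// mulr_ge0// nm_ge0.
move=> x lx; have [lT hT] := h x lx; have [lU hU] := k x lx; split; first exact: l2m_lin.
move=> M hM; rewrite mulrDl -mulrA; apply: ubD; last exact: hU.
by apply: ubZ; exact: hT.
Qed.
Lemma opb_ext T U c : (forall x, l2m x -> T x = U x) -> opb T c -> opb U c.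
Proof. by move=> e [c0 h]; split => // x lx; rewrite -e//; exact: h. Qed.

Lemma opb_B T U c d : opb T c -> opb U d -> opb (T - U) (c + d).
Proof.
move=> hT hU; have := opb_lin (-1) hU hT; rewrite nmN nm1 mul1r (addrC d).
by apply: opb_ext => x _; rewrite -[LHS]/(-1 *: U x + T x) scaleN1r addrC.
Qed.
Lemma opb_D T U c d : opb T c -> opb U d -> opb (T + U) (c + d).
Proof.
move=> hT hU; have := opb_lin 1 hT hU; rewrite nm1 mul1r.
by apply: opb_ext => x _; rewrite -[LHS]/(1 *: T x + U x) scale1r.
Qed.

(** The limit is taken coordinate by coordinate, in the complete fibres. Finite sets of coordinates
    then transfer the Cauchy estimates to the limit. *)
Lemma opb_complete (T : nat -> S -> S) : (forall n, exists c, opb (T n) c) ->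
  (forall n x, ~ l2m x -> T n x = 0) ->
  (forall e, 0 < e -> exists N, forall m n, (N <= m)%N -> (N <= n)%N -> opb (T m - T n) e) ->
  exists U, [/\ forall x, l2m x -> l2m (U x), forall x, ~ l2m x -> U x = 0 &
    forall e, 0 < e -> exists N, forall n, (N <= n)%N -> opb (U - T n) e].
Proof.
move=> bT mT cT.
have lT n x : l2m x -> l2m (T n x).
  by move=> lx; have [c [_ /(_ x lx) []]] := bT n.
have /choice [U hU] x : exists y : S, (l2m x -> forall g, cvgs (@dn R _) (fun n => T n x g) (y g)) /\ (~ l2m x -> y = 0).
  have [lx|nlx] := pselect (l2m x); last by exists 0.
  have [M hM] := tails_ub lx.2; have M0 := ub_ge0 hM.
  have lim g : exists l, cvgs (@dn R _) (fun n => T n x g) l.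
    apply: cauchys_cvgs => e e0; have k0 : 0 < M + 1 by lra.
    have [N hN] := cT _ (divr_gt0 e0 k0); exists N => m n hm hn.
    have [_ /(_ x lx) [_ /(_ M hM) /(_ [:: g] erefl)]] := hN m n hm hn.
    rewrite nF1 -[(T m - T n) x g]/(T m x g - T n x g) /dn; set d := e / _ => h.
    have dE : d * (M + 1) = e by rewrite /d divfK// gt_eqF.
    have d0 : 0 < d by rewrite divr_gt0.
    by nra.
  exists (fun g => xget 0 [set l | cvgs (@dn R _) (fun n => T n x g) l]); split => // _ g.
  by have [l hl] := lim g; case: xgetP => [y _ //|/(_ l)].
have conv x e : l2m x -> 0 < e -> exists N, forall n, (N <= n)%N -> forall M, ub x M -> ub (U x - T n x) (e * M).
  move=> lx e0; have [N hN] := cT _ e0; exists N => n hn M hM s us; apply: ler_eps => d d0.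
  have [lU _] := hU x; have {}lU := lU lx.
  have [K hK] : exists K, forall m, (K <= m)%N -> nF s (U x - T m x) <= d.
    elim: s d d0 {us} => [|g s IHs] d d0; first by exists 0%N => m _; rewrite nF_nil ltW.
    have d2 : 0 < d / 2 by lra.
    have [K hK] := IHs _ d2; have [K' hK'] := lU g _ d2.
    exists (maxn K K') => m; rewrite geq_max => /andP[/hK h1 /hK'].
    rewrite /dn nmBC -[U x g - T m x g]/((U x - T m x) g) => h2.
    set y := U x - T m x in h1 h2 *; apply: sqr_le; first exact: ltW.
    rewrite nF_sqr /rsum big_cons; apply: le_trans (nmD _ _) _.
    rewrite nm_rip -[\sum_(j <- s) _]/(rsum s y) -nF_sqr.
    by have := nm_ge0 (y g); have := nF_ge0 s y; nra.
  have := hK (maxn K N) (leq_maxl _ _); have := hN (maxn K N) n (leq_maxr _ _) hn; set m := maxn _ _.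
  move=> [_ /(_ x lx) [_ /(_ M hM) /(_ s us)]]; rewrite -[(T m - T n) x]/(T m x - T n x) => h1 h2.
  have -> : U x - T n x = (U x - T m x) + (T m x - T n x) by rewrite addrA subrK.
  by apply: le_trans (nFD _ _ _) _; lra.
have lUx x : l2m x -> l2m (U x).
  move=> lx; have [M hM] := tails_ub lx.2; have M0 := ub_ge0 hM; split.
    move=> g gH; have [lU _] := hU x; apply: cvgs_uniq (lU lx g) _ => e e0; exists 0%N => n _.
    by rewrite /dn (lT n x lx).1// subrr nm0 ltW.
  apply: tails_lim => e e0; have k0 : 0 < M + 1 by lra.
  have [N /(_ N (leqnn _) M hM) h] := conv x _ lx (divr_gt0 e0 k0).
  exists (T N x); split; first exact: (lT N x lx).2.
  apply: ub_le h; set d := e / _; have dE : d * (M + 1) = e by rewrite /d divfK// gt_eqF.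
  have d0 : 0 < d by rewrite divr_gt0.
  by nra.
exists U; split => //; first by move=> x; case: (hU x).
move=> e e0; have e2 : 0 < e / 2 by lra.
have [N hN] := cT _ e2; exists N => n hn; split; first exact: ltW.
move=> x lx; split; first by apply: l2m_B; [exact: lUx|exact: lT].
move=> M hM; have [K hK] := conv x _ lx e2; have M0 := ub_ge0 hM.
have := hN (maxn K N) n (leq_maxr _ _) hn; have := hK (maxn K N) (leq_maxl _ _) M hM; set m := maxn _ _.
move=> h1 [_ /(_ x lx) [_ /(_ M hM) h2]].
have := ubD h1 h2; rewrite -mulrDl (_ : e / 2 + e / 2 = e); last by field.
by rewrite -[(T m - T n) x]/(T m x - T n x) addrA subrK.
Qed.

End H.
End Norms.

(** * The left regular representation *)

Section Left.
Context {R : realType} {G : groupType} {A : fellBundle R G}.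
Local Notation S := (section A).
Local Notation tot := (tot A).
Implicit Types (u v w : tot) (l m : seq tot) (s : seq G).

Definition lsh (h k : G) : G := (h * k)%g.
Lemma lsh_inj h : injective (lsh h). Proof. exact: mulgI. Qed.

Definition Lu u (x : S) : S :=
  fun k => fcast (mulVKg (tag u) k) (fmul (tagged u) (x ((tag u)^-1 * k)%g)).

Lemma tg_Lu u x k : tg (Lu u x k) = tmul u (tg (x ((tag u)^-1 * k)%g)).
Proof. exact: tag_fcast. Qed.
Lemma Lu_lin u : linear (Lu u).
Proof.
move=> c x y; apply: functional_extensionality_dep => k.
by rewrite -[RHS]/(c *: Lu u x k + Lu u y k) /Lu -fcastL -fmulLr.
Qed.
Lemma Lu_add g c (a b : A g) x : Lu (tg (c *: a + b)) x = c *: Lu (tg a) x + Lu (tg b) x.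
Proof.
apply: functional_extensionality_dep => k.
by rewrite -[RHS]/(c *: Lu (tg a) x k + Lu (tg b) x k) /Lu -fcastL -fmulLl.
Qed.
Lemma tg_eq (x : S) g h : g = h -> tg (x g) = tg (x h). Proof. by move=> ->. Qed.
Lemma LuM u v x : Lu (tmul u v) x = Lu u (Lu v x).
Proof.
apply: functional_extensionality_dep => k; apply: tagI; rewrite !tg_Lu tmulA; congr (tmul u (tmul v _)).
by apply: tg_eq; rewrite tag_tmul invgM mulgA.
Qed.

(** A list of homogeneous elements, possibly several in one fibre, represents their sum in the
    algebra of finitely supported sections. Sums, products, adjoints and multiples become operations
    on lists. *)
Definition Lop l (x : S) : S := \sum_(u <- l) Lu u x.
Lemma Lop_lin l : linear (Lop l).
Proof.
move=> c x y; rewrite /Lop scaler_sumr -big_split; apply: eq_bigr => u _ /=.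
exact: Lu_lin.
Qed.
Lemma Lop_cat l m x : Lop (l ++ m) x = Lop l x + Lop m x.
Proof. by rewrite /Lop big_cat. Qed.
Lemma Lop_cons u l x : Lop (u :: l) x = Lu u x + Lop l x.
Proof. by rewrite /Lop big_cons. Qed.

Definition lmulL l m : seq tot := [seq tmul u v | u <- l, v <- m].
Lemma Lop_mul l m x : Lop (lmulL l m) x = Lop l (Lop m x).
Proof.
rewrite /Lop /lmulL big_allpairs_dep; apply: eq_bigr => u _ /=.
rewrite (lin_sum (Lu_lin u)); apply: eq_bigr => v _; exact: LuM.
Qed.
Definition cs (c : R[i]) u : tot := tg (c *: tagged u).
Lemma Lu_cs c u x : Lu (cs c u) x = c *: Lu u x.
Proof.
case: u => g a; have := Lu_add c a 0 x; rewrite addr0 /cs /= => ->.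
suff -> : Lu (tg (0 : A g)) x = 0 by rewrite addr0.
by have := Lu_add (-1) (0 : A g) 0 x; rewrite scaler0 addr0 scaleN1r addNr.
Qed.
Lemma Lop_cs c l x : Lop (map (cs c) l) x = c *: Lop l x.
Proof. by rewrite /Lop big_map scaler_sumr; apply: eq_bigr => u _; exact: Lu_cs. Qed.

(** ** Action of the unitization on the fibres *)

Definition dact g (d : uni A) (x : A g) : A g := d.1 *: x + lact d.2 x.
Lemma lact_M g (a b : A 1%g) (x : A g) : lact (mul1 a b) x = lact a (lact b x).
Proof. by apply: tagI; rewrite !T_lact T_mul1 tmulA. Qed.
Lemma lactLl g c (a b : A 1%g) (x : A g) : lact (c *: a + b) x = c *: lact a x + lact b x.
Proof. by rewrite /lact fmulLl fcastL. Qed.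
Lemma lact0 g (x : A g) : lact 0 x = 0.
Proof. by have := lactLl (-1) 0 0 x; rewrite scaler0 addr0 scaleN1r addNr. Qed.
Lemma lact0r g (a : A 1%g) : lact a (0 : A g) = 0.
Proof. by have := lactL a (-1) (0 : A g) 0; rewrite scaler0 addr0 scaleN1r addNr. Qed.
Lemma lactZl g c (a : A 1%g) (x : A g) : lact (c *: a) x = c *: lact a x.
Proof. by have := lactLl c a 0 x; rewrite lact0 !addr0. Qed.
Lemma lactDl g (a b : A 1%g) (x : A g) : lact (a + b) x = lact a x + lact b x.
Proof. by have := lactLl 1 a b x; rewrite !scale1r. Qed.
Lemma dact_M g (d e : uni A) (x : A g) : dact (d * e) x = dact d (dact e x).
Proof.
rewrite /dact /= (lactL d.2) (lactDl _ (bm d.2 e.2)) lactLl (lactZl e.1 d.2) lact_M -addrA.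
exact: pu_M_aux.
Qed.
Lemma ripLl g c (x y z : A g) : rip (c *: y + z) x = c^* *: rip y x + rip z x.
Proof. rewrite -rip_star ripL -(rip_star x y) -(rip_star x z).
exact: (@bsL R (fib1 A) c (rip x y) (rip x z)). Qed.
Lemma rip_dact g (d : uni A) (x y : A g) : rip (dact d x) y = rip x (dact (star d) y).
Proof. by rewrite /dact ripLl rip_lact ripL. Qed.
Lemma rip0l g (x : A g) : rip 0 x = 0.
Proof. by have := ripLl (-1) x 0 0; rewrite scaler0 addr0 rmorphN rmorph1 scaleN1r addNr. Qed.

Lemma rip0r g (x : A g) : rip x 0 = 0.
Proof. by have := ripL (-1) x 0 0; rewrite scaler0 addr0 scaleN1r addNr. Qed.
Lemma ripZ g c (x y : A g) : rip x (c *: y) = c *: rip x y.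
Proof. by have := ripL c x y 0; rewrite rip0r !addr0. Qed.

(** For [z = u y], take [w = s y] with [s^2 = |u|^2 - u^* u] in the unitization of the unit
    fibre. *)
Lemma rip_le u g (y : A g) k (z : A k) : tg z = tmul u (tg y) ->
  exists w : A g, rip z z = rc (nmt u ^+ 2) *: rip y y - rip w w.
Proof.
move=> ez; pose a : A 1%g := fibre 1%g (tmul (tstar u) u).
have t1 : tag (tmul (tstar u) u) = 1%g by rewrite tag_tmul tag_tstar mulVg.
have Ta : tg a = tmul (tstar u) u by rewrite fibreK.
have na : nm a = nmt u ^+ 2 by rewrite -[nm a]/(nmt (tg a)) Ta nmt_starmul.
have sa : star (uin a) = uin a.
  by rewrite -inj_star; congr uin; apply: tagI; rewrite T_star1 Ta tstarM tstarK.
have ps : pos (rc (nmt u ^+ 2) *: 1 - uin a) by apply: pos_nrm => //; rewrite nrm_inj na.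
have [s [ss sE _ _]] := sqrt_pos ps.
exists (dact s y); rewrite rip_dact ss -dact_M sE.
have -> : dact (rc (nmt u ^+ 2) *: 1 - uin a) y = rc (nmt u ^+ 2) *: y - lact a y.
  have -> : rc (nmt u ^+ 2) *: 1 - uin a = ((rc (nmt u ^+ 2) : R[i]^o), - a) :> uni A.
    by apply: unz_eq; rewrite /= ?subr0 ?scaler0 ?sub0r// [_ *: _]mulr1.
  by rewrite /dact /= -scaleN1r lactZl scaleN1r.
have -> : rip y (rc (nmt u ^+ 2) *: y - lact a y) = rc (nmt u ^+ 2) *: rip y y - rip y (lact a y).
  by rewrite addrC -scaleN1r ripL scaleN1r ripZ addrC.
rewrite opprB addrC subrK; apply: tagI.
by rewrite !T_rip T_lact Ta ez tstarM !tmulA.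
Qed.

Lemma quad_le (p : irrep A) (xi : irrep_space p) u g (y : A g) k (z : A k) : tg z = tmul u (tg y) ->
  re (hip xi (p (rip z z) xi)) <= nmt u ^+ 2 * re (hip xi (p (rip y y) xi)).
Proof.
move=> /rip_le [w ->]; rewrite irr_B irr_Z hiprB hiprZ reB reZ.
by have := pu_pos xi (posA_rip w); rewrite pu_inj; lra.
Qed.

Lemma quad_ge0 (p : irrep A) (xi : irrep_space p) g (y : A g) : 0 <= re (hip xi (p (rip y y) xi)).
Proof. by have := pu_pos xi (posA_rip y); rewrite pu_inj. Qed.

Lemma nF_Lu u (x : S) s : nF s (Lu u x) <= nmt u * nF (map (lsh (tag u)^-1%g) s) x.
Proof.
apply: nF_le => [|p xi xn]; first by rewrite mulr_ge0 ?nF_ge0 ?nmt_ge0.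
apply: (@le_trans _ _ (nmt u * @ipn R (secIP xi (map (lsh (tag u)^-1%g) s)) x)); last first.
  by rewrite ler_wpM2l ?nmt_ge0 ?nF_ge.
apply: sqr_le; first by rewrite mulr_ge0 ?ipn_ge0 ?nmt_ge0.
rewrite exprMn !ipn_sqr /= !re_sum big_map mulr_sumr; apply: ler_sum => k _.
by apply: quad_le; exact: tg_Lu.
Qed.

Lemma tails_Lu u (x : S) : tails x -> tails (Lu u x).
Proof.
move=> tx e e0; have k0 : 0 < nmt u + 1 by have := nmt_ge0 u; lra.
have [s0 [us0 h]] := tx _ (divr_gt0 e0 k0).
exists (map (lsh (tag u)) s0); split; first by rewrite map_inj_uniq//; exact: lsh_inj.
move=> s us ds; apply: le_trans (nF_Lu _ _ _) _.
have := h (map (lsh (tag u)^-1%g) s) _ _.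
rewrite map_inj_uniq => [/(_ us)|]; last exact: lsh_inj.
set d := e / _; have dE : d * (nmt u + 1) = e by rewrite /d divfK// gt_eqF.
have d0 : 0 < d by rewrite divr_gt0.
have q g : g \in map (lsh (tag u)^-1%g) s -> g \notin s0.
  move=> /mapP[k ks ->]; apply/negP => hk; move/negP: (ds k ks); apply.
  by apply/mapP; exists ((tag u)^-1 * k)%g; rewrite // /lsh mulVKg.
move=> /(_ q); have := nmt_ge0 u; set t := map _ s; have := nF_ge0 t x; nra.
Qed.

Lemma Lop_l2m (H : {pred G}) l x : (forall h k, h \in H -> k \in H -> (h^-1 * k)%g \in H) ->
  (forall u, List.In u l -> tag u \in H) -> l2m H x -> l2m H (Lop l x).
Proof.
move=> HV tl [h tx]; elim: l tl => [|u l IHl] tl.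
  by rewrite /Lop big_nil; exact: l2m_0.
rewrite Lop_cons -[Lu u x]scale1r; apply: l2m_lin; last by apply: IHl => v vl; apply: tl; right.
split; last exact: tails_Lu.
move=> g gH; rewrite /Lu h ?fmul0r ?fcast0//; apply: contra gH => k.
have uH : tag u \in H by apply: tl; left.
have H1 : 1%g \in H by rewrite -(mulVg (tag u)); exact: HV.
have uV : (tag u)^-1%g \in H by rewrite -[_^-1%g]mulg1; exact: HV.
by rewrite -(mulVKg (tag u) g) -{1}(invgK (tag u)); exact: HV.
Qed.

Definition lam (H : {pred G}) l (x : S) : S := if `[< l2m H x >] then Lop l x else 0.
Lemma lamE (H : {pred G}) l x : l2m H x -> lam H l x = Lop l x.
Proof. by move=> h; rewrite /lam asboolT. Qed.
Lemma lam_out (H : {pred G}) l x : ~ l2m H x -> lam H l x = 0.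
Proof. by move=> h; rewrite /lam asboolF. Qed.

(** ** Finitely supported sections *)

Definition fpred : {pred S} := fun x => `[< exists s, forall g, g \notin s -> x g = 0 >].
Lemma fpred_submod : submod_closed fpred.
Proof.
split; first by apply/asboolP; exists [::].
move=> c x y /asboolP[s hs] /asboolP[t ht]; apply/asboolP; exists (s ++ t) => g.
rewrite mem_cat negb_or => /andP[/hs a /ht b].
by rewrite -[LHS]/(c *: x g + y g) a b scaler0 addr0.
Qed.
HB.instance Definition _ := GRing.isSubmodClosed.Build _ _ fpred fpred_submod.
Record fsec := FSec { fs :> S; fsP : fs \in fpred }.
HB.instance Definition _ := [isSub for fs].
HB.instance Definition _ := [Choice of fsec by <:].
HB.instance Definition _ := [SubChoice_isSubLmodule of fsec by <:].

Lemma fs_eq (x y : fsec) : (forall g, fs x g = fs y g) -> x = y.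
Proof. by move=> h; apply: val_inj; exact: functional_extensionality_dep. Qed.
Definition supp (x : fsec) : seq G := undup (xget [::] [set s : seq G | forall g, g \notin s -> fs x g = 0]).
Lemma suppP (x : fsec) g : g \notin supp x -> fs x g = 0.
Proof.
rewrite mem_undup; have /asboolP [s hs] := fsP x.
by case: xgetP => [t _ ht|/(_ s)]; [exact: ht|].
Qed.
Lemma supp_uniq (x : fsec) : uniq (supp x). Proof. exact: undup_uniq. Qed.

Lemma sum_supp (V : nmodType) (F : G -> V) s t : uniq s -> uniq t -> {subset s <= t} ->
  (forall g, g \notin s -> F g = 0) -> \sum_(g <- t) F g = \sum_(g <- s) F g.
Proof.
move=> us ut st h; rewrite (bigID (mem s)) /= [X in _ + X]big1 ?addr0; last by move=> g /h.
rewrite -big_filter; apply: perm_big; apply: uniq_perm; rewrite ?filter_uniq// => g.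
by rewrite mem_filter; case: (boolP (g \in s)) => // /st ->.
Qed.

Section States.
Variables (p : irrep A) (xi : irrep_space p).

Let fip (x y : fsec) := \sum_(g <- supp x) hip xi (p (rip (fs x g) (fs y g)) xi).
Let fipE (x y : fsec) s : uniq s -> (forall g, g \notin s -> fs x g = 0) ->
  fip x y = \sum_(g <- s) hip xi (p (rip (fs x g) (fs y g)) xi).
Proof.
move=> us hs; pose t := undup (supp x ++ s).
have z g : fs x g = 0 -> hip xi (p (rip (fs x g) (fs y g)) xi) = 0 by move=> ->; rewrite rip0l irr_0 hipr0.
transitivity (\sum_(g <- t) hip xi (p (rip (fs x g) (fs y g)) xi)).
  apply/esym; apply: sum_supp; rewrite ?supp_uniq ?undup_uniq//.
    by move=> g gs; rewrite mem_undup mem_cat gs.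
  by move=> g /suppP /z.
apply: sum_supp; rewrite ?undup_uniq//.
  by move=> g gs; rewrite mem_undup mem_cat gs orbT.
by move=> g /hs /z.
Qed.

Definition fsIP : semiIP R.
Proof.
refine (@SemiIP R fsec fip _ _ _).
- move=> x c y z; rewrite /fip mulr_sumr -big_split; apply: eq_bigr => g _ /=.
  transitivity (hip xi (p (rip (fs x g) (c *: fs y g + fs z g)) xi)); first by [].
  by rewrite ripL irr_L hiprD hiprZ.
- move=> x y; pose t := undup (supp x ++ supp y).
  have ut : uniq t by exact: undup_uniq.
  rewrite (fipE x ut) ?(fipE y ut).
  + rewrite rmorph_sum; apply: eq_bigr => g _ /=.
    by rewrite -hip_conj -irr_S rip_star.
  + by move=> g; rewrite mem_undup mem_cat negb_or => /andP[/suppP].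
  + by move=> g; rewrite mem_undup mem_cat negb_or => /andP[_ /suppP].
- move=> x; rewrite /fip re_sum; apply: sumr_ge0 => g _; exact: quad_ge0.
Defined.

Lemma fsIP_on (x y : fsIP) s : uniq s -> (forall g, g \notin s -> fs x g = 0) ->
  ip x y = \sum_(g <- s) hip xi (p (rip (fs x g) (fs y g)) xi).
Proof. exact: fipE. Qed.

Lemma fsIP_sqr (x : fsIP) s : uniq s -> (forall g, g \notin s -> fs x g = 0) ->
  ipn x ^+ 2 = \sum_(g <- s) re (hip xi (p (rip (fs x g) (fs x g)) xi)).
Proof. by move=> us hs; rewrite ipn_sqr (fsIP_on x us hs) re_sum. Qed.

End States.

Lemma Lu_in u (x : fsec) : Lu u x \in fpred.
Proof.
apply/asboolP; exists (map (lsh (tag u)) (supp x)) => g gn; rewrite /Lu suppP ?fmul0r ?fcast0//.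
apply: contra gn => h; apply/mapP; exists ((tag u)^-1 * g)%g; rewrite // /lsh mulVKg //.
Qed.
Definition Lf u (x : fsec) : fsec := FSec (Lu_in u x).
Definition Lopf l (x : fsec) : fsec := \sum_(u <- l) Lf u x.
Lemma fs_sum I (r : seq I) (F : I -> fsec) : fs (\sum_(i <- r) F i) = \sum_(i <- r) fs (F i).
Proof. by elim: r => [|i r IHr]; rewrite ?big_nil// !big_cons -IHr. Qed.
Lemma LopfE l (x : fsec) : fs (Lopf l x) = Lop l x.
Proof. by rewrite /Lopf fs_sum. Qed.
Lemma Lopf_lin l : linear (Lopf l).
Proof. by move=> c x y; apply: val_inj; rewrite /= !LopfE; exact: Lop_lin. Qed.

Section StatesL.
Variables (p : irrep A) (xi : irrep_space p).
Local Notation V := (fsIP xi).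

Lemma Lf_adj u (x y : V) : ip (Lf u x : V) y = ip x (Lf (tstar u) y : V).
Proof.
rewrite (@fsIP_on p xi (Lf u x) y (map (lsh (tag u)) (supp x))).
- rewrite (@fsIP_on p xi x _ (supp x)) ?supp_uniq//; last by move=> g /suppP.
  rewrite big_map; apply: eq_bigr => g _; congr (hip xi (p _ xi)); apply: tagI.
  rewrite !T_rip /= !tg_Lu tstarM tmulA; congr (tmul (tstar _) (tmul _ _)).
    by apply: tg_eq; rewrite mulKg.
  by apply: tg_eq; rewrite tag_tstar invgK.
- by rewrite map_inj_uniq ?supp_uniq//; exact: lsh_inj.
- move=> g gn; rewrite /= /Lu suppP ?fmul0r ?fcast0//.
  apply: contra gn => h; apply/mapP; exists ((tag u)^-1 * g)%g; rewrite // /lsh mulVKg //.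
Qed.
Lemma Lf_le u (x : V) : ipn (Lf u x : V) <= nmt u * ipn x.
Proof.
apply: sqr_le; first by rewrite mulr_ge0 ?ipn_ge0 ?nmt_ge0.
rewrite exprMn (@fsIP_sqr p xi (Lf u x) (map (lsh (tag u)) (supp x))).
- rewrite (@fsIP_sqr p xi x (supp x)) ?supp_uniq//; last by move=> g /suppP.
  rewrite big_map mulr_sumr; apply: ler_sum => g _; apply: quad_le.
  rewrite /= tg_Lu; congr (tmul _ _); by apply: tg_eq; rewrite mulKg.
- by rewrite map_inj_uniq ?supp_uniq//; exact: lsh_inj.
- move=> g gn; rewrite /= /Lu suppP ?fmul0r ?fcast0//.
  apply: contra gn => h; apply/mapP; exists ((tag u)^-1 * g)%g; rewrite // /lsh mulVKg //.
Qed.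
Lemma Lopf_adj l (x y : V) : ip (Lopf l x : V) y = ip x (Lopf (map (@tstar R G A) l) y : V).
Proof.
rewrite /Lopf big_map; elim: l => [|u l IHl]; first by rewrite !big_nil ipl0 ipr0.
by rewrite !big_cons (iplD y (Lf u x : V)) (iprD x (Lf (tstar u) y : V)) Lf_adj IHl.
Qed.
Lemma Lopf_le l (x : V) : ipn (Lopf l x : V) <= (\sum_(u <- l) nmt u) * ipn x.
Proof.
rewrite /Lopf; elim: l => [|u l IHl]; first by rewrite !big_nil ipn0 mul0r.
rewrite !big_cons mulrDl; apply: le_trans (ipnD (Lf u x : V) _) _; rewrite lerD//; exact: Lf_le.
Qed.

Lemma fsIP_ub (x : V) M : nm xi = 1 -> ub (x : fsec) M -> ipn x <= M.
Proof.
move=> xn hM; apply: le_trans (hM _ (supp_uniq x)); apply: le_trans (nF_ge _ _ xn).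
apply: sqr_le; first exact: ipn_ge0.
rewrite (@fsIP_sqr p xi x (supp x)) ?supp_uniq//; last by move=> g /suppP.
Qed.
End StatesL.

Lemma ub_fsIP (x : fsec) M : 0 <= M ->
  (forall (p : irrep A) (xi : irrep_space p), nm xi = 1 -> ipn (x : fsIP xi) <= M) -> ub x M.
Proof.
move=> M0 h s us; apply: nF_le => // p xi xn; apply: le_trans (h p xi xn).
apply: sqr_le; first exact: ipn_ge0.
pose t := undup (s ++ supp x).
rewrite (@fsIP_sqr p xi x t) ?undup_uniq//; last first.
  by move=> g; rewrite mem_undup mem_cat negb_or => /andP[_ /suppP].
rewrite ipn_sqr /= re_sum [leRHS](bigID (mem s)) /=.
have -> : \sum_(g <- s) re (hip xi (p (rip (fs x g) (fs x g)) xi)) = \sum_(g <- t | g \in s) re (hip xi (p (rip (fs x g) (fs x g)) xi)).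
  rewrite -[RHS]big_filter; apply: perm_big; apply: uniq_perm; rewrite ?filter_uniq ?undup_uniq// => g.
  by rewrite mem_filter mem_undup mem_cat; case: (g \in s).
by rewrite lerDl; apply: sumr_ge0 => g _; exact: quad_ge0.
Qed.

(* truncation to the finitely many coordinates on which the values of [Lop l x]
   in [s] depend *)
Lemma opb_phi (H : {pred G}) l (c : R) : (forall h k, h \in H -> k \in H -> (h^-1 * k)%g \in H) ->
  (forall u, List.In u l -> tag u \in H) -> 0 <= c ->
  (forall (p : irrep A) (xi : irrep_space p) (x : fsIP xi), ipn (Lopf l x : fsIP xi) <= c * ipn x) ->
  opb H (lam H l) c.
Proof.
move=> HV tl c0 hc; split => // x lx; rewrite lamE//; split; first exact: Lop_l2m.
move=> M hM s us; have M0 := ub_ge0 hM.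
pose E := flatten [seq map (lsh (tag u)^-1%g) s | u <- l].
pose x0 : S := fun g => if g \in E then x g else 0.
have x0P : x0 \in fpred by apply/asboolP; exists E => g /negPf; rewrite /x0 => ->.
pose x1 := FSec x0P.
have -> : nF s (Lop l x) = nF s (Lopf l x1).
  rewrite LopfE; apply: nF_eq => g gs; rewrite /Lop.
  have sumE (F : tot -> S) r : (\sum_(u <- r) F u) g = \sum_(u <- r) F u g.
    by elim: r => [|v r IHr]; rewrite ?big_nil// !big_cons -IHr.
  rewrite !sumE; apply: big_eq_In => u ul; rewrite /Lu /= /x0.
  case: ifPn => //; have -> // : ((tag u)^-1 * g)%g \in E.
  rewrite /E; elim: (l) ul => // v r IHr /=; rewrite mem_cat => -[->|/IHr ->]; last by rewrite orbT.
  by rewrite (map_f (lsh (tag u)^-1%g) gs).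
have hx1 : ub x1 M.
  move=> t ut; apply: le_trans (hM [seq g <- t | g \in E] (filter_uniq _ ut)).
  suff -> : nF t x1 = nF [seq g <- t | g \in E] x by [].
  rewrite /nF /rsum [X in nm X](bigID (mem E)) /= [X in _ + X]big1 ?addr0; last first.
    by move=> g /negPf gE; rewrite /x0 gE rip0l.
  by rewrite -big_filter; congr (Num.sqrt (nm _)); apply: eq_big_seq => g; rewrite mem_filter => /andP[gE _]; rewrite /x0 gE.
apply: (ub_fsIP (x := Lopf l x1)) us; first by rewrite mulr_ge0.
move=> p xi xn; apply: le_trans (hc p xi x1) _; rewrite ler_wpM2l//.
exact: (fsIP_ub (x := x1)).
Qed.

(** ** Lists and finitely supported functions *)

Lemma convE (f x : S) s k : uniq s -> (forall g, g \notin s -> f g = 0) ->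
  Defs.conv f x k = \sum_(h <- s) Lu (tg (f h)) x k.
Proof.
move=> us hs; rewrite /Defs.conv (fsbigE s)//.
  by apply: eq_big => // h; rewrite mem_set.
by move=> i _ /hs ->; rewrite fmul0l fcast0.
Qed.

Lemma left_reg_conv (H : {pred G}) (f : S) l : (forall x, Defs.conv f x = Lop l x) -> left_reg H f = lam H l.
Proof.
move=> h; apply/funext => x; rewrite /left_reg /lam h.
by congr (if _ then _ else _); apply/asbool_equiv_eq; exact: l2mP.
Qed.

Lemma Lop_app l x k : Lop l x k = \sum_(u <- l) Lu u x k.
Proof. by rewrite /Lop; elim: l => [|v r IHr]; rewrite ?big_nil// !big_cons -IHr. Qed.

Lemma list_of_Cc (H : {pred G}) (f : S) : Cc H f -> exists l,
  (forall u, List.In u l -> tag u \in H) /\ left_reg H f = lam H l.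
Proof.
move=> [fH /finite_seqP [s hs]].
have hs' g : g \notin undup s -> f g = 0.
  rewrite mem_undup => /negP gs; apply: contrapT => fg; apply: gs.
  by have : [set` s] g by rewrite -hs.
pose t := [seq g <- undup s | g \in H].
exists (map (fun g => tg (f g)) t); split.
  by move=> u /(@List.in_map_iff _ _ _ _ _) [g [<-]] /= /List.filter_In[_ ->].
apply: left_reg_conv => x; apply: functional_extensionality_dep => k.
rewrite Lop_app big_map; apply: convE; first by rewrite filter_uniq ?undup_uniq.
by move=> g; rewrite mem_filter negb_and => /orP[/fH|/hs'].
Qed.

Lemma Cc_of_list (H : {pred G}) l : (forall u, List.In u l -> tag u \in H) -> exists2 f : S,
  Cc H f & left_reg H f = lam H l.
Proof.
move=> tl; pose f : S := fun k => \sum_(u <- l) fibre k u.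
have tl' u : u \in [pred v | `[< List.In v l >]] -> tag u \in H by move=> /asboolP /tl.
pose s := undup (map tag l).
have fs0 g : g \notin s -> f g = 0.
  rewrite mem_undup => gs; rewrite /f (big_eq_In (F' := fun=> 0)) ?big1// => u ul.
  apply: fibre0 => e; move/negP: gs; apply; rewrite -e.
  by elim: (l) ul => // v r IHr [->|/IHr h]; rewrite inE ?eqxx// h orbT.
exists f.
  split.
    move=> g gH; rewrite /f (big_eq_In (F' := fun=> 0)) ?big1// => u /tl ut.
    by apply: fibre0 => e; move: gH; rewrite -e ut.
  apply: (@sub_finite_set _ _ [set` s]); last exact: finite_seq.
  by move=> g /= fg; apply: contrapT => /negP /fs0.
apply: left_reg_conv => x; apply: functional_extensionality_dep => k.
rewrite (convE x k (undup_uniq _) fs0) Lop_app.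
have e h : Lu (tg (f h)) x k = \sum_(u <- l) Lu (tg (fibre h u)) x k.
  rewrite /f; elim: (l) => [|v r IHr].
    by rewrite !big_nil /Lu fmul0l fcast0.
  rewrite !big_cons -IHr; have := Lu_add 1 (fibre h v) (\sum_(j <- r) fibre h j) x.
  by rewrite !scale1r => ->.
rewrite (eq_bigr _ (fun h _ => e h)) exchange_big /=; apply: big_eq_In => u ul.
have us : tag u \in s.
  rewrite mem_undup; by elim: (l) ul => // v r IHr [->|/IHr h]; rewrite inE ?eqxx// h orbT.
rewrite (bigD1_seq (tag u)) ?undup_uniq//= big1 ?addr0; first by rewrite fibreK.
move=> h hu; rewrite fibre0; first by rewrite /Lu fmul0l fcast0.
by move=> e'; rewrite e' eqxx in hu.
Qed.

Lemma left_reg_unit (H : {pred G}) (f : S) : (forall g, g != 1%g -> f g = 0) ->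
  left_reg H f = lam H [:: tg (f 1%g)].
Proof.
move=> hf; apply: left_reg_conv => x; apply: functional_extensionality_dep => k.
rewrite (convE (s := [:: 1%g]) x k) ?Lop_app ?big_seq1//.
by move=> g; rewrite inE => /hf.
Qed.

End Left.

(** * Bounds for representations by the regular representation *)

Section Paschke.
Context {R : realType} {G : groupType} {A : fellBundle R G}.
Local Notation S := (section A).
Local Notation fsec := (@fsec R G A).

Lemma uin_D (a b : A 1%g) : uin (a + b) = uin a + uin b.
Proof. by have := injL 1 a b; rewrite !scale1r. Qed.
Lemma uin_Z c (a : A 1%g) : uin (c *: a) = c *: uin a.
Proof. by have := injL c a 0; rewrite !addr0. Qed.

Definition ract g (x : A g) (a : A 1%g) : A g := fcast (mulg1 g) (fmul x a).
Lemma T_ract g (x : A g) a : tg (ract x a) = tmul (tg x) (tg a). Proof. exact: tag_fcast. Qed.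
Definition rdact g (d : uni A) (x : A g) : A g := d.1 *: x + ract x d.2.

Lemma ract0 g (a : A 1%g) : ract (0 : A g) a = 0.
Proof. by rewrite /ract fmul0l fcast0. Qed.
Lemma rdact0 g (d : uni A) : rdact d (0 : A g) = 0.
Proof. by rewrite /rdact scaler0 add0r ract0. Qed.

Lemma rip_rdact g (x y : A g) (e : uni A) : uin (rip x (rdact e y)) = uin (rip x y) * e.
Proof.
have -> : rip x (rdact e y) = e.1 *: rip x y + mul1 (rip x y) e.2.
  rewrite /rdact ripL; congr (_ + _); apply: tagI.
  by rewrite T_mul1 !T_rip T_ract tmulA.
by apply: unz_eq; rewrite /= ?mul0r// scale0r add0r.
Qed.
Lemma rdact_rip g (x y : A g) (d e : uni A) : uin (rip (rdact d x) (rdact e y)) = star d * uin (rip x y) * e.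
Proof.
rewrite rip_rdact -(rip_star y (rdact d x)) inj_star rip_rdact starM -inj_star rip_star //.
Qed.

Lemma Rd_in (d : uni A) (x : fsec) : (fun g => rdact d (fs x g)) \in @fpred R G A.
Proof. by apply/asboolP; exists (supp x) => g /suppP ->; exact: rdact0. Qed.
Definition Rd d x : fsec := FSec (Rd_in d x).

Lemma rdact_lin g (d : uni A) : linear (@rdact g d).
Proof.
move=> c x y; rewrite /rdact /ract.
have -> : fcast (mulg1 g) (fmul (c *: x + y) d.2) = c *: fcast (mulg1 g) (fmul x d.2) + fcast (mulg1 g) (fmul y d.2).
  by rewrite fmulLl fcastL.
by lmod.
Qed.

Lemma Lu_Rd u (d : uni A) (x : fsec) k : Lu u (Rd d x) k = rdact d (Lu u x k).
Proof.
apply: tagI; rewrite tg_Lu /= /rdact.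
set y := fs x _; have yE : tg (Lu u x k) = tmul u (tg y) by rewrite tg_Lu.
set z := Lu u x k in yE *.
have -> : tmul u (tg (d.1 *: y + ract y d.2)) = tg (d.1 *: fmul (tagged u) y + fmul (tagged u) (ract y d.2)).
  by rewrite -fmulLr.
have kk : (tag u * ((tag u)^-1 * k) = k)%g by rewrite mulVKg.
have e1 : z = fcast kk (fmul (tagged u) y) by apply: tagI; rewrite tag_fcast yE.
have -> : ract z d.2 = fcast kk (fmul (tagged u) (ract y d.2)).
  apply: tagI; rewrite tag_fcast T_ract yE tmulA.
  by rewrite -[RHS]/(tmul u (tg (ract y d.2))) T_ract.
by rewrite e1 -fcastL tag_fcast.
Qed.

Lemma Lop_Rd l (d : uni A) (x : fsec) : Lopf l (Rd d x) = Rd d (Lopf l x).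
Proof.
apply: fs_eq => k; rewrite LopfE Lop_app -[RHS]/(rdact d (fs (Lopf l x) k)) LopfE Lop_app.
by rewrite (lin_sum (rdact_lin d)); apply: eq_bigr => u _; exact: Lu_Rd.
Qed.

Lemma rsum_Rd (d : uni A) (x : fsec) s : uin (rsum s (Rd d x)) = star d * uin (rsum s x) * d.
Proof.
rewrite /rsum !inj_sum mulr_sumr mulr_suml; apply: eq_bigr => g _; exact: rdact_rip.
Qed.

Lemma ub_on (x : fsec) s : uniq s -> (forall g, g \notin s -> fs x g = 0) -> ub x (nF s x).
Proof.
move=> us hs t ut; pose r := undup (s ++ t).
apply: (@le_trans _ _ (nF r x)).
  by apply: nF_mono; rewrite ?undup_uniq// => g gt; rewrite mem_undup mem_cat gt orbT.
suff e : rsum r x = rsum s x by rewrite /nF e.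
apply: sum_supp; rewrite ?undup_uniq//.
  by move=> g gs; rewrite mem_undup mem_cat gs.
by move=> g /hs ->; rewrite rip0l.
Qed.

Lemma pos_conj (h s : uni A) : pos h -> pos (star s * h * s).
Proof.
move=> /sqrt_pos[r [sr <- _ _]].
have -> : star s * (r * r) * s = star (r * s) * (r * s) by rewrite starM sr !mulrA.
exact: pos_star_mul.
Qed.

(** [s] is the square root of [f = a + e] and [b] its inverse. The inverse of [f] is a Neumann
    series around the scalar [M = nrm a + e]. *)
Lemma inv_sqrt (a : uni A) (e : R) : pos a -> 0 < e -> exists s b : uni A,
  [/\ star s = s, star b = b, s * s = a + rc e *: 1, s * b = 1 & b * s = 1].
Proof.
move=> pa e0; pose f := a + rc e *: 1.
have pf : pos f by apply: posD => //; apply: pos_rc; exact: ltW.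
have [s [ss sE _ _]] := sqrt_pos pf.
have n0 := nrm_ge0 a; pose M := nrm a + e; have M0 : 0 < M by rewrite /M; lra.
pose v := rc M^-1 *: (rc (nrm a) *: 1 - a).
have nv : nrm v < 1.
  rewrite nrmZr ?invr_ge0 ?(ltW M0)// mulrC ltr_pdivrMr// mul1r.
  apply: (@le_lt_trans _ _ (nrm a)); last by rewrite /M; lra.
  apply: pos_le => //; first by apply: pos_nrm => //; exact: pos_sa.
  by have -> : rc (nrm a) *: 1 - (rc (nrm a) *: 1 - a) = a by lmod.
have [u [u1 u2 _]] := neumann nv.
have vE : 1 - v = rc M^-1 *: f.
  have : rc M^-1 *: (rc M *: (1 : uni A)) = 1 by rewrite scalerA -rcM mulVf ?gt_eqF// rc1 scale1r.
  move=> {1}<-; rewrite /v /f /M rcD; lmod.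
pose w := rc M^-1 *: u.
have w1 : w * f = 1 by rewrite /w -scalerAl scalerAr -vE.
have w2 : f * w = 1 by rewrite /w -scalerAr scalerAl -vE.
have sf : star f = f by exact: pos_sa.
have sw : star w = w.
  have : star w * f = 1 by rewrite -{1}sf -starM w2 star_one.
  by move=> h; rewrite -[star w]mulr1 -w2 mulrA h mul1r.
have sb : s * (s * w) = 1 by rewrite mulrA sE.
have bs' : (w * s) * s = 1 by rewrite -mulrA sE.
have e1 : w * s = s * w.
  have : (w * s) * (s * (s * w)) = w * s by rewrite sb mulr1.
  by rewrite (mulrA (w * s)) bs' mul1r => ->.
exists s, (s * w); split => //; first by rewrite starM ss sw e1.
by rewrite -e1.
Qed.

(** Paschke's inequality [<T x | T x> <= c^2 <x | x>] at a vector state. With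
    [b = (<x | x> + e)^(-1/2)] acting from the right, [x b] has norm at most 1 and [T] commutes with
    this action, so [b <T x | T x> b <= c^2]; conjugation by [b^-1] and [e -> 0] give the claim. *)
Lemma opb_state (H : {pred G}) l (c : R) (p : irrep A) (xi : irrep_space p) (x : fsec) :
  opb H (lam H l) c -> (forall g, g \notin H -> fs x g = 0) ->
  ipn (Lopf l x : fsIP xi) <= c * ipn (x : fsIP xi).
Proof.
move=> [c0 hc] xH; pose y := Lopf l x.
pose s := supp x; pose t := supp y.
pose a := rsum s x; pose b0 := rsum t y.
have state (z : fsec) : ipn (z : fsIP xi) ^+ 2 = re (hip xi (p (rsum (supp z) z) xi)).
  rewrite (@fsIP_sqr _ _ _ p xi z (supp z)) ?supp_uniq//; last by move=> g /suppP.
  by rewrite /rsum irr_sum hip_sumr re_sum.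
apply: sqr_le; first by rewrite mulr_ge0// ipn_ge0.
rewrite exprMn !state -/s -/y -/t -/a -/b0.
apply: ler_eps => d d0; have k0 : 0 < c ^+ 2 * nm xi ^+ 2 + 1.
  by have := sqr_ge0 c; have := sqr_ge0 (nm xi); nra.
pose e := d / (c ^+ 2 * nm xi ^+ 2 + 1); have e0 : 0 < e by rewrite divr_gt0.
have dE : e * (c ^+ 2 * nm xi ^+ 2 + 1) = d by rewrite /e divfK// gt_eqF.
have [r [b [sr sb rr rb br]]] := inv_sqrt (posA_rsum s x) e0.
have tl (z : fsec) : tails z.
  move=> f f0; exists (supp z); split; first exact: supp_uniq.
  move=> q uq dq; rewrite (@nF_eq _ _ _ q z 0); first by apply: le_trans (ub0 uq) (ltW f0).
  by move=> g /dq /suppP.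
have lx : l2m H (Rd b x).
  by split; [move=> g gH; rewrite /= xH ?rdact0|exact: tl].
have n1 : nF s (Rd b x) <= 1.
  apply: sqr_le => //; rewrite expr1n nF_sqr -nrm_inj; apply: pos_le => //; first exact: posA_rsum.
  rewrite rsum_Rd sb -[uin (rsum s x)](addrK (rc e *: 1)) -rr.
  have -> : rc 1 *: 1 - b * (r * r - rc e *: 1) * b = rc e *: (b * b).
    by nce; rewrite br mul1r rb; lmod.
  by apply: posZ; [exact: ltW|apply: pos_sq].
have u1 : ub (Rd b x) 1.
  apply: ub_le n1 _; apply: ub_on; first exact: supp_uniq.
  by move=> g /suppP h; rewrite /= h rdact0.
have [_ /(_ 1 u1 t (supp_uniq _))] := hc _ lx.
rewrite lamE// -LopfE Lop_Rd -/y mulr1 => h.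
have h2 : pos (rc (c ^+ 2) *: 1 - b * uin b0 * b).
  rewrite -{1}sb -rsum_Rd; apply: pos_nrm; first by apply: pos_sa; exact: posA_rsum.
  by rewrite nrm_inj -nF_sqr ler_pXn2r// nnegrE nF_ge0.
have := pu_pos xi (pos_conj r h2).
have -> : star r * (rc (c ^+ 2) *: 1 - b * uin b0 * b) * r = rc (c ^+ 2) *: (uin a + rc e *: 1) - uin b0.
  rewrite -rr sr; nce; rewrite rb mul1r -!mulrA br mulr1; lmod.
rewrite pu_B pu_Z pu_D pu_Z pu_1 !pu_inj hiprB hiprZ hiprD hiprZ hipxx !reB reZ reD reZ re_rc.
by have := sqr_ge0 c; nra.
Qed.

End Paschke.

Lemma sum_const_seq (R : realType) (I : Type) (s : seq I) (c : R) : \sum_(i <- s) c = (size s)%:R * c.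
Proof.
elim: s => [|i s IHs]; first by rewrite big_nil mul0r.
by rewrite big_cons IHs /= -natr1 mulrDl mul1r addrC.
Qed.

(** * Foelner sets in cyclic groups *)

Section Foelner.
Context {G : groupType}.

Lemma cyc_bound (g h : G) : cyc g h -> exists N, forall i, (N <= i)%N -> exists2 j, (h * g ^+ i = g ^+ j)%g & (j <= i + N)%N.
Proof.
move=> [n [->|->]]; exists n => i ni.
  by exists (n + i)%N; rewrite ?expgnDr// addnC.
exists (i - n)%N; first by rewrite -{1}(subnKC ni) expgnDr mulgA mulVg mul1g.
by rewrite (leq_trans (leq_subr _ _)) ?leq_addr.
Qed.

Lemma cyc_torsion (g h : G) m : (0 < m)%N -> (g ^+ m = 1)%g -> cyc g h -> exists2 i, (i < m)%N & (h = g ^+ i)%g.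
Proof.
move=> m0 gm ch.
have red n : exists2 i, (i < m)%N & (g ^+ n = g ^+ i)%g.
  exists (n %% m)%N; first by rewrite ltn_mod.
  by rewrite {1}(divn_eq n m) expgnDr mulnC expgnA gm expg1n mul1g.
have [N hN] := cyc_bound ch.
have [j hj _] := hN (N * m)%N (leq_pmulr _ m0).
have [i im e] := red j; exists i => //.
by rewrite -e -hj mulnC expgnA gm expg1n mulg1.
Qed.

(** If [g] has finite order, both sets are the whole subgroup. Otherwise they are the powers with
    exponents in [[0, n + 2 N)] and [[N, N + n)], where [N] bounds the shifts by [E] and
    [n > 2 N / d]. *)
Lemma foelner (R : realType) (g : G) (E : seq G) (d : R) : 0 < d -> (forall h, h \in E -> cyc g h) ->
  exists F F0 : seq G, [/\ uniq F, uniq F0, {subset F0 <= F}, (forall h, h \in F -> cyc g h) &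
    [/\ (0 < size F)%N, (forall h k, h \in E -> k \in F0 -> (h * k)%g \in F) &
    (1 - d) * (size F)%:R <= (size F0)%:R :> R]].
Proof.
move=> d0 cE.
have cX i : cyc g (g ^+ i)%g by exists i; left.
have [[m m0 gm]|inf] := pselect (exists2 m, (0 < m)%N & (g ^+ m = 1)%g).
  have ex : exists m, (0 < m)%N && (g ^+ m == 1)%g by exists m; rewrite m0 gm eqxx.
  case: (ex_minnP ex) => {m0 gm}m /andP[m0 /eqP gm] mmin.
  pose F := map (fun i => g ^+ i)%g (iota 0 m).
  have uF : uniq F.
    rewrite map_inj_in_uniq ?iota_uniq// => i j; rewrite !mem_iota !add0n /= => im jm.
    wlog ij : i j im jm / (i <= j)%N.
      by move=> W e; case/orP: (leq_total i j) => h; [exact: W|apply/esym/W].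
    move=> e; apply/eqP; rewrite eqn_leq ij leqNgt; apply/negP => lt.
    have : (m <= j - i)%N.
      apply: mmin; rewrite subn_gt0 lt; apply/eqP/(mulgI (g ^+ i)%g).
      by rewrite -expgnDr subnKC// mulg1.
    by rewrite leqNgt (leq_ltn_trans (leq_subr _ _)).
  exists F, F; split => //.
    by move=> h /mapP[i _ ->].
  split; first by rewrite size_map size_iota.
    move=> h k hE /mapP[i _ ->].
    have [|j jm ->] := cyc_torsion m0 gm (h := (h * g ^+ i)%g); last by rewrite map_f// mem_iota.
    by apply: cyc_M => //; exact: cE.
  have F0 : (0 : R) <= (size F)%:R by rewrite ler0n.
  by nra.
have inj_pow : injective (fun i => g ^+ i)%g.
  move=> i j; wlog ij : i j / (i <= j)%N.
    by move=> W e; case/orP: (leq_total i j) => h; [exact: W|apply/esym/W].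
  move=> e; apply/eqP; rewrite eqn_leq ij leqNgt; apply/negP => lt; apply: inf.
  exists (j - i)%N; first by rewrite subn_gt0.
  by apply: (mulgI (g ^+ i)%g); rewrite -expgnDr subnKC// mulg1.
have [N hN] : exists N, forall h, h \in E -> forall i, (N <= i)%N -> exists2 j, (h * g ^+ i = g ^+ j)%g & (j <= i + N)%N.
  elim: E cE => [|h E IHE] cE; first by exists 0%N.
  have [|N hN] := IHE; first by move=> k kE; apply: cE; rewrite inE kE orbT.
  have [|M hM] := @cyc_bound g h; first by apply: cE; rewrite inE eqxx.
  exists (M + N)%N => k; rewrite inE => /orP[/eqP ->|kE] i hi.
    have [|j e hj] := hM i; first by apply: leq_trans hi; exact: leq_addr.
    by exists j => //; rewrite (leq_trans hj)// leq_add2l leq_addr.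
  have [|j e hj] := hN k kE i; first by apply: leq_trans hi; exact: leq_addl.
  by exists j => //; rewrite (leq_trans hj)// leq_add2l leq_addl.
have [n hn] := nat_gt (2 * N%:R / d).
exists (map (fun i => g ^+ i)%g (iota 0 (n + (N + N)))), (map (fun i => g ^+ i)%g (iota N n)); split.
- by rewrite map_inj_uniq ?iota_uniq.
- by rewrite map_inj_uniq ?iota_uniq.
- move=> h hh; case/mapP: hh => i; rewrite mem_iota => /andP[a b] ->; rewrite map_f// mem_iota /= add0n.
  by apply: leq_trans b _; rewrite addnA [(n + N)%N]addnC leq_addr.
- by move=> h /mapP[i _ ->].
split.
- rewrite size_map size_iota addn_gt0; suff -> : (0 < n)%N by [].
  rewrite -(ltr0n R); apply: le_lt_trans hn; by rewrite divr_ge0 ?mulr_ge0 ?ler0n// ltW.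
- move=> h k hE kF; case/mapP: kF => i; rewrite mem_iota => /andP[a b] ->.
  have [j -> hj] := hN h hE i a; rewrite map_f// mem_iota /= add0n.
  by rewrite (leq_ltn_trans hj)// addnA ltn_add2r addnC.
- rewrite !size_map !size_iota !natrD; move: hn; rewrite ltr_pdivrMr//.
  have : (0 : R) <= N%:R by rewrite ler0n.
  set x : R := N%:R; set y : R := n%:R; nra.
Qed.
End Foelner.

(** * Coherent extensions are bounded by the reduced norm *)

Section Bound.
Context {R : realType} {G : groupType} {A : fellBundle R G} (p : irrep A).
Local Notation H := (irrep_space p).

Lemma irr_dense_sub (K : set H) : K 0 -> (forall c y z, K y -> K z -> K (c *: y + z)) ->
  (forall a x, K x -> K (p a x)) -> (exists2 x, K x & x <> 0) ->
  forall y (e : R), 0 < e -> exists2 z, K z & nm (y - z) <= e.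
Proof.
apply: (@rep_dense_sub R H (A 1%g) p); [exact: irr_lin|exact: irr_bdd|exact: irr_i].
Qed.

Lemma coc_fibre_dense k (T T' : tot A -> H -> H) (v0 v : H) (e : R) : coc k T T' -> v0 <> 0 -> 0 < e ->
  exists a : A k, nm (v - T (tg a) v0) <= e.
Proof.
move=> cT v00 e0; pose K : set H := range (fun a : A k => T (tg a) v0).
have K0 : K 0.
  exists 0 => //; have := coc_add cT (-1) 0 0 v0; by rewrite scaler0 addr0 scaleN1r addNr.
have KL c y z : K y -> K z -> K (c *: y + z).
  by move=> [a _ <-] [b _ <-]; exists (c *: a + b) => //; rewrite (coc_add cT).
have Ki a x : K x -> K (p a x).
  move=> [b _ <-]; exists (lact a b) => //.
  by rewrite T_lact -[p a _]pE_T (coc_b cT).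
have Kn : exists2 x, K x & x <> 0.
  apply: contrapT => h; apply: v00; apply: (coc_n cT) => u /tag_eta[a ->].
  by apply: contrapT => ne; apply: h; exists (T (tg a) v0) => //; exists a.
have [_ [a _ <-] ha] := irr_dense_sub K0 KL Ki Kn v e0.
by exists a.
Qed.

Definition rhol (rho : tot A -> H -> H) l v := \sum_(u <- l) rho u v.

(** Choose [X k] over [k] in a Foelner set [F] with [rho (X k) v0] close to [v], and let [x] be the
    section with these values. At the state of [v0], the square of [x] is about [size F * |v|^2].
    The values of [l x] on [F0] are mapped to vectors close to [rho l v], so that its square is at
    least about [size F0 * |rho l v|^2]. The regular bound [opb_state] compares the two. *)
Lemma rho_bound g rho l (c : R) (HH : {pred G}) : cohrep g rho ->
  (forall h, h \in HH <-> cyc g h) -> (forall u, List.In u l -> cyc g (tag u)) ->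
  opb HH (lam HH l) c -> forall v, nm (rhol rho l v) <= c * nm v.
Proof.
move=> cr HHc tl hc v; have c0 : 0 <= c by case: hc.
have [a0 [w aw]] := irr_n p; have w0 : w <> 0 by move=> h; apply: aw; rewrite h (lin0 (@irr_lin _ _ _ p a0)).
pose v0 := rc (nm w)^-1 *: w.
have v0n : nm v0 = 1.
  by rewrite /v0 nmZ nm_rc ger0_norm ?invr_ge0 ?nm_ge0// mulVf// gt_eqF// nm_gt0.
have v00 : v0 <> 0 by move=> h; move: v0n; rewrite h nm0 => /eqP; rewrite eq_sym oner_eq0.
pose a := nm (rhol rho l v); pose C := \sum_(u <- l) nmt u.
have C0 : 0 <= C by apply: sumr_ge0 => u _; exact: nmt_ge0.
have a0' : 0 <= a by exact: nm_ge0.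
have n0 := nm_ge0 v.
(* It collects the errors of first order in [e] in the final inequality
   [(1 - e) (a - C e)^2 <= c^2 (|v| + e)^2]. *)
pose K := a ^+ 2 + 2 * a * C + c ^+ 2 * (2 * nm v + 1).
have K0 : 0 <= K by rewrite /K !addr_ge0 ?mulr_ge0 ?sqr_ge0//; lra.
suff key e : 0 < e -> e <= 1 -> a ^+ 2 <= (c * nm v) ^+ 2 + e * K.
  apply: sqr_le; first exact: mulr_ge0.
  apply: ler_eps => d d0; have k0 : 0 < d + K by lra.
  pose q := d / (d + K); have q0 : 0 < q by rewrite divr_gt0.
  have qE : q * (d + K) = d by rewrite /q divfK// gt_eqF.
  have q1 : q <= 1 by rewrite /q ler_pdivrMr//; lra.
  by apply: le_trans (key q q0 q1) _; rewrite lerD2l; nra.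
move=> e0 e1.
have [ae|ae] := ltP a (C * e).
  have : a ^+ 2 <= a * (C * e) by rewrite expr2 ler_wpM2l// ltW.
  have : a * (C * e) <= e * K.
    rewrite /K; have := sqr_ge0 a; have := mulr_ge0 (sqr_ge0 c) (_ : 0 <= 2 * nm v + 1).
    have : 0 <= a * C by rewrite mulr_ge0.
    move=> h1 h2 h3; have {}h2 := h2 (_ : 0 <= 2 * nm v + 1).
    have : 0 <= c ^+ 2 * (2 * nm v + 1) by rewrite mulr_ge0 ?sqr_ge0//; lra.
    by nra.
  by have := sqr_ge0 (c * nm v); lra.
(* The value of [l x] at [k] involves [x] at [(tag u)^-1 k], hence the inverses. *)
have [|F [F0 [uF uF0 sF cF [F1 EF sz]]]] := @foelner G R g (map (fun u => (tag u)^-1%g) l) e e0.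
  move=> h /mapP[u ul ->]; apply: cyc_V; apply: tl.
  elim: (l) ul => // b r IHr; rewrite inE => /orP[/eqP ->|/IHr]; [by left|by right].
have coc_cr k : cyc g k -> exists r', coc k rho r' by exact: (cr_coc cr).
pose X k : A k := xget 0 [set a : A k | nm (v - rho (tg a) v0) <= e].
have hX k : k \in F -> nm (v - rho (tg (X k)) v0) <= e.
  move=> /cF /coc_cr [r' cr']; have [b hb] := coc_fibre_dense v cr' v00 e0.
  by rewrite /X; case: xgetP => [y _ //|/(_ b)].
pose x0 : section A := fun k => if k \in F then X k else 0.
have x0P : x0 \in @fpred R G A by apply/asboolP; exists F => k /negPf; rewrite /x0 => ->.
pose x : @fsec R G A := FSec x0P.
have xF k : k \in F -> fs x k = X k by rewrite /= /x0 => ->.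
have xN k : k \notin F -> fs x k = 0 by rewrite /= /x0 => /negPf ->.
have quad k (y : A k) : cyc g k -> re (hip v0 (p (rip y y) v0)) = nm (rho (tg y) v0) ^+ 2.
  by move=> /coc_cr [r' cr']; rewrite nm_sqr_hip (coc_s cr')// -T_rip pE_T.
have nx : ipn (x : fsIP v0) ^+ 2 <= (size F)%:R * (nm v + e) ^+ 2.
  rewrite (@fsIP_sqr _ _ _ p v0 x F)// -sum_const_seq.
  rewrite !big_seq; apply: ler_sum => k kF; rewrite xF// quad; last exact: cF.
  rewrite ler_pXn2r ?nnegrE ?nm_ge0//; last by lra.
  have := hX k kF; have := nmB v (v - rho (tg (X k)) v0).
  by rewrite subKr; lra.
pose y := Lopf l x.
have ny k : k \in F0 -> a - C * e <= nm (rho (tg (fs y k)) v0).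
  move=> kF; have ck : cyc g k by apply/cF/sF.
  have [rk crk] := coc_cr k ck.
  have rsumE (s : seq (tot A)) (f : tot A -> A k) : rho (tg (\sum_(u <- s) f u)) v0 = \sum_(u <- s) rho (tg (f u)) v0.
    elim: s => [|u s IHs].
      rewrite !big_nil; have := coc_add crk (-1) 0 0 v0.
      by rewrite scaler0 addr0 scaleN1r addNr.
    rewrite !big_cons -IHs; have := coc_add crk 1 (f u) (\sum_(j <- s) f j) v0.
    by rewrite !scale1r.
  have tl' u : u \in l -> cyc g (tag u).
    move=> ul; apply: tl; elim: (l) ul => // b r IHr.
    by rewrite inE => /orP[/eqP ->|/IHr]; [left|right].
  have near : nm (rhol rho l v - rho (tg (fs y k)) v0) <= C * e.
    rewrite /y LopfE Lop_app rsumE /rhol -sumrB /C mulr_suml.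
    apply: le_trans (nm_sum _ _ _) _; rewrite !big_seq; apply: ler_sum => u ul.
    have cu := tl' u ul; have [ru cru] := coc_cr _ cu.
    have jF : ((tag u)^-1 * k)%g \in F by apply: EF => //; exact: (map_f (fun u : tot A => (tag u)^-1%g) ul).
    rewrite tg_Lu (cr_mul cr)//; last exact: cF.
    rewrite -(linB (coc_lin cru erefl)) /=.
    apply: le_trans (coc_le cru _ erefl) _; rewrite ler_wpM2l ?nmt_ge0//.
    by rewrite -[x0 _]/(fs x _) xF// hX.
  have := nmD (rhol rho l v - rho (tg (fs y k)) v0) (rho (tg (fs y k)) v0).
  by rewrite subrK -/a; lra.
have ny2 : (size F0)%:R * (a - C * e) ^+ 2 <= ipn (y : fsIP v0) ^+ 2.
  pose t := undup (F0 ++ supp y).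
  rewrite (@fsIP_sqr _ _ _ p v0 y t) ?undup_uniq//; last first.
    by move=> k; rewrite mem_undup mem_cat negb_or => /andP[_ /suppP].
  rewrite [leRHS](bigID (mem F0)) /=.
  have h0 : 0 <= \sum_(k <- t | k \notin F0) re (hip v0 (p (rip (fs y k) (fs y k)) v0)).
    by apply: sumr_ge0 => k _; exact: quad_ge0.
  have -> : \sum_(k <- t | k \in F0) re (hip v0 (p (rip (fs y k) (fs y k)) v0)) =
            \sum_(k <- F0) re (hip v0 (p (rip (fs y k) (fs y k)) v0)).
    rewrite -big_filter; apply: perm_big; apply: uniq_perm; rewrite ?filter_uniq ?undup_uniq// => k.
    by rewrite mem_filter mem_undup mem_cat; case: (k \in F0).
  have h1 : (size F0)%:R * (a - C * e) ^+ 2 <= \sum_(k <- F0) re (hip v0 (p (rip (fs y k) (fs y k)) v0)).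
    rewrite -sum_const_seq.
    rewrite !big_seq; apply: ler_sum => k kF; rewrite quad; last exact/cF/sF.
    by rewrite ler_pXn2r ?nnegrE ?nm_ge0 ?ny// subr_ge0.
  by lra.
have hxy : ipn (y : fsIP v0) <= c * ipn (x : fsIP v0).
  apply: opb_state hc _ => k kH; apply: xN; apply: contra kH => kF; apply/HHc; exact: cF.
have hxy2 : ipn (y : fsIP v0) ^+ 2 <= c ^+ 2 * ipn (x : fsIP v0) ^+ 2.
  by rewrite -exprMn ler_pXn2r ?nnegrE ?ipn_ge0 ?mulr_ge0 ?ipn_ge0.
have sF0 : (0 : R) < (size F)%:R by rewrite ltr0n.
have fin : (1 - e) * (a - C * e) ^+ 2 <= c ^+ 2 * (nm v + e) ^+ 2.
  rewrite -(ler_pM2l sF0).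
  have c2 := sqr_ge0 c; have s2 := sqr_ge0 (a - C * e).
  have h1 := ler_wpM2l c2 nx; have h2 := ler_wpM2r s2 sz.
  apply: (@le_trans _ _ ((size F0)%:R * (a - C * e) ^+ 2)).
    by apply: le_trans h2; rewrite mulrA (mulrC (size F)%:R).
  by apply: le_trans ny2 _; apply: le_trans hxy2 _; apply: le_trans h1 _; rewrite mulrCA.
have aC : 0 <= a * C by rewrite mulr_ge0.
have e3 : 0 <= e * (1 - e) by rewrite mulr_ge0 ?subr_ge0// ltW.
have c2 := sqr_ge0 c.
have l1 : a ^+ 2 - e * a ^+ 2 - 2 * (a * C) * e <= (1 - e) * (a - C * e) ^+ 2.
  have : 0 <= (1 - e) * (C * e) ^+ 2 by rewrite mulr_ge0 ?sqr_ge0// subr_ge0.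
  have : 0 <= 2 * (a * C) * e * e by rewrite !mulr_ge0// ltW.
  by nra.
have l2 : c ^+ 2 * (nm v + e) ^+ 2 <= (c * nm v) ^+ 2 + e * (c ^+ 2 * (2 * nm v + 1)).
  have : 0 <= c ^+ 2 * (e * (1 - e)) by rewrite mulr_ge0.
  by nra.
have -> : e * K = e * a ^+ 2 + 2 * (a * C) * e + e * (c ^+ 2 * (2 * nm v + 1)) by rewrite /K; ring.
by lra.
Qed.
End Bound.

(** * Positivity is independent of the coherent extension *)

Section Acar.
Context {R : realType} {G : groupType} {A : fellBundle R G} (g : G).
Local Notation S := (section A).
Local Notation tot := (tot A).
Implicit Types (u : tot) (l m : seq tot).

Definition cycp : {pred G} := fun h => `[< cyc g h >].
Lemma cycpP h : h \in cycp <-> cyc g h.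
Proof. by split => [/asboolP//|h1]; apply/asboolP. Qed.

Lemma cycp_subgroup : cyclic_subgroup cycp.
Proof.
split; last by exists g => x; exact: cycpP.
split; first by apply/cycpP; exists 0%N; left; rewrite expg0.
by move=> u v /cycpP hu /cycpP hv; apply/cycpP; apply: cyc_M => //; exact: cyc_V.
Qed.

Lemma cycp_cl h k : h \in cycp -> k \in cycp -> (h^-1 * k)%g \in cycp.
Proof. by move=> /cycpP hu /cycpP hv; apply/cycpP; apply: cyc_M => //; exact: cyc_V. Qed.

Definition okl l := forall u, List.In u l -> cyc g (tag u).
Local Notation HH := cycp.
Lemma oklH l : okl l -> forall u, List.In u l -> tag u \in HH.
Proof. by move=> o u /o h; apply/cycpP. Qed.
Lemma okl_nil : okl [::]. Proof. by []. Qed.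
Lemma okl_cons u l : cyc g (tag u) -> okl l -> okl (u :: l).
Proof. by move=> h1 h2 v [<-|/h2]. Qed.
Lemma okl_cat l m : okl l -> okl m -> okl (l ++ m).
Proof. by move=> h1 h2 u /List.in_app_iff[/h1|/h2]. Qed.
Lemma okl_map (f : tot -> tot) l : (forall u, cyc g (tag u) -> cyc g (tag (f u))) -> okl l -> okl (map f l).
Proof. by move=> h1 h2 u; elim: l h2 => [//|v l IH] h2 /= [<-|hu]; [apply: h1; apply: h2; left|apply: IH => // w hw; apply: h2; right]. Qed.
Lemma okl_cs c l : okl l -> okl (map (cs c) l). Proof. by apply: okl_map. Qed.
Lemma okl_star l : okl l -> okl (map (@tstar R G A) l).
Proof. by apply: okl_map => u h; exact: cyc_V. Qed.
Lemma okl_mul l m : okl l -> okl m -> okl (lmulL l m).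
Proof.
move=> h1 h2; rewrite /lmulL /=; elim: l h1 => [//|u l IH] h1 /=.
apply: okl_cat; last by apply: IH => w hw; apply: h1; right.
by apply: okl_map h2 => v hv; apply: cyc_M => //; apply: h1; left.
Qed.
Lemma cyc1 : cyc g 1%g. Proof. by exists 0%N; left; rewrite expg0. Qed.
Lemma okl_1 (a : A 1%g) : okl [:: tg a].
Proof. by apply: okl_cons; [exact: cyc1|exact: okl_nil]. Qed.

Lemma lam_l2m l x : okl l -> l2m HH x -> l2m HH (lam HH l x).
Proof. by move=> o hx; rewrite lamE//; apply: Lop_l2m hx; [exact: cycp_cl|exact: oklH]. Qed.

Lemma Lop_okl l x : okl l -> l2m HH x -> l2m HH (Lop l x).
Proof. by move=> o hx; rewrite -(@lamE _ _ _ HH)//; exact: lam_l2m. Qed.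

Lemma lam_opb l : okl l -> opb HH (lam HH l) (\sum_(u <- l) nmt u).
Proof.
move=> o; apply: opb_phi; [exact: cycp_cl|exact: oklH| |].
  by apply: sumr_ge0 => u _; exact: nmt_ge0.
by move=> p xi x; exact: Lopf_le.
Qed.

Lemma lam_B l x y : l2m HH x -> l2m HH y -> lam HH l (x - y) = lam HH l x - lam HH l y.
Proof. by move=> hx hy; rewrite !lamE//; [rewrite linB//; exact: Lop_lin|exact: l2m_B]. Qed.

Lemma lam_mul l m x : okl m -> l2m HH x -> lam HH (lmulL l m) x = lam HH l (lam HH m x).
Proof. by move=> o hx; rewrite [in RHS]lamE; [rewrite !lamE// Lop_mul|exact: lam_l2m]. Qed.

Lemma lam_sub l m x : l2m HH x -> lam HH (l ++ map (cs (-1)) m) x = lam HH l x - lam HH m x.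
Proof. by move=> hx; rewrite !lamE// Lop_cat Lop_cs scaleN1r. Qed.

Lemma lam_lin c l m x : l2m HH x -> lam HH (map (cs c) l ++ m) x = c *: lam HH l x + lam HH m x.
Proof. by move=> hx; rewrite !lamE// Lop_cat Lop_cs. Qed.

Lemma rhol_cat p (rho : tot -> irrep_space p -> irrep_space p) l m v :
  rhol rho (l ++ m) v = rhol rho l v + rhol rho m v.
Proof. by rewrite /rhol big_cat. Qed.

Definition redc (T : S -> S) : Prop := [/\ forall x, l2m HH x -> l2m HH (T x),
  forall x, ~ l2m HH x -> T x = 0 & forall e : R, 0 < e -> exists2 l, okl l & opb HH (T - lam HH l) e].

Lemma redcP T : acar (reduced_algebra A HH) T <-> redc T.
Proof.
split=> -[h1 h2 h3]; split.
- by move=> x /l2mP hx; apply/l2mP; exact: h1.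
- by move=> x hx; apply: h2 => /l2mP.
- move=> e e0; have e0' : 0 < rc e by rewrite -rc0 rc_lt.
  have [f hf ho] := h3 _ e0'; have [l [ol El]] := list_of_Cc hf.
  have o : okl l by move=> u /ol /cycpP.
  exists l => //; apply: opnorm_opb; last by rewrite -El.
  by move=> x hx; apply: l2m_B; [by apply/l2mP; apply: h1; apply/l2mP|exact: lam_l2m].
- by move=> x /l2mP hx; apply/l2mP; exact: h1.
- by move=> x hx; apply: h2 => /l2mP.
- move=> e /gt0_rc[r r0 ->]; have [l o hl] := h3 _ r0.
  have [f hf Ef] := Cc_of_list (oklH o); exists f => //.
  by rewrite Ef; exact: opb_opnorm.
Qed.

Lemma redc_bdd T : redc T -> exists2 c, 0 <= c & opb HH T c.
Proof.
move=> [h1 h2 h3]; have [l o hl] := h3 1 ltr01.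
have h := opb_D hl (lam_opb o).
exists (1 + \sum_(u <- l) nmt u); first by case: h.
by apply: opb_ext h => x hx; rewrite /= !fctE; rewrite subrK.
Qed.

Lemma ub_small (x : S) : (forall e : R, 0 < e -> ub x e) -> x = 0.
Proof.
move=> h; apply: functional_extensionality_dep => k.
apply: nm_small => e e0; have := h e e0 [:: k] isT; by rewrite nF1.
Qed.
Lemma redc0 T : redc T -> T 0 = 0.
Proof.
move=> /redc_bdd[c c0 [_ h]]; apply: ub_small => e e0.
have [_ /(_ 0 (@ub0 _ _ A))] := h 0 (@l2m_0 _ _ A HH).
by rewrite mulr0; apply: ub_le; exact: ltW.
Qed.

Lemma scale_small (c e : R) : 0 <= c -> 0 <= e -> c * (e / (c + 1)) <= e.
Proof. by move=> c0 e0; rewrite mulrA ler_pdivrMr ?ltr_wpDl// mulrC ler_wpM2l//; lra. Qed.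

Lemma redcB T x y : redc T -> l2m HH x -> l2m HH y -> T (x - y) = T x - T y.
Proof.
move=> [h1 h2 h3] hx hy; apply: subr0_eq; apply: ub_small => e e0.
have [M hM] := tails_ub (proj2 hx); have [N hN] := tails_ub (proj2 hy).
have M0 := ub_ge0 hM; have N0 := ub_ge0 hN.
have e1 : 0 < e / ((M + N) * 2 + 1) by rewrite divr_gt0// ltr_wpDl//; lra.
have [l ol [_ hl]] := h3 _ e1.
have hMN : ub (x - y) (M + N).
  rewrite -scaleN1r; apply: ubD => //; have := ubZ (-1) hN; by rewrite nmN nm1 mul1r.
have [_ /(_ _ hM) ex] := hl _ hx; have [_ /(_ _ hN) ey] := hl _ hy.
have [_ /(_ _ hMN) exy] := hl _ (l2m_B hx hy).
have := ubD exy (ubZ (-1) (ubD ex (ubZ (-1) ey))); rewrite !fctE lam_B//.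
have ->: T (x - y) - (lam HH l x - lam HH l y) + -1 *: (T x - lam HH l x + -1 *: (T y - lam HH l y)) =
  T (x - y) - (T x - T y) by lmod.
apply: ub_le; rewrite !nmN nm1 !mul1r -!mulrDr.
apply: le_trans (_ : ((M + N) * 2) * (e / ((M + N) * 2 + 1)) <= _); last by apply: scale_small; lra.
by rewrite mulrC; apply: ler_wpM2r; [exact: ltW|lra].
Qed.

(** The approximant [m] of [B] is fixed before that of [X], so that [l] can afterwards be chosen
    with additional properties, such as small values under an extension. *)
Lemma comp_left B X (e : R) : redc B -> redc X -> 0 < e -> exists m cm,
  [/\ okl m, 0 <= cm, opb HH (lam HH m) cm & forall l d, opb HH (X - lam HH l) d -> okl l ->
    cm * d <= e / 2 -> opb HH (B \o X - lam HH (lmulL m l)) e].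
Proof.
move=> hB hX e0; have [cx cx0 bx] := redc_bdd hX.
have e1 : 0 < e / 2 / (cx + 1) by rewrite !divr_gt0// ltr_wpDl.
case: (hB) => hB1 _ /(_ _ e1)[m om hm]; exists m, (\sum_(u <- m) nmt u); split => //; [|exact: lam_opb|].
  by apply: sumr_ge0 => u _; exact: nmt_ge0.
move=> l d hd ol hde.
apply: opb_le (opb_ext _ (opb_D (opb_comp hm bx) (opb_comp (lam_opb om) hd))); last first.
  move=> x hx; rewrite /= !fctE /= lam_mul// lam_B; [|by case: hX => h _ _; exact: h|exact: lam_l2m].
  by rewrite addrA subrK.
have E : e = e / 2 + e / 2 by field.
rewrite [X in _ <= X]E; apply: lerD hde; rewrite mulrC; apply: scale_small => //; lra.
Qed.

(** Here the approximant [m] of [B] depends on [l]; what matters is that its norm is bounded by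
    [cb + 1] uniformly. *)
Lemma comp_right B : redc B -> exists2 cb, 0 <= cb & forall X l (d e : R), okl l -> opb HH (X - lam HH l) d ->
  0 < e -> exists m, [/\ okl m, opb HH (lam HH m) (cb + 1) & opb HH (X \o B - lam HH (lmulL l m)) (d * cb + e)].
Proof.
move=> hB; have [cb cb0 bb] := redc_bdd hB; exists cb => // X l d e ol hd e0.
have [cl0 _] := lam_opb ol; set cl := \sum_(u <- l) nmt u in cl0.
have e1 : 0 < Num.min 1 (e / (cl + 1)) by rewrite lt_min ltr01 divr_gt0// ltr_wpDl.
case: (hB) => hB1 _ /(_ _ e1)[m om hm]; exists m; split=> //.
  apply: opb_le (opb_ext _ (opb_B bb hm)); first by apply: lerD => //; rewrite ge_min lexx.
  by move=> x hx; rewrite /= !fctE subKr.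
apply: opb_le (opb_ext _ (opb_D (opb_comp hd bb) (opb_comp (lam_opb ol) hm))); last first.
  move=> x hx; rewrite /= !fctE /= lam_mul// lam_B; [|exact: hB1|exact: lam_l2m].
  by rewrite addrA subrK.
rewrite lerD2l -/cl; apply: le_trans (_ : cl * (e / (cl + 1)) <= _).
  by apply: ler_wpM2l => //; rewrite ge_min lexx orbT.
by rewrite mulrA ler_pdivrMr ?ltr_wpDl// mulrC ler_wpM2l//; [exact: ltW|lra].
Qed.

Lemma redc_comp B X : redc B -> redc X -> redc (B \o X).
Proof.
move=> hB hX; split=> [x hx|x hx|e e0].
- by case: hB => h _ _; apply: h; case: hX => h _ _; exact: h.
- by rewrite /=; case: hX => _ -> // _; exact: redc0.
- have [m [cm [om cm0 bm hm]]] := comp_left hB hX e0.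
  have e1 : 0 < e / 2 / (cm + 1) by rewrite !divr_gt0// ltr_wpDl.
  case: hX => _ _ /(_ _ e1)[l ol hl]; exists (lmulL m l); first exact: okl_mul.
  apply: hm hl ol _.
  apply: scale_small => //; lra.
Qed.

End Acar.

Section Sep.
Context {R : realType} {G : groupType} {A : fellBundle R G}.

Lemma nm_star_mul (a : A 1%g) : nm (mul1 (star1 a) a) = nm a ^+ 2.
Proof. exact: (@bnC _ (fib1 A)). Qed.

Lemma irr_sep (a : A 1%g) : (forall (p : irrep A) v, p a v = 0) -> a = 0.
Proof.
move=> h; apply: contrapT => /nm_gt0 a0.
have [|p [xi [_]]] := @norm_attained _ _ A _ (posA_rip a).
  by rewrite nm_rip exprn_gt0.
have ->: rip a a = mul1 (star1 a) a.
  by apply: tagI; rewrite T_rip T_mul1 T_star1.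
rewrite irr_M h (lin0 (@irr_lin _ _ _ p (star1 a))) hipr0 re0.
by rewrite nm_star_mul => h2; have := lt_le_trans (exprn_gt0 2 a0) h2; rewrite ltxx.
Qed.

Definition dlt (c : A 1%g) : section A := fun k => fibre k (tg c).
Lemma tails_dlt c : tails (dlt c).
Proof.
move=> e e0; exists [:: 1%g]; split=> // s us hs.
rewrite (@nF_eq _ _ _ s _ 0); first by apply: le_trans (ltW e0); exact: (@ub0 _ _ A).
by move=> k /hs; rewrite inE => /eqP k1; rewrite /dlt fibre0 //= => /esym.
Qed.
Lemma l2m_dlt g (c : A 1%g) : l2m (cycp g) (dlt c).
Proof.
split; last exact: tails_dlt.
move=> k hk; rewrite /dlt fibre0 //= => k1; move: hk; rewrite -k1 => /negP; apply.
by apply/cycpP; exact: cyc1.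
Qed.
Lemma Lu_dlt (a c : A 1%g) : Lu (tg a) (dlt c) = dlt (mul1 a c).
Proof.
apply: functional_extensionality_dep => k; apply: tagI; rewrite tg_Lu /dlt /=.
case: (pselect (k = 1%g)) => [->|k1].
  by rewrite fibreT (_ : tg (fibre _ _) = tg c) ?fibreK ?T_mul1 //= invg1 mulg1.
rewrite [in RHS]fibre0 /=; last by move/esym.
rewrite fibre0 /=; last by rewrite invg1 mul1g => /esym.
have E : forall k', k' = k -> tg (0 : A k') = tg (0 : A k) by move=> k' ->.
by rewrite /tmul /= fmul0r; apply: E; exact: mulVKg.
Qed.
End Sep.

(** * The ideal of elements that vanish under the selected extensions *)

Section Ideal.
Context {R : realType} {G : groupType} {A : fellBundle R G} (g : G) (I : set (A 1%g)).
Local Notation S := (section A).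
Local Notation tot := (tot A).
Local Notation HH := (cycp g).
Implicit Types (u : tot) (l m : seq tot).
Hypothesis idI : ideal (unit_algebra A) I.

Definition hat (p : irrep A) := exists k v, I k /\ p k v <> 0.
Definition perp (b : A 1%g) := forall p, hat p -> forall v, p b v = 0.

Lemma perp_star b : perp b -> perp (star1 b).
Proof.
move=> h p hp v; apply: hip_eq0; by rewrite irr_S h// hipr0.
Qed.

Lemma perp_I b : perp b -> I b -> b = 0.
Proof.
move=> h hb; apply: irr_sep => p v; apply: contrapT => h0.
by apply: (h0); apply: h; exists b, v.
Qed.

Variable good : forall p : irrep A, (tot -> irrep_space p -> irrep_space p) -> Prop.
Hypothesis hgood : forall p, hat p -> exists2 rho, @cohrep R G A p g rho & good rho.

(** Extensions are defined on lists only, so vanishing of [T] under [rho] means that it has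
    approximants that are small in norm under [rho]. The last clause says that [T] kills the range
    of all products with [b] in [perp]; it makes the intersection with the unit fibre trivial, which
    the first condition only places in [perp]. *)
Definition kerN : set (S -> S) := [set T : S -> S | [/\ redc g T,
  forall (p : irrep A) rho, hat p -> cohrep g rho -> @good p rho -> forall e : R, 0 < e ->
    exists2 l, okl g l & opb HH (T - lam HH l) e /\ forall v, nm (rhol rho l v) <= e * nm v &
  forall b m x, perp b -> okl g m -> l2m HH x -> T (Lop m (Lop [:: tg b] x)) = 0]].

Lemma rhol_cs p (rho : tot -> irrep_space p -> irrep_space p) c l v : cohrep g rho -> okl g l ->
  rhol rho (map (cs c) l) v = c *: rhol rho l v.
Proof.
move=> hr; elim: l => [|u l IH] o; first by rewrite /rhol !big_nil scaler0.
rewrite /rhol /= !big_cons scalerDr -[X in _ + X = _]/(rhol rho (map (cs c) l) v) IH; last by move=> w hw; apply: o; right.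
congr (_ + _); have ou : cyc g (tag u) by apply: o; left.
have [rho' hc] := cr_coc hr ou; rewrite /cs.
rewrite -[_ *: _]addr0 (coc_add hc) {1 2}/tg.
have E0 : rho (tg (0 : A (tag u))) v = 0.
  have := coc_add hc (-1) 0 0 v; rewrite scaler0 addr0 scaleN1r => ->; by rewrite addNr.
by rewrite E0 addr0; case: (u).
Qed.

Lemma rhol_lin p (rho : tot -> irrep_space p -> irrep_space p) l : cohrep g rho -> okl g l -> linear (rhol rho l).
Proof.
move=> hr; elim: l => [|u l IH] o c x y; first by rewrite /rhol !big_nil scaler0 addr0.
rewrite /rhol !big_cons -!/(rhol rho l _) IH; last by move=> w hw; apply: o; right.
have ou : cyc g (tag u) by apply: o; left.
have [rho' hc] := cr_coc hr ou; rewrite (coc_lin hc)//; lmod.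
Qed.

Lemma rhol_mul p (rho : tot -> irrep_space p -> irrep_space p) l m v : cohrep g rho -> okl g l -> okl g m ->
  rhol rho (lmulL l m) v = rhol rho l (rhol rho m v).
Proof.
move=> hr; elim: l => [|u l IH] o om; first by rewrite /lmulL /rhol /= !big_nil.
rewrite {1}/lmulL /= rhol_cat -/(lmulL l m) IH//; last by move=> w hw; apply: o; right.
rewrite /rhol [in RHS]big_cons; congr (_ + _).
have ou : cyc g (tag u) by apply: o; left.
have [rho' hc] := cr_coc hr ou.
rewrite big_map (lin_sum (coc_lin hc erefl)); apply: big_eq_In => w hw.
by rewrite (cr_mul hr) //; exact: om.
Qed.

Lemma rhol_bound p (rho : tot -> irrep_space p -> irrep_space p) l c : cohrep g rho -> okl g l ->
  opb HH (lam HH l) c -> forall v, nm (rhol rho l v) <= c * nm v.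
Proof. by move=> hr o h; apply: rho_bound hr _ o h => k; exact: cycpP. Qed.

Lemma kerN_ideal : ideal (reduced_algebra A HH) kerN.
Proof.
split.
- by move=> T [/redcP].
- split.
  + split=> [x hx|//|e e0]; first exact: l2m_0.
    exists [::] => //; split; first exact: ltW.
    move=> x hx; have ->: (0 - lam HH [::]) x = 0.
      by rewrite /= !fctE lamE// /Lop big_nil subr0.
    split; [exact: l2m_0|move=> M hM; apply: ub_le (@ub0 _ _ A); apply: mulr_ge0; [exact: ltW|exact: ub_ge0 hM]].
  + move=> p rho hp hr _ e e0; exists [::] => //; split.
      split; first exact: ltW.
      move=> x hx; have ->: (0 - lam HH [::]) x = 0.
        by rewrite /= !fctE lamE// /Lop big_nil subr0.
      split; [exact: l2m_0|move=> M hM; apply: ub_le (@ub0 _ _ A); apply: mulr_ge0; [exact: ltW|exact: ub_ge0 hM]].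
    by move=> v; rewrite /rhol big_nil nm0; apply: mulr_ge0; [exact: ltW|exact: nm_ge0].
  + by [].
- move=> c X Y [hX1 hX2 hX3] [hY1 hY2 hY3].
  have key : forall l1 l2 (e1 e2 : R), opb HH (X - lam HH l1) e1 -> opb HH (Y - lam HH l2) e2 ->
     opb HH ((c *: X + Y) - lam HH (map (cs c) l1 ++ l2)) (nm c * e1 + e2).
    move=> l1 l2 e1 e2 h1 h2; apply: opb_ext (opb_lin c h1 h2) => x hx.
    by rewrite /= !fctE /= lam_lin//; lmod.
  have cp : 0 < nm c + 1 by rewrite ltr_wpDl ?nm_ge0.
  have esp : forall e : R, nm c * (e / (nm c + 1)) + e / (nm c + 1) = e by move=> e; field; rewrite gt_eqF.
  split.
  + split=> [x hx|x hx|e e0].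
    * by rewrite /= !fctE; apply: l2m_lin; [case: hX1 => h _ _; exact: h|case: hY1 => h _ _; exact: h].
    * by rewrite /= !fctE; case: hX1 => _ -> // _; case: hY1 => _ -> // _; rewrite scaler0 addr0.
    * have e0' : 0 < e / (nm c + 1) by rewrite divr_gt0.
      case: hX1 => _ _ /(_ _ e0')[l1 o1 h1]; case: hY1 => _ _ /(_ _ e0')[l2 o2 h2].
      exists (map (cs c) l1 ++ l2); first by apply: okl_cat => //; exact: okl_cs.
      by have := key _ _ _ _ h1 h2; rewrite esp.
  + move=> p rho hp hr gr e e0.
    have e0' : 0 < e / (nm c + 1) by rewrite divr_gt0.
    have [l1 o1 [h1 r1]] := hX2 p rho hp hr gr _ e0'.
    have [l2 o2 [h2 r2]] := hY2 p rho hp hr gr _ e0'.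
    exists (map (cs c) l1 ++ l2); first by apply: okl_cat => //; exact: okl_cs.
    split; first by have := key _ _ _ _ h1 h2; rewrite esp.
    move=> v; rewrite rhol_cat rhol_cs//; apply: le_trans (nmD _ _) _; rewrite nmZ.
    rewrite -[X in _ <= X * _](esp e) mulrDl; apply: lerD (r2 v).
    by rewrite -mulrA; apply: ler_wpM2l (r1 v); exact: nm_ge0.
  + by move=> b m x hb om hx; rewrite /= !fctE hX3// hY3// scaler0 addr0.
- move=> B X /redcP hB [hX1 hX2 hX3]; split; first exact: redc_comp.
  + move=> p rho hp hr gr e e0.
    have [m [cm [om cm0 bm hm]]] := comp_left hB hX1 e0.
    have e1 : 0 < e / 2 / (cm + 1) by rewrite !divr_gt0// ltr_wpDl.
    have cme : cm * (e / 2 / (cm + 1)) <= e / 2.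
      by apply: scale_small => //; lra.
    have [l ol [hl rl]] := hX2 p rho hp hr gr _ e1.
    exists (lmulL m l); first exact: okl_mul.
    split; first exact: hm hl ol cme.
    move=> v; rewrite rhol_mul//; apply: le_trans (rhol_bound hr om bm _) _.
    apply: le_trans (ler_wpM2l cm0 (rl v)) _; rewrite mulrA; apply: ler_wpM2r; first exact: nm_ge0.
    by apply: le_trans cme _; lra.
  + by move=> b m x hb om hx; rewrite /= hX3//; exact: redc0 hB.
- move=> B X /redcP hB [hX1 hX2 hX3]; split; first exact: redc_comp.
  + move=> p rho hp hr gr e e0.
    have [cb cb0 hm] := comp_right hB.
    have e1 : 0 < e / 2 / (cb + 1) by rewrite !divr_gt0// ltr_wpDl.
    have e2 : 0 < e / 2 by lra.
    have [l ol [hl rl]] := hX2 p rho hp hr gr _ e1.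
    have [m [om bm xm]] := hm _ _ _ _ ol hl e2.
    have E : e / 2 / (cb + 1) * (cb + 1) = e / 2 by rewrite divfK// gt_eqF// ltr_wpDl.
    exists (lmulL l m); first exact: okl_mul.
    split; first by apply: opb_le xm; nra.
    move=> v; rewrite rhol_mul//; apply: le_trans (rl _) _.
    apply: le_trans (ler_wpM2l (ltW e1) (rhol_bound hr om bm _)) _; rewrite mulrA E; apply: ler_wpM2r; [exact: nm_ge0|lra].
  + move=> b m x hb om hx /=; apply: ub_small => e e0.
    have hz : l2m HH (Lop m (Lop [:: tg b] x)).
      by apply: Lop_okl => //; apply: Lop_okl => //; exact: okl_1.
    have [M hM] := tails_ub (proj2 hz); have M0 := ub_ge0 hM.
    have [cx cx0 [_ bx]] := redc_bdd hX1.
    have e1 : 0 < e / (cx * M + 1) by rewrite divr_gt0// ltr_wpDl// mulr_ge0.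
    case: (hB) => hB1 _ /(_ _ e1)[l ol [_ hl]].
    have [hz1 /(_ M hM) hz2] := hl _ hz.
    have [_ /(_ _ hz2)] := bx _ hz1; rewrite !fctE (redcB hX1)//; last by apply: lam_l2m.
      rewrite lamE// -(Lop_mul l m) hX3//; last exact: okl_mul.
      by rewrite subr0; apply: ub_le; rewrite mulrCA mulrC; apply: scale_small; rewrite ?mulr_ge0// ltW.
    exact: hB1.
- move=> T /redcP hT h; have h' : forall e : R, 0 < e -> exists2 Y, kerN Y & opb HH (T - Y) e.
    move=> e e0; have e0' : 0 < rc e by rewrite -rc0 rc_lt.
    have [Y hY hTY] := h _ e0'; exists Y => //; apply: opnorm_opb hTY => x hx.
    by apply: l2m_B; [case: hT => h1 _ _; exact: h1|case: hY => -[h1 _ _] _ _; exact: h1].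
  split=> //.
  + move=> p rho hp hr gr e e0; have e2 : 0 < e / 2 by lra.
    have [Y [hY1 hY2 hY3] bY] := h' _ e2.
    have [l ol [hl rl]] := hY2 p rho hp hr gr _ e2.
    exists l => //; split; last by move=> v; apply: le_trans (rl v) _; apply: ler_wpM2r; [exact: nm_ge0|lra].
    apply: opb_le (opb_ext _ (opb_D bY hl)); first by lra.
    by move=> x hx; rewrite /= !fctE addrA subrK.
  + move=> b m x hb om hx; apply: ub_small => e e0.
    have hz : l2m HH (Lop m (Lop [:: tg b] x)).
      by apply: Lop_okl => //; apply: Lop_okl => //; exact: okl_1.
    have [M hM] := tails_ub (proj2 hz).
    have M0 := ub_ge0 hM.
    have e1 : 0 < e / (M + 1) by rewrite divr_gt0// ltr_wpDl.
    have [Y [hY1 hY2 hY3] [_ bY]] := h' _ e1.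
    have [_ /(_ M hM)] := bY _ hz; rewrite !fctE hY3// subr0; apply: ub_le.
    by rewrite mulrC; apply: scale_small => //; exact: ltW.
Qed.

Lemma rhol_approx p (rho : tot -> irrep_space p -> irrep_space p) T l m c d : cohrep g rho ->
  okl g l -> okl g m -> opb HH (T - lam HH l) c -> opb HH (T - lam HH m) d ->
  forall v, nm (rhol rho l v - rhol rho m v) <= (c + d) * nm v.
Proof.
move=> hr ol om hl hm v.
have h : opb HH (lam HH (l ++ map (cs (-1)) m)) (d + c).
  apply: opb_ext (opb_B hm hl) => x hx; rewrite lam_sub// !fctE; lmod.
have := rhol_bound hr (okl_cat ol (@okl_cs _ _ _ _ (-1) _ om)) h v.
by rewrite rhol_cat rhol_cs// scaleN1r [d + c]addrC.
Qed.

(** An element [a] of the intersection acts as 0 in all [p] in question, so [a] and its adjoint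
    belong to [perp]; the last clause of [kerN] then applies to [a] itself. *)
Lemma kerN_unit : kerN `&` unit_coefficients A HH = [set 0].
Proof.
apply/seteqP; split=> T.
  move=> -[[hT1 hT2 hT3] [f hf E]].
  have ET := left_reg_unit HH hf; set a := f 1%g in ET; rewrite E in ET.
  have ha : perp a.
    move=> p hp v; have [rho hr gr] := hgood hp.
    apply: nm_small => e e0.
    have e1 : 0 < e / 2 / (nm v + 1) by rewrite !divr_gt0// ltr_wpDl ?nm_ge0.
    have [l ol [hl rl]] := hT2 p rho hp hr gr _ e1.
    have h0 : opb HH (T - lam HH [:: tg a]) 0.
      split=> // x hx; rewrite ET !fctE subrr; split; [exact: l2m_0|].
      by move=> M _; rewrite mul0r; exact: ub0.
    have := rhol_approx hr (@okl_1 _ _ _ g a) ol h0 hl v.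
    rewrite {1}/rhol big_seq1 (cr_1 hr)// pE_T add0r => h1.
    have h2 := nmD (p a v - rhol rho l v) (rhol rho l v); rewrite subrK in h2.
    have h3 := @scale_small _ (nm v) (e / 2) (nm_ge0 v) ltac:(lra).
    by have := rl v; rewrite -[X in nm (rhol rho l v) <= X]mulrC; move: h1; rewrite mulrC; lra.
  (* With [b = a^*], the list of [a^* a] and the section of [c] at 1, the last clause of [kerN]
     reads [a a^* a a^* c = 0]. *)
  pose d := mul1 (mul1 a (star1 a)) (mul1 a (star1 a)).
  have hd : forall c, mul1 d c = 0.
    move=> c; have := hT3 (star1 a) [:: tg (mul1 (star1 a) a)] (dlt c) (perp_star ha) (@okl_1 _ _ _ _ _) (l2m_dlt _ _).
    have Lop1 : forall (b : A 1%g) x, Lop [:: tg b] x = Lu (tg b) x by move=> b x; rewrite /Lop big_seq1.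
    rewrite ET !Lop1 lamE; last by rewrite !Lu_dlt; exact: l2m_dlt.
    rewrite Lop1 !Lu_dlt => /(congr1 (fun x : S => x 1%g)); rewrite /dlt fibreT => E1.
    have -> //: mul1 d c = mul1 a (mul1 (mul1 (star1 a) a) (mul1 (star1 a) c)).
    by apply: tagI; rewrite !T_mul1 !tmulA.
  have d0 : d = 0.
    apply: nm_eq0; apply/eqP; rewrite -(@nm_bs _ (fib1 A)) -sqrf_eq0 -(@bnC _ (fib1 A)) (@bsK _ (fib1 A)).
    by rewrite -[bm _ _]/(mul1 d (star1 d)) hd nm0.
  have sa : star1 (mul1 a (star1 a)) = mul1 a (star1 a).
    by apply: tagI; rewrite T_star1 T_mul1 tstarM T_star1 tstarK.
  have e0 : mul1 a (star1 a) = 0.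
    by apply: nm_eq0; apply/eqP; rewrite -sqrf_eq0 -nm_star_mul sa -/d d0 nm0.
  have a0 : a = 0.
    apply: nm_eq0; apply/eqP; rewrite -(@nm_bs _ (fib1 A)) -sqrf_eq0 -nm_star_mul.
    have ->: mul1 (star1 (@bs _ (fib1 A) a)) (@bs _ (fib1 A) a) = mul1 (star1 (star1 a)) (star1 a) by [].
    by rewrite (_ : star1 (star1 a) = a) ?e0 ?nm0//; exact: (@bsK _ (fib1 A)).
  rewrite /= ET a0; apply: functional_extensionality_dep => x.
  case: (pselect (l2m HH x)) => hx; last by rewrite lam_out.
  rewrite lamE// /Lop big_seq1; apply: functional_extensionality_dep => k.
  by rewrite /Lu /= fmul0l fcast0.
move=> ->; split; first exact: ideal0 kerN_ideal.
exists 0 => //; rewrite (@left_reg_unit _ _ _ HH 0)//.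
apply: functional_extensionality_dep => x.
case: (pselect (l2m HH x)) => hx; last by rewrite lam_out.
rewrite lamE// /Lop big_seq1; apply: functional_extensionality_dep => k.
by rewrite /Lu /= fmul0l fcast0.
Qed.

Lemma kerN_eq0 : detects_ideals (reduced_algebra A HH) (unit_coefficients A HH) -> forall T, kerN T -> T = 0.
Proof.
move=> hdet T hT; have /(_ kerN_unit) E := hdet _ kerN_ideal.
by move: hT; rewrite E.
Qed.
End Ideal.

Section Abs.
Context {R : realType} {H : hilbertSpace R}.
(** Uniqueness of positive square roots. With [D = r - T], [(r + T) D = 0] shows that the forms of
    [r] and [T], both non-negative, vanish at all [D y]; so the form of [D] vanishes there too,
    which gives [D^3 = 0] and then [D = 0] by selfadjointness. *)
Lemma abs_eq (T r : H -> H) : linear T -> linear r -> (forall x, nm (T x) <= nm x) ->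
  (forall x y, hip (T x) y = hip x (T y)) -> (forall x y, hip (r x) y = hip x (r y)) ->
  (forall x, r (r x) = T (T x)) -> (forall x, T (r x) = r (T x)) ->
  (forall x, 0 <= re (hip x (T x))) -> (forall x, 0 <= re (hip x (r x))) -> forall x, r x = T x.
Proof.
move=> lT lr cT sT sr rr tr pT pr.
pose D x := r x - T x.
have lD : linear D by move=> c x y; rewrite /D lT lr; lmod.
have sD x y : hip (D x) y = hip x (D y) by rewrite /D hiplB hiprB sT sr.
have DD x : r (D x) + T (D x) = 0.
  by rewrite /D (linB lr) (linB lT) rr tr; lmod.
have D3 x : D (D (D x)) = 0.
  apply: (@nonneg_sa_eq0 _ _ (fun x => D (D (D x)))) => [c y z|y z|y].
  - by rewrite !lD.
  - by rewrite !sD.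
  - rewrite -sD {2}/D hiprB.
    have := congr1 (hip (D y)) (DD y); rewrite hiprD hipr0 => /(congr1 re); rewrite reD re0 reB => E.
    have h1 := pT (D y); have h2 := pr (D y); lra.
have D2 x : D (D x) = 0.
  by apply: hip_eq0; rewrite sD D3 hipr0.
have D1 x : D x = 0 by apply: hip_eq0; rewrite sD D2 hipr0.
by move=> x; apply: subr0_eq; exact: D1.
Qed.
End Abs.

(** * Detection of ideals makes positivity independent of the extension *)

Section Main.
Context {R : realType} {G : groupType} {A : fellBundle R G} (g : G) (I : set (A 1%g)).
Local Notation S := (section A).
Local Notation tot := (tot A).
Local Notation HH := (cycp g).
Implicit Types (u : tot) (l m : seq tot).
Hypothesis idI : ideal (unit_algebra A) I.
Hypothesis hdet : detects_ideals (reduced_algebra A HH) (unit_coefficients A HH).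

Section Iter.
Variable h : seq tot.
Hypothesis oh : okl g h.
(** [(1 - h^2) l], a list although 1 need not belong to the algebra. *)
Definition sq l := l ++ map (cs (-1)) (lmulL h (lmulL h l)).
Fixpoint zl n l := if n is n'.+1 then map (cs 2^-1) (sq l ++ zl n' (zl n' l)) else [::].
Lemma okl_zl n l : okl g l -> okl g (zl n l).
Proof.
elim: n l => [|n IH] l ol /=; first exact: okl_nil.
apply: okl_cs; apply: okl_cat; last by apply: (IH); exact: IH.
by apply: okl_cat => //; apply: okl_cs; do 2 apply: okl_mul => //.
Qed.

(** [E] stands for each of the three evaluations of lists: [Lopf] on finitely supported sections,
    [Lop] on all sections and [rhol] under an extension. *)
Lemma zl_eval (X : lmodType R[i]) (E : seq tot -> X -> X) n l x :
  (forall l m, E (l ++ m) x = E l x + E m x) -> (forall c l, okl g l -> E (map (cs c) l) x = c *: E l x) ->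
  (E [::] x = 0) -> (forall l, okl g l -> E (lmulL h l) x = E h (E l x)) ->
  okl g l -> E (zl n l) x = sqit (fun y => y - E h (E h y)) n (E l x).
Proof.
move=> Ec Es E0 Em; elim: n l => [//|n IH] l ol /=.
have o1 : okl g (sq l) by apply: okl_cat => //; apply: okl_cs; do 2 apply: okl_mul => //.
rewrite Es; last by apply: okl_cat => //; do 2 apply: okl_zl.
rewrite Ec IH; last exact: okl_zl.
rewrite IH// /sq Ec Es; last by do 2 apply: okl_mul => //.
by rewrite Em ?Em// ?scaleN1r//; exact: okl_mul.
Qed.

(** The iterates for [1 - h^2] tend to [1 - |h|], so these lists tend to [(|h| - h) k]. *)
Definition ll (k : A 1%g) n : seq tot := [:: tg k] ++ map (cs (-1)) (zl n [:: tg k]) ++ map (cs (-1)) (lmulL h [:: tg k]).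
Lemma okl_ll (k : A 1%g) n : okl g (ll k n).
Proof.
apply: okl_cat; first exact: okl_1.
apply: okl_cat; first by apply: okl_cs; apply: okl_zl; exact: okl_1.
by apply: okl_cs; apply: okl_mul => //; exact: okl_1.
Qed.

Lemma ll_eval (X : lmodType R[i]) (E : seq tot -> X -> X) (k : A 1%g) n x :
  (forall l m, E (l ++ m) x = E l x + E m x) -> (forall c l, okl g l -> E (map (cs c) l) x = c *: E l x) ->
  (E [::] x = 0) -> (forall l, okl g l -> E (lmulL h l) x = E h (E l x)) ->
  E (ll k n) x = E [:: tg k] x - sqit (fun y => y - E h (E h y)) n (E [:: tg k] x) - E h (E [:: tg k] x).
Proof.
move=> Ec Es E0 Em; have o1 : okl g [:: tg k] by exact: okl_1.
rewrite /ll !Ec !Es; [|by apply: okl_mul|by apply: okl_zl].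
by rewrite zl_eval// Em// !scaleN1r addrA.
Qed.

Hypothesis h1 : \sum_(u <- h) nmt u <= 1.
Hypothesis hphi : forall (p : irrep A) (xi : irrep_space p) (x y : fsIP xi),
  ip (Lopf h x : fsIP xi) y = ip x (Lopf h y : fsIP xi).

Lemma Lopf_contr (p : irrep A) (xi : irrep_space p) (x : fsIP xi) : ipn (Lopf h x : fsIP xi) <= ipn x.
Proof. by apply: le_trans (Lopf_le _ _) _; rewrite -[X in _ <= X]mul1r; apply: ler_wpM2r; first exact: ipn_ge0. Qed.

Lemma Y_contr (p : irrep A) (xi : irrep_space p) (x : fsIP xi) :
  ipn (x - (Lopf h (Lopf h x : fsIP xi) : fsIP xi)) <= ipn x.
Proof.
apply: sqr_le; first exact: ipn_ge0.
have E : ip (x - (Lopf h (Lopf h x : fsIP xi) : fsIP xi)) (x - (Lopf h (Lopf h x : fsIP xi) : fsIP xi)) =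
  ip x x - 2 * ip (Lopf h x : fsIP xi) (Lopf h x : fsIP xi) + ip (Lopf h (Lopf h x : fsIP xi) : fsIP xi) (Lopf h (Lopf h x : fsIP xi) : fsIP xi).
  by rewrite iplB !iprB -!hphi; ring.
rewrite [X in X <= _]ipn_sqr E !ip_ipn.
have -> : 2 = rc 2 :> R[i] by rewrite rc_nat.
rewrite -rcM -rcB -rcD re_rc; have := Lopf_contr (Lopf h x : fsIP xi); have := ipn_ge0 (Lopf h (Lopf h x : fsIP xi) : fsIP xi).
by move=> a0 a1; have := ler_pM a0 a0 a1 a1; rewrite -!expr2; have := sqr_ge0 (ipn (Lopf h x : fsIP xi)); lra.
Qed.

Lemma ll_cauchy_le (k : A 1%g) (m n : nat) : (n <= m)%N ->
  opb HH (lam HH (ll k n) - lam HH (ll k m)) ((zeta R m - zeta R n) * nm k).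
Proof.
move=> nm_; have zz := zeta_mono nm_ : zeta R n <= _.
have := @opb_phi _ _ _ HH (ll k n ++ map (cs (-1)) (ll k m)) ((zeta R m - zeta R n) * nm k).
move=> /(_ (@cycp_cl _ g)) H0.
apply: opb_ext (H0 _ _ _) => [x hx| | |p xi x].
- by rewrite lam_sub// !fctE.
- by apply: oklH; apply: okl_cat; [exact: okl_ll|apply: okl_cs; exact: okl_ll].
- by apply: mulr_ge0; [rewrite subr_ge0|exact: nm_ge0].
- have Ev n0 : Lopf (ll k n0) x = Lopf [:: tg k] x - sqit (fun y : fsIP xi => y - (Lopf h (Lopf h y : fsIP xi) : fsIP xi)) n0 (Lopf [:: tg k] x : fsIP xi)
     - Lopf h (Lopf [:: tg k] x : fsIP xi).
    apply: (@ll_eval (fsIP xi) (fun l x => Lopf l x)) => [l l'|c l ol||l ol].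
    + by apply: fs_eq => u; rewrite !LopfE Lop_cat -!LopfE.
    + by apply: fs_eq => u; rewrite !LopfE Lop_cs -!LopfE.
    + by rewrite /Lopf big_nil.
    + by apply: fs_eq => u; rewrite !LopfE Lop_mul -!LopfE.
  set y := Lopf [:: tg k] x in Ev.
  have ->: Lopf (ll k n ++ map (cs (-1)) (ll k m)) x = Lopf (ll k n) x - Lopf (ll k m) x.
    by apply: fs_eq => u; rewrite LopfE Lop_cat Lop_cs -!LopfE scaleN1r.
  rewrite !Ev.
  pose Y := fun y : fsIP xi => y - (Lopf h (Lopf h y : fsIP xi) : fsIP xi).
  have ->: y - sqit Y n (y : fsIP xi) - Lopf h (y : fsIP xi) - (y - sqit Y m (y : fsIP xi) - Lopf h (y : fsIP xi)) =
     sqit Y m (y : fsIP xi) - sqit Y n (y : fsIP xi) by lmod.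
  apply: le_trans (sqit_cauchy _ _ _ _ _ _ _) _ => //.
  + exact: ipnD.
  + exact: ipnZ.
  + exact: ipn_ge0.
  + by move=> c a b; rewrite /Y !(Lopf_lin h); lmod.
  + exact: Y_contr.
  + rewrite -mulrA; apply: ler_wpM2l; first by rewrite subr_ge0.
    by apply: le_trans (Lopf_le _ _) _; rewrite big_seq1.
Qed.

Lemma ll_cauchy (k : A 1%g) (e : R) : 0 < e -> exists N, forall m n : nat, (N <= m)%N -> (N <= n)%N ->
  opb HH (lam HH (ll k m) - lam HH (ll k n)) e.
Proof.
move=> e0; have e1 : 0 < e / (nm k + 1) by rewrite divr_gt0// ltr_wpDl ?nm_ge0.
have [N hN] := zeta_cauchy e1; exists N => m n Nm Nn.
have le1 (m' n' : nat) : (N <= m')%N -> (N <= n')%N -> (zeta R m' - zeta R n') * nm k <= e.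
  move=> h2 h3; apply: le_trans (ler_wpM2r (nm_ge0 k) (hN _ _ h3 h2)) _.
  by rewrite mulrC; apply: scale_small; [exact: nm_ge0|exact: ltW].
case: (leqP m n) => mn; first by apply: opb_le (ll_cauchy_le k mn); exact: le1.
have h2 := opb_lin (-1) (ll_cauchy_le k (ltnW mn)) (lam_opb (@okl_nil _ _ A g)).
apply: opb_le (opb_ext _ h2); first by rewrite nmN nm1 mul1r big_nil addr0; exact: le1.
move=> x hx; rewrite /= !fctE (_ : lam HH [::] x = 0); [lmod|by rewrite lamE// /Lop big_nil].
Qed.

Hypothesis hgood : forall p, hat I p -> exists2 rho, @cohrep R G A p g rho &
  forall v, 0 <= re (hip v (rhol rho h v)).
Hypothesis hrho : forall (p : irrep A) rho, @cohrep R G A p g rho ->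
  forall v w, hip (rhol rho h v) w = hip v (rhol rho h w).

Lemma rhol_contr (p : irrep A) rho v : @cohrep R G A p g rho -> nm (rhol rho h v) <= nm v.
Proof.
move=> hr; apply: le_trans (_ : (\sum_(u <- h) nmt u) * nm v <= _); last first.
  by rewrite -[X in _ <= X]mul1r; apply: ler_wpM2r; first exact: nm_ge0.
rewrite /rhol; elim: (h) oh => [|u l IH] ol; first by rewrite !big_nil nm0 mul0r.
rewrite !big_cons mulrDl; apply: le_trans (nmD _ _) _; apply: lerD; last by apply: IH => w hw; apply: ol; right.
have ou : cyc g (tag u) by apply: ol; left.
by have [rho' hc] := cr_coc hr ou; exact: coc_le hc _ _ _.
Qed.

Lemma rhol_ll (p : irrep A) rho (k : A 1%g) n v : @cohrep R G A p g rho ->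
  rhol rho (ll k n) v = p k v - sqit (fun y => y - rhol rho h (rhol rho h y)) n (p k v) - rhol rho h (p k v).
Proof.
move=> hr; rewrite (@ll_eval _ (rhol rho)).
- by have ->: rhol rho [:: tg k] v = p k v by rewrite /rhol big_seq1 (cr_1 hr)// pE_T.
- by move=> l m; exact: rhol_cat.
- by move=> c l ol; exact: rhol_cs hr ol.
- by rewrite /rhol big_nil.
- by move=> l ol; exact: (rhol_mul _ hr oh ol).
Qed.

Lemma rhol_abs (p : irrep A) rho : @cohrep R G A p g rho ->
  exists r : irrep_space p -> irrep_space p, [/\ linear r, forall x, nm (r x) <= 2 * nm x,
   forall x, 0 <= re (hip x (r x)),
   (forall v, 0 <= re (hip v (rhol rho h v))) -> forall x, r x = rhol rho h x &
   forall (k : A 1%g) (e : R), 0 < e -> exists N, forall n v, (N <= n)%N ->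
     nm (rhol rho (ll k n) v - (r (p k v) - rhol rho h (p k v))) <= e * nm v].
Proof.
move=> hr; have lT := rhol_lin hr oh.
have [r [lr br sr [rr pr cr cv]]] := op_abs lT (fun v => rhol_contr v hr) (hrho hr).
exists r; split=> // [pT|k e e0].
  apply: abs_eq (lT) (lr) (fun v => rhol_contr v hr) (hrho hr) sr rr _ pT pr => x.
  have bT : bdd (rhol rho h) by exists 1 => y; rewrite mul1r; exact: (@rhol_contr p rho y hr).
  exact: cr _ lT bT (fun=> erefl) x.
have e1 : 0 < e / (nm k + 1) by rewrite divr_gt0// ltr_wpDl ?nm_ge0.
have [N hN] := zeta_cauchy e1; exists N => n v Nn; rewrite rhol_ll//.
set y := p k v; pose Y := fun y => y - rhol rho h (rhol rho h y).
have ->: y - sqit Y n y - rhol rho h y - (r y - rhol rho h y) = y - sqit Y n y - r y by lmod.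
apply: ler_eps => d d0; have [M hM] := cv y d d0.
pose m := maxn M n; have := hM m (leq_maxl _ _).
rewrite /dn -/Y => h2.
have h3 : nm (sqit Y m y - sqit Y n y) <= (zeta R m - zeta R n) * nm y.
  apply: sqit_cauchy; last exact: leq_maxr.
  - exact: nmD.
  - exact: nmZ.
  - exact: nm_ge0.
  - by move=> c a b; rewrite /Y !(rhol_lin hr oh); lmod.
  - move=> a; have cT := fun v => @rhol_contr p rho v hr.
    rewrite -(@ler_pXn2r _ 2)// ?nnegrE ?nm_ge0// nm_sqrB -(hrho hr) hipxx re_rc.
    have := cT (rhol rho h a); have := nm_ge0 (rhol rho h a); have := nm_ge0 (rhol rho h (rhol rho h a)); nra.
have h4 := hN n m Nn (leq_trans Nn (leq_maxr _ _)).
have ->: y - sqit Y n y - r y = (sqit Y m y - sqit Y n y) + (y - sqit Y m y - r y) by lmod.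
apply: le_trans (nmD _ _) _; apply: lerD h2; apply: le_trans h3 _.
apply: le_trans (ler_wpM2r (nm_ge0 _) h4) _.
apply: le_trans (ler_wpM2l (ltW e1) (irr_contr k v)) _.
by rewrite mulrA; apply: ler_wpM2r; [exact: nm_ge0|rewrite mulrC; apply: scale_small; [exact: nm_ge0|exact: ltW]].
Qed.

(** For [w = k u b], the element [w w^*] of the unit fibre lies in [I]. Every [p] that does not
    vanish on [I] has an extension, under which [w w^*] is 0 because [b] is; so it belongs to [perp]
    as well. *)
Lemma killed_product (k b : A 1%g) u : I k -> perp I b -> cyc g (tag u) ->
  nmt (tmul (tg k) (tmul u (tg b))) = 0.
Proof.
move=> Ik hb ou.
pose w := tmul (tg k) (tmul u (tg b)).
have [a Ea] : exists a : A 1%g, tmul w (tstar w) = tg a.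
  by apply: tag_eta; rewrite !tag_tmul /= mulgV.
have Ia : I a.
  have [d Ed] : exists d : A 1%g, tmul (tmul u (tg b)) (tstar w) = tg d.
    by apply: tag_eta; rewrite !tag_tmul /= !mul1g mulgV.
  have ->: a = mul1 k d by apply: tagI; rewrite -Ea T_mul1 -Ed /w !tmulA.
  exact: (ideal_mulr idI).
have pa : perp I a.
  move=> p hp v; have [rho hr _] := hgood hp.
  have ob : cyc g (tag (tg b)) := cyc1 g.
  have ok : cyc g (tag (tg k)) := cyc1 g.
  have oub : cyc g (tag (tmul u (tg b))) by exact: cyc_M.
  have ow : cyc g (tag w) by exact: cyc_M.
  rewrite -pE_T -Ea -(cr_1 hr); last by rewrite tag_tmul /= mulgV.
  rewrite (cr_mul hr)//; last exact: cyc_V.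
  rewrite /w (cr_mul hr)// (cr_mul hr)// [rho (tg b) _](cr_1 hr)// pE_T (hb p hp).
  have [r1 c1] := cr_coc hr ou; have [r2 c2] := cr_coc hr ok.
  by rewrite (lin0 (coc_lin c1 erefl)) (lin0 (coc_lin c2 erefl)).
have a0 := perp_I pa Ia.
apply/eqP; rewrite -nmt_star -sqrf_eq0 -nmt_starmul tstarK -/w Ea a0 /nmt /=.
by rewrite nm0.
Qed.

Lemma Lu_eq0 u (x : S) : nmt u = 0 -> Lu u x = 0.
Proof.
move=> /nm_eq0 u0; apply: functional_extensionality_dep => k.
by rewrite /Lu u0 fmul0l fcast0.
Qed.

(** The limit belongs to [kerN]: selected extensions make [h] equal to its modulus, and products
    with [perp] vanish by [killed_product]. Detection of ideals makes it 0. *)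
Lemma limit_eq0 (k : A 1%g) : I k -> forall e : R, 0 < e -> exists N, forall n : nat, (N <= n)%N ->
  opb HH (lam HH (ll k n)) e.
Proof.
move=> Ik; have [||e e0|U [U1 U2 U3]] := @opb_complete _ _ A HH (fun n => lam HH (ll k n)).
- by move=> n; exists (\sum_(u <- ll k n) nmt u); apply: lam_opb; exact: okl_ll.
- by move=> n x hx; exact: lam_out.
- exact: ll_cauchy.
have hU : kerN g I (fun p (rho : tot -> irrep_space p -> irrep_space p) => forall v, 0 <= re (hip v (rhol rho h v))) U.
  split.
  - split=> // e e0; have [N hN] := U3 e e0; exists (ll k N); first exact: okl_ll.
    exact: hN.
  - move=> p rho hp hr gr e e0; have [N hN] := U3 e e0.
    have [r [_ _ _ rT /(_ k e e0)[N' hN']]] := rhol_abs hr.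
    exists (ll k (maxn N N')); first exact: okl_ll.
    split; first by apply: hN; exact: leq_maxl.
    by move=> v; have := hN' _ v (leq_maxr N N'); rewrite rT// subrr subr0.
  - move=> b m x hb om hx; apply: ub_small => e e0.
    have hz : l2m HH (Lop m (Lop [:: tg b] x)).
      by apply: Lop_okl => //; apply: Lop_okl => //; exact: okl_1.
    have [M hM] := tails_ub (proj2 hz); have M0 := ub_ge0 hM.
    have e1 : 0 < e / (M + 1) by rewrite divr_gt0// ltr_wpDl.
    have [N hN] := U3 _ e1; have [_ /(_ _ hz)[_ /(_ M hM)]] := hN N (leqnn N).
    rewrite !fctE lamE// (@ll_eval _ (fun l x => Lop l x)) => [|l l'|c l ol||l ol].
    + have ->: Lop [:: tg k] (Lop m (Lop [:: tg b] x)) = 0.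
        have Lop1 w z : Lop [:: w] z = Lu w z by rewrite /Lop big_seq1.
        elim: m om {hz hM} => [|u m IH] om; first by rewrite /Lop big_nil; have := Lop_lin [:: tg k] (-1) 0 0; rewrite scaler0 addr0 scaleN1r addNr.
        rewrite (Lop_cons u m) -[X in X + _]scale1r (Lop_lin [:: tg k]) scale1r IH ?addr0; last by move=> w hw; apply: om; right.
        have ou : cyc g (tag u) by apply: om; left.
        by rewrite !Lop1 -!LuM tmulA; apply: Lu_eq0; exact: killed_product.
      have lY : linear (fun y : S => y - Lop h (Lop h y)) by move=> c a a'; rewrite !Lop_lin; lmod.
      have -> : sqit (fun y : S => y - Lop h (Lop h y)) N 0 = 0 by have := sqit_lin N lY (-1) 0 0; rewrite scaler0 addr0 scaleN1r addNr.
      have -> : Lop h 0 = 0 by have := Lop_lin h (-1) 0 0; rewrite scaler0 addr0 scaleN1r addNr.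
      by rewrite !subr0; apply: ub_le; rewrite mulrC; apply: scale_small => //; exact: ltW.
    + exact: Lop_cat.
    + exact: Lop_cs.
    + by rewrite /Lop big_nil.
    + exact: Lop_mul.
have U0 := kerN_eq0 hgood hdet hU.
move=> e e0; have [N hN] := U3 e e0; exists N => n /hN.
have h2 : opb HH (lam HH [::] : S -> S) 0 by have := lam_opb (@okl_nil _ _ A g); rewrite big_nil.
move=> h3; apply: opb_le (opb_ext _ (opb_B h2 h3)); first by rewrite add0r.
by move=> x hx; rewrite U0 !fctE lamE// /Lop big_nil sub0r sub0r opprK.
Qed.

(** By [limit_eq0] and the bound for extensions, [rho h] agrees with its modulus on the vectors
    [p k x] with [k] in [I], which are dense. *)
Lemma positivity_h (p : irrep A) rho : hat I p -> @cohrep R G A p g rho ->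
  forall v, 0 <= re (hip v (rhol rho h v)).
Proof.
move=> hp hr v; have [r [lr br pr _ hN]] := rhol_abs hr.
have lT := rhol_lin hr oh.
have E (k : A 1%g) x : I k -> r (p k x) = rhol rho h (p k x).
  move=> Ik; apply: subr0_eq; apply: nm_small => e e0.
  have e1 : 0 < e / 2 / (nm x + 1) by rewrite !divr_gt0// ltr_wpDl ?nm_ge0.
  have [N1 h2] := limit_eq0 Ik e1; have [N2 h3] := hN k _ e1.
  have := rhol_bound hr (@okl_ll k (maxn N1 N2)) (h2 _ (leq_maxl _ _)) x.
  have := h3 (maxn N1 N2) x (leq_maxr _ _).
  set a := rhol rho _ _; set b := r _ - _ => h4 h5.
  have := nmB a (a - b); rewrite subKr => h6.
  have h7 := @scale_small _ (nm x) (e / 2) (nm_ge0 x) ltac:(lra).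
  by move: h4 h5; rewrite mulrC; lra.
suff /(_ v) <- : forall x, r x = rhol rho h x by exact: pr.
move=> x; have [k0 [v0 [Ik0 kv0]]] := hp.
apply: subr0_eq; apply: nm_small => e e0; have e3 : 0 < e / 3 by lra.
have [||||z [k Ik <-] hz] := @irr_dense_sub _ _ _ p [set p k v0 | k in I] _ _ _ _ x _ e3.
- by exists 0; [exact: ideal0 idI|exact: irr_0].
- move=> c _ _ [a Ia <-] [b Ib <-]; exists (c *: a + b); [exact: ideal_lin idI _ _ _ Ia Ib|exact: irr_L].
- move=> a _ [b Ib <-]; exists (mul1 a b); [exact: (ideal_mull idI)|exact: irr_M].
- by exists (p k0 v0) => //; exists k0.
have ->: r x - rhol rho h x = r (x - p k v0) - rhol rho h (x - p k v0).
  by rewrite (linB lr) (linB lT) E//; lmod.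
apply: le_trans (nmB _ _) _; have := br (x - p k v0); have := rhol_contr (x - p k v0) hr; lra.
Qed.
End Iter.

Lemma rhol_star (p : irrep A) rho l v w : @cohrep R G A p g rho -> okl g l ->
  hip (rhol rho (map (@tstar R G A) l) v) w = hip v (rhol rho l w).
Proof.
move=> hr; elim: l => [|u l IH] o; first by rewrite /rhol !big_nil hipl0 hipr0.
rewrite /rhol /= !big_cons hiplD hiprD -!/(rhol rho _ _) IH; last by move=> z hz; apply: o; right.
by rewrite (cr_star hr)//; apply: o; left.
Qed.

(** [m] is replaced by its real part, scaled by [kp] so that the norms of the entries sum to at most
    1. The real part of the quadratic form changes only by the factor [2 kp]. *)
Theorem positivity m : okl g m ->
  (forall p, hat I p -> exists2 rho, @cohrep R G A p g rho & forall v, 0 <= re (hip v (rhol rho m v))) ->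
  forall (p : irrep A) rho, hat I p -> @cohrep R G A p g rho -> forall v, 0 <= re (hip v (rhol rho m v)).
Proof.
move=> om hg p rho hp hr v.
pose s := \sum_(u <- m) nmt u.
have s0 : 0 <= s by apply: sumr_ge0 => u _; exact: nmt_ge0.
pose kp : R := (2 * s + 1)^-1.
have k0 : 0 < kp by rewrite invr_gt0; lra.
pose m' := map (@tstar R G A) m; pose h := map (cs (rc kp)) (m ++ m').
have om' : okl g m' by exact: okl_star.
have omm : okl g (m ++ m') by exact: okl_cat.
have oh : okl g h by exact: okl_cs.
have nh : \sum_(u <- h) nmt u <= 1.
  have ->: \sum_(u <- h) nmt u = kp * (2 * s).
    rewrite big_map (eq_bigr (fun u => kp * nmt u)); last first.
      by move=> u _; rewrite /nmt /= nmZ nm_rc gtr0_norm.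
    rewrite -mulr_sumr big_cat /= -/s [X in _ + X](_ : _ = s); first by congr (_ * _); lra.
    by rewrite big_map; apply: eq_bigr => u _; exact: nmt_star.
  by rewrite /kp mulrC ler_pdivrMr; lra.
have hrE (q : irrep A) sg x : @cohrep R G A q g sg -> rhol sg h x = rc kp *: (rhol sg m x + rhol sg m' x).
  by move=> hs; rewrite (rhol_cs _ _ hs omm) rhol_cat.
have hre (q : irrep A) sg x : @cohrep R G A q g sg -> re (hip x (rhol sg h x)) = 2 * kp * re (hip x (rhol sg m x)).
  move=> hs; rewrite hrE// hiprZ reZ hiprD reD.
  have ->: re (hip x (rhol sg m' x)) = re (hip x (rhol sg m x)) by rewrite -(rhol_star _ _ hs om) hip_conj re_conj.
  by lra.
have : 0 <= re (hip v (rhol rho h v)).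
  apply: positivity_h oh nh _ _ _ _ _ hp hr v.
  - move=> q xi x y.
    have E z : Lopf h z = rc kp *: (Lopf m z + Lopf m' z).
      by apply: fs_eq => u; rewrite LopfE Lop_cs Lop_cat -!LopfE.
    rewrite !E iplZ iprZ rc_conj iplD iprD; congr (_ * _).
    have mm : map (@tstar R G A) m' = m by rewrite /m' mapK //; exact: tstarK.
    have E1 := Lopf_adj m x y; have E2 := Lopf_adj m' x y; rewrite mm in E2.
    by rewrite E1 E2 addrC.
  - move=> q hq; have [sg hs gs] := hg q hq; exists sg => // x.
    by rewrite hre//; apply: mulr_ge0 => //; lra.
  - move=> q sg hs x y; rewrite !hrE// hiplZ hiprZ rc_conj hiplD hiprD; congr (_ * _).
    rewrite rhol_star// addrC; congr (_ + _).
    by rewrite -rhol_star// /m' mapK//; exact: tstarK.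
by rewrite hre// pmulr_rge0//; lra.
Qed.
End Main.

(** * Small compressions *)

Section Resolvent.
Context {R : realType} {G : groupType} {A : fellBundle R G}.
Implicit Types (h q : uni A).

Lemma resolvent h (t : R) : pos h -> 0 < t -> exists q : uni A,
  [/\ star q = q, q * (h + rc t *: 1) = 1 & (h + rc t *: 1) * q = 1].
Proof.
move=> ph t0; have [s [b [ss sb E h1 h2]]] := inv_sqrt ph t0.
exists (b * b); split; first by rewrite starM sb.
  by rewrite -E mulrA -[b * b * s]mulrA h2 mulr1 h2.
by rewrite -E mulrA -[s * s * b]mulrA h1 mulr1 h1.
Qed.

Lemma resolvent_bound h q (t : R) p (y : irrep_space p) : pos h -> 0 < t -> (h + rc t *: 1) * q = 1 ->
  t * nm (pu q y) <= nm y /\ re (hip (pu q y) (pu h (pu q y))) <= nm (pu q y) * nm y.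
Proof.
move=> ph t0 E; set u := pu q y.
have Ey : y = pu h u + rc t *: u by rewrite -[LHS]pu_1 -E pu_M pu_D pu_Z pu_1.
have := hip_cs u y; have := re_le_nm (hip u y); rewrite {1}Ey hiprD hiprZ reD reZ hipxx re_rc => h1 h2.
have h3 := pu_pos u ph; have n0 := nm_ge0 u; have ny := nm_ge0 y.
split; last by nra.
case: (ltrP 0 (nm u)) => u0; last by nra.
rewrite -(ler_pM2l u0); nra.
Qed.

(* [kappa = b b^* (b b^* + t)^-1] for an element [b] that almost fixes [et] and
   whose adjoint almost annihilates [v]. *)
Lemma irr_density_contr (p : irrep A) (v et : irrep_space p) (e : R) : hip v et = 0 -> 0 < e ->
  exists k : A 1%g, [/\ star1 k = k, forall (q : irrep A) y, nm (q k y) <= nm y,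
    nm (et - p k et) <= e & nm (p k v) <= e].
Proof.
move=> ve e0.
have n0 := nm_ge0 et.
(* So [r |et| <= e / 2]. The element [b] is taken to fix [et] up to [e / 2] and with
   [|b^* v| <= e r]. *)
pose r := e / 2 / (nm et + 1); have r0 : 0 < r by rewrite !divr_gt0//; lra.
have e1 : 0 < Num.min (e / 2) (e * r) by rewrite lt_min; apply/andP; split; [lra|exact: mulr_gt0].
have [b [h1 h2]] := irr_density ve e1; move: h1 h2; rewrite !le_min => /andP[h1 _] /andP[_ h2].
pose h := uin b * star (uin b).
have ph : pos h by have := pos_star_mul (star (uin b)); rewrite starK.
have t0 : 0 < r ^+ 2 by rewrite exprn_gt0.
have [q [sq q1 q2]] := resolvent ph t0.
have [k Ek] := inj_mul q (mul1 b (star1 b)).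
have Eh : uin (mul1 b (star1 b)) = h by rewrite injM inj_star.
rewrite Eh in Ek.
have Ek1 : uin k = 1 - rc (r ^+ 2) *: q by rewrite -Ek -q2 mulrDl -scalerAl mul1r addrK.
have Ek2 : uin k = q * h by rewrite Ek1 -q1 mulrDr -scalerAr mulr1 addrK.
have hb (s : irrep A) (u : irrep_space s) : re (hip u (pu h u)) = nm (pu (star (uin b)) u) ^+ 2.
  by rewrite pu_M -pu_S hipxx re_rc.
(* This bound of [(b b^* + t)^-1 b] by [1 / r] is the reason for [t = r^2]; it turns the estimates
   on [b] into those on [kappa]. *)
have qb (s : irrep A) (y : irrep_space s) : r * nm (pu q (pu (uin b) y)) <= nm y.
  set u := pu q _.
  have := hip_cs (pu (star (uin b)) (pu q u)) y.
  rewrite pu_S -{1}sq pu_S -/u hipxx nm_rc ger0_norm ?sqr_ge0// => h3.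
  have [h4 h5] := resolvent_bound u ph t0 q2.
  rewrite hb in h5; set w := nm (pu (star (uin b)) (pu q u)) in h3 h5.
  have nu := nm_ge0 u; have ny := nm_ge0 y; have nw : 0 <= w := nm_ge0 _.
  case: (ltrP 0 (nm u)) => u0; last by nra.
  have h6 : (r * w) ^+ 2 <= nm u ^+ 2 by rewrite exprMn; nra.
  have h7 : r * w <= nm u by apply: sqr_le.
  rewrite -(ler_pM2l u0); nra.
exists k; split.
- have: uin (star1 k) = uin k.
    rewrite inj_star Ek1 starB star_one starZr sq //.
  by case.
- move=> s y; rewrite -pu_inj.
  have [h3 h4] := resolvent_bound y ph t0 q2; set u := pu q y in h3 h4.
  have Ey : y = pu h u + rc (r ^+ 2) *: u by rewrite -[LHS]pu_1 -q2 pu_M pu_D pu_Z pu_1.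
  have Ek3 : pu (uin k) y = pu h u by rewrite -Ek pu_M.
  rewrite Ek3; apply: sqr_le; first exact: nm_ge0.
  clearbody u.
  rewrite Ey (nm_sqrD (pu h u) (_ *: u)) hiprZ reZ (hip_conj u (pu h u)) re_conj.
  have := pu_pos u ph; have := sqr_ge0 (nm (rc (r ^+ 2) *: u)); have := t0; nra.
- rewrite -pu_inj Ek1 pu_B pu_1 pu_Z subKr nmZ nm_rc gtr0_norm//.
  have := qb p et; have [] := resolvent_bound (et - p b et) ph t0 q2.
  have ->: pu q et = pu q (pu (uin b) et) + pu q (et - p b et).
    by rewrite -(linD (pu_lin q)) pu_inj addrC subrK.
  move=> h3 _ h4; have h5 := nmD (pu q (pu (uin b) et)) (pu q (et - p b et)).
  have h6 : r * nm et <= e / 2 by rewrite /r mulrC; apply: scale_small => //; lra.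
  have h7 : r ^+ 2 * nm (pu q (pu (uin b) et)) <= e / 2 by have := nm_ge0 et; nra.
  rewrite nmBC in h1.
  apply: le_trans (ler_wpM2l (ltW t0) h5) _; rewrite mulrDr.
  by nra.
- rewrite -pu_inj Ek2 pu_M pu_M -inj_star [pu (uin (star1 b)) v]pu_inj.
  have := qb p (p (star1 b) v) => h3; rewrite -(ler_pM2l r0); lra.
Qed.
End Resolvent.

(** * Spectral cut-offs of positive elements *)

Section Cutoff.
Context {R : realType} {D : cstarAlg R}.

(* With [w = 1 - 2 e] one has [z = 1 - |w|], so that [e + z / 2] and [e - z / 2]
   are [min (2 e) 1] and [max (2 e - 1) 0]. *)
Lemma cutoff (e : D) (P : set D) : pos e -> nrm e = 1 -> alg_closed P -> P e ->
  exists a m k : D, [/\ [/\ star a = a, nrm a <= 1, star m = m & a * m = m],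
    [/\ a = e * k, nrm k <= 6 & m <> 0] & P a /\ P m].
Proof.
move=> pe ne cP Pe; have se := pos_sa pe.
pose w : D := 1 - (e + e).
have sw : star w = w by rewrite starB star_one starD se.
have p1e : pos (1 - e).
  by have := @pos_nrm _ _ e 1 se; rewrite ne lexx rc1 scale1r; apply.
have nw : nrm w <= 1.
  apply: interval_pos => //; rewrite rc1 scale1r.
    by rewrite /w subKr; exact: posD.
  have -> : 1 + w = (1 - e) + (1 - e) by rewrite /w; lmod.
  exact: posD.
have n1e : nrm (1 - e) <= 1 by apply: pos_le => //; rewrite rc1 scale1r subKr.
pose y : D := 1 - w * w.
have ny : nrm y <= 1 by exact: nrm_1Bsq.
have Ey : y = rc 4 *: (e - e * e).
  rewrite /y /w; nce; rewrite rc_nat; lmod.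
have sy : star y = y by rewrite /y starB starM star_one sw.
have [z [zE nz sz zP]] := sqrt_one ny; have {}sz := sz sy.
have Py (Q : set D) : alg_closed Q -> Q e -> Q y.
  move=> cQ Qe; rewrite Ey; apply: alg_closedZ => //; apply: alg_closedB => //.
  by case: cQ => _ h _; exact: h.
have ze : z * e = e * z by apply: (zP _ (comm_closed e)); apply: Py; [exact: comm_closed|].
have Pz : P z by apply: zP => //; exact: Py.
pose v := rc (2^-1) *: z.
have nv : nrm v <= 2^-1 by rewrite nrmZr ?invr_ge0// -[X in _ <= X]mulr1 ler_pM2l ?invr_gt0.
have [u [u1 u2 nu]] : exists u : D, [/\ u * (1 - v) = 1, (1 - v) * u = 1 & nrm u <= 1 + nrm v * nrm u].
  by apply: neumann; apply: le_lt_trans nv _; rewrite invf_lt1// ltr1n.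
have nu2 : nrm u <= 2 by have := nrm_ge0 u; nra.
pose b := e + v; pose m := e - v.
have ve : v * e = e * v by rewrite /v -scalerAl -scalerAr ze.
have zv : z = v + v by rewrite /v; lmod.
have sv : star v = v by rewrite /v starZr sz.
clearbody v.
have vv : v * v = v - (e - e * e).
  have := zE; rewrite zv Ey => /(congr1 (fun x => rc (4^-1) *: x)); nce => h.
  have -> : v * v = rc 4^-1 *: (rc 4 *: (e - e * e) + (v * v + v * v + (v * v + v * v))) - (e - e * e).
    rewrite rcV rc_nat; lmod.
  rewrite !addrA in h *; rewrite -h rcV rc_nat; lmod.
have bm : b * m = m.
  have : b * m = e * e - v * v + (v * e - e * v) by rewrite /b /m; nc.
  by rewrite ve subrr addr0 vv => ->; rewrite /m; lmod.
have sb : star b = b by rewrite starD se sv.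
have nb : nrm (1 - b) <= 1.
  have nz1 : nrm (1 - z) <= 1.
    have s1 : star (1 - z) = 1 - z by rewrite starB star_one sz.
    have := nrm_sa s1; have -> : (1 - z) * (1 - z) = w * w.
      have : (1 - z) * (1 - z) = 1 - (z + z) + z * z by nc.
      by rewrite zE /y => ->; lmod.
    move=> h; apply: sqr_le => //; rewrite -h expr1n; apply: le_trans (nrmM _ _) _.
    by have := nrm_ge0 w; nra.
  have -> : 1 - b = rc (2^-1) *: w + rc (2^-1) *: (1 - z) by rewrite /b /w zv rcV rc_nat; lmod.
  apply: le_trans (nrmD _ _) _; rewrite !nrmZr ?invr_ge0//; lra.
have Ev : v = e * ((1 - e) * u).
  have E1 : v * (1 - v) = e * (1 - e) by rewrite mulrBr mulr1 vv subKr; nc.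
  by rewrite mulrA -E1 -mulrA u2 mulr1.
(* Since [v (1 - v) = e (1 - e)] and [u] inverts [1 - v], the element [v] is [e] times [(1 - e) u],
   and [b = e + v] is a multiple of [e] as well. *)
pose k0 := 1 + (1 - e) * u.
have Eb : b = e * k0 by rewrite /k0 mulrDr mulr1 -Ev.
have nk0 : nrm k0 <= 3.
  apply: le_trans (nrmD _ _) _; rewrite nrm1; have := nrmM (1 - e) u.
  have := nrm_ge0 u; have := nrm_ge0 (1 - e); nra.
have Pv : P v.
  have -> : v = rc (2^-1) *: z by rewrite zv rcV rc_nat; lmod.
  exact: alg_closedZ.
(* [b] fixes [m], hence so does [1 - (1 - b)^2], whose norm is at most 1 by [nrm_1Bsq]. It equals
   [b (2 - b)], so the cofactor of [e] has norm at most [3 * 2 = 6], the 6 that recurs below. *)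
exists (1 - (1 - b) * (1 - b)), m, (k0 * (1 + (1 - b))); split; [split|split|split].
- by rewrite starB starM starB star_one sb.
- by apply: nrm_1Bsq => //; rewrite starB star_one sb.
- by rewrite starB se sv.
- by rewrite mulrBl mul1r -mulrA [(1 - b) * m]mulrBl mul1r bm subrr mulr0 subr0.
- have gen (q : D) : 1 - (1 - q) * (1 - q) = q * (1 + (1 - q)) by nc.
  by rewrite mulrA -Eb; exact: gen.
- apply: le_trans (nrmM _ _) _; have := nrmD 1 (1 - b); rewrite nrm1.
  have := nrm_ge0 k0; have := nrm_ge0 (1 + (1 - b)); nra.
- move=> /eqP; rewrite subr_eq0 => /eqP ev; have := nv; rewrite -ev ne; lra.
- have Pb : P b by exact: alg_closedD.
  have ->: 1 - (1 - b) * (1 - b) = b + b - b * b by nc.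
  by apply: alg_closedB => //; [exact: alg_closedD|case: cP => _ h _; exact: h].
- exact: alg_closedB.
Qed.
End Cutoff.

Section Estimates.
Context {R : realType}.
Implicit Types (a b e u w y C S K X tau : R).

Lemma le_of_sqr y a b C : 0 <= y -> 0 <= b -> 0 <= C -> y ^+ 2 <= a * b -> a <= C * y -> y <= C * b.
Proof.
move=> y0 b0 C0 h1 h2; case: (ltrP 0 y) => yp.
  by rewrite -(ler_pM2l yp); nra.
by apply: le_trans yp _; exact: mulr_ge0.
Qed.

Lemma compress_bound1 tau X e a b : 0 < tau -> 0 <= X -> e = tau / 2 / (26 * X + 1) ->
  a <= 2 * X * (13 * e) -> b <= e -> tau^-1 * (a + b) <= 2^-1.
Proof.
move=> t0 X0 E ha hb.
rewrite ler_pdivrMl//; apply: le_trans (_ : (26 * X + 1) * e <= _); first by lra.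
by rewrite E mulrC divfK; [lra|rewrite gt_eqF//; lra].
Qed.

Lemma compress_bound2 e X tau S K u w : 0 < e -> 0 <= X -> tau = (e / (1 + X)) ^+ 2 -> 0 <= S -> 0 <= K ->
  0 <= u -> u <= w -> tau^-1 * (S ^+ 2 + K ^+ 2) <= u * w -> u * S + K * (X * u) <= e * w ^+ 2.
Proof.
move=> e0 X0 tE S0 K0 u0 uw h.
pose r := e / (1 + X); have r0 : 0 < r by rewrite divr_gt0//; lra.
rewrite -/r in tE; have t0 : 0 < tau by rewrite tE exprn_gt0.
have w0 : 0 <= w by lra.
have h5 : S ^+ 2 + K ^+ 2 <= (r * w) ^+ 2.
  by rewrite exprMn -tE -ler_pdivrMl//; nra.
have b1 : S <= r * w by apply: sqr_le; [nra|have := sqr_ge0 K; lra].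
have b2 : K <= r * w by apply: sqr_le; [nra|have := sqr_ge0 S; lra].
have -> : e = r * (1 + X) by rewrite /r divfK// gt_eqF//; lra.
have d1 : u * S <= w * (r * w) by apply: ler_pM.
have d2 : K * (X * u) <= (r * w) * (X * w).
  by apply: ler_pM => //; [exact: mulr_ge0|exact: ler_wpM2l].
lra.
Qed.
End Estimates.

(** * Compressions with small quadratic form *)

Section Small.
Context {R : realType} {G : groupType} {A : fellBundle R G} (g : G) (I : set (A 1%g)).
Hypothesis idI : ideal (unit_algebra A) I.
Hypothesis hdet : detects_ideals (reduced_algebra A (cycp g)) (unit_coefficients A (cycp g)).
Hypothesis g1 : g <> 1%g.
Hypothesis fixI : forall p, hat I p -> is_tensor g p p.
Local Notation coh p rho := (@cohrep R G A p g rho).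

Lemma cyc_g : cyc g g. Proof. by exists 1%N; left; rewrite expg1. Qed.

Definition sand (c : A 1%g) (x : A g) : tot A := tmul (tg (star1 c)) (tmul (tg x) (tg c)).
Lemma cyc_sand c x : cyc g (tag (sand c x)).
Proof. by rewrite !tag_tmul; apply: cyc_M; [exact: cyc1|apply: cyc_M; [exact: cyc_g|exact: cyc1]]. Qed.
Lemma coh_a p rho (a : A 1%g) v : coh p rho -> rho (tg a) v = p a v.
Proof. by move=> hr; rewrite (cr_1 hr)// pE_T. Qed.
Lemma coh_sand p rho c x v : coh p rho -> hip v (rho (sand c x) v) = hip (p c v) (rho (tg x) (p c v)).
Proof.
move=> hr; rewrite /sand (cr_mul hr); [|exact: cyc1|by rewrite tag_tmul; apply: cyc_M; [exact: cyc_g|exact: cyc1]].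
by rewrite (cr_mul hr); [rewrite !(coh_a _ _ hr) irr_S'|exact: cyc_g|exact: cyc1].
Qed.

Lemma coh_lin p rho (x : A g) : coh p rho -> linear (rho (tg x)).
Proof. by move=> hr; have [rho' hc] := cr_coc hr cyc_g; exact: (coc_lin hc (erefl : tag (tg x) = g)). Qed.
Lemma coh_le p rho (x : A g) v : coh p rho -> nm (rho (tg x) v) <= nm x * nm v.
Proof. by move=> hr; have [rho' hc] := cr_coc hr cyc_g; exact: (coc_le hc _ (erefl : tag (tg x) = g)). Qed.

(* Otherwise the quadratic form of [rho x] on the range of [p c] would be
   almost positive, after multiplication by a phase, for a suitable extension of
   every [p]; then it would be so for all extensions, whereas their average
   vanishes. *)
Lemma small_vector (c : A 1%g) (x : A g) (e : R) : I c -> c <> 0 -> 0 < e ->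
  exists (p : irrep A) rho v, [/\ hat I p, coh p rho, nm (p c v) = 1 &
    nm (hip (p c v) (rho (tg x) (p c v))) <= e].
Proof.
move=> Ic c0 e0; apply: contrapT => hn.
pose vals : set R := [set r | exists (p : irrep A) rho v, [/\ hat I p, coh p rho, nm (p c v) = 1 &
    r = nm (hip (p c v) (rho (tg x) (p c v)))]].
have unitv (p : irrep A) v : p c v <> 0 -> nm (p c (rc (nm (p c v))^-1 *: v)) = 1.
  move=> /nm_gt0 h; rewrite (linZ (@irr_lin _ _ _ p c)) nmZ nm_rc gtr0_norm ?invr_gt0// mulVf// gt_eqF//.
have [p0 [v0 pv0]] : exists (p : irrep A) v, p c v <> 0.
  apply: contrapT => h; apply: c0; apply: irr_sep => p v; apply: contrapT => h1.
  by apply: h; exists p, v.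
have hp0 : hat I p0 by exists c, v0.
have vlt r : vals r -> e < r.
  move=> [p [rho [v [hp hr n1 ->]]]]; rewrite ltNge; apply/negP => h.
  by apply: hn; exists p, rho, v.
have vub r : vals r -> r <= nm x.
  move=> [p [rho [v [hp hr n1 ->]]]]; apply: le_trans (hip_cs _ _) _; rewrite n1 mul1r.
  by have := coh_le x (p c v) hr; rewrite n1 mulr1.
have [N [cc [rho [hc nc sc s0]]]] := coherent_family (fixI hp0) g1.
have vne : vals !=set0.
  by eexists; exists p0, (rho 0%N), (rc (nm (p0 c v0))^-1 *: v0); split => //; exact: unitv.
have hs : has_sup vals by split=> //; exists (nm x) => r; exact: vub.
pose s := sup vals.
have les r : vals r -> r <= s by move=> h; exact: sup_upper_bound.
have es : e < s by case: vne => r hr; apply: lt_le_trans (vlt r hr) (les r hr).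
have s_gt0 : 0 < s by lra.
(* A number of modulus at most [s] and real part above [s (1 - d)] has squared distance at most
   [2 d s^2 = e^2] from [s]. *)
pose d := e ^+ 2 / (2 * s ^+ 2).
have ds : 2 * d * s ^+ 2 = e ^+ 2 by rewrite /d; field; rewrite gt_eqF.
have d0 : 0 < d by rewrite /d divr_gt0 ?exprn_gt0// mulr_gt0 ?exprn_gt0.
have [_ [p1 [rho1 [v1 [hp1 hr1 n1 ->]]]] h1] := sup_adherent (mulr_gt0 s_gt0 d0) hs.
have [w [nw wE wc]] := phase (hip (p1 c v1) (rho1 (tg x) (p1 c v1))).
(* Its form [s (1 - d) |c v|^2 - re (w <c v | x c v>)] is negative at [v1], where the supremum [s]
   is nearly reached and [w] is the phase. By [positivity], this is absurd once every [p] is seen to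
   have an extension with non-negative form. *)
pose m : seq (tot A) := tg (rc (s * (1 - d)) *: mul1 (star1 c) c) :: map (cs (- w)) [:: sand c x].
have om : okl g m.
  apply: okl_cons; first exact: cyc1.
  by apply: okl_cs; apply: okl_cons; [exact: cyc_sand|exact: okl_nil].
have form p sg v : coh p sg -> re (hip v (rhol sg m v)) =
    s * (1 - d) * nm (p c v) ^+ 2 - re (w * hip (p c v) (sg (tg x) (p c v))).
  move=> hr; rewrite /rhol big_cons -/(rhol sg _ v) (rhol_cs _ _ hr); last first.
    by apply: okl_cons; [exact: cyc_sand|exact: okl_nil].
  rewrite (coh_a _ _ hr) irr_Z irr_M hiprD !hiprZ irr_S' hipxx /rhol big_seq1 (coh_sand _ _ _ hr).
  by rewrite -rcM reD re_rc mulNr reN.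
have bad : ~ 0 <= re (hip v1 (rhol rho1 m v1)).
  rewrite form// n1 expr1n mulr1 wE re_rc => h.
  by move: h1; rewrite -/s; nra.
apply: bad; apply: (positivity idI hdet om) => // p hp; apply: contrapT => hno.
have [N' [cc' [sg [hc' nc' sc' s0']]]] := coherent_family (fixI hp) g1.
have /choice[z hz] j : exists v, nm (p c v) = 1 /\ s * (1 - d) < re (w * hip (p c v) (sg j (tg x) (p c v))).
  apply: contrapT => h; apply: hno; exists (sg j) => // v; rewrite form// subr_ge0 leNgt; apply/negP => h2.
  have pcv : p c v <> 0.
    by move=> E; move: h2; rewrite E hipl0 mulr0 re0 nm0 expr0n mulr0 ltxx.
  apply: h; exists (rc (nm (p c v))^-1 *: v); split; first exact: unitv.
  have h3 : 0 < (nm (p c v))^-1 by rewrite invr_gt0; exact: nm_gt0.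
  rewrite (linZ (@irr_lin _ _ _ p c)) (linZ (coh_lin x (hc' j))) hiplZ hiprZ rc_conj.
  have ->: w * (rc (nm (p c v))^-1 * (rc (nm (p c v))^-1 * hip (p c v) (sg j (tg x) (p c v)))) =
     rc ((nm (p c v))^-1 ^+ 2) * (w * hip (p c v) (sg j (tg x) (p c v))) by rewrite rcX; ring.
  rewrite reZ -(ltr_pM2l (exprn_gt0 2 h3)) in h2 *.
  apply: le_lt_trans h2; rewrite mulrCA -exprMn mulVf ?expr1n ?mulr1//.
  by rewrite gt_eqF//; exact: nm_gt0.
pose T := sg 0%N (tg x).
pose M : set (irrep_space p) := range (p c).
(* Convexity of the numerical range: one unit vector in the range of [p c] realizes the average over
   the twists, which will be at most [e] in modulus, whereas every value exceeds [e]. *)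
have [|||z0 [[v' _ Ev'] nz0 Ez0]] := @numerical_range_avg _ _ T M (coh_lin x (hc' 0%N)) _ N' (fun j => p c (z j)).
- by move=> k _ _ [a _ <-] [b _ <-]; exists (k *: a + b) => //; exact: irr_lin.
- by move=> j; exists (z j).
- by move=> j; case: (hz j).
have : e < nm (hip z0 (T z0)).
  by apply: vlt; exists p, (sg 0%N), v'; rewrite Ev'.
apply/negP; rewrite -leNgt Ez0.
pose eta j := w * hip (p c (z j)) (sg j (tg x) (p c (z j))) - rc s.
have eta_le j : nm (eta j) <= e.
  have [nz rz] := hz j; set f := w * hip (p c (z j)) (sg j (tg x) (p c (z j))) in rz *.
  have fs : nm f <= s by rewrite nmM nw mul1r; apply: les; exists p, (sg j), (z j).
  apply: sqr_le; first exact: ltW.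
  have ->: nm (eta j) ^+ 2 = nm f ^+ 2 - 2 * s * re f + s ^+ 2.
    by rewrite !nm_sqr /eta mulrBr !reB re_rc (re_i_mul (rc_conj s)); ring.
  rewrite -ds; have := nm_ge0 f; nra.
(* The extension [sg j] is [cc' j] times [T] on [x]. The terms with [s] cancel in the sum because
   the [cc' j] sum to 0, and only the [eta j] remain. *)
have TE j : hip (p c (z j)) (T (p c (z j))) = (cc' j)^* * w^* * (rc s + eta j).
  rewrite /eta addrC subrK sc'// hiprZ.
  have c1 : (cc' j)^* * cc' j = 1 by rewrite conj_mul nc' expr1n.
  transitivity ((cc' j)^* * cc' j * (w^* * w) * hip (p c (z j)) (T (p c (z j)))); last by rewrite /T; ring.
  by rewrite c1 wc !mul1r.
have -> : \sum_(i < N'.+1) hip (p c (z i)) (T (p c (z i))) = \sum_(i < N'.+1) (cc' i)^* * w^* * eta i.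
  under eq_bigr do rewrite TE mulrDr.
  rewrite big_split /=; under eq_bigr do rewrite -mulrA.
  rewrite -mulr_suml -rmorph_sum /= s0' conj0 mul0r add0r; by apply: eq_bigr => i _; rewrite ?mulrA.
rewrite nmM nm_rc ger0_norm ?invr_ge0// mulrC ler_pdivrMr//.
apply: le_trans (nm_sum _ _ _) _; apply: le_trans (_ : \sum_(i < N'.+1) e <= _).
  by apply: ler_sum => i _; rewrite !nmM !nm_conj nc' nw !mul1r.
by rewrite sumr_const card_ord mulr_natr.
Qed.

Lemma coh_B p rho (a b : A g) v : coh p rho -> rho (tg (a - b)) v = rho (tg a) v - rho (tg b) v.
Proof.
move=> hr; have [rho' hc] := cr_coc hr cyc_g.
by have := coc_add hc (-1) b a v; rewrite scaleN1r addrC => ->; lmod.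
Qed.
Lemma coh_lact p rho a (y : A g) v : coh p rho -> rho (tg (lact a y)) v = p a (rho (tg y) v).
Proof. by move=> hr; rewrite T_lact (cr_mul hr); [exact: coh_a|exact: cyc1|exact: cyc_g]. Qed.
Lemma coh_ract p rho a (y : A g) v : coh p rho -> rho (tg (ract y a)) v = rho (tg y) (p a v).
Proof. by move=> hr; rewrite T_ract (cr_mul hr); [rewrite coh_a|exact: cyc_g|exact: cyc1]. Qed.
Lemma coh_rip p rho (y z : A g) v w : coh p rho -> hip (rho (tg y) v) (rho (tg z) w) = hip v (p (rip y z) w).
Proof.
move=> hr; have [rho' hc] := cr_coc hr cyc_g.
by rewrite (coc_s hc) // -T_rip pE_T.
Qed.

(** At one vector [v] the form of [x' = c^* x c] is small. A contraction [k'] that almost kills [v]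
    and almost fixes the part of [x' v] orthogonal to [v] splits [x'] into [z = x' - k' x'], which
    is small at [v], and [k' x'], whose form at [u] is that of [x'] between [k' u] and [u]. The
    resolvent [f] of [z^* z + k'^2] confines to vectors where both are small, without losing [v]. *)
Lemma compress1 (c : A 1%g) (x : A g) (e : R) : I c -> nm c = 1 -> 0 < e ->
  exists (f : uni A) (c' : A 1%g), [/\ uin c' = uin c * f, 1 <= 12 * nm c' &
    forall (p : irrep A) rho w, coh p rho ->
    nm (hip (p c' w) (rho (tg x) (p c' w))) <= e * nm w ^+ 2].
Proof.
move=> Ic nc e0.
have pe : pos (uin (mul1 (star1 c) c)) by rewrite injM inj_star; exact: pos_star_mul.
have ne : nrm (uin (mul1 (star1 c) c)) = 1 by rewrite nrm_inj nm_star_mul nc expr1n.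
have [|a [m [k [[sa na sm am] [ak nk m0] [[a' _ Ea] [m' _ Em]]]]]] := cutoff pe ne (@inj_closed _ _ A); first by exists (mul1 (star1 c) c).
(* [m'] lives where [c^* c] is bounded below: [m = a m] with [a = c^* c k]. So [v] below can have
   norm at most 6 while [c v] has norm 1. *)
have cutv (p : irrep A) w : nm (p m' w) <= 6 * nm (p c (p m' w)).
  have E : p m' w = pu (star k) (p (star1 c) (p c (p m' w))).
    rewrite -irr_M -[p (mul1 _ _) _]pu_inj -pu_M -[in LHS]pu_inj Em -[in RHS]pu_inj Em -pu_M.
    by rewrite -{1}am -sa ak starM (pos_sa pe).
  rewrite {1}E; apply: le_trans (pu_contr _ _) _.
  have := irr_contr (star1 c) (p c (p m' w)); rewrite (@nm_bs _ (fib1 A) c : nm (star1 c) = _) nc mul1r.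
  rewrite nrm_star; have := nm_ge0 (p (star1 c) (p c (p m' w))); have := nm_ge0 (p c (p m' w)); have := nrm_ge0 k; nra.
pose X := nm x; have X0 : 0 <= X := nm_ge0 x.
pose tau := (e / (1 + X)) ^+ 2; have t0 : 0 < tau by rewrite exprn_gt0// divr_gt0//; lra.
pose e1 := tau / 2 / (26 * X + 1).
have e10 : 0 < e1 by rewrite !divr_gt0//; lra.
have Icm : I (mul1 c m') by exact: (ideal_mulr idI).
have cm0 : mul1 c m' <> 0.
  move=> E; apply: m0; rewrite -Em; suff -> : m' = 0 by [].
  apply: irr_sep => p v; apply: nm_le0.
  by have := cutv p v; rewrite -irr_M E irr_0 nm0 mulr0.
have [p [rho [v0 [hp hr n1 rv]]]] := small_vector x Icm cm0 e10.
rewrite irr_M in n1 rv; set v := p m' v0 in n1 rv.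
have nv6 : nm v <= 6 by have := cutv p v0; rewrite -/v n1 mulr1.
have nv1 : 1 <= nm v by rewrite -n1 -[X in _ <= X]mul1r -nc; exact: irr_contr.
pose x' : A g := lact (star1 c) (ract x c).
have rx' q (sg : tot A -> irrep_space q -> irrep_space q) y : coh q sg -> sg (tg x') y = q (star1 c) (sg (tg x) (q c y)).
  by move=> hs; rewrite coh_lact// coh_ract.
have nx' q (sg : tot A -> irrep_space q -> irrep_space q) y : coh q sg -> nm (sg (tg x') y) <= X * nm y.
  move=> hs; rewrite rx'//; apply: le_trans (irr_contr _ _) _; rewrite (@nm_bs _ (fib1 A) c : nm (star1 c) = _) nc mul1r.
  apply: le_trans (coh_le x (q c y) hs) _; apply: ler_wpM2l => //.
  by have := irr_contr c y; rewrite nc mul1r.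
pose et := rho (tg x') v; pose th := (rc (nm v ^+ 2))^-1 * hip v et.
have hve : nm (hip v et) <= e1 by rewrite /et rx'// irr_S'.
have nth : nm th <= e1.
  rewrite /th nmM -rcV nm_rc ger0_norm ?invr_ge0 ?sqr_ge0//.
  have v2 : 1 <= nm v ^+ 2 by rewrite expr2; nra.
  rewrite ler_pdivrMl; last by lra.
  by apply: le_trans hve _; nra.
have ve0 : hip v (et - th *: v) = 0.
  rewrite hiprB hiprZ hipxx /th mulrAC mulVf ?mul1r ?subrr// rc_eq0 expf_eq0 /= gt_eqF//; lra.
have [k' [sk ck h1 h2]] := irr_density_contr ve0 e10.
pose z : A g := x' - lact k' x'.
have rz q (sg : tot A -> irrep_space q -> irrep_space q) y : coh q sg -> sg (tg z) y = sg (tg x') y - q k' (sg (tg x') y).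
  by move=> hs; rewrite coh_B// coh_lact.
(* [13 = 1 + 2 * 6]: the error of [k'] on the orthogonal part, and [|th| <= e1] times
   [|v - k' v| <= 2 * 6]. *)
have rzv : nm (rho (tg z) v) <= 13 * e1.
  rewrite rz// -/et.
  have -> : et - p k' et = (et - th *: v - p k' (et - th *: v)) + th *: (v - p k' v).
    by rewrite (linB (@irr_lin _ _ _ p k')) (linZ (@irr_lin _ _ _ p k')); lmod.
  apply: le_trans (nmD _ _) _; rewrite nmZ.
  have := nmB v (p k' v); have := ck p v; have := nm_ge0 (v - p k' v); have := nm_ge0 th; nra.
have rzy y : nm (rho (tg z) y) <= 2 * X * nm y.
  rewrite rz//; apply: le_trans (nmB _ _) _; have := ck p (rho (tg x') y); have := nx' p rho y hr; lra.
(* For [u = f w] with [f = (1 + s)^-1], the form of [s] at [u] is at most [|u| |w|], so [z u] and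
   [k' u] have norm at most [sqrt tau |w|]; [tau] is chosen for the final [e]. *)
pose s : A 1%g := rc tau^-1 *: (rip z z + mul1 k' k').
have ps : pos (uin s).
  rewrite /s uin_Z; apply: posZ; first by rewrite invr_ge0 ltW.
  rewrite uin_D; apply: posD; first exact: posA_rip.
  by rewrite injM -{1}sk inj_star; exact: pos_star_mul.
have [f [sf f1 f2]] := resolvent ps ltr01.
have [c' Ec] := inj_mul f c; exists f, c'; split=> //.
(* Consequently [f] moves [v] by at most 1/2, so [|c' v| >= 1/2]. With [|v| <= 6] this is the factor
   12. *)
- have psv : nm (p s v) <= 2^-1.
    rewrite /s irr_Z nmZ nm_rc gtr0_norm ?invr_gt0// irr_D irr_M.
    have hk : nm (p k' (p k' v)) <= e1 by apply: le_trans (ck p _) _.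
    have hz : nm (p (rip z z) v) <= 2 * X * (13 * e1).
      set y := p (rip z z) v.
      have h3 : nm y ^+ 2 <= nm (rho (tg z) y) * nm (rho (tg z) v).
        have := hip_cs (rho (tg z) y) (rho (tg z) v); rewrite coh_rip// -/y hipxx nm_rc ger0_norm ?sqr_ge0//.
      exact: le_trans (le_of_sqr (nm_ge0 _) (nm_ge0 _) (mulr_ge0 (ler0n R 2) X0) h3 (rzy y)) (ler_wpM2l (mulr_ge0 (ler0n R 2) X0) rzv).
    apply: le_trans (compress_bound1 t0 X0 erefl hz hk); apply: ler_wpM2l; [by rewrite invr_ge0 ltW|exact: nmD].
  pose u := pu f v.
  have uv : u - v = - pu f (p s v).
    rewrite /u -[in X in _ - X](pu_1 v) -f1 pu_M -(linB (pu_lin f)) pu_D pu_inj pu_Z pu_1 rc1 scale1r.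
    by rewrite -(linN (pu_lin f)); congr (pu f _); lmod.
  have uv2 : nm (u - v) <= 2^-1.
    rewrite uv nmN; have [] := resolvent_bound (p s v) ps ltr01 f2; rewrite mul1r; lra.
  have cu : p c' v = p c u by rewrite -pu_inj -Ec pu_M pu_inj.
  have := irr_contr c' v; rewrite cu.
  have h3 : nm (p c v) <= nm (p c u) + nm (u - v).
    have -> : p c v = p c u - p c (u - v) by rewrite (linB (@irr_lin _ _ _ p c)); lmod.
    apply: le_trans (nmB _ _) _; apply: lerD => //.
    by have := irr_contr c (u - v); rewrite nc mul1r.
  rewrite n1 in h3; have := nm_ge0 c'; nra.
- move=> q sg w hs; rewrite -!pu_inj -Ec !pu_M !pu_inj.
  set u := pu f w.
  have [h3 h4] := resolvent_bound w ps ltr01 f2; rewrite -/u mul1r in h3 h4.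
  have usu : re (hip u (q s u)) = tau^-1 * (nm (sg (tg z) u) ^+ 2 + nm (q k' u) ^+ 2).
    rewrite /s irr_Z hiprZ reZ irr_D hiprD reD -(coh_rip z z u u hs) hipxx re_rc.
    by rewrite irr_M -{1}sk irr_S' hipxx re_rc.
  rewrite pu_inj usu in h4.
  rewrite -irr_S' -(rx' q sg u hs).
  have -> : sg (tg x') u = sg (tg z) u + q k' (sg (tg x') u) by rewrite rz// subrK.
  rewrite hiprD [hip u (q k' _)](_ : _ = hip (q k' u) (sg (tg x') u)); last by rewrite -{1}sk irr_S'.
  apply: le_trans (nmD _ _) _.
  apply: le_trans (lerD (hip_cs _ _) (le_trans (hip_cs _ _) (ler_wpM2l (nm_ge0 _) (nx' q sg u hs)))) _.
  exact: compress_bound2 e0 X0 erefl (nm_ge0 _) (nm_ge0 _) (nm_ge0 _) h3 h4.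
Qed.

Lemma ideal_uni_r (c c2 : A 1%g) (f : uni A) : I c -> uin c2 = uin c * f -> I c2.
Proof.
move=> Ic; rewrite (uniE f) mulrDr -scalerAr mulr1 -injM -injL => -[->].
by apply: (ideal_lin idI) => //; exact: (ideal_mulr idI).
Qed.

Lemma compress (c : A 1%g) (x : A g) (e : R) : I c -> c <> 0 -> 0 < e ->
  exists (f : uni A) (c' : A 1%g), [/\ uin c' = uin c * f, I c', nm c' = 1 &
    forall (p : irrep A) rho w, coh p rho ->
    nm (hip (p c' w) (rho (tg x) (p c' w))) <= e * nm w ^+ 2].
Proof.
move=> Ic /nm_gt0 c0 e0.
pose c1 : A 1%g := rc (nm c)^-1 *: c.
have nc1 : nm c1 = 1 by rewrite nmZ nm_rc gtr0_norm ?invr_gt0// mulVf// gt_eqF.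
have Ilin := ideal_lin idI; have I0 := ideal0 idI.
have IZ r a : I a -> I (rc r *: a) by move=> Ia; have := Ilin (rc r) a 0 Ia I0; rewrite addr0.
(* Scaling the compressed element to norm 1 multiplies its form by at most [12^2]. *)
have e1 : 0 < e / 144 by rewrite divr_gt0.
have [f [c2 [E2 n2 h2]]] := compress1 x (IZ _ _ Ic) nc1 e1.
have n0 : 0 < nm c2 by lra.
pose r := (nm c2)^-1; have r0 : 0 < r by rewrite invr_gt0.
have r12 : r <= 12 by rewrite /r -[_^-1]mul1r ler_pdivrMr.
exists (rc (r * (nm c)^-1) *: f), (rc r *: c2); split.
- by rewrite uin_Z E2 uin_Z -scalerAr -scalerAl scalerA rcM.
- apply: (IZ); exact: ideal_uni_r (IZ _ _ Ic) E2.
- by rewrite nmZ nm_rc gtr0_norm// mulVf// gt_eqF.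
- move=> p rho w hr; rewrite irr_Z (linZ (coh_lin x hr)) hiplZ hiprZ !nmM nm_conj !nm_rc gtr0_norm//.
  have := h2 p rho w hr; set b := nm (hip _ _) => hb; have b0 : 0 <= b := nm_ge0 _.
  have r2 : r * r <= 144 by nra.
  rewrite mulrA; apply: le_trans (ler_wpM2r b0 r2) _; lra.
Qed.
End Small.

(** * Nested cut-offs and their common eigenvectors *)

Section Absorb.
Context {R : realType} {G : groupType} {A : fellBundle R G}.

(** A substitute for [d] lying in the closed right ideal generated by [b], stated as what it does
    for left multipliers that fix [b]. *)
Definition absorb (b : uni A) (d : uni A) : Prop := forall a0 : uni A, a0 * b = b -> a0 * d = d.

Lemma absorb_alg b : alg_closed (absorb b).
Proof.
split=> [c x y hx hy a0 h|x y hx hy a0 h|u l hu hl a0 h].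
- by rewrite mulrDr -scalerAr hx// hy.
- by rewrite mulrA hx.
- apply: subr0_eq; apply: nrm_small => e e0.
  have e1 : 0 < e / (nrm a0 + 1) by rewrite divr_gt0// ltr_wpDl ?nrm_ge0.
  have [N hN] := hl _ e1; have := hN N (leqnn N) => h1.
  have -> : a0 * l - l = (u N - l) - a0 * (u N - l) by rewrite mulrBr hu//; lmod.
  apply: le_trans (nrmB _ _) _; have := nrmM a0 (u N - l).
  have h2 : (nrm a0 + 1) * (e / (nrm a0 + 1)) = e by rewrite mulrC divfK// gt_eqF// ltr_wpDl// nrm_ge0.
  have := nrm_ge0 a0; nra.
Qed.

Lemma absorb_mulr b d : absorb b (b * d).
Proof. by move=> a0 h; rewrite mulrA h. Qed.

Lemma absorb_trans b d f : absorb b d -> absorb d f -> absorb b f.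
Proof. by move=> h1 h2 a0 h; apply: h2; exact: h1. Qed.

Lemma cutoff_fib (e : A 1%g) : posA e -> nm e = 1 -> exists (a m : A 1%g) (k : uni A),
  [/\ [/\ star1 a = a, nm a <= 1, star1 m = m & mul1 a m = m],
      [/\ uin a = uin e * k, nrm k <= 6 & m <> 0] &
      absorb (uin e) (uin a) /\ absorb (uin e) (uin m)].
Proof.
rewrite -nrm_inj => pe ne.
pose P := [set d : uni A | range (@uin R G A) d /\ absorb (uin e) d].
have cP : alg_closed P.
  have [p1 p2 p3] := @inj_closed _ _ A; have [q1 q2 q3] := @absorb_alg (uin e).
  split=> [z x y [x1 x2] [y1 y2]|x y [x1 x2] [y1 y2]|u l hu hl].
  - by split; [exact: p1|exact: q1].
  - by split; [exact: p2|exact: q2].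
  - by split; [apply: p3 hl => n|apply: q3 hl => n]; case: (hu n).
have [|a [m [k [[sa na sm am] [ak nk m0] [[[a' _ Ea] ha] [[m' _ Em] hm]]]]]] := cutoff pe ne cP.
  by split; [exists e|].
have uI x y : uin x = uin y -> x = y :> A 1%g by case.
exists a', m', k; rewrite Ea Em; split; [split|split|] => //.
- by apply: uI; rewrite inj_star Ea.
- by rewrite -nrm_inj Ea.
- by apply: uI; rewrite inj_star Em.
- by apply: uI; rewrite injM Ea Em.
- by move=> E; apply: m0; rewrite -Em E.
Qed.
End Absorb.

(** * Nested cut-offs *)

Section Step.
Context {R : realType} {G : groupType} {A : fellBundle R G} (g : G) (I : set (A 1%g)).
Hypothesis idI : ideal (unit_algebra A) I.
Hypothesis hdet : detects_ideals (reduced_algebra A (cycp g)) (unit_coefficients A (cycp g)).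
Hypothesis g1 : g <> 1%g.
Hypothesis fixI : forall p, hat I p -> is_tensor g p p.
Local Notation coh p rho := (@cohrep R G A p g rho).

(** [a'] and [m'] live below [m], and [a'] fixes [m'], the room left for the next stage. Along a
    sequence this gives [a_n a_j = a_j] for [n < j]. *)
Definition nested (m a' m' : A 1%g) : Prop :=
  [/\ [/\ I a', I m', star1 a' = a' & nm a' <= 1], [/\ mul1 a' m' = m', star1 m' = m' & m' <> 0],
      absorb (uin m) (uin a') & absorb (uin m) (uin m')].

Lemma nested_step (m : A 1%g) (x : A g) (e : R) : I m -> m <> 0 -> 0 < e ->
  exists a' m', nested m a' m' /\ forall (p : irrep A) rho xi, coh p rho -> p a' xi = xi ->
    nm (hip xi (rho (tg x) xi)) <= e * nm xi ^+ 2.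
Proof.
(* A vector [xi] fixed by the cut-off of [c c^*] has the form [c w] with [|w| <= 6 |xi|], which
   costs a factor 36. *)
move=> Im m0 e0; have e1 : 0 < e / 36 by rewrite divr_gt0.
have [f [c [Ec Ic nc hc]]] := compress idI hdet g1 fixI x Im m0 e1.
have sK : star1 (star1 c) = c by exact: (@bsK _ (fib1 A)).
have pe : posA (mul1 c (star1 c)).
  by rewrite /posA injM inj_star -{1}[uin c]starK; exact: pos_star_mul.
have ne : nm (mul1 c (star1 c)) = 1.
  by rewrite -{1}sK nm_star_mul (@nm_bs _ (fib1 A) c : nm (star1 c) = _) nc expr1n.
have [a [m' [k [[sa na sm am] [ak nk m1] [ha hm]]]]] := cutoff_fib pe ne.
have mc : absorb (uin m) (uin (mul1 c (star1 c))).
  rewrite injM; apply: (@absorb_trans _ _ _ _ (uin c)); last exact: absorb_mulr.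
  by rewrite Ec; exact: absorb_mulr.
have Ie : I (mul1 c (star1 c)) by exact: (ideal_mulr idI).
have Ia : I a by exact: (ideal_uni_r idI) Ie ak.
exists a, m'; split; first split; try split => //.
- by rewrite -am; exact: (ideal_mulr idI).
- exact: absorb_trans mc ha.
- exact: absorb_trans mc hm.
- move=> p rho xi hr hxi.
  pose w := p (star1 c) (pu k xi).
  have Ew : xi = p c w by rewrite -[LHS]hxi -pu_inj ak pu_M pu_inj irr_M.
  have nw : nm w <= 6 * nm xi.
    apply: le_trans (irr_contr _ _) _; rewrite (@nm_bs _ (fib1 A) c : nm (star1 c) = _) nc mul1r.
    apply: le_trans (pu_contr _ _) _; apply: ler_wpM2r => //; exact: nm_ge0.
  rewrite Ew; apply: le_trans (hc p rho w hr) _; rewrite -Ew.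
  have := nm_ge0 w; have := nm_ge0 xi => h1 h2.
  have : nm w ^+ 2 <= 36 * nm xi ^+ 2 by nra.
  by rewrite mulrAC ler_pdivrMr// -mulrA; move=> h3; rewrite [X in _ <= e * X]mulrC; apply: ler_wpM2l => //; exact: ltW.
Qed.

Lemma nested_seq (Q : nat -> A 1%g -> A 1%g -> Prop) (m0 : A 1%g) : I m0 -> m0 <> 0 -> star1 m0 = m0 ->
  (forall n m, I m -> m <> 0 -> star1 m = m -> exists a' m', nested m a' m' /\ Q n m a') ->
  exists a m : nat -> A 1%g, [/\ m 0%N = m0, forall n, nested (m n) (a n) (m n.+1) &
     forall n, Q n (m n) (a n)].
Proof.
move=> I0 n0 s0 hQ.
have /choice[F hF] (s : nat * A 1%g) : exists t : A 1%g * A 1%g,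
    I s.2 -> s.2 <> 0 -> star1 s.2 = s.2 -> nested s.2 t.1 t.2 /\ Q s.1 s.2 t.1.
  case: (pselect [/\ I s.2, s.2 <> 0 & star1 s.2 = s.2]) => [[h1 h2 h3]|h].
    by have [a' [m' h]] := hQ s.1 s.2 h1 h2 h3; exists (a', m').
  by exists (0, 0) => h1 h2 h3; exfalso; apply: h.
pose m := fix m n := if n is n'.+1 then (F (n', m n')).2 else m0.
have mI n : [/\ I (m n), m n <> 0 & star1 (m n) = m n].
  elim: n => [//|n [h1 h2 h5]]; have [[[_ h3 _ _] [_ h6 h4] _ _] _] := hF (n, m n) h1 h2 h5.
  by split.
exists (fun n => (F (n, m n)).1), m; split=> // n; have [h1 h2 h3] := mI n.
  by have [] := hF (n, m n) h1 h2 h3.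
by have [] := hF (n, m n) h1 h2 h3.
Qed.
End Step.

Section Half.
Context {R : realType}.
Lemma half_small (e : R) : 0 < e -> exists N, forall n, (N <= n)%N -> 2^-1 ^+ n <= e.
Proof. by apply: expr_small; lra. Qed.
Lemma half_le n : 0 <= (2^-1 : R) ^+ n <= 1.
Proof. by apply/andP; split; [apply: exprn_ge0; lra|apply: exprn_ile1; lra]. Qed.
Definition wgt n : R := 2^-1 ^+ n.+1.
End Half.

(** * The weighted sum of the cut-offs and its eigenvectors *)

Section Limit.
Context {R : realType} {G : groupType} {A : fellBundle R G} (I : set (A 1%g)).
Variables (a m : nat -> A 1%g).
Hypothesis hn : forall n, nested I (m n) (a n) (m n.+1).

Lemma seq_am n j : (n < j)%N -> uin (a n) * uin (m j) = uin (m j).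
Proof.
elim: j => [//|j IH]; rewrite ltnS leq_eqVlt => /predU1P[->|nj].
  by have [_ [h _ _] _ _] := hn j; rewrite -injM h.
by have [_ _ _ h] := hn j; apply: h; exact: IH.
Qed.
Lemma seq_aa n j : (n < j)%N -> uin (a n) * uin (a j) = uin (a j).
Proof. by move=> nj; have [_ _ h _] := hn j; apply: h; exact: seq_am. Qed.

Local Notation w := (@wgt R).
Let w0 n : 0 < w n. Proof. by rewrite exprn_gt0// invr_gt0. Qed.
Let w_sum N : \sum_(i < N) w i = 1 - 2^-1 ^+ N.
Proof.
elim: N => [|N IH]; first by rewrite big_ord0 expr0 subrr.
by rewrite big_ord_recr /= IH /wgt exprS; lra.
Qed.
Let na n : nm (a n) <= 1. Proof. by have [[]] := hn n. Qed.

Definition psum N : A 1%g := \sum_(i < N) rc (wgt i) *: a i.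

Let psum_diff M N : (N <= M)%N -> nm (psum M - psum N) <= 2^-1 ^+ N - 2^-1 ^+ M.
Proof.
move=> /subnK <-; move: (M - N)%N => k; elim: k => [|k IH]; first by rewrite add0n !subrr nm0.
rewrite addSn {1}/psum big_ord_recr /= -/(psum (k + N)).
have -> : psum (k + N) + rc (w (k + N)) *: a (k + N)%N - psum N = (psum (k + N) - psum N) + rc (w (k + N)) *: a (k + N)%N by lmod.
apply: le_trans (nmD _ _) _; rewrite nmZ nm_rc gtr0_norm//.
by have := na (k + N); have := w0 (k + N); rewrite {2}/wgt exprS /wgt exprS; nra.
Qed.

(** The second bound holds because the weights sum to 1 and the [a n] are contractions: the
    remaining terms weigh [1 - w n]. *)
Lemma psum_cvg : exists ai : A 1%g, (forall e : R, 0 < e -> exists N0, forall N, (N0 <= N)%N -> nm (ai - psum N) <= e) /\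
  forall n, nm (ai - rc (w n) *: a n) <= 1 - w n.
Proof.
have half N : 0 <= (2^-1 : R) ^+ N by rewrite exprn_ge0// invr_ge0.
have hc : cauchys (@dn R (A 1%g)) psum.
  move=> e e0; have [N hN] := half_small e0.
  exists N => i j Ni Nj; rewrite /dn; wlog ij : i j Ni Nj / (j <= i)%N.
    by move=> W; case/orP: (leq_total j i) => h; [|rewrite nmBC]; exact: W.
  apply: le_trans (psum_diff ij) _; have := hN j Nj; have := half i; lra.
have [ai hai] := cauchys_cvgs hc; exists ai; split=> [e e0|n].
  by have [N0 h] := hai e e0; exists N0 => N /h; rewrite /dn nmBC.
apply: ler_eps => e e0; have [N0 h] := hai e e0.
pose N := maxn N0 n.+1; have := h N (leq_maxl _ _); rewrite /dn nmBC => h1.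
have nN : (n < N)%N by exact: leq_maxr.
have -> : ai - rc (w n) *: a n = (psum N - rc (w n) *: a n) + (ai - psum N) by lmod.
apply: le_trans (nmD _ _) _; apply: lerD h1.
rewrite /psum (bigD1 (Ordinal nN)) //= addrAC subrr add0r.
apply: le_trans (nm_sum _ _ _) _.
apply: le_trans (_ : \sum_(i < N | i != Ordinal nN) w i <= _).
  apply: ler_sum => i _; rewrite nmZ nm_rc gtr0_norm// -[X in _ <= X]mulr1; apply: ler_wpM2l; [exact: ltW|exact: na].
have := w_sum N; rewrite (bigD1 (Ordinal nN)) //=; have := half N.
set Sm := \sum_(i < N | _) _; lra.
Qed.

(** The terms other than the one of [a n] contribute at most [1 - w n] to the value 1, so
    [re <xi | a n xi> >= 1]. For a contraction and a unit vector this is equality in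
    Cauchy-Schwarz. *)
Lemma fixed_vectors (ai : A 1%g) (p : irrep A) (xi : irrep_space p) : nm xi = 1 ->
  (forall n, nm (ai - rc (w n) *: a n) <= 1 - w n) -> 1 <= re (hip xi (p ai xi)) -> forall n, p (a n) xi = xi.
Proof.
move=> nxi h1 h2 n; apply: subr0_eq; apply: nm_eq0; apply/eqP.
rewrite -sqrf_eq0 eq_le sqr_ge0 andbT nm_sqrB nxi.
have h3 : re (hip xi (p ai xi)) = re (hip xi (p (ai - rc (w n) *: a n) xi)) + w n * re (hip xi (p (a n) xi)).
  by rewrite irr_B irr_Z hiprB hiprZ reB reZ subrK.
have h4 := re_le_nm (hip xi (p (ai - rc (w n) *: a n) xi)).
have h5 := hip_cs xi (p (ai - rc (w n) *: a n) xi).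
have h6 := irr_contr (ai - rc (w n) *: a n) xi.
have h7 := irr_contr (a n) xi; rewrite nxi mul1r mulr1 in h5 h6 h7.
have h8 := na n; have := w0 n; have := h1 n; rewrite hip_conj re_conj.
have n0 := nm_ge0 (p (a n) xi); rewrite expr1n => h9 h10.
have : 1 <= re (hip xi (p (a n) xi)) by rewrite -(ler_pM2l h10); lra.
nra.
Qed.

Lemma psum_m N (K : R) : (rc K *: 1 + uin (psum N)) * uin (m N) = rc (K + (1 - 2^-1 ^+ N)) *: uin (m N).
Proof.
rewrite mulrDl -scalerAl mul1r /psum inj_sum mulr_suml rcD scalerDl; congr (_ + _).
rewrite -w_sum rc_sum scaler_suml; apply: eq_bigr => i _.
by rewrite uin_Z -scalerAl seq_am.
Qed.

Lemma psum_fix N (p : irrep A) (v : irrep_space p) : p (a N) v = v -> p (psum N) v = rc (1 - 2^-1 ^+ N) *: v.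
Proof.
move=> hv; rewrite /psum irr_sum -w_sum rc_sum scaler_suml; apply: eq_bigr => i _.
rewrite irr_Z -{1}hv -[p (a N) v]pu_inj -[p (a i) _]pu_inj -pu_M seq_aa//.
by rewrite pu_inj hv.
Qed.

(** All [a i] with [i < N] fix the nonzero element [m N], on which [K + psum N] therefore acts as
    the scalar [K + 1 - 2^-N]. *)
Lemma state_norm (ai : A 1%g) : (forall e : R, 0 < e -> exists N0, forall N, (N0 <= N)%N -> nm (ai - psum N) <= e) ->
  forall K : R, 0 <= K -> K + 1 <= nrm (rc K *: 1 + uin ai).
Proof.
move=> h K K0; apply: ler_eps => e e0.
have e2 : 0 < e / 2 by lra.
have [N0 h0] := h _ e2.
have [N1 h1] := half_small e2.
pose N := (maxn N0 N1).+1.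
have hN0 := h0 N (leqW (leq_maxl _ _)); have hN1 := h1 N (leqW (leq_maxr _ _)).
have m0 : 0 < nm (m N) by have [_ [_ _ hm] _ _] := hn (maxn N0 N1); exact: nm_gt0.
have E : rc K *: 1 + uin ai = (rc K *: 1 + uin (psum N)) + uin (ai - psum N).
  by rewrite -addrA -uin_D [psum N + _]addrC subrK.
have h3 : nrm ((rc K *: 1 + uin (psum N)) * uin (m N)) <= nrm (rc K *: 1 + uin (psum N)) * nm (m N).
  by rewrite -nrm_inj; exact: nrmM.
rewrite psum_m nrmZr in h3; last by have /andP[h5 h6] := @half_le R N; lra.
rewrite nrm_inj ler_pM2r// in h3.
have h4 : nrm (rc K *: 1 + uin (psum N)) <= nrm (rc K *: 1 + uin ai) + nm (ai - psum N).
  rewrite -nrm_inj E -[X in nrm X <= _](addrK (uin (ai - psum N))); exact: nrmB.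
lra.
Qed.
End Limit.

(** * Elements of [A_g] that are bounded below on a cut-off *)

Section Lower.
Context {R : realType} {G : groupType} {A : fellBundle R G} (g : G) (I : set (A 1%g)).
Hypothesis idI : ideal (unit_algebra A) I.
Hypothesis hdet : detects_ideals (reduced_algebra A (cycp g)) (unit_coefficients A (cycp g)).
Hypothesis g1 : g <> 1%g.
Hypothesis fixI : forall p, hat I p -> is_tensor g p p.
Local Notation coh p rho := (@cohrep R G A p g rho).

(** The cut-off [a] of [y^* y] is a multiple [y^* y k] with [nrm k <= 6], so a vector fixed by it
    can be recovered from its image under [y^* y]. *)
Lemma cutoff_bounded_below (y : A g) : nm y = 1 -> I (rip y y) -> exists a m : A 1%g,
  [/\ [/\ I m, m <> 0, star1 m = m & mul1 a m = m], absorb (uin (rip y y)) (uin m) &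
   forall (p : irrep A) rho xi, coh p rho -> p a xi = xi -> nm xi <= 6 * nm (rho (tg y) xi)].
Proof.
move=> ny Iy; have ne : nm (rip y y) = 1 by rewrite nm_rip ny expr1n.
have [a [m [k [[sa na sm am] [ak nk m1] [ha hm]]]]] := cutoff_fib (posA_rip y) ne.
have Ia : I a by exact: (ideal_uni_r idI) Iy ak.
exists a, m; split=> //.
  by split => //; rewrite -am; exact: (ideal_mulr idI).
move=> p rho xi hr hxi; set b := rip y y in ak ne.
have sb : star1 b = b by exact: rip_star.
have E : xi = pu (star k) (p b xi).
  by rewrite -[LHS]hxi -sa -pu_inj inj_star ak starM -inj_star sb pu_M pu_inj.
have h1 : nm (p b xi) <= nm (rho (tg y) xi).
  have := hip_cs (rho (tg y) (p b xi)) (rho (tg y) xi).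
  rewrite coh_rip// -/b hipxx nm_rc ger0_norm ?sqr_ge0//.
  have := coh_le y (p b xi) hr; rewrite ny mul1r.
  have := nm_ge0 (rho (tg y) xi); have := nm_ge0 (p b xi) => b0 r0 h2 h3.
  case: (ltrP 0 (nm (p b xi))) => bp; last by lra.
  rewrite -(ler_pM2l bp); nra.
rewrite {1}E; apply: le_trans (pu_contr _ _) _; rewrite nrm_star.
have := nm_ge0 (p b xi); have := nrm_ge0 k; nra.
Qed.

Lemma ideal_nondeg (J : set (A 1%g)) (p : irrep A) (v : irrep_space p) :
  (forall b x, J x -> J (mul1 x b)) -> (exists b x, J b /\ p b x <> 0) ->
  (forall b, J b -> p b v = 0) -> v = 0.
Proof.
move=> JM [b0 [x0 [Jb0 hb0]]] hv.
have [] := @irr_i _ _ _ p [set v | forall b, J b -> p b v = 0].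
- split.
  + apply/closed_eps => x hx b Jb; apply: nm_small => e e0.
    have e1 : 0 < e / (nm b + 1) by rewrite divr_gt0// ltr_wpDl ?nm_ge0.
    have [y hy nxy] := hx _ e1.
    have -> : p b x = p b (x - y) by rewrite (linB (@irr_lin _ _ _ p b)) (hy b Jb) subr0.
    apply: le_trans (irr_contr _ _) _; apply: le_trans (ler_wpM2l (nm_ge0 b) nxy) _.
    by apply: scale_small; [exact: nm_ge0|exact: ltW].
  + by move=> b Jb; exact: lin0 (@irr_lin _ _ _ p b).
  + by move=> c x y hx hy b Jb; rewrite (@irr_lin _ _ _ p b) hx// hy// scaler0 addr0.
- by move=> a x hx b Jb; rewrite -irr_M; apply: hx; exact: JM.
- by move=> E; have : [set v | forall b, J b -> p b v = 0] v by []; rewrite E.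
- move=> E; exfalso; apply: hb0.
  have : [set v | forall b, J b -> p b v = 0] x0 by rewrite E.
  by apply.
Qed.

(** An extension is nondegenerate, so some [y0] over [g] does not kill a nonzero vector [p k v] with
    [k] in [I]. Then [y0 k] is nonzero, and its inner product with itself ends in the factor [k]. *)
Lemma exists_y : (exists2 k, I k & k <> 0) -> exists y : A g, nm y = 1 /\ I (rip y y).
Proof.
move=> [k Ik k0].
have [p [v hv]] : exists (p : irrep A) v, p k v <> 0.
  apply: contrapT => h; apply: k0; apply: irr_sep => p v; apply: contrapT => h1.
  by apply: h; exists p, v.
have hp : hat I p by exists k, v.
have [N [c [rho [hc _ _ _]]]] := coherent_family (fixI hp) g1.
have hr := hc 0%N; have [rho' ho] := cr_coc hr (cyc_g g).
have [y0 hy0] : exists y0 : A g, rho 0%N (tg y0) (p k v) <> 0.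
  apply: contrapT => h; apply: hv; apply: (coc_n ho) => u /tag_eta[y ->].
  by apply: contrapT => h1; apply: h; exists y.
have y1 : ract y0 k <> 0.
  move=> E; apply: hy0; rewrite -coh_ract// E.
  by have := coh_B (0 : A g) 0 v hr; rewrite subrr subrr.
pose y := rc (nm (ract y0 k))^-1 *: ract y0 k.
have ny0 := nm_gt0 y1.
exists y; split; first by rewrite nmZ nm_rc gtr0_norm ?invr_gt0// mulVf// gt_eqF.
have Ey : y = ract (rc (nm (ract y0 k))^-1 *: y0) k.
  by rewrite /y /ract -[_ *: y0]addr0 fmulLl fcastL fmul0l fcast0 addr0.
have -> : rip y y = mul1 (rip y (rc (nm (ract y0 k))^-1 *: y0)) k.
  by apply: tagI; rewrite T_mul1 !T_rip tmulA {2}Ey T_ract.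
exact: (ideal_mull idI).
Qed.
End Lower.

(** * The separable and the Type I case *)

Section Cases.
Context {R : realType} {G : groupType} {A : fellBundle R G} (g : G) (I Je : set (A 1%g)).
Hypothesis idI : ideal (unit_algebra A) I.
Hypothesis hdet : detects_ideals (reduced_algebra A (cycp g)) (unit_coefficients A (cycp g)).
Hypothesis g1 : g <> 1%g.
Hypothesis fixI : forall p, hat I p -> is_tensor g p p.
Hypothesis neI : exists2 k, I k & k <> 0.
Hypothesis idJ : ideal (unit_algebra A) Je.
Hypothesis IJ : I `<=` Je.
Local Notation coh p rho := (@cohrep R G A p g rho).

Lemma limit_state (a m : nat -> A 1%g) (J : set (A 1%g)) (ai : A 1%g) :
  (forall n, nested I (m n) (a n) (m n.+1)) ->
  (forall n, nm (ai - rc (wgt n) *: a n) <= 1 - @wgt R n) ->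
  J 0 -> (forall c x y, J x -> J y -> J (c *: x + y)) ->
  (forall b x, J x -> J (mul1 b x)) -> (forall b x, J x -> J (mul1 x b)) ->
  (forall K j, 0 <= K -> J j -> K + 1 <= nrm (rc K *: 1 + uin ai + uin j)) ->
  exists (p : irrep A) (xi : irrep_space p), [/\ hat I p, nm xi = 1, forall n, p (a n) xi = xi & forall j x, J j -> p j x = 0].
Proof.
move=> hn h1 J0 Jl Jm Jr hK.
have [p [xi [nxi r1 kJ]]] := exists_irrep J0 Jl Jm Jr ltr01 hK.
have fx := fixed_vectors hn nxi h1 r1.
exists p, xi; split=> //; exists (a 0%N), xi; split; first by have [[]] := hn 0%N.
by rewrite fx => E; move: nxi; rewrite E nm0 => /eqP; rewrite eq_sym oner_eq0.
Qed.

Lemma separable_contra : separable_set Je -> False.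
Proof.
move=> [D [cD DJ JD]].
have /countable_injP[f fi] := cD.
pose d k : A 1%g := xget 0 [set x | D x /\ f x = k].
have dE x : D x -> d (f x) = x.
  move=> Dx; rewrite /d; case: xgetP => [y _ [Dy fy]|h]; last by have /h := conj Dx (erefl (f x)).
  by apply: fi => //; rewrite inE.
have [y [ny Iy]] := exists_y idI g1 fixI neI.
have [b [m0 [[Im0 m00 sm0 bm0] _ hlow]]] := cutoff_bounded_below idI ny Iy.
(* [logn 2 n.+1] takes every value for arbitrarily large [n], so each [d k] is treated with
   arbitrarily small tolerance. *)
pose Q n (m a' : A 1%g) := forall (p : irrep A) rho xi, coh p rho -> p a' xi = xi ->
    nm (hip xi (rho (tg (lact (d (logn 2 n.+1)) y)) xi)) <= n.+1%:R^-1 * nm xi ^+ 2.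
have [n m Im mn0 _|a [m [E0 hn hQ]]] := nested_seq (Q := Q) Im0 m00 sm0.
  by apply: nested_step => //; rewrite invr_gt0.
have [ai [hai hai2]] := psum_cvg hn.
have [||||K j K0 ->|p [xi [hp nxi fx _]]] := limit_state (J := [set 0]) hn hai2.
- by [].
- by move=> c x z -> ->; rewrite scaler0 addr0.
- by move=> z x ->; rewrite /mul1 fmul0r fcast0.
- by move=> z x ->; rewrite /mul1 fmul0l fcast0.
- have h := state_norm hn hai K0.
  have -> : uin (0 : A 1%g) = 0 by [].
  by rewrite addr0.
have [N [c [rho [hc _ _ _]]]] := coherent_family (fixI hp) g1.
have hr := hc 0%N; set T := rho 0%N in hr.
have bxi : p b xi = xi.
  rewrite -(fx 0%N) -!pu_inj -pu_M; congr (pu _ _).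
  by have [_ _ h _] := hn 0%N; apply: h; rewrite E0 -injM bm0.
have xi0 : xi <> 0 by move=> E; move: nxi; rewrite E nm0 => /eqP; rewrite eq_sym oner_eq0.
pose et := T (tg y) xi.
have et0 : et <> 0.
  by move=> E; have := hlow p T xi hr bxi; rewrite -/et E nm0 mulr0 nxi; lra.
have dk k : hip xi (p (d k) et) = 0.
  apply: nm_small => e e0.
  have [N' hN'] := nat_gt e^-1.
  pose n := (2 ^ k * (2 * N').+1).-1.
  have nS : n.+1 = (2 ^ k * (2 * N').+1)%N by rewrite prednK// muln_gt0 expn_gt0.
  have Ek : logn 2 n.+1 = k.
    rewrite nS lognM ?expn_gt0// pfactorK// lognE /= dvdn2 /= oddM /= addn0 //.
  have := hQ n p T xi hr (fx n); rewrite Ek coh_lact// nxi expr1n mulr1 => h; apply: le_trans h _.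
  rewrite -[e]invrK lef_pV2 ?posrE ?invr_gt0//; apply: ltW; apply: lt_le_trans hN' _.
  rewrite ler_nat nS; apply: leq_trans (leq_pmull _ _); last by rewrite expn_gt0.
  by rewrite mul2n -addnn -addnS leq_addr.
(* So [xi] is orthogonal to [p(Je) et], which is dense since [et] is nonzero and [p] does not vanish
   on [Je]. *)
have bJ z : Je z -> hip xi (p z et) = 0.
  move=> /JD /closure_eps hz; apply: nm_small => e e0.
  have e1 : 0 < e / (nm et + 1) by rewrite divr_gt0// ltr_wpDl ?nm_ge0.
  have [x Dx hx] := hz _ e1.
  have -> : hip xi (p z et) = hip xi (p (z - x) et) by rewrite irr_B hiprB -(dE x Dx) dk subr0.
  apply: le_trans (hip_cs _ _) _; rewrite nxi mul1r; apply: le_trans (irr_contr _ _) _.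
  apply: le_trans (ler_wpM2r (nm_ge0 _) hx) _.
  by rewrite mulrC; apply: scale_small; [exact: nm_ge0|exact: ltW].
have [z Jz hz] : exists2 z, Je z & p z et <> 0.
  apply: contrapT => h; apply: et0; apply: (@ideal_nondeg _ _ _ Je).
  - by move=> z x Jx; exact: (ideal_mulr idJ).
  - by have [i [v [Ii hv]]] := hp; exists i, v; split=> //; exact: IJ.
  - by move=> z Jz; apply: contrapT => h2; apply: h; exists z.
have [|||||w [z' Jz' <-] hw] := @irr_dense_sub _ _ _ p [set p z et | z in Je] _ _ _ _ xi 2^-1 _.
- by exists 0; [exact: ideal0 idJ|exact: irr_0].
- by move=> k _ _ [x Jx <-] [x' Jx' <-]; exists (k *: x + x'); [exact: (ideal_lin idJ)|exact: irr_L].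
- by move=> x _ [x' Jx' <-]; exists (mul1 x x'); [exact: (ideal_mull idJ)|exact: irr_M].
- by exists (p z et) => //; exists z.
- by rewrite invr_gt0.
have := hip_cs xi (xi - p z' et); rewrite hiprB bJ// subr0 hipxx nxi expr1n nm_rc normr1 mul1r; lra.
Qed.

(* The compression of [x] to [M_n] is small although [x] is bounded below on
   [M_n] and maps it to [M_(n-1)]: hence the dimension of [M_n] is infinite. *)
Lemma unit_vector_orthogonal (H : hilbertSpace R) (M : nat -> set H) (T : nat -> H -> H) : (forall n, linear (T n)) ->
  (forall n c x y, M n x -> M n y -> M n (c *: x + y)) ->
  (forall n x, M n.+1 x -> M n x) -> (forall n x, M n.+1 x -> M n (T n x)) ->
  (forall n x, M n.+1 x -> nm (hip x (T n x)) <= 100^-1 * nm x ^+ 2) ->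
  (forall n x, M n.+1 x -> nm x <= 6 * nm (T n x)) ->
  (forall n, exists2 x, M n x & nm x = 1) ->
  forall k N (u : nat -> H), exists z, [/\ M N z, nm z = 1 & forall i, (i < k)%N -> hip (u i) z = 0].
Proof.
move=> lT lM Mi TM Ts Tl Mn; elim=> [|k IH] N u.
  by have [x Mx nx] := Mn N; exists x; split.
have M0 n : M n 0 by have [x Mx _] := Mn n; have := lM n (-1) x x Mx Mx; rewrite scaleN1r addNr.
have MZ n c x : M n x -> M n (c *: x) by move=> h; have := lM n c x 0 h (M0 n); rewrite addr0.
have MD n x y : M n x -> M n y -> M n (x + y) by move=> h1 h2; have := lM n 1 x y h1 h2; rewrite scale1r.
apply: contrapT => hno.
(* If the claim fails for [k + 1], the vectors [u i] separate the points of [M N], whose dimension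
   is then at most [k + 1]. *)
have hno' z : M N z -> (forall i, (i < k.+1)%N -> hip (u i) z = 0) -> z = 0.
  move=> Mz hz; apply: contrapT => /nm_gt0 z0; apply: hno; exists (rc (nm z)^-1 *: z); split.
  - exact: MZ.
  - by rewrite nmZ nm_rc gtr0_norm ?invr_gt0// mulVf// gt_eqF.
  - by move=> i /hz h; rewrite hiprZ h mulr0.
(* The induction hypothesis for the [k] vectors other than [u i], enumerated by [bump], gives a dual
   basis up to scalars inside [M (N + 1)]. Hence [M N] and [M (N + 1)] coincide. *)
have /choice[f hf] (i : 'I_k.+1) : exists z, [/\ M N.+1 z, hip (u i) z <> 0 &
    forall j : 'I_k.+1, j != i -> hip (u j) z = 0].
  have [z [Mz nz hz]] := IH N.+1 (fun j => u (bump i j)).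
  have hz2 (j : 'I_k.+1) : j != i -> hip (u j) z = 0.
    move=> ji; have ij : i != j by rewrite eq_sym.
    have [j' Ej _] := unlift_some ij; rewrite Ej /=.
    by apply: (hz j'); exact: ltn_ord.
  exists z; split=> // E; have := hno' z (Mi _ _ Mz) _; move=> /(_ _)/wrap[].
    move=> j jk; case: (eqVneq (Ordinal jk) i) => [Ei|ji]; last exact: (hz2 (Ordinal jk)).
    by have -> : j = i by rewrite -Ei.
  by move=> z0; move: nz; rewrite z0 nm0 => /eqP; rewrite eq_sym oner_eq0.
have MM z : M N z -> M N.+1 z.
  move=> Mz; pose z' := \sum_(i < k.+1) (hip (u i) z / hip (u i) (f i)) *: f i.
  have Mz' : M N.+1 z'.
    rewrite /z'; elim/big_ind: _ => [|x y|i _]; [exact: M0|exact: MD|by apply: MZ; case: (hf i)].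
  suff -> : z = z' by [].
  apply: subr0_eq; apply: hno'.
    by rewrite -scaleN1r; apply: MD => //; apply: MZ; exact: Mi.
  move=> i ik; rewrite hiprB /z' hip_sumr (bigD1 (Ordinal ik)) //= big1 ?addr0.
    rewrite hiprZ divfK ?subrr//; apply/eqP; by case: (hf (Ordinal ik)).
  by move=> j ji; rewrite hiprZ; have [_ _ h] := hf j; rewrite (h (Ordinal ik)) ?mulr0// eq_sym.
have [x Mx nx] := Mn N.+1; pose v := T N x.
have Mv : M N.+1 v by apply: MM; exact: TM.
pose F z := hip z (T N z).
(* Now [v = T x] lies in [M (N + 1)] again, so polarization bounds [|v|^2] by [(|v|^2 + 1) / 100],
   against [|v| >= 1 / 6]. *)
have pol : 4 * hip v v = F (v + x) - F (v - x) - 'i * (F (v + 'i *: x) - F (v - 'i *: x)).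
  rewrite /F !(linB (lT N)) !(linD (lT N)) !(linZ (lT N)) !(hiplB, hiprB) !(hiplD, hiprD, hiplZ, hiprZ) conj_i -/v.
  ring: (@mulii R).
have Fb z : M N.+1 z -> nm (F z) <= 100^-1 * nm z ^+ 2 by exact: Ts.
have := Tl N x Mx; rewrite nx -/v => h1.
have h2 : nm (4 * hip v v) = 4 * nm v ^+ 2.
  by rewrite nmM hipxx nm_rc ger0_norm ?sqr_ge0// -(@rc_nat R 4) nm_rc ger0_norm.
have Mix : M N.+1 ('i *: x) by exact: MZ.
have MN z : M N.+1 z -> M N.+1 (- z) by move=> h; rewrite -scaleN1r; exact: MZ.
have b1 := Fb _ (MD _ _ _ Mv Mx); have b2 := Fb _ (MD _ _ _ Mv (MN _ Mx)).
have b3 := Fb _ (MD _ _ _ Mv Mix); have b4 := Fb _ (MD _ _ _ Mv (MN _ Mix)).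
have t1 := nmB (F (v + x) - F (v - x)) ('i * (F (v + 'i *: x) - F (v - 'i *: x))).
have t2 := nmB (F (v + x)) (F (v - x)); have t3 := nmB (F (v + 'i *: x)) (F (v - 'i *: x)).
rewrite -pol h2 nmM nm_i mul1r in t1.
rewrite nm_sqrD in b1; rewrite nm_sqrB in b2; rewrite nm_sqrD in b3; rewrite nm_sqrB in b4.
rewrite nmZ nm_i mul1r in b3 b4; rewrite nx expr1n in b1 b2 b3 b4.
nra.
Qed.

Lemma rank_one_compact (H : hilbertSpace R) (xi : H) : compact_operator (fun x => hip xi x *: xi).
Proof.
split=> [c x y|]; first by rewrite hip_linear; lmod.
pose f (t : R^o * R^o) : H := (rc t.1 + 'i * rc t.2) *: xi.
pose Q : set (R^o * R^o) := `[- (nm xi), nm xi] `*` `[- (nm xi), nm xi].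
have cf : continuous f.
  move=> t; apply/cvgrPdist_le => _ /gt0_rc[e e0 ->].
  have d0 : 0 < e / 2 / (nm xi + 1) by rewrite !divr_gt0// ltr_wpDl ?nm_ge0.
  exists (ball t.1 (e / 2 / (nm xi + 1)), ball t.2 (e / 2 / (nm xi + 1))).
    by split; exact: nbhsx_ballx.
  move=> /= t' [h1 h2].
  rewrite normE rc_le.
  have -> : f t - f t' = (rc (t.1 - t'.1) + 'i * rc (t.2 - t'.2)) *: xi.
    by rewrite /f !rcB; lmod.
  rewrite nmZ; have h3 := nmD (rc (t.1 - t'.1)) ('i * rc (t.2 - t'.2)).
  rewrite nmM nm_i mul1r !nm_rc in h3.
  have {}h1 : `|t.1 - t'.1| < e / 2 / (nm xi + 1) by exact: h1.
  have {}h2 : `|t.2 - t'.2| < e / 2 / (nm xi + 1) by exact: h2.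
  have h4 := @scale_small _ (nm xi) (e / 2) (nm_ge0 xi) ltac:(lra).
  apply: le_trans (ler_wpM2r (nm_ge0 xi) h3) _; have := nm_ge0 xi; nra.
have cQ : compact Q by apply: compact_setX; exact: segment_compact.
have cfQ : compact (f @` Q) by apply: continuous_compact => //; exact: continuous_subspaceT.
apply: (@subclosed_compact _ _ (f @` Q)); [exact: closed_closure|exact: cfQ|].
rewrite (closure_id (f @` Q)).1; last by apply: compact_closed => //; exact: norm_hausdorff.
apply: closureS => _ [x hx <-].
set z := hip xi x.
have nz : nm z <= nm xi.
  apply: le_trans (hip_cs _ _) _; rewrite -[X in _ <= X]mulr1; apply: ler_wpM2l; first exact: nm_ge0.
  by rewrite -rc_le -normE rc1.
exists (re z, - re ('i * z)).
  split; rewrite /= in_itv /=; apply/andP; split.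
  - by have := re_ge_nm z; lra.
  - by have := re_le_nm z; lra.
  - have := re_le_nm ('i * z); rewrite nmM nm_i mul1r; lra.
  - have := re_ge_nm ('i * z); rewrite nmM nm_i mul1r; lra.
by rewrite /f /= [in RHS](c_decomp z) rcN mulrN.
Qed.

(** Compactness of [p j]: its norm is arbitrarily small on the orthogonal complement of finitely
    many vectors. In this form the ideal properties and the comparison with [unit_vector_orthogonal]
    are immediate. *)
Definition nearly0 (p : irrep A) (j : A 1%g) : Prop := forall tau : R, 0 < tau -> exists k (u : nat -> irrep_space p),
  forall et, (forall i, (i < k)%N -> hip (u i) et = 0) -> nm (p j et) <= tau * nm et.

Lemma nearly0_lin p c x y : nearly0 p x -> nearly0 p y -> nearly0 p (c *: x + y).
Proof.
move=> hx hy tau t0; have e0 : 0 < tau / (nm c + 1) by rewrite divr_gt0// ltr_wpDl ?nm_ge0.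
have [k [u hu]] := hx _ e0; have [l [v hv]] := hy _ e0.
exists (k + l)%N, (fun i => if (i < k)%N then u i else v (i - k)%N) => et h.
have h1 : nm (p x et) <= tau / (nm c + 1) * nm et.
  by apply: hu => i ik; have := h i (ltn_addr _ ik); rewrite ik.
have h2 : nm (p y et) <= tau / (nm c + 1) * nm et.
  by apply: hv => i il; have := h (k + i)%N; rewrite ltn_add2l => /(_ il); rewrite ltnNge leq_addr /= addKn.
rewrite irr_L; apply: le_trans (nmD _ _) _; rewrite nmZ.
apply: le_trans (lerD (ler_wpM2l (nm_ge0 c) h1) h2) _.
rewrite mulrA -mulrDl; apply: ler_wpM2r; first exact: nm_ge0.
by have n0 := nm_ge0 c; rewrite le_eqVlt; apply/orP; left; apply/eqP; field; apply: lt0r_neq0; lra.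
Qed.

Lemma nearly0_mull p b x : nearly0 p x -> nearly0 p (mul1 b x).
Proof.
move=> hx tau t0; have e0 : 0 < tau / (nm b + 1) by rewrite divr_gt0// ltr_wpDl ?nm_ge0.
have [k [u hu]] := hx _ e0; exists k, u => et /hu h.
rewrite irr_M; apply: le_trans (irr_contr _ _) _; apply: le_trans (ler_wpM2l (nm_ge0 b) h) _.
by rewrite mulrA; apply: ler_wpM2r; [exact: nm_ge0|apply: scale_small; [exact: nm_ge0|exact: ltW]].
Qed.

Lemma nearly0_mulr p b x : nearly0 p x -> nearly0 p (mul1 x b).
Proof.
move=> hx tau t0; have e0 : 0 < tau / (nm b + 1) by rewrite divr_gt0// ltr_wpDl ?nm_ge0.
have [k [u hu]] := hx _ e0; exists k, (fun i => p (star1 b) (u i)) => et h.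
rewrite irr_M; apply: le_trans (hu _ _) _; first by move=> i /h; rewrite irr_S.
apply: le_trans (ler_wpM2l (ltW e0) (irr_contr b et)) _; rewrite mulrA; apply: ler_wpM2r; first exact: nm_ge0.
by rewrite mulrC; apply: scale_small; [exact: nm_ge0|exact: ltW].
Qed.

Lemma restrict_rep (p : irrep A) : representation Je p.
Proof.
have [h1 h2 h3 h4 h5] := irrep_rep p.
split=> [b _|b _|c b b' x _ _|b b' x _ _|b x y _].
- exact: h1.
- exact: h2.
- exact: h3.
- exact: h4.
- exact: h5.
Qed.

Lemma restrict_irr (p : irrep A) : hat I p -> irreducible Je p.
Proof.
move=> [i [v [Ii hv]]]; split; first by exists i; [exact: IJ|exists v].
move=> K [Kc K0 Kl] KJ.
case: (pselect (exists2 z, K z & exists2 b, Je b & p b z <> 0)) => [[z Kz [b Jb bz]]|h].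
  right; apply/seteqP; split=> // x _.
  move/closed_eps: Kc; apply=> e e0.
  have [||||w [z' Jz' <-] hw] := @irr_dense_sub _ _ _ p [set p b z | b in Je] _ _ _ _ x e e0.
  - by exists 0; [exact: ideal0 idJ|exact: irr_0].
  - by move=> k _ _ [y Jy <-] [x' Jx' <-]; exists (k *: y + x'); [exact: (ideal_lin idJ)|exact: irr_L].
  - by move=> y _ [x' Jx' <-]; exists (mul1 y x'); [exact: (ideal_mull idJ)|exact: irr_M].
  - by exists (p b z) => //; exists b.
  by exists (p z' z) => //; exact: KJ.
left; apply/seteqP; split=> [z Kz|_ ->//].
apply: (@ideal_nondeg _ _ _ Je p) => [b x Jx||b Jb].
- exact: (ideal_mulr idJ).
- by exists i, v; split => //; exact: IJ.
- by apply: contrapT => hb; apply: h; exists z => //; exists b.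
Qed.

(** [x] is a multiple of some [m y m], so that whatever fixes [m] fixes the range of [x]. A cut-off
    of [x^* x] makes it bounded below, and a nested step inside that cut-off makes its form
    small. *)
Lemma typeI_step (n : nat) (m : A 1%g) : I m -> m <> 0 -> star1 m = m ->
  exists a' m', nested I m a' m' /\ exists x : A g, forall (p : irrep A) rho xi, coh p rho -> p a' xi = xi ->
    [/\ nm (hip xi (rho (tg x) xi)) <= 100^-1 * nm xi ^+ 2, nm xi <= 6 * nm (rho (tg x) xi) &
     forall a0 : A 1%g, mul1 a0 m = m -> p a0 (rho (tg x) xi) = rho (tg x) xi].
Proof.
move=> Im m0 sm.
have [p [v hv]] : exists (p : irrep A) v, p m v <> 0.
  apply: contrapT => h; apply: m0; apply: irr_sep => p v; apply: contrapT => h1.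
  by apply: h; exists p, v.
have hp : hat I p by exists m, v.
have [N [c [rho [hc _ _ _]]]] := coherent_family (fixI hp) g1.
have hr := hc 0%N; have [rho' ho] := cr_coc hr (cyc_g g).
have [y0 hy0] : exists y0 : A g, p m (rho 0%N (tg y0) (p m v)) <> 0.
  apply: contrapT => h; apply: (hv); apply: nm_small => e e0.
  have e1 : 0 < e / (nm m + 1) by rewrite divr_gt0// ltr_wpDl ?nm_ge0.
  have pmv : p m v <> 0 by exact: hv.
  have [y hy] := coc_fibre_dense v ho pmv e1.
  have E : p m (rho 0%N (tg y) (p m v)) = 0.
    by apply: contrapT => h2; apply: h; exists y.
  rewrite -[p m v]subr0 -E -(linB (@irr_lin _ _ _ p m)).
  apply: le_trans (irr_contr _ _) _; apply: le_trans (ler_wpM2l (nm_ge0 m) hy) _.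
  by apply: scale_small; [exact: nm_ge0|exact: ltW].
pose x0 : A g := lact m (ract y0 m).
have x00 : x0 <> 0.
  move=> E; apply: hy0; rewrite -(coh_ract _ _ _ hr) -(coh_lact _ _ _ hr) -/x0 E.
  by have := coh_B (0 : A g) 0 v hr; rewrite subrr subrr => <-; have := coh_B (0 : A g) 0 v hr; rewrite subrr => ->; rewrite subrr.
have nx0 := nm_gt0 x00; pose r : R := (nm x0)^-1; pose x : A g := rc r *: x0.
have r0 : 0 < r by rewrite invr_gt0.
have nx : nm x = 1 by rewrite nmZ nm_rc gtr0_norm// mulVf// gt_eqF.
pose y1 : A g := rc r *: y0.
have Ex : x = lact m (ract y1 m).
  rewrite /x /x0 /y1 -[rc r *: y0]addr0 /ract fmulLl fcastL fmul0l fcast0.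
  by rewrite lactL lact0r addr0.
have Tx : tg x = tmul (tg m) (tmul (tg y1) (tg m)) by rewrite Ex T_lact T_ract.
have Erip : rip x x = mul1 m (rip (lact m y1) x).
  apply: tagI; rewrite T_mul1 !T_rip {1}Tx T_lact !tstarM -T_star1 sm !tmulA //.
have Irip : I (rip x x) by rewrite Erip; exact: (ideal_mulr idI).
have [b [m1 [[Im1 m10 sm1 bm1] ha hlow]]] := cutoff_bounded_below idI nx Irip.
have e100 : 0 < 100^-1 :> R by rewrite invr_gt0.
have [a' [m' [[h1 h2 h3 h4] hs]]] := nested_step idI hdet g1 fixI x Im1 m10 e100.
have abs1 : absorb (uin m) (uin m1).
  by apply: absorb_trans ha; rewrite Erip injM; exact: absorb_mulr.
exists a', m'; split; first by split => //; exact: absorb_trans abs1 _.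
exists x => q sg xi hsg hxi; split; first exact: hs.
- apply: hlow => //; rewrite -hxi -!pu_inj -pu_M h3// -injM bm1 //.
- move=> a0 ha0; rewrite -(coh_lact _ _ _ hsg); congr (sg _ _).
  by rewrite T_lact Tx -tmulA -T_mul1 ha0.
Qed.

Lemma typeI_contra : typeI Je -> False.
Proof.
move=> tI; have [y [ny Iy]] := exists_y idI g1 fixI neI.
have [b [m0 [[Im0 m00 sm0 bm0] _ _]]] := cutoff_bounded_below idI ny Iy.
have [a [m [E0 hn hQ]]] := nested_seq Im0 m00 sm0 typeI_step.
have [ai [hai hai2]] := psum_cvg hn.
pose good (J : set (A 1%g)) := [/\ forall c x y, J x -> J y -> J (c *: x + y),
  forall b x, J x -> J (mul1 b x), forall b x, J x -> J (mul1 x b) &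
  forall (K : R) j, 0 <= K -> J j -> K + 1 <= nrm (rc K *: 1 + uin ai + uin j)].
have [J [gJ maxJ]] : exists J, good J /\ forall J', J `<` J' -> ~ good J'.
  (* [good] does not ask for 0 in [J], so the union of the empty chain is covered. A maximal [J] is
     nevertheless not empty, because the zero ideal is good. *)
  apply: Zorn_bigcup => F FP tot_F; split.
  - move=> c x z [J1 FJ1 Jx] [J2 FJ2 Jz]; have [h|h] := tot_F _ _ FJ1 FJ2.
      by exists J2 => //; have [gl _ _ _] := FP _ FJ2; apply: gl => //; exact: h.
    by exists J1 => //; have [gl _ _ _] := FP _ FJ1; apply: gl => //; exact: h.
  - by move=> z x [J1 FJ1 Jx]; exists J1 => //; have [_ gl _ _] := FP _ FJ1; exact: gl.
  - by move=> z x [J1 FJ1 Jx]; exists J1 => //; have [_ _ gl _] := FP _ FJ1; exact: gl.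
  - by move=> K x K0 [J1 FJ1 Jx]; have [_ _ _ gl] := FP _ FJ1; exact: gl.
have [Jl Jm Jr Jc] := gJ.
have J0 : J 0.
  case: (pselect (exists x, J x)) => [[x Jx]|h].
    by have := Jl (-1) x x Jx Jx; rewrite scaleN1r addNr.
  exfalso; apply: (maxJ [set 0]).
    by split=> [x Jx|h2]; [exfalso; apply: h; exists x|apply: h; exists 0; exact: h2].
  split.
  + by move=> c x z -> ->; rewrite scaler0 addr0.
  + by move=> z x ->; rewrite /mul1 fmul0r fcast0.
  + by move=> z x ->; rewrite /mul1 fmul0l fcast0.
  + move=> K j K0 ->; have h3 := state_norm hn hai K0.
    have -> : uin (0 : A 1%g) = 0 by [].
    by rewrite addr0.
have [p [xi [hp nxi fx kJ]]] := limit_state hn hai2 J0 Jl Jm Jr Jc.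
have [N0 [c [rho [hc _ _ _]]]] := coherent_family (fixI hp) g1.
have hr := hc 0%N.
pose M n : set (irrep_space p) := [set v | p (a n) v = v].
have /choice[x hx] := hQ.
have Mroom : forall k N (u : nat -> irrep_space p), exists z, [/\ M N z, nm z = 1 & forall i, (i < k)%N -> hip (u i) z = 0].
  apply: (@unit_vector_orthogonal _ M (fun n => rho 0%N (tg (x n.+1)))).
  - by move=> n; exact: coh_lin.
  - by move=> n k v w hv hw; rewrite /M /= (@irr_lin _ _ _ p) hv hw.
  - move=> n v hv; rewrite /M /= -[in RHS]hv -{1}hv -!pu_inj -pu_M (seq_aa hn)//.
  - move=> n v hv; have [_ _ h] := hx n.+1 p _ v hr hv; apply: h.
    by have [_ [h _ _] _ _] := hn n.
  - by move=> n v hv; have [h _ _] := hx n.+1 p _ v hr hv.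
  - by move=> n v hv; have [_ h _] := hx n.+1 p _ v hr hv.
  - by move=> n; exists xi => //; exact: fx.
(* Far out, the space [M N] contains a unit vector that [p j] almost kills, and on which the sum of
   the [a n] acts almost as the identity; so [K + ai + j] keeps norm at least [K + 1]. *)
have gn : good (nearly0 p).
  split; [by move=> k v w; exact: nearly0_lin|by move=> k v; exact: nearly0_mull|by move=> k v; exact: nearly0_mulr|].
  move=> K j K0 hj; apply: ler_eps => e e0.
  have e4 : 0 < e / 4 by lra.
  have [N1 h1] := hai _ e4; have [N2 h2] := half_small e4.
  pose N := maxn N1 N2; have hN1 := h1 N (leq_maxl _ _); have hN2 := h2 N (leq_maxr _ _).
  have [k [u hu]] := hj _ e4.
  have [z [Mz nz uz]] := Mroom k N u.
  have := hu z uz; rewrite nz mulr1 => h3.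
  have := pu_contr (rc K *: 1 + uin ai + uin j) z; rewrite nz mulr1.
  rewrite !pu_D pu_Z pu_1 !pu_inj => h4.
  have E : rc (K + (1 - 2^-1 ^+ N)) *: z = (rc K *: z + p ai z + p j z) - p (ai - psum a N) z - p j z.
    rewrite irr_B (psum_fix hn Mz) rcD; lmod.
  have h5 : K + (1 - 2^-1 ^+ N) = nm (rc (K + (1 - 2^-1 ^+ N)) *: z).
    rewrite nmZ nz mulr1 nm_rc ger0_norm//; have /andP[h6 h7] := @half_le R N; lra.
  have h6 := irr_contr (ai - psum a N) z; rewrite nz mulr1 in h6.
  have h7 := nmB (rc K *: z + p ai z + p j z - p (ai - psum a N) z) (p j z).
  have h8 := nmB (rc K *: z + p ai z + p j z) (p (ai - psum a N) z).
  rewrite -E -h5 in h7; lra.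
have JN : J `<=` nearly0 p.
  move=> j Jj tau t0; exists 0%N, (fun=> 0) => et _; rewrite kJ// nm0; apply: mulr_ge0; [exact: ltW|exact: nm_ge0].
have NJ : nearly0 p `<=` J.
  by apply: contrapT => h; apply: (maxJ _ _ gn); split.
have [j Jj pj] := tI _ _ (restrict_rep p) (restrict_irr hp) _ (rank_one_compact xi).
have nj : nearly0 p j.
  move=> tau t0; exists 1%N, (fun=> xi) => et h.
  have -> : p j et = hip xi et *: xi by exact: (congr1 (fun T => T et) pj).
  rewrite (h 0%N)// scale0r nm0; apply: mulr_ge0; [exact: ltW|exact: nm_ge0].
have : p j xi = xi.
  have -> : p j xi = hip xi xi *: xi by exact: (congr1 (fun T => T xi) pj).
  by rewrite hipxx nxi expr1n rc1 scale1r.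
by rewrite (kJ _ _ (NJ _ nj)) => E; move: nxi; rewrite -E nm0 => /eqP; rewrite eq_sym oner_eq0.
Qed.
End Cases.

(** * The dual groupoid *)

Section Dual.
Context {R : realType} {G : groupType} {A : fellBundle R G}.

Lemma idealI (J K : set (A 1%g)) : ideal (unit_algebra A) J -> ideal (unit_algebra A) K ->
  ideal (unit_algebra A) (J `&` K).
Proof.
move=> [j1 j2 j3 j4 j5 j6] [k1 k2 k3 k4 k5 k6]; split.
- by [].
- by [].
- by move=> c x y [hx hx'] [hy hy']; split; [exact: j3|exact: k3].
- by move=> b x hb [hx hx']; split; [exact: j4|exact: k4].
- by move=> b x hb [hx hx']; split; [exact: j5|exact: k5].
- move=> x hx h; split; [apply: j6 => // e /h[y [hy hy'] hxy]|apply: k6 => // e /h[y [hy hy'] hxy]]; by exists y.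
Qed.

Lemma source_min g (K : set (A 1%g)) : closed_subspace K -> (forall x y : A g, K (rip x y)) ->
  @source_ideal R G A g `<=` K.
Proof. by move=> cK hK; apply: smallest_sub => // _ [x [y ->]]. Qed.

Lemma source_closed g : closed_subspace (@source_ideal R G A g).
Proof.
split.
- apply/closed_eps => x hx K hK; have [[/closed_eps cK _ _] _] := hK; apply: cK => e e0.
  by have [y hy nxy] := hx e e0; exists y => //; exact: hy.
- by move=> K [[_ K0 _] _].
- by move=> c x y hx hy K hK; have [[_ _ KL] _] := hK; apply: KL; [exact: hx|exact: hy].
Qed.

Lemma source_rip g (x y : A g) : @source_ideal R G A g (rip x y).
Proof. by move=> K [_ hK]; apply: hK; exists x, y. Qed.

Lemma preim_closed (f : A 1%g -> A 1%g) (K : set (A 1%g)) (C : R) : linear f ->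
  (forall x, nm (f x) <= C * nm x) -> closed_subspace K -> closed_subspace [set x | K (f x)].
Proof.
move=> lf bf [/closed_eps cK K0 KL]; split.
- apply/closed_eps => x hx; apply: cK => e e0.
  have e1 : 0 < e / (`|C| + 1) by rewrite divr_gt0// ltr_wpDl.
  have [y Ky hxy] := hx _ e1; exists (f y) => //.
  have -> : f x - f y = f (x - y) by rewrite -scaleN1r addrC -lf scaleN1r addrC.
  apply: le_trans (bf _) _; apply: le_trans (_ : `|C| * nm (x - y) <= _).
    by apply: ler_wpM2r; [exact: nm_ge0|exact: ler_norm].
  apply: le_trans (ler_wpM2l (normr_ge0 C) hxy) _; apply: scale_small => //; exact: ltW.
- by rewrite /=; have := lf (-1) 0 0; rewrite scaler0 addr0 scaleN1r addNr => ->.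
- by move=> c x y; rewrite /= lf; exact: KL.
Qed.

Lemma source_idealP g : ideal (unit_algebra A) (@source_ideal R G A g).
Proof.
have [cs0 s0 sL] := source_closed g; split => //.
- move=> b x _; apply: (@source_min g [set x | @source_ideal R G A g (mul1 b x)]).
    apply: (@preim_closed _ _ (nm b)) (source_closed g) => [c y z|y]; last exact: (@bnM _ (fib1 A)).
    exact: (@bmLr _ (fib1 A)).
  move=> y z /=; have -> : mul1 b (rip y z) = rip (ract y (star1 b)) z; last exact: source_rip.
  by apply: tagI; rewrite T_mul1 !T_rip T_ract tstarM T_star1 tstarK tmulA.
- move=> b x _; apply: (@source_min g [set x | @source_ideal R G A g (mul1 x b)]).
    apply: (@preim_closed _ _ (nm b)) (source_closed g) => [c y z|y]; last by rewrite mulrC; exact: (@bnM _ (fib1 A)).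
    exact: (@bmLl _ (fib1 A)).
  move=> y z /=; have -> : mul1 (rip y z) b = rip y (ract z b); last exact: source_rip.
  by apply: tagI; rewrite T_mul1 !T_rip T_ract tmulA.
- move=> x _ h; move/closed_eps: cs0; apply=> e e0.
  have e0' : 0 < rc e by rewrite -rc0 rc_lt.
  by have [y hy hxy] := h _ e0'; exists y => //; rewrite -rc_le -normE.
Qed.

Lemma ueq_refl (p : irrep A) : unitarily_equivalent p p.
Proof. by exists id; split=> // y; exists y. Qed.

Lemma ueq_nonzero (p q : irrep A) (b : A 1%g) : unitarily_equivalent p q ->
  (exists v, p b v <> 0) <-> (exists v, q b v <> 0).
Proof.
move=> [U [lU iU sU UM]]; have U0 : U 0 = 0 by have := lU (-1) 0 0; rewrite scaler0 addr0 scaleN1r addNr.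
split=> [[v hv]|[w hw]].
  exists (U v); rewrite -UM => E; apply: hv; apply: hip_eq0; by rewrite -iU E hipl0.
by have [v Ev] := sU w; exists v => E; apply: hw; rewrite -Ev -UM E.
Qed.

Lemma is_tensor_ueq g (p p1 q : irrep A) : unitarily_equivalent p p1 -> is_tensor g p1 q -> is_tensor g p q.
Proof.
move=> [U [lU iU sU UM]] [t [t1 t2 t3 t4 t5]]; exists (fun x v => t x (U v)); split.
- by move=> v; exact: t1.
- by move=> x c v w; rewrite lU t2.
- by move=> x y v w; rewrite t3 -UM iU.
- by move=> a x v; exact: t4.
- rewrite -t5; congr smallest; apply/seteqP; split=> z [x [v ->]]; first by exists x, (U v).
  by have [w <-] := sU v; exists x, w.
Qed.

End Dual.

Theorem corollary6p5 (R : realType) (G : groupType) (A : fellBundle R G)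
  (hess : exists J : set (A 1%g),
     essential_ideal (unit_algebra A) J /\ (separable_set J \/ typeI J))
  (hdet : forall H : {pred G}, cyclic_subgroup H ->
     detects_ideals (reduced_algebra A H) (unit_coefficients A H)) :
  topologically_free (dual_groupoid A).
Proof.
move=> [U [[V oV UV] [c Uc] Unu Ufix]].
have [Je [[idJ Jess] Jcase]] := hess.
pose g := c.1; have g1 : g <> 1%g := Unu c Uc.
have [J idV VJ] := oV g.
pose K := J `&` @source_ideal R G A g.
have idK : ideal (unit_algebra A) K by apply: idealI => //; exact: source_idealP.
have idI : ideal (unit_algebra A) (Je `&` K) by exact: idealI.
(* The class of the arrow [c] is killed neither by [J] nor by the source ideal, hence not by
   products of their elements, as an irreducible representation is nondegenerate on an ideal that it
   does not kill. *)
have /(Jess _ idK) IK : K <> [set 0].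
  have Vc : V (g, c.2) by have := (UV c).1 Uc; rewrite /g; case: (arrow_pair c).
  have [p Xp [a [v [Ja av]]]] := (VJ _).1 Vc.
  have [p' Xp' [b [w [sb bw]]]] := arrow_dom c.
  have [q Eq] := dualP c.2.
  have qp : unitarily_equivalent q p by move: Xp; rewrite Eq.
  have qp' : unitarily_equivalent q p' by move: Xp'; rewrite Eq.
  have [w' bw'] : exists w', p b w' <> 0.
    by apply/(ueq_nonzero b qp); apply/(ueq_nonzero b qp'); exists w.
  have [d sd hd] : exists2 d, @source_ideal R G A g d & p d (p a v) <> 0.
    apply: contrapT => h; apply: av; apply: (@ideal_nondeg _ _ _ (@source_ideal R G A g) p) => [e x hx||e he].
    - by apply: (ideal_mulr (source_idealP g)).
    - by exists b, w'.
    - by apply: contrapT => h2; apply: h; exists e.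
  move=> K0; have : K (mul1 d a).
    by split; [exact: (ideal_mull idV)|exact: (ideal_mulr (source_idealP g))].
  by rewrite K0 => E; apply: hd; rewrite -irr_M E irr_0.
have neI : exists2 k, (Je `&` K) k & k <> 0.
  apply: contrapT => h; apply: IK; apply/seteqP; split=> [k hk|_ ->]; last exact: ideal0 idI.
  by apply: contrapT => k0; apply: h; exists k.
(* Such a [p] does not vanish on [J] or on the source ideal, so [(g, [p])] is an arrow in [U].
   Equality of range and source there makes [p] a tensor product for some representative of its
   class, and [is_tensor_ueq] moves this to [p]. *)
have fixI : forall p, hat (Je `&` K) p -> is_tensor g p p.
  move=> p [a [v [[_ [Ja sa]] av]]].
  have hX : exists q : irrep A, unitary_class p = unitary_class q by exists p.
  pose X := Dual hX.
  have sX : dual_hat (@source_ideal R G A (g, X).1) (g, X).2.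
    by exists p; [exact: ueq_refl|exists a, v].
  have Uc' : U (DualArrow sX).
    by apply/UV; apply/VJ; exists p; [exact: ueq_refl|exists a, v].
  have /= E := Ufix _ Uc'.
  have : dual_range (DualArrow sX) p by rewrite E; exact: ueq_refl.
  by move=> [p1 hp1 ht]; exact: is_tensor_ueq hp1 ht.
have hd := hdet _ (cycp_subgroup g).
have IJ : Je `&` K `<=` Je by move=> x [].
case: Jcase => hJ.
  exact: separable_contra idI hd g1 fixI neI idJ IJ hJ.
exact: typeI_contra idI hd g1 fixI neI idJ IJ hJ.
Qed.
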